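(* For any Segal group action $X_\bullet\to A_\bullet$ (over a Segal group $A_\bullet$), viewed as an object in $\int_{A_\bullet\in(s\mathcal S_0)_{\mathrm{seg}}}(s\mathcal S_{/\iota(A_\bullet)})_{\mathrm{act}}$, the Postnikov tower $$\cdots\to(P_n X_\bullet\to P_nA_\bullet)\to\cdots\to(P_1X_\bullet\to P_1A_\bullet)\to(P_0X_\bullet\to P_0A_\bullet)$$ converges, in the sense that $$(X_\bullet\to A_\bullet)\simeq\mathrm{holim}_n\,(P_nX_\bullet\to P_nA_\bullet)$$ in this integral model category.
   Context: Spaces are simplicial sets; $\mathcal S$ is the category of spaces with the Kan–Quillen model structure. $s\mathcal S=\mathcal S^{\Delta^{op}}$ is the category of simplicial spaces; its Reedy (= injective) model structure has levelwise weak equivalences and monomorphisms as cofibrations. $|A_\bullet|=\mathrm{diag}(A_\bullet)$. $s\mathcal S_0$ is the category of reduced simplicial spaces ($A_0=*$), $\iota:s\mathcal S_0\to s\mathcal S$ the full inclusion and $(-)^{\mathrm{red}}$ its left adjoint, $A^{\mathrm{red}}_n=A_n/s^*(A_0)$ with $s:[n]\to[0]$. The reduced Reedy model structure on $s\mathcal S_0$ has weak equivalences, fibrations and cofibrations detected by $\iota$. A Segal group is a reduced, Reedy fibrant simplicial space $A_\bullet$ with $A_k\to(A_1)^k$ a weak equivalence for all $k\ge2$ and such that the monoid $\pi_0(A_1)$ is a group. $(s\mathcal S_0)_{\mathrm{seg}}$ is the left Bousfield localization of the reduced Reedy model structure at the maps $f^{\mathrm{red}}_{n,i}$, $n\ge1$,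 $0\le i\le n$, where $f_{n,i}:\Delta^{\{0,\dots,n\}}\coprod_{\Delta^{\{i\}}}\Delta^{\{i,n+1\}}\hookrightarrow\Delta^{n+1}$; its fibrant objects are the Segal groups. For a Segal group $A_\bullet$, a Segal group action is a Reedy fibration $p:X_\bullet\to\iota(A_\bullet)$ such that for every $k$ the two maps $\sigma_{\{0\}}^*\times p_k,\ \sigma_{\{k\}}^*\times p_k:X_k\to X_0\times A_k$ are weak equivalences, where $\sigma_{\{j\}}:[0]\to[k]$ sends $0$ to $j$. $s\mathcal S_{\mathrm{equ}}$ is the model structure on $s\mathcal S$ in which $f$ is a weak equivalence iff $|f|$ is one, cofibrations are monomorphisms, and fibrations are the equifibred Reedy fibrations ($f:X_\bullet\to Y_\bullet$ is equifibred if for every injective $[m]\to[k]$ in $\Delta$ the square with corners $X_k,Y_k,X_m,Y_m$ is homotopy Cartesian). $(s\mathcal S_{/\iota(A_\bullet)})_{\mathrm{act}}$ is the slice of $s\mathcal S_{\mathrm{equ}}$; $f:A_\bullet\to B_\bullet$ induces $f_!$ (post-composition) $\dashv f^*$ (pullback). The Grothendieck construction carries the integral model structure: objects are pairs $(A_\bullet,X_\bullet\to\iota(A_\bullet))$, morphisms $(f,\varphi):(A_\bullet,X_\bullet)\to(B_\bullet,Y_\bullet)$ are commutative squares (i.e. $f:A_\bullet\to B_\bullet$ and $\varphi:f_!X_\bullet\to Y_\bullet$, with adjoint $\varphi^{ad}:X_\bullet\to f^*Y_\bullet$). It is a weak equivalence if $f$ and $\varphi$ are weak equivalences (all objects of the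 fibres are cofibrant); a fibration if $f$ and $\varphi^{ad}$ are fibrations; a cofibration if $f$ and $\varphi$ are cofibrations. Postnikov pieces: for a space $X$, $P_n(X)=\mathrm{cosk}_{n+1}(X^{\mathrm{fib}})$, where $X^{\mathrm{fib}}$ is a functorial Kan replacement and $\mathrm{cosk}_m(Z)$ has as $k$-simplices the maps $\mathrm{sk}_m\Delta^k\to Z$; there are natural maps $X\to P_{n+1}(X)\to P_n(X)$. $P_n$ is applied to simplicial spaces in each simplicial degree. The Kan replacement is taken with $*^{\mathrm{fib}}=*$, so that $P_n$ preserves reduced simplicial spaces. Homotopy limits are taken in the integral model category. *)

(* Defs.v *)
From HB Require Import structures.
From mathcomp Require Import all_boot.
From mathcomp Require Import boolp.
From Stdlib Require Import Relation_Operators.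

Set Implicit Arguments.
Unset Strict Implicit.
Unset Printing Implicit Defensive.
#[local] Obligation Tactic := simpl.

Reserved Notation "g ∘ f" (at level 40, left associativity).

Record category := Category {
  obj :> Type;
  hom : obj -> obj -> Type;
  idm : forall x, hom x x;
  cmp : forall x y z, hom y z -> hom x y -> hom x z;
  cmpA : forall w x y z (h : hom y z) (g : hom x y) (f : hom w x),
    cmp h (cmp g f) = cmp (cmp h g) f;
  cmp1m : forall x y (f : hom x y), cmp (idm y) f = f;
  cmpm1 : forall x y (f : hom x y), cmp f (idm x) = f }.

Arguments hom {c} x y.
Arguments idm {c} x.
Arguments cmp {c x y z} g f.
Notation "g ∘ f" := (cmp g f).

Definition Types : category :=
  @Category Type (fun A B => A -> B) (fun A x => x) (fun A B C g f x => g (f x))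
    (fun _ _ _ _ _ _ _ => erefl) (fun _ _ _ => erefl) (fun _ _ _ => erefl).

Record functor (C D : category) := Functor {
  fob :> C -> D;
  fmap : forall x y, hom x y -> hom (fob x) (fob y);
  fmap1 : forall x, fmap (idm x) = idm (fob x);
  fmapM : forall x y z (g : hom y z) (f : hom x y),
    fmap (g ∘ f) = fmap g ∘ fmap f }.
Arguments fmap {C D} F {x y} f : rename.

Record ntrans (C D : category) (F G : functor C D) := NTrans {
  ntf :> forall x, hom (F x) (G x);
  ntN : forall x y (f : hom x y), ntf y ∘ fmap F f = fmap G f ∘ ntf x }.

Section Category.
Variable C : category.

Definition id_functor : functor C C :=
  @Functor C C (fun x => x) (fun _ _ f => f) (fun _ => erefl)
    (fun _ _ _ _ _ => erefl).

Definition is_terminal (t : C) := forall x : C, exists! f : hom x t, True.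

Definition llp (a b x y : C) (i : hom a b) (p : hom x y) :=
  forall (u : hom a x) (v : hom b y), p ∘ u = v ∘ i ->
    exists h : hom b x, h ∘ i = u /\ p ∘ h = v.

Definition full_subcategory (P : C -> Prop) : category :=
  @Category {x : C | P x} (fun x y => @hom C (sval x) (sval y))
    (fun x => idm (sval x)) (fun _ _ _ g f => g ∘ f)
    (fun _ _ _ _ h g f => cmpA h g f) (fun _ _ f => cmp1m f)
    (fun _ _ f => cmpm1 f).

Record pullbacks := Pullbacks {
  pb : forall x y z : C, hom x z -> hom y z -> C;
  pb1 : forall x y z (f : hom x z) (g : hom y z), hom (pb f g) x;
  pb2 : forall x y z (f : hom x z) (g : hom y z), hom (pb f g) y;
  pb_sq : forall x y z (f : hom x z) (g : hom y z), f ∘ pb1 f g = g ∘ pb2 f g;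
  pb_map : forall x y z (f : hom x z) (g : hom y z) w (a : hom w x) (b : hom w y),
    f ∘ a = g ∘ b -> hom w (pb f g);
  pb_map1 : forall x y z (f : hom x z) (g : hom y z) w (a : hom w x) (b : hom w y)
    (e : f ∘ a = g ∘ b), pb1 f g ∘ pb_map e = a;
  pb_map2 : forall x y z (f : hom x z) (g : hom y z) w (a : hom w x) (b : hom w y)
    (e : f ∘ a = g ∘ b), pb2 f g ∘ pb_map e = b;
  pb_ext : forall x y z (f : hom x z) (g : hom y z) w (h k : hom w (pb f g)),
    pb1 f g ∘ h = pb1 f g ∘ k -> pb2 f g ∘ h = pb2 f g ∘ k -> h = k }.

(* The three distinguished classes of maps of a model structure; the model
   category axioms are not part of the record. *)
Record model := Model {
  weq : forall x y : C, hom x y -> Prop;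
  cof : forall x y : C, hom x y -> Prop;
  fib : forall x y : C, hom x y -> Prop }.

Definition fibrant (M : model) (x : C) :=
  exists (t : C) (f : hom x t), is_terminal t /\ fib M f.

Record tower := Tower {
  tob :> nat -> C;
  tmap : forall n, hom (tob n.+1) (tob n) }.

Record tower_map (S T : tower) := TowerMap {
  tmf :> forall n, hom (S n) (T n);
  tmN : forall n, tmf n ∘ tmap S n = tmap T n ∘ tmf n.+1 }.

Record cone (x : C) (T : tower) := Cone {
  leg :> forall n, hom x (T n);
  legN : forall n, tmap T n ∘ leg n.+1 = leg n }.

Definition is_limit (x : C) (T : tower) (l : cone x T) :=
  forall (w : C) (c : cone w T), exists! h : hom w x, forall n, l n ∘ h = c n.

(* The fibrant objects of the injective model structure on towers. *)
Definition fibrant_tower (M : model) (T : tower) :=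
  fibrant M (T 0) /\ forall n, fib M (tmap T n).

(* The cone c exhibits x as the homotopy limit of T: the homotopy limit is
   the limit L of a fibrant replacement T' of T, and the map x -> L induced
   by c is a weak equivalence.  In a model category this does not depend on
   the choice of T' and L. *)
Definition is_holim (M : model) (x : C) (T : tower) (c : cone x T) :=
  exists (T' : tower) (r : tower_map T T') (L : C) (l : cone L T') (h : hom x L),
    [/\ forall n, weq M (r n), fibrant_tower M T', is_limit l,
        forall n, l n ∘ h = r n ∘ c n & weq M h].

End Category.

Program Definition comp_functor (C D E : category) (G : functor D E)
    (F : functor C D) : functor C E :=
  @Functor C E (fun x => G (F x)) (fun x y f => fmap G (fmap F f)) _ _.
Next Obligation. by move=> C D E G F x; rewrite !fmap1. Qed.
Next Obligation. by move=> C D E G F x y z g f; rewrite !fmapM. Qed.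

(* Delta m n is the set of monotone maps [m] -> [n], where [n] = 'I_n.+1. *)
Definition monotone m n (f : {ffun 'I_m.+1 -> 'I_n.+1}) :=
  [forall i : 'I_m.+1, forall j : 'I_m.+1, (i <= j) ==> (f i <= f j)].

Definition Delta m n := {f : {ffun 'I_m.+1 -> 'I_n.+1} | monotone f}.

Definition dfun m n (t : Delta m n) : 'I_m.+1 -> 'I_n.+1 := val t.
Coercion dfun : Delta >-> Funclass.

Lemma Delta_ext m n (s t : Delta m n) : s =1 t -> s = t.
Proof. by move=> e; apply/val_inj/ffunP. Qed.

Lemma Delta_homo m n (t : Delta m n) : {homo t : i j / i <= j}.
Proof. by move=> i j ij; have /forallP/(_ i)/forallP/(_ j)/implyP := valP t; apply. Qed.

Lemma monotoneP m n (f : 'I_m.+1 -> 'I_n.+1) :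
  {homo f : i j / i <= j} -> monotone (finfun f).
Proof.
by move=> h; apply/forallP=> i; apply/forallP=> j; apply/implyP; rewrite !ffunE; apply: h.
Qed.

Definition mkDelta m n (f : 'I_m.+1 -> 'I_n.+1) (h : {homo f : i j / i <= j}) :
  Delta m n := exist _ (finfun f) (monotoneP h).

Lemma mkDeltaE m n (f : 'I_m.+1 -> 'I_n.+1) (h : {homo f : i j / i <= j}) :
  mkDelta h =1 f.
Proof. by move=> i; rewrite /dfun /= ffunE. Qed.

Definition did n : Delta n n := @mkDelta n n id (fun i j h => h).

Definition dcmp l m n (g : Delta m n) (f : Delta l m) : Delta l n :=
  @mkDelta l n (fun i => g (f i)) (fun i j h => Delta_homo g (Delta_homo f h)).

Lemma dcmpA k l m n (h : Delta m n) (g : Delta l m) (f : Delta k l) :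
  dcmp h (dcmp g f) = dcmp (dcmp h g) f.
Proof. by apply: Delta_ext => i; rewrite !mkDeltaE. Qed.

Lemma dcmp1f m n (f : Delta m n) : dcmp (did n) f = f.
Proof. by apply: Delta_ext => i; rewrite !mkDeltaE. Qed.

Lemma dcmpf1 m n (f : Delta m n) : dcmp f (did m) = f.
Proof. by apply: Delta_ext => i; rewrite !mkDeltaE. Qed.

(* The constant map [m] -> [n] at j; vertex j is sigma_{j} : [0] -> [n]. *)
Definition dconst m n (j : 'I_n.+1) : Delta m n :=
  @mkDelta m n (fun _ => j) (fun _ _ _ => leqnn j).

Definition vertex n (j : 'I_n.+1) : Delta 0 n := dconst 0 j.

Definition edge_fun n (a b : 'I_n.+1) (t : 'I_2) := if t == ord0 then a else b.

Lemma edge_homo n (a b : 'I_n.+1) (ab : a <= b) :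
  {homo edge_fun a b : i j / i <= j}.
Proof. by rewrite /edge_fun; case=> [[|[|//]] ?] [[|[|//]] ?]. Qed.

Definition edge n (a b : 'I_n.+1) (ab : a <= b) : Delta 1 n := mkDelta (edge_homo ab).

Lemma spine_le n (i : 'I_n) : widen_ord (leqnSn n) i <= lift ord0 i.
Proof. by rewrite lift0 /=. Qed.

(* The edge {i, i+1} of [n]. *)
Definition spine n (i : 'I_n) : Delta 1 n := edge (spine_le i).

Definition dsurj n : Delta n 0 := dconst n ord0.

Lemma dsurj_cmp m n (t : Delta m n) : dcmp (dsurj n) t = dsurj m.
Proof. by apply: Delta_ext => i; rewrite !mkDeltaE. Qed.

Record simplicial (C : category) := Simplicial {
  sob :> nat -> C;
  smap : forall m n, Delta m n -> hom (sob n) (sob m);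
  smap1 : forall n, smap (did n) = idm (sob n);
  smapM : forall l m n (g : Delta m n) (f : Delta l m),
    smap (dcmp g f) = smap f ∘ smap g }.
Arguments smap {C} X {m n} t : rename.
Notation "X .[ t ]" := (smap X t).

Record smor (C : category) (X Y : simplicial C) := SMor {
  smf :> forall n, hom (X n) (Y n);
  smN : forall m n (t : Delta m n), smf m ∘ X.[t] = Y.[t] ∘ smf n }.

Lemma smor_ext (C : category) (X Y : simplicial C) (f g : smor X Y) :
  (forall n, f n = g n) -> f = g.
Proof.
case: f g => [f fN] [g gN] /= e.
have {}e : f = g by apply: functional_extensionality_dep.
by move: gN; rewrite -e => gN; congr SMor; apply: Prop_irrelevance.
Qed.

Program Definition smor_id (C : category) (X : simplicial C) : smor X X :=
  @SMor C X X (fun n => idm (X n)) _.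
Next Obligation. by move=> C X m n t; rewrite cmp1m cmpm1. Qed.

Program Definition smor_cmp (C : category) (X Y Z : simplicial C)
    (g : smor Y Z) (f : smor X Y) : smor X Z :=
  @SMor C X Z (fun n => g n ∘ f n) _.
Next Obligation. by move=> C X Y Z g f m n t; rewrite cmpA -smN -!cmpA smN. Qed.

Program Definition simp (C : category) : category :=
  @Category (simplicial C) (@smor C) (@smor_id C) (@smor_cmp C) _ _ _.
Next Obligation. by move=> C w x y z h g f; apply: smor_ext => n /=; rewrite cmpA. Qed.
Next Obligation. by move=> C x y f; apply: smor_ext => n /=; rewrite cmp1m. Qed.
Next Obligation. by move=> C x y f; apply: smor_ext => n /=; rewrite cmpm1. Qed.

Program Definition levelwise (C D : category) (F : functor C D) :
    functor (simp C) (simp D) :=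
  @Functor (simp C) (simp D)
    (fun X => @Simplicial D (fun n => F (X n)) (fun m n t => fmap F X.[t]) _ _)
    (fun X Y f => @SMor D _ _ (fun n => fmap F (f n)) _) _ _.
Next Obligation. by move=> C D F X n; rewrite smap1 fmap1. Qed.
Next Obligation. by move=> C D F X l m n g f; rewrite smapM fmapM. Qed.
Next Obligation. by move=> C D F X Y f m n t /=; rewrite -!fmapM smN. Qed.
Next Obligation. by move=> C D F X; apply: smor_ext => n /=; rewrite fmap1. Qed.
Next Obligation. by move=> C D F X Y Z g f; apply: smor_ext => n /=; rewrite fmapM. Qed.

Program Definition levelwise_nt (C D : category) (F G : functor C D) (a : ntrans F G) :
    ntrans (levelwise F) (levelwise G) :=
  @NTrans (simp C) (simp D) (levelwise F) (levelwise G)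
    (fun X => @SMor D (levelwise F X) (levelwise G X) (fun n => a (X n))
       (fun m n t => ntN a X.[t])) _.
Next Obligation. by move=> C D F G a X Y f; apply: smor_ext => n /=; rewrite ntN. Qed.

Program Definition levelwise_unit (C : category) (F : functor C C)
    (a : ntrans (id_functor C) F) : ntrans (id_functor (simp C)) (levelwise F) :=
  @NTrans (simp C) (simp C) (id_functor (simp C)) (levelwise F)
    (fun X => @SMor C X (levelwise F X) (fun n => a (X n)) (fun m n t => ntN a X.[t])) _.
Next Obligation. by move=> C F a X Y f; apply: smor_ext => n; apply: (ntN a). Qed.

Definition sset : category := simp Types.
Definition sspace : category := simp sset.

Lemma sset_ext (X Y : sset) (f g : hom X Y) : (forall n x, f n x = g n x) -> f = g.
Proof. by move=> e; apply: smor_ext => n; apply: functional_extensionality_dep. Qed.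

Lemma smap1x (X : sset) n (x : X n) : X.[did n] x = x.
Proof. by rewrite (smap1 X). Qed.

Lemma smapMx (X : sset) l m n (g : Delta m n) (f : Delta l m) (x : X n) :
  X.[dcmp g f] x = X.[f] (X.[g] x).
Proof. by rewrite (smapM X). Qed.

Lemma smNx (X Y : sset) (h : hom X Y) m n (t : Delta m n) (x : X n) :
  h m (X.[t] x) = Y.[t] (h n x).
Proof. exact: (congr1 (fun u => u x) (smN h t)). Qed.

Program Definition types_pb : pullbacks Types :=
  @Pullbacks Types
    (fun X Y Z f g => {p : X * Y | f p.1 = g p.2})
    (fun X Y Z f g p => (sval p).1) (fun X Y Z f g p => (sval p).2) _
    (fun X Y Z f g W a b e w => exist _ (a w, b w) (congr1 (fun u => u w) e)) _ _ _.
Next Obligation. by move=> X Y Z f g; apply: functional_extensionality_dep => -[p]. Qed.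
Next Obligation. by []. Qed.
Next Obligation. by []. Qed.
Next Obligation.
move=> X Y Z f g W h k e1 e2; apply: functional_extensionality_dep => w.
move: (congr1 (fun u => u w) e1) (congr1 (fun u => u w) e2) => /=.
case: (h w) (k w) => [[a b] /= p] [[c d] /= q] ac bd.
by move: q; rewrite -ac -bd => q; congr exist; apply: Prop_irrelevance.
Qed.

Section SimpPullback.
Variables (C : category) (P : pullbacks C).

Section Square.
Variables (X Y Z : simp C) (f : hom X Z) (g : hom Y Z).

Lemma spb_sq m n (t : Delta m n) :
  f m ∘ (X.[t] ∘ pb1 P (f n) (g n)) = g m ∘ (Y.[t] ∘ pb2 P (f n) (g n)).
Proof. by rewrite !cmpA !smN -!cmpA pb_sq. Qed.

Program Definition spb : simp C :=
  @Simplicial C (fun n => pb P (f n) (g n)) (fun m n t => pb_map P (spb_sq t)) _ _.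
Next Obligation.
by move=> n; apply: (pb_ext (p := P)); rewrite ?pb_map1 ?pb_map2 smap1 cmp1m cmpm1.
Qed.
Next Obligation.
move=> l m n s t; apply: (pb_ext (p := P)).
- by rewrite pb_map1 cmpA pb_map1 -cmpA pb_map1 smapM cmpA.
- by rewrite pb_map2 cmpA pb_map2 -cmpA pb_map2 smapM cmpA.
Qed.

Definition spb1 : hom spb X :=
  @SMor C spb X (fun n => pb1 P (f n) (g n)) (fun m n t => pb_map1 P (spb_sq t)).
Definition spb2 : hom spb Y :=
  @SMor C spb Y (fun n => pb2 P (f n) (g n)) (fun m n t => pb_map2 P (spb_sq t)).

Lemma spb_comm : f ∘ spb1 = g ∘ spb2.
Proof. by apply: smor_ext => n; apply: pb_sq. Qed.

Variables (W : simp C) (a : hom W X) (b : hom W Y) (e : f ∘ a = g ∘ b).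

Lemma spb_level n : f n ∘ a n = g n ∘ b n.
Proof. exact: (congr1 (fun h : smor W Z => h n) e). Qed.

Program Definition spb_map : hom W spb :=
  @SMor C W spb (fun n => pb_map P (spb_level n)) _.
Next Obligation.
move=> m n t; apply: (pb_ext (p := P)).
- by rewrite !cmpA !pb_map1 -cmpA pb_map1 smN.
- by rewrite !cmpA !pb_map2 -cmpA pb_map2 smN.
Qed.

End Square.

Program Definition simp_pb : pullbacks (simp C) :=
  @Pullbacks (simp C) spb spb1 spb2 spb_comm spb_map _ _ _.
Next Obligation.
by move=> X Y Z f g W a b e; apply: smor_ext => n /=; rewrite pb_map1. Qed.
Next Obligation.
by move=> X Y Z f g W a b e; apply: smor_ext => n /=; rewrite pb_map2. Qed.
Next Obligation.
move=> X Y Z f g W h k e1 e2; apply: smor_ext => n; apply: (pb_ext (p := P)).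
- exact: (congr1 (fun u : smor W X => u n) e1).
- exact: (congr1 (fun u : smor W Y => u n) e2).
Qed.

End SimpPullback.

Definition sset_pb : pullbacks sset := simp_pb types_pb.
Definition sspace_pb : pullbacks sspace := simp_pb sset_pb.

Program Definition const_sset : functor Types sset :=
  @Functor Types sset
    (fun T => @Simplicial Types (fun _ => T) (fun _ _ _ x => x) _ _)
    (fun S T f => @SMor Types _ _ (fun _ => f) _) _ _.
Next Obligation. by []. Qed.
Next Obligation. by []. Qed.
Next Obligation. by []. Qed.
Next Obligation. by move=> T; apply: sset_ext. Qed.
Next Obligation. by move=> S T U g f; apply: sset_ext. Qed.

Definition pt : sset := const_sset unit.

Definition is_point (X : sset) := forall k, exists! x : X k, True.

Program Definition simplex (n : nat) : sset :=
  @Simplicial Types (fun k => Delta k n) (fun l k t x => dcmp x t) _ _.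
Next Obligation. by move=> n k; apply: functional_extensionality_dep => x; apply: dcmpf1. Qed.
Next Obligation.
by move=> n k l m g f; apply: functional_extensionality_dep => x; apply: dcmpA. Qed.

Program Definition simplex_map m n (t : Delta m n) : hom (simplex m) (simplex n) :=
  @SMor Types (simplex m) (simplex n) (fun k x => dcmp t x) _.
Next Obligation.
by move=> m n t k l s; apply: functional_extensionality_dep => x; apply: dcmpA. Qed.

Section Subset.

Definition sub_closed (K : sset) (P : forall k, K k -> Prop) :=
  forall l k (t : Delta l k) x, P k x -> P l (K.[t] x).

Lemma sig_ext (T : Type) (P : T -> Prop) (x y : {x | P x}) : sval x = sval y -> x = y.
Proof.
case: x y => [x p] [y q] /= e; move: q; rewrite -e => q.
by congr exist; apply: Prop_irrelevance.
Qed.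

Program Definition subS (K : sset) (P : forall k, K k -> Prop) (cP : sub_closed P) : sset :=
  @Simplicial Types (fun k => {x : K k | P k x})
    (fun l k t x => exist _ (K.[t] (sval x)) (cP l k t (sval x) (svalP x))) _ _.
Next Obligation.
by move=> K P cP k; apply: functional_extensionality_dep => x; apply/sig_ext/smap1x. Qed.
Next Obligation.
by move=> K P cP k l m g f; apply: functional_extensionality_dep => x; apply/sig_ext/smapMx.
Qed.

Program Definition subS_incl (K : sset) (P : forall k, K k -> Prop) (cP : sub_closed P) :
    hom (subS cP) K :=
  @SMor Types (subS cP) K (fun k x => sval x) _.
Next Obligation. by []. Qed.

Program Definition subS_map (K L : sset) (P : forall k, K k -> Prop) (cP : sub_closed P)
    (Q : forall k, L k -> Prop) (cQ : sub_closed Q) (f : hom K L)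
    (h : forall k x, P k x -> Q k (f k x)) : hom (subS cP) (subS cQ) :=
  @SMor Types (subS cP) (subS cQ)
    (fun k x => exist _ (f k (sval x)) (h k (sval x) (svalP x))) _.
Next Obligation.
by move=> K L P cP Q cQ f h l k t; apply: functional_extensionality_dep => x; apply/sig_ext/smNx.
Qed.

End Subset.

(* The horn: the simplices [k] -> [n] missing some vertex j <> i. *)
Definition in_horn n (i : 'I_n.+1) k (x : Delta k n) : Prop :=
  exists j : 'I_n.+1, j != i /\ forall s, x s != j.

Lemma horn_closed n (i : 'I_n.+1) : sub_closed (K := simplex n) (in_horn i).
Proof. by move=> l k t x [j [ji jx]]; exists j; split=> // s; rewrite mkDeltaE. Qed.

Definition horn n (i : 'I_n.+1) : sset := subS (@horn_closed n i).
Definition horn_incl n (i : 'I_n.+1) : hom (horn i) (simplex n) :=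
  subS_incl (@horn_closed n i).

Definition kan_fib (X Y : sset) (p : hom X Y) :=
  forall n (i : 'I_n.+2), llp (horn_incl (n := n.+1) i) p.

Program Definition to_pt (X : sset) : hom X pt :=
  @SMor Types X pt (fun _ _ => tt) _.
Next Obligation. by []. Qed.

Definition kan (X : sset) := kan_fib (to_pt X).

(* The functor - x L. *)
Program Definition prodF (L : sset) : functor sset sset :=
  @Functor sset sset
    (fun X => @Simplicial Types (fun k => (X k * L k)%type)
       (fun m n t x => (X.[t] x.1, L.[t] x.2)) _ _)
    (fun X Y f => @SMor Types _ _ (fun k x => (f k x.1, x.2)) _) _ _.
Next Obligation.
by move=> L X n; apply: functional_extensionality_dep => -[x y] /=; rewrite !smap1x. Qed.
Next Obligation.
by move=> L X l m n g f; apply: functional_extensionality_dep => -[x y] /=; rewrite !smapMx.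
Qed.
Next Obligation.
by move=> L X Y f m n t; apply: functional_extensionality_dep => -[x y] /=; rewrite smNx. Qed.
Next Obligation. by move=> L X; apply: sset_ext => n [x y]. Qed.
Next Obligation. by move=> L X Y Z g f; apply: sset_ext => n [x y]. Qed.

Program Definition prodF_nt (K L : sset) (g : hom K L) : ntrans (prodF K) (prodF L) :=
  @NTrans sset sset (prodF K) (prodF L)
    (fun X => @SMor Types (prodF K X) (prodF L X) (fun k x => (x.1, g k x.2)) _) _.
Next Obligation.
by move=> K L g X m n t; apply: functional_extensionality_dep => -[x y] /=; rewrite smNx. Qed.
Next Obligation. by move=> K L g X Y f; apply: sset_ext => n [x y]. Qed.

Definition prodS (X Y : sset) : sset := prodF Y X.

Program Definition pairS (W X Y : sset) (f : hom W X) (g : hom W Y) : hom W (prodS X Y) :=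
  @SMor Types W (prodS X Y) (fun k w => (f k w, g k w)) _.
Next Obligation.
by move=> W X Y f g m n t; apply: functional_extensionality_dep => w /=; rewrite !smNx. Qed.

Program Definition powS (X : sset) (I : Type) : sset :=
  @Simplicial Types (fun k => I -> X k) (fun m n t x i => X.[t] (x i)) _ _.
Next Obligation.
by move=> X I n; do 2![apply: functional_extensionality_dep => ?]; rewrite smap1x. Qed.
Next Obligation.
by move=> X I l m n g f; do 2![apply: functional_extensionality_dep => ?]; rewrite smapMx. Qed.

Program Definition tupleS (W X : sset) (I : Type) (f : I -> hom W X) : hom W (powS X I) :=
  @SMor Types W (powS X I) (fun k w i => f i k w) _.
Next Obligation.
by move=> W X I f m n t; do 2![apply: functional_extensionality_dep => ?]; rewrite /= smNx. Qed.

Definition homotopic (X Z : sset) (f g : hom X Z) :=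
  exists H : hom (prodS X (simplex 1)) Z,
    forall k (x : X k), H k (x, dconst k ord0) = f k x /\ H k (x, dconst k ord_max) = g k x.

(* Weak homotopy equivalence: f^* : [Y, Z] -> [X, Z] is a bijection for every
   Kan complex Z, where [-, Z] denotes simplicial homotopy classes. *)
Definition weak_eq (X Y : sset) (f : hom X Y) :=
  forall Z : sset, kan Z ->
    (forall u : hom X Z, exists v : hom Y Z, homotopic (v ∘ f) u) /\
    (forall v w : hom Y Z, homotopic (v ∘ f) (w ∘ f) -> homotopic v w).

Definition kan_quillen : model sset :=
  @Model sset weak_eq (fun X Y f => forall k, injective (f k)) kan_fib.

(* The square f : X -> Y, u : X -> X', v : Y -> Y', g : X' -> Y' is homotopy
   Cartesian: after replacing g by a fibration q : Q -> Y', the induced map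
   X -> Y x_{Y'} Q is a weak equivalence (the model structure on spaces being
   right proper, the choice of Q is immaterial). *)
Definition homotopy_cartesian (X Y X' Y' : sset) (f : hom X Y) (u : hom X X')
    (v : hom Y Y') (g : hom X' Y') :=
  g ∘ u = v ∘ f /\
  exists (Q : sset) (j : hom X' Q) (q : hom Q Y') (h : hom X (pb sset_pb v q)),
    [/\ weq kan_quillen j /\ fib kan_quillen q, q ∘ j = g,
        pb1 sset_pb v q ∘ h = f, pb2 sset_pb v q ∘ h = j ∘ u & weq kan_quillen h].

Definition level_eq (X Y : sspace) (f : hom X Y) := forall n, weq kan_quillen (f n).

Definition level_mono (X Y : sspace) (f : hom X Y) := forall n, cof kan_quillen (f n).

(* The injective (= Reedy) model structure, whose fibrations are the maps with
   the right lifting property against the trivial cofibrations. *)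
Definition reedy : model sspace :=
  @Model sspace level_eq level_mono
    (fun X Y p => forall (A B : sspace) (i : hom A B), level_mono i -> level_eq i -> llp i p).

Program Definition diag (X : sspace) : sset :=
  @Simplicial Types (fun k => X k k) (fun m n t x => X.[t] m ((X n).[t] x)) _ _.
Next Obligation.
by move=> X n; apply: functional_extensionality_dep => x; rewrite smap1x (smap1 X). Qed.
Next Obligation.
move=> X l m n g f; apply: functional_extensionality_dep => x /=.
by rewrite (smapM X) smapMx /= smNx.
Qed.

Program Definition diag_map (X Y : sspace) (f : hom X Y) : hom (diag X) (diag Y) :=
  @SMor Types (diag X) (diag Y) (fun k => f k k) _.
Next Obligation.
move=> X Y f m n t; apply: functional_extensionality_dep => x /=.
have := congr1 (fun h : smor (X n) (Y m) => h m ((X n).[t] x)) (smN f t).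
by move=> /= ->; rewrite smNx.
Qed.

Definition equifibred (X Y : sspace) (f : hom X Y) :=
  forall m k (t : Delta m k), injective t ->
    homotopy_cartesian (f k) X.[t] Y.[t] (f m).

Definition equ : model sspace :=
  @Model sspace (fun X Y f => weq kan_quillen (diag_map f)) level_mono
    (fun X Y f => fib reedy f /\ equifibred f).

Definition reduced (X : sspace) := is_point (X 0).

Definition rsspace : category := full_subcategory reduced.

Definition incl (A : rsspace) : sspace := sval A.
Definition incl_map (A B : rsspace) (f : hom A B) : hom (incl A) (incl B) := f.

Definition reduced_reedy : model rsspace :=
  @Model rsspace (fun A B f => weq reedy (incl_map f))
    (fun A B f => cof reedy (incl_map f)) (fun A B f => fib reedy (incl_map f)).

(* X / f(U), i.e. the pushout of X <-f- U -> pt: a k-simplex is an equivalence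
   class of elements of X k + {None}, all elements of f(U) being identified
   with the extra point None (so a base point is added when U is empty). *)
Section Collapse.
Variables (U X : sset) (f : hom U X).

Definition in_base k (x : option (X k)) : Prop :=
  if x is Some x then exists u, f k u = x else True.

Definition collapse_rel k (x y : option (X k)) : Prop :=
  x = y \/ in_base x /\ in_base y.

Definition collapse_level k := {c : option (X k) -> Prop | exists x, c = collapse_rel x}.

Definition cls k (x : option (X k)) : collapse_level k :=
  exist _ (collapse_rel x) (ex_intro _ x erefl).

Lemma cls_surj k (c : collapse_level k) : exists x, c = cls x.
Proof. by case: c => c [x e]; exists x; apply: sig_ext. Qed.

Lemma eq_cls k (x y : option (X k)) : cls x = cls y <-> collapse_rel x y.
Proof.
split=> [e|].
  have /= -> := congr1 (fun c : collapse_level k => sval c y) e; by left.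
case=> [->//|[bx by_]]; apply: sig_ext; apply: functional_extensionality_dep => z /=.
by apply/propext; split=> -[<-|[]]; right.
Qed.

End Collapse.

Section CollapseMap.
Variables (U X V Y : sset) (f : hom U X) (g : hom V Y) (k l : nat) (a : X k -> Y l).
Hypothesis h : forall x, in_base f (Some x) -> in_base g (Some (a x)).

Lemma in_base_omap z : in_base f z -> in_base g (omap a z).
Proof. by case: z => // z; apply: h. Qed.

Definition collapse_pred (c : collapse_level f k) (y : option (Y l)) : Prop :=
  exists x, sval c x /\ collapse_rel g (omap a x) y.

Lemma collapse_predE x : collapse_pred (cls f x) = collapse_rel g (omap a x).
Proof.
apply: functional_extensionality_dep => y; apply/propext; split=> [[z [/= xz zy]]|xy].
- case: xz zy => [<-//|[/in_base_omap bx /in_base_omap bz]] [<-|[_ by_]]; by right.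
- by exists x; split=> //; left.
Qed.

Lemma collapse_fun_ex (c : collapse_level f k) :
  exists x, collapse_pred c = collapse_rel g x.
Proof. by have [x ->] := cls_surj c; exists (omap a x); apply: collapse_predE. Qed.

Definition collapse_fun (c : collapse_level f k) : collapse_level g l :=
  exist _ _ (collapse_fun_ex c).

Lemma collapse_funE x : collapse_fun (cls f x) = cls g (omap a x).
Proof. by apply: sig_ext; apply: collapse_predE. Qed.

End CollapseMap.

Section CollapseS.
Variables (U X : sset) (f : hom U X).

Lemma base_closed l k (t : Delta l k) (x : X k) :
  in_base f (Some x) -> in_base f (Some (X.[t] x)).
Proof. by case=> u <-; exists (U.[t] u); rewrite smNx. Qed.

Program Definition collapse : sset :=
  @Simplicial Types (collapse_level f) (fun l k t => collapse_fun (base_closed t)) _ _.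
Next Obligation.
move=> n; apply: functional_extensionality_dep => c; have [x ->] := cls_surj c.
by rewrite collapse_funE; case: x => //= x; rewrite smap1x.
Qed.
Next Obligation.
move=> l m n g h; apply: functional_extensionality_dep => c; have [x ->] := cls_surj c.
by rewrite /= !collapse_funE; case: x => //= x; rewrite smapMx.
Qed.

End CollapseS.

Section CollapseSMap.
Variables (U X V Y : sset) (f : hom U X) (g : hom V Y).
Variables (b : hom U V) (a : hom X Y) (e : a ∘ f = g ∘ b).

Lemma base_map k (x : X k) : in_base f (Some x) -> in_base g (Some (a k x)).
Proof.
case=> u <-; exists (b k u).
exact: (esym (congr1 (fun h : smor U Y => h k u) e)).
Qed.

Program Definition collapse_map : hom (collapse f) (collapse g) :=
  @SMor Types (collapse f) (collapse g) (fun k => collapse_fun (@base_map k)) _.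
Next Obligation.
move=> m n t; apply: functional_extensionality_dep => c; have [x ->] := cls_surj c.
by rewrite /= !collapse_funE; case: x => //= x; rewrite smNx.
Qed.

Lemma collapse_mapE k x : collapse_map k (cls f x) = cls g (omap (a k) x).
Proof. exact: collapse_funE. Qed.

End CollapseSMap.

Section Red.
Variable A : sspace.

Lemma red_sq m n (t : Delta m n) : A.[t] ∘ A.[dsurj n] = A.[dsurj m] ∘ idm (A 0).
Proof. by rewrite cmpm1 -smapM dsurj_cmp. Qed.

Program Definition red_obj : sspace :=
  @Simplicial sset (fun n => collapse A.[dsurj n]) (fun m n t => collapse_map (red_sq t)) _ _.
Next Obligation.
move=> n; apply: sset_ext => k c; have [x ->] := cls_surj c; rewrite collapse_mapE.
by case: x => //= x; rewrite (smap1 A).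
Qed.
Next Obligation.
move=> l m n g f; apply: sset_ext => k c; have [x ->] := cls_surj c.
by rewrite /= !collapse_funE; case: x => //= x; rewrite (smapM A).
Qed.

Lemma red_reduced : reduced red_obj.
Proof.
move=> k; exists (cls _ None); split=> // c _; have [x ->] := cls_surj c.
apply/eq_cls; right; split=> //; case: x => //= x; exists x.
have -> : dsurj 0 = did 0 by apply: Delta_ext => i; rewrite !mkDeltaE ord1.
by rewrite (smap1 A).
Qed.

Definition red : rsspace := exist _ red_obj red_reduced.

End Red.

Program Definition red_map (A B : sspace) (f : hom A B) : hom (red A) (red B) :=
  @SMor sset (red_obj A) (red_obj B)
    (fun n => collapse_map (f := A.[dsurj n]) (g := B.[dsurj n]) (b := f 0) (a := f n)
               (smN f (dsurj n))) _.
Next Obligation.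
move=> A B f m n t; apply: sset_ext => k c; have [x ->] := cls_surj c.
rewrite /= !collapse_funE; case: x => //= x; congr (cls _ (Some _)).
exact: (congr1 (fun h : smor (A n) (B m) => h k x) (smN f t)).
Qed.

(* A simplicial set as a levelwise discrete simplicial space; the Delta^n of
   simplicial spaces is disc (simplex n). *)
Definition disc : functor sset sspace := levelwise const_sset.

(* The source of f_{n,i}, as the union of the faces {0, ..., n} and {i, n+1}
   of Delta^{n+1}; the two faces intersect exactly in the vertex i. *)
Definition in_ext n (i : 'I_n.+1) k (x : Delta k n.+1) : Prop :=
  (forall s, x s <= n) \/ (forall s, x s = i :> nat \/ x s = n.+1 :> nat).

Lemma ext_closed n (i : 'I_n.+1) : sub_closed (K := simplex n.+1) (in_ext i).
Proof.
by move=> l k t x [h|h]; [left|right] => s; rewrite mkDeltaE; apply: h.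
Qed.

Definition fni n (i : 'I_n.+1) : hom (disc (subS (@ext_closed n i))) (disc (simplex n.+1)) :=
  fmap disc (subS_incl (@ext_closed n i)).

(* A x K, with K constant in the outer simplicial direction. *)
Definition tensor (A : sspace) (K : sset) : sspace := levelwise (prodF K) A.

Program Definition Map (A Z : sspace) : sset :=
  @Simplicial Types (fun k => @hom sspace (tensor A (simplex k)) Z)
    (fun l k t u => @cmp sspace _ _ _ u (levelwise_nt (prodF_nt (simplex_map t)) A)) _ _.
Next Obligation.
move=> A Z k; apply: functional_extensionality_dep => u.
apply: smor_ext => n; apply: sset_ext => j [x y] /=.
by rewrite dcmp1f.
Qed.
Next Obligation.
move=> A Z l m n g f; apply: functional_extensionality_dep => u /=.
apply: smor_ext => p; apply: sset_ext => j [x y] /=.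
by rewrite dcmpA.
Qed.

Program Definition Map_pre (A B Z : sspace) (f : hom A B) : hom (Map B Z) (Map A Z) :=
  @SMor Types (Map B Z) (Map A Z)
    (fun k u => @cmp sspace _ _ _ u (fmap (levelwise (prodF (simplex k))) f)) _.
Next Obligation.
move=> A B Z f m n t; apply: functional_extensionality_dep => u /=.
by apply: smor_ext => p; apply: sset_ext => j [x y].
Qed.
Arguments Map_pre {A B} Z f.

(* Left Bousfield localization of the (simplicial) reduced Reedy model
   structure at the maps f_{n,i}^red.  For reduced A and Z the space Map(A, Z)
   is the simplicial mapping space of reduced simplicial spaces, since
   Hom((A x Delta^k)^red, Z) = Hom(A x Delta^k, Z); every object is cofibrant,
   so it is a homotopy function complex when Z is fibrant. *)
Definition seg_local (Z : rsspace) :=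
  fibrant reduced_reedy Z /\
  forall n (i : 'I_n.+1), 1 <= n ->
    weq kan_quillen (Map_pre (incl Z) (incl_map (red_map (fni i)))).

Definition seg_eq (A B : rsspace) (f : hom A B) :=
  forall Z : rsspace, seg_local Z -> weq kan_quillen (Map_pre (incl Z) (incl_map f)).

Definition seg : model rsspace :=
  @Model rsspace seg_eq (cof reduced_reedy)
    (fun X Y p => forall (A B : rsspace) (i : hom A B),
       cof reduced_reedy i -> seg_eq i -> llp i p).

Definition same_component (X : sset) : X 0 -> X 0 -> Prop :=
  clos_refl_sym_trans (X 0)
    (fun x y => exists e : X 1, X.[vertex ord0] e = x /\ X.[vertex ord_max] e = y).

(* The multiplication of pi_0(A_1), as a relation between representatives:
   [c] = [a] [b], the monoid structure being induced by A_1 x A_1 <~ A_2 -> A_1. *)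
Definition pi0_mul (A : sspace) (a b c : A 1 0) :=
  exists t : A 2 0,
    [/\ same_component (A.[spine (ord0 : 'I_2)] 0 t) a,
        same_component (A.[spine (ord_max : 'I_2)] 0 t) b &
        same_component (A.[@edge 2 ord0 ord_max erefl] 0 t) c].

(* Every element of the monoid pi_0(A_1) is invertible; its unit is the class
   of the degeneracy of the point o of A_0. *)
Definition pi0_group (A : sspace) :=
  forall (o : A 0 0) (a : A 1 0), exists b : A 1 0,
    pi0_mul a b (A.[dsurj 1] 0 o) /\ pi0_mul b a (A.[dsurj 1] 0 o).

Definition segal_group (A : rsspace) :=
  [/\ fibrant reedy (incl A),
      forall k, 2 <= k -> weq kan_quillen (tupleS (fun i : 'I_k => (incl A).[spine i])) &
      pi0_group (incl A)].

Definition segal_group_action (A : rsspace) (X : sspace) (p : hom X (incl A)) :=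
  fib reedy p /\
  forall k, weq kan_quillen (pairS X.[vertex (ord0 : 'I_k.+1)] (p k)) /\
            weq kan_quillen (pairS X.[vertex (ord_max : 'I_k.+1)] (p k)).

Record iobj := IObj {
  ibase : rsspace;
  itot : sspace;
  iproj : hom itot (incl ibase) }.

Record imor (P Q : iobj) := IMor {
  imb : hom (ibase P) (ibase Q);
  imt : hom (itot P) (itot Q);
  imC : incl_map imb ∘ iproj P = iproj Q ∘ imt }.

Lemma imor_ext (P Q : iobj) (f g : imor P Q) : imb f = imb g -> imt f = imt g -> f = g.
Proof.
case: f g => [a b c] [a' b' c'] /= e1 e2; move: c'; rewrite -e1 -e2 => c'.
by congr IMor; apply: Prop_irrelevance.
Qed.

Program Definition imor_id (P : iobj) : imor P P :=
  @IMor P P (idm (ibase P)) (idm (itot P)) _.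
Next Obligation.
move=> P; apply: etrans (esym (cmpm1 (c := sspace) (iproj P))).
exact: (cmp1m (c := sspace) (iproj P)).
Qed.

Program Definition imor_cmp (P Q R : iobj) (g : imor Q R) (f : imor P Q) : imor P R :=
  @IMor P R (imb g ∘ imb f) (imt g ∘ imt f) _.
Next Obligation.
move=> P Q R g f.
apply: etrans (esym (cmpA (c := sspace) (imb g) (imb f) (iproj P))) _.
apply: etrans (congr1 (@cmp sspace _ _ _ (imb g)) (imC f)) _.
apply: etrans (cmpA (c := sspace) (imb g) (iproj Q) (imt f)) _.
apply: etrans (congr1 (fun h => @cmp sspace _ _ _ h (imt f)) (imC g)) _.
exact: esym (cmpA (c := sspace) (iproj R) (imt g) (imt f)).
Qed.

Program Definition integral_cat : category :=
  @Category iobj imor imor_id imor_cmp _ _ _.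
Next Obligation. by move=> *; apply: imor_ext; apply: (cmpA (c := simp _)). Qed.
Next Obligation. by move=> *; apply: imor_ext; apply: (cmp1m (c := simp _)). Qed.
Next Obligation. by move=> *; apply: imor_ext; apply: (cmpm1 (c := simp _)). Qed.

(* phi^ad : X -> f^* Y, with f^* Y = incl A x_{incl B} Y. *)
Definition adjunct (P Q : iobj) (f : imor P Q) :
    hom (itot P) (pb sspace_pb (incl_map (imb f)) (iproj Q)) :=
  pb_map sspace_pb (imC f).

(* The classes of maps of the slices of equ are detected by the forgetful
   functor to simplicial spaces, and phi : f_! X -> Y has underlying map
   imt : X -> Y. *)
Definition integral : model integral_cat :=
  @Model integral_cat
    (fun P Q (f : imor P Q) => weq seg (imb f) /\ weq equ (imt f))
    (fun P Q (f : imor P Q) => cof seg (imb f) /\ cof equ (imt f))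
    (fun P Q (f : imor P Q) => fib seg (imb f) /\ fib equ (adjunct f)).

Record kan_replacement := KanReplacement {
  kr :> functor sset sset;
  kr_unit : ntrans (id_functor sset) kr;
  kr_weq : forall X, weq kan_quillen (kr_unit X);
  kr_kan : forall X, kan (kr X);
  kr_pt : is_point (kr pt) }.

(* sk_m K consists of the simplices that factor through dimension <= m. *)
Definition in_skel m (K : sset) k (x : K k) : Prop :=
  exists2 i, i <= m & exists (t : Delta k i) (y : K i), x = K.[t] y.

Lemma skel_closed m K : sub_closed (@in_skel m K).
Proof.
move=> l k s x [i im [t [y ->]]]; exists i => //; exists (dcmp t s), y.
by rewrite smapMx.
Qed.

Definition skel m (K : sset) : sset := subS (@skel_closed m K).

Lemma in_skel_map m (K L : sset) (f : hom K L) k (x : K k) :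
  in_skel m x -> in_skel m (f k x).
Proof. by case=> i im [t [y ->]]; exists i => //; exists t, (f i y); rewrite smNx. Qed.

Lemma in_skelS m (K : sset) k (x : K k) :
  in_skel m x -> in_skel m.+1 ((idm K : smor K K) k x).
Proof. by case=> i im [t [y e]]; exists i; [exact: leqW | exists t, y]. Qed.

Definition skel_map m (K L : sset) (f : hom K L) : hom (skel m K) (skel m L) :=
  subS_map (@skel_closed m K) (@skel_closed m L) (@in_skel_map m K L f).

Definition skel_incl m (K : sset) : hom (skel m K) K := subS_incl (@skel_closed m K).

Definition skelS m (K : sset) : hom (skel m K) (skel m.+1 K) :=
  subS_map (@skel_closed m K) (@skel_closed m.+1 K) (@in_skelS m K).

Program Definition cosk m : functor sset sset :=
  @Functor sset sset
    (fun Z => @Simplicial Types (fun k => @hom sset (skel m (simplex k)) Z)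
      (fun l k t u => @cmp sset _ _ _ u (skel_map m (simplex_map t))) _ _)
    (fun Z W g => @SMor Types _ _ (fun k u => @cmp sset _ _ _ g u) _) _ _.
Next Obligation.
move=> m Z k; apply: functional_extensionality_dep => u.
apply: sset_ext => n x /=; congr (smf u n _); apply: sig_ext => /=.
by rewrite dcmp1f.
Qed.
Next Obligation.
move=> m Z j k l g f; apply: functional_extensionality_dep => u /=.
apply: sset_ext => n x /=; congr (smf u n _); apply: sig_ext => /=.
by rewrite dcmpA.
Qed.
Next Obligation.
by move=> m Z W g k l t; apply: functional_extensionality_dep => u; apply: sset_ext.
Qed.
Next Obligation. by move=> m Z; apply: sset_ext => k u; apply: sset_ext. Qed.
Next Obligation. by move=> m X Y Z g f; apply: sset_ext => k u; apply: sset_ext. Qed.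

(* The map Delta^k -> Z classifying a k-simplex x. *)
Program Definition yoneda (Z : sset) k (x : Z k) : hom (simplex k) Z :=
  @SMor Types (simplex k) Z (fun l t => Z.[t] x) _.
Next Obligation.
by move=> Z k x l m t; apply: functional_extensionality_dep => s /=; rewrite smapMx. Qed.

Program Definition cosk_unit m : ntrans (id_functor sset) (cosk m) :=
  @NTrans sset sset (id_functor sset) (cosk m)
    (fun Z => @SMor Types Z (cosk m Z)
       (fun k x => @cmp sset _ _ _ (yoneda x) (skel_incl m (simplex k))) _) _.
Next Obligation.
move=> m Z k l t; apply: functional_extensionality_dep => x; apply: sset_ext => n y /=.
by rewrite smapMx.
Qed.
Next Obligation.
move=> m Z W f; apply: sset_ext => k x; apply: sset_ext => n y /=.
by rewrite smNx.
Qed.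

Program Definition cosk_tower m : ntrans (cosk m.+1) (cosk m) :=
  @NTrans sset sset (cosk m.+1) (cosk m)
    (fun Z => @SMor Types (cosk m.+1 Z) (cosk m Z)
       (fun k u => @cmp sset _ _ _ u (skelS m (simplex k))) _) _.
Next Obligation.
move=> m Z k l t; apply: functional_extensionality_dep => u; apply: sset_ext => n y /=.
by congr (smf u n _); apply: sig_ext.
Qed.
Next Obligation. by move=> m Z W f; apply: sset_ext => k u; apply: sset_ext. Qed.

Lemma point_map (X Y : sset) : is_point Y -> exists f : hom X Y, forall g : hom X Y, g = f.
Proof.
move=> pY; pose w k := projT1 (cid (pY k)).
have wU k (v : Y k) : v = w k.
  by rewrite /w; case: cid => u [_ uU] /=; rewrite (uU v).
unshelve eexists.
  refine (@SMor Types X Y (fun k _ => w k) _) => m n t.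
  by apply: functional_extensionality_dep => x /=; apply/esym/wU.
by move=> g; apply: sset_ext => k x; apply: wU.
Qed.

Lemma point_fob (F : functor sset sset) (X Y : sset) :
  is_point X -> is_point Y -> is_point (F X) -> is_point (F Y).
Proof.
move=> pX pY pFX k.
have [f _] := point_map X pY; have [g _] := point_map Y pX.
have [i iU] := point_map Y pY.
have fg : f ∘ g = idm Y by rewrite (iU (f ∘ g)) (iU (idm Y)).
have [x [_ xU]] := pFX k.
exists (fmap F f k x); split=> // z _.
have e : fmap F f ∘ fmap F g = idm (F Y) by rewrite -fmapM fg fmap1.
have zE : fmap F f k (fmap F g k z) = z := congr1 (fun h : smor (F Y) (F Y) => h k z) e.
by rewrite -zE (xU (fmap F g k z)).
Qed.

Lemma cosk_pt m (Z : sset) : is_point Z -> is_point (cosk m Z).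
Proof.
by move=> pZ k; have [f fU] := point_map (skel m (simplex k)) pZ; exists f; split.
Qed.

Lemma pt_point : is_point pt.
Proof. by move=> k; exists tt; split=> // -[]. Qed.

Section Postnikov.
Variable R : kan_replacement.

Definition postnikov n : functor sset sset := comp_functor (cosk n.+1) R.

Lemma postnikov_unit_nat n (X Y : sset) (f : hom X Y) :
  (cosk_unit n.+1 (R Y) ∘ kr_unit R Y) ∘ f =
  fmap (postnikov n) f ∘ (cosk_unit n.+1 (R X) ∘ kr_unit R X).
Proof.
have e1 : kr_unit R Y ∘ f = fmap R f ∘ kr_unit R X := ntN (kr_unit R) f.
have e2 : cosk_unit n.+1 (R Y) ∘ fmap R f = fmap (postnikov n) f ∘ cosk_unit n.+1 (R X) :=
  ntN (cosk_unit n.+1) (fmap R f).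
by rewrite -cmpA e1 cmpA e2 cmpA.
Qed.

Definition postnikov_unit n : ntrans (id_functor sset) (postnikov n) :=
  @NTrans sset sset (id_functor sset) (postnikov n)
    (fun X => cosk_unit n.+1 (R X) ∘ kr_unit R X) (postnikov_unit_nat n).

Program Definition postnikov_map n : ntrans (postnikov n.+1) (postnikov n) :=
  @NTrans sset sset (postnikov n.+1) (postnikov n) (fun X => cosk_tower n.+1 (R X)) _.
Next Obligation. by move=> n X Y f; apply: (ntN (cosk_tower n.+1)). Qed.

Lemma postnikov_unitN n (X : sset) :
  postnikov_map n X ∘ postnikov_unit n.+1 X = postnikov_unit n X.
Proof. by apply: sset_ext => k x; apply: sset_ext. Qed.

Lemma postnikov_pt n (X : sset) : is_point X -> is_point (postnikov n X).
Proof. by move=> pX; apply/cosk_pt/(point_fob pt_point pX)/kr_pt. Qed.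

Definition postnikov_red n (A : rsspace) : rsspace :=
  exist _ (levelwise (postnikov n) (incl A)) (@postnikov_pt n (incl A 0) (svalP A)).

Definition postnikov_obj (P : iobj) n : iobj :=
  @IObj (postnikov_red n (ibase P)) (levelwise (postnikov n) (itot P))
    (fmap (levelwise (postnikov n)) (iproj P)).

Definition postnikov_tower (P : integral_cat) : tower integral_cat :=
  @Tower integral_cat (postnikov_obj P)
    (fun n => @IMor (postnikov_obj P n.+1) (postnikov_obj P n)
       (levelwise_nt (postnikov_map n) (incl (ibase P)))
       (levelwise_nt (postnikov_map n) (itot P))
       (ntN (levelwise_nt (postnikov_map n)) (iproj P))).

Program Definition postnikov_cone (P : integral_cat) : cone P (postnikov_tower P) :=
  @Cone integral_cat P (postnikov_tower P)
    (fun n => @IMor P (postnikov_obj P n)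
       (levelwise_unit (postnikov_unit n) (incl (ibase P)))
       (levelwise_unit (postnikov_unit n) (itot P))
       (ntN (levelwise_unit (postnikov_unit n)) (iproj P))) _.
Next Obligation.
by move=> P n; apply: imor_ext; apply: smor_ext => k; apply: postnikov_unitN.
Qed.

End Postnikov.

(* Main.v *)
From HB Require Import structures.
From mathcomp Require Import all_boot.
From mathcomp Require Import boolp zify.
Require Import Defs.

(* Let Z be the Kan replacement of X -> A and M_n Z the image of Z in its n-coskeleton,
   degreewise.  For a Kan complex K the map cosk_(n+1) K -> M_n K is a trivial fibration,
   M_(n+1) K -> M_n K is a Kan fibration, and K is the strict limit of the M_n K.  To
   turn degreewise Kan fibrations into Reedy fibrations, apply the totalization of the
   cobar construction of a cofree functor on the integral category; the unit into it is a
   degreewise homotopy equivalence (extra codegeneracy), and it preserves strict limits.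
   The resulting tower T'_n is a degreewise replacement of the Postnikov tower.  It is
   fibrant: the Segal condition and the invertibility of the shear map A_2 -> A_1 x A_1 are
   invariant under degreewise equivalences and under M_n, so the bases are local and a
   Reedy fibration between local objects is a fibration; likewise the action condition
   persists, so that X_k -> A_k x_(A_m) X_m is a trivial fibration for every injection
   [m] -> [k], which yields equifibredness.  Finally, degreewise equivalences are weak
   equivalences of the localization and have weakly equivalent diagonals. *)

Set Implicit Arguments.
Unset Strict Implicit.
Unset Printing Implicit Defensive.
#[local] Obligation Tactic := simpl.

(** The Postnikov tower cannot serve as its own replacement: even for a Kan complex, [cosk_tower] is
    in general not a Kan fibration, since a simplex of the smaller coskeleton may be a boundary
    without filler. Passing to images of [Z] removes exactly these simplices. A Reedy fibrant
    replacement from a small object argument need not commute with inverse limits. The cofree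
    functor, its iterates and the totalization consist of families of simplices subject to
    equations, so they preserve limits on the nose; this is the reason for the cobar construction.
    Only cofaces enter the totalization, so there are no matching objects and levelwise fibrations
    suffice. The base has to stay reduced, which forces a based variant of the cofree object. Weak
    equivalences are defined by homotopy classes of maps into Kan complexes. Accordingly no homotopy
    groups and no class of anodyne maps appear: a trivial cofibration is a pair of subcomplexes
    along which maps into Kan complexes extend, also after pushout products with boundary inclusions
    ([tc]), and closure properties are proved for this notion. *)

Lemma dcmpE l m n (g : Delta m n) (f : Delta l m) i : dcmp g f i = g (f i).
Proof. exact: mkDeltaE. Qed.

Lemma didE n (i : 'I_n.+1) : did n i = i.
Proof. exact: mkDeltaE. Qed.

Lemma dconstE m n (j : 'I_n.+1) (i : 'I_m.+1) : dconst m j i = j.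
Proof. exact: mkDeltaE. Qed.

Lemma Delta_eqE m n (s t : Delta m n) i : s = t -> s i = t i.
Proof. by move=> ->. Qed.

Lemma dconst_cmp l m n (j : 'I_n.+1) (t : Delta l m) : dcmp (dconst m j) t = dconst l j.
Proof. by apply: Delta_ext => i; rewrite dcmpE !dconstE. Qed.

Lemma cmp_dconst l m n (t : Delta m n) (j : 'I_m.+1) :
  dcmp t (dconst l j) = dconst l (t j).
Proof. by apply: Delta_ext => i; rewrite dcmpE !dconstE. Qed.

Lemma Delta0_eq k (s t : Delta k 0) : s = t.
Proof. by apply: Delta_ext => i; rewrite (ord1 (s i)) (ord1 (t i)). Qed.

(** * Surjections, boundaries and faces in the simplex category *)

Definition dsurjective k n (t : Delta k n) := forall j, exists i, t i = j.

Definition bd n k (t : simplex n k) : Prop := exists j, forall s, dfun t s != j.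

Lemma not_bd n k (t : Delta k n) : ~ bd t -> dsurjective t.
Proof.
move=> h j; apply: contrapT => h2; apply: h; exists j => s; apply/eqP => e.
by apply: h2; exists s.
Qed.

Lemma bd_closed n : sub_closed (K := simplex n) (@bd n).
Proof. by move=> l k t x [j jx]; exists j => s; rewrite dcmpE. Qed.

(** Any set-theoretic section of a monotone surjection is automatically monotone, so an arbitrary
    one can be altered to pass through [i0]. This freedom lets a surjection be recovered from its
    sections. *)
Lemma dsurj_section k n (t : Delta k n) (i0 : 'I_k.+1) : dsurjective t ->
  exists s : Delta n k, dcmp t s = did n /\ s (t i0) = i0.
Proof.
move=> tS.
have [s0 s0P] : exists s : 'I_n.+1 -> 'I_k.+1, forall j, t (s j) = j.
  by exists (fun j => projT1 (cid (tS j))) => j; case: cid.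
pose s j := if j == t i0 then i0 else s0 j.
have sP j : t (s j) = j by rewrite /s; case: eqP => [->|_] //.
have sH : {homo s : i j / i <= j}.
  move=> i j ij; rewrite leqNgt; apply/negP => h.
  have := Delta_homo t (ltnW h); rewrite !sP => ji.
  have e : i = j by apply/val_inj/eqP; rewrite eqn_leq ij ji.
  by rewrite e ltnn in h.
exists (mkDelta sH); split.
  by apply: Delta_ext => j; rewrite dcmpE mkDeltaE sP didE.
by rewrite mkDeltaE /s eqxx.
Qed.

(** A section of [t] is strictly increasing, hence squeezed to the identity: [s1] bounds its values
    from below and [s2] from above. *)
Lemma dsurj_endo n (t : Delta n n) : dsurjective t -> t = did n.
Proof.
move=> tS; have [s [ts _]] := dsurj_section ord0 tS.
have tsE j : t (s j) = j by rewrite -dcmpE ts didE.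
have sI (i j : 'I_n.+1) : i < j -> s i < s j.
  move=> ij; rewrite ltnNge; apply/negP => h.
  by have := Delta_homo t h; rewrite !tsE leqNgt ij.
have s1 m (i : 'I_n.+1) : i = m :> nat -> m <= s i.
  elim: m i => [//|m IH i im].
  have mn : m < n.+1 by have := ltn_ord i; lia.
  by apply: leq_ltn_trans (IH (Ordinal mn) erefl) (sI _ _ _); rewrite im.
have s2 m (i : 'I_n.+1) : i + m = n -> s i <= i.
  elim: m i => [|m IH] i im; first by have := ltn_ord (s i); lia.
  have mn : i.+1 < n.+1 by lia.
  have := IH (Ordinal mn); have := sI i (Ordinal mn) (ltnSn i) => /=; lia.
have sE i : s i = i.
  apply: val_inj => /=; apply/eqP; rewrite eqn_leq (s1 _ _ erefl) andbT.
  by apply: (s2 (n - i)); have := ltn_ord i; lia.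
by apply: Delta_ext => i; rewrite didE -[in LHS](sE i) tsE.
Qed.

Lemma dface_homo n (j : 'I_n.+2) : {homo lift j : i k / i <= k}.
Proof. by move=> i k /= ik; rewrite leq_bump2. Qed.
Definition dface n (j : 'I_n.+2) : Delta n n.+1 := mkDelta (@dface_homo n j).

Lemma dfaceE n (j : 'I_n.+2) i : dface j i = lift j i.
Proof. exact: mkDeltaE. Qed.

Definition dretr_fun n (j i : 'I_n.+2) : 'I_n.+1 := inord (minn n (unbump j i)).

Lemma dretr_homo n (j : 'I_n.+2) : {homo dretr_fun j : i k / i <= k}.
Proof. by move=> i k ik; rewrite /dretr_fun !inordK /unbump; lia. Qed.

(* The minimum makes this a retraction also for the last coface. *)
Definition dretr n (j : 'I_n.+2) : Delta n.+1 n := mkDelta (@dretr_homo n j).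

Lemma dface_retr n (j i : 'I_n.+2) : i != j -> dface j (dretr j i) = i.
Proof.
rewrite -val_eqE => /= ij; apply: val_inj; rewrite dfaceE mkDeltaE /= /dretr_fun inordK.
  by rewrite /bump /unbump; have := ltn_ord i; have := ltn_ord j; lia.
by lia.
Qed.

Lemma dretr_face n (j : 'I_n.+2) : dcmp (dretr j) (dface j) = did n.
Proof.
apply: Delta_ext => i; rewrite dcmpE didE; apply: val_inj.
rewrite dfaceE mkDeltaE /= /dretr_fun inordK.
  by rewrite /= /bump /unbump; have := ltn_ord i; lia.
by lia.
Qed.

Lemma miss_factor n k (t : Delta k n.+1) j : (forall s, t s != j) ->
  t = dcmp (dface j) (dcmp (dretr j) t).
Proof. by move=> h; apply: Delta_ext => s; rewrite !dcmpE dface_retr. Qed.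

Lemma bd_factor n k (t : Delta k n) : bd t ->
  exists m (u : Delta m n) (v : Delta k m), m < n /\ t = dcmp u v.
Proof.
case: n t => [|n] t [j jt]; first by have := jt ord0; rewrite (ord1 (t _)) (ord1 j) eqxx.
by exists n, (dface j), (dcmp (dretr j) t); rewrite -miss_factor.
Qed.

Lemma lt_bd m n k (u : Delta m n) (v : Delta k m) : m < n -> bd (dcmp u v).
Proof.
move=> mn; suff [j ju] : bd u by exists j => s; rewrite dcmpE.
apply: contrapT => /not_bd us; have [s [usE _]] := dsurj_section ord0 us.
have si : injective s by move=> a b ab; rewrite -(didE a) -(didE b) -usE !dcmpE ab.
by have := leq_card _ si; rewrite !card_ord; lia.
Qed.

Program Definition mor_fst (X Y : sset) : hom (prodS X Y) X :=
  @SMor Types (prodS X Y) X (fun k z => z.1) _.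
Next Obligation. by []. Qed.

Program Definition mor_snd (X Y : sset) : hom (prodS X Y) Y :=
  @SMor Types (prodS X Y) Y (fun k z => z.2) _.
Next Obligation. by []. Qed.

(** * Partial maps and extension problems *)

Section Ext.

(** The domain is deliberately no part of the data. Statements ask separately that [G] be defined on
    a subcomplex, and may apply to a [G] that is defined on more. *)
Record pmap (B X : sset) (G : forall k, B k -> X k -> Prop) : Prop := PMap {
  pm_cl : forall k l (t : Delta l k) b x, G k b x -> G l (B.[t] b) (X.[t] x);
  pm_fun : forall k b x y, G k b x -> G k b y -> x = y }.

Definition graph (B X : sset) (f : hom B X) k (b : B k) (x : X k) : Prop := x = f k b.

Lemma graph_pmap (B X : sset) (f : hom B X) : pmap (graph f).
Proof.
by split=> [k l t b x ->|k b x y -> ->] //; rewrite /graph smNx.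
Qed.

Lemma pmap_total (B X : sset) (G : forall k, B k -> X k -> Prop) : pmap G ->
  (forall k b, exists x, G k b x) -> exists h : hom B X, forall k b, G k b (h k b).
Proof.
move=> pG tot; pose f k b := projT1 (cid (tot k b)).
have fP k b : G k b (f k b) by rewrite /f; case: cid.
have fN m n (t : Delta m n) : (fun b => f m (B.[t] b)) = (fun b => X.[t] (f n b)).
  apply: functional_extensionality_dep => b /=.
  by apply: (pm_fun pG (fP _ _)); apply: (pm_cl pG).
by exists (@SMor Types B X f fN).
Qed.

Lemma pmap_restrict (B X : sset) (G : forall k, B k -> X k -> Prop) P :
  pmap G -> sub_closed (K := B) P -> pmap (fun k b x => P k b /\ G k b x).
Proof.
move=> pG cP; split=> [k l t b x [Pb Gb]|k b x y [_ Gx] [_ Gy]].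
  by split; [apply: cP | apply: (pm_cl pG)].
exact: (pm_fun pG Gx Gy).
Qed.

Lemma pmap_post (B X Y : sset) (G : forall k, B k -> X k -> Prop) (p : hom X Y) :
  pmap G -> pmap (fun k b y => exists2 x, G k b x & p k x = y).
Proof.
move=> pG; split=> [k l t b y [x Gx <-]|k b y y' [x Gx <-] [x' Gx' <-]].
  by exists (X.[t] x); [apply: (pm_cl pG) | rewrite smNx].
by rewrite (pm_fun pG Gx Gx').
Qed.

Lemma pmap_pre (A B X : sset) (f : hom A B) (G : forall k, B k -> X k -> Prop) :
  pmap G -> pmap (fun k a x => G k (f k a) x).
Proof.
move=> pG; split=> [k l t a x Gx|k a x x' Gx Gx'].
  by rewrite smNx; apply: (pm_cl pG).
exact: (pm_fun pG Gx Gx').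
Qed.

Lemma pmap_union (B X : sset) (G H : forall k, B k -> X k -> Prop) :
  pmap G -> pmap H -> (forall k b x y, G k b x -> H k b y -> x = y) ->
  pmap (fun k b x => G k b x \/ H k b x).
Proof.
move=> pG pH GH; split=> [k l t b x [Gx|Hx]|k b x y [Gx|Hx] [Gy|Hy]].
- by left; apply: (pm_cl pG).
- by right; apply: (pm_cl pH).
- exact: (pm_fun pG Gx Gy).
- exact: (GH _ _ _ _ Gx Hy).
- by apply: esym; apply: (GH _ _ _ _ Gy Hx).
- exact: (pm_fun pH Hx Hy).
Qed.

(* Lifting problems are posed for partial maps, encoded as functional relations, so
   that subcomplexes need not be turned into simplicial sets of their own. *)
Definition ext (B : sset) (P P' : forall k, B k -> Prop) (X Y : sset) (p : hom X Y) :=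
  forall (G : forall k, B k -> X k -> Prop) (V : forall k, B k -> Y k -> Prop),
    pmap G -> pmap V -> (forall k b, P k b -> exists x, G k b x) ->
    (forall k b, P' k b -> exists y, V k b y) ->
    (forall k b x y, P k b -> G k b x -> V k b y -> p k x = y) ->
  exists G' : forall k, B k -> X k -> Prop,
    [/\ pmap G', forall k b, P' k b -> exists x, G' k b x,
        forall k b x, P k b -> G k b x -> G' k b x &
        forall k b x y, P' k b -> G' k b x -> V k b y -> p k x = y].

Definition full (B : sset) k (b : B k) : Prop := True.

Lemma full_closed (B : sset) : sub_closed (@full B).
Proof. by []. Qed.

Lemma ext_total (B : sset) P (X Y : sset) (p : hom X Y) (G : forall k, B k -> X k -> Prop)
    (v : hom B Y) : ext P (@full B) p -> pmap G ->
  (forall k b, P k b -> exists x, G k b x) ->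
  (forall k b x, P k b -> G k b x -> p k x = v k b) ->
  exists h : hom B X, (forall k b x, P k b -> G k b x -> h k b = x) /\
    (forall k b, p k (h k b) = v k b).
Proof.
move=> e pG tG Gv.
have [||G' [pG' tG' GG' G'v]] := e G (graph v) pG (graph_pmap v) tG.
- by move=> k b _; exists (v k b).
- by move=> k b x y Pb Gb ->; apply: Gv.
have [h hP] := pmap_total pG' (fun k b => tG' k b I).
exists h; split=> [k b x Pb Gb|k b].
  exact: (pm_fun pG' (hP _ _) (GG' _ _ _ Pb Gb)).
exact: (G'v _ _ _ _ I (hP _ _) erefl).
Qed.

Lemma ext_trans (B : sset) P1 P2 P3 (X Y : sset) (p : hom X Y) :
  (forall k b, P1 k b -> P2 k b) -> (forall k b, P2 k b -> P3 k b) ->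
  ext (B := B) P1 P2 p -> ext P2 P3 p -> ext P1 P3 p.
Proof.
move=> s12 s23 e1 e2 G V pG pV tG tV GV.
have [||H [pH tH GH HV]] := e1 G V pG pV tG; [by move=> k b /s23/tV | by [] |].
have [K [pK tK HK KV]] := e2 H V pH pV tH tV HV.
exists K; split=> // k b x Pb Gb; apply: HK; [exact: s12 | exact: GH].
Qed.

Lemma ext_sub (B : sset) P P' Q Q' (X Y : sset) (p : hom X Y) :
  (forall k b, P k b <-> Q k b) -> (forall k b, P' k b <-> Q' k b) ->
  ext (B := B) P P' p -> ext Q Q' p.
Proof.
move=> PQ PQ' e G V pG pV tG tV GV.
have [|||G' [pG' tG' GG' G'V]] := e G V pG pV.
- by move=> k b /PQ; apply: tG.
- by move=> k b /PQ'; apply: tV.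
- by move=> k b x y /PQ; apply: GV.
exists G'; split=> //.
- by move=> k b /PQ'; apply: tG'.
- by move=> k b x /PQ; apply: GG'.
- by move=> k b x y /PQ'; apply: G'V.
Qed.

(* Only the part of A on which r o f is the identity matters. *)
Lemma ext_retract (A B : sset) (f : hom A B) (r : hom B A) P P' Q Q' (X Y : sset)
    (p : hom X Y) :
  (forall k a, Q' k a -> r k (f k a) = a) ->
  (forall k a, Q k a -> P k (f k a)) -> (forall k a, Q k a -> Q' k a) ->
  (forall k a, Q' k a -> P' k (f k a)) ->
  (forall k b, P k b -> Q k (r k b)) -> (forall k b, P' k b -> Q' k (r k b)) ->
  ext (B := B) P P' p -> ext (B := A) Q Q' p.
Proof.
move=> rf QP QQ' QP' PQ PQ' e G V pG pV tG tV GV.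
have [|||G' [pG' tG' GG' G'V]] := e (fun k b x => G k (r k b) x) (fun k b y => V k (r k b) y)
    (pmap_pre r pG) (pmap_pre r pV).
- by move=> k b /PQ/tG.
- by move=> k b /PQ'/tV.
- by move=> k b x y /PQ; apply: GV.
exists (fun k a x => G' k (f k a) x); split.
- exact: pmap_pre.
- by move=> k a /QP'/tG'.
- by move=> k a x Qa Ga; apply: GG'; [exact: QP | rewrite rf //; apply: QQ'].
- by move=> k a x y Qa Gx Vy; apply: (G'V _ _ _ _ (QP' _ _ Qa) Gx); rewrite rf.
Qed.

Lemma ext_union (B : sset) (P : nat -> forall k, B k -> Prop) (X Y : sset) (p : hom X Y) :
  (forall n, sub_closed (P n)) -> (forall n k b, P n k b -> P n.+1 k b) ->
  (forall n, ext (P n) (P n.+1) p) -> ext (P 0) (fun k b => exists n, P n k b) p.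
Proof.
move=> cP mP eP G V pG pV tG tV GV.
(* The domain of stage n is required to be exactly [P n]: every value of a stage then lies over
   [P n], where the next extension keeps it, so the stages are nested and their union is
   functional. *)
pose TP n (H : forall k, B k -> X k -> Prop) := [/\ pmap H,
   forall k b, P n k b <-> exists x, H k b x,
   forall k b x, P 0 k b -> G k b x -> H k b x &
   forall k b x y, H k b x -> V k b y -> p k x = y].
pose T n := {H | TP n H}.
have P0 n k b : P 0 k b -> P n k b by elim: n => // n IH /IH/mP.
have T0 : T 0.
  exists (fun k b x => P 0 k b /\ G k b x); split; first exact: pmap_restrict.
  - by move=> k b; split=> [Pb|[x []]//]; have [x Gx] := tG _ _ Pb; exists x.
  - by [].
  - by move=> k b x y [Pb Gb]; apply: GV.
have step n (H : T n) : exists H' : T n.+1, forall k b x, sval H k b x -> sval H' k b x.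
  case: H => H [pH tH GH HV] /=.
  have [|||H' [pH' tH' HH' H'V]] := eP n H V pH pV.
  - by move=> k b /tH.
  - by move=> k b Pb; apply: tV; exists n.+1.
  - by move=> k b x y _; apply: HV.
  have gd : TP n.+1 (fun k b x => P n.+1 k b /\ H' k b x).
    split; first exact: pmap_restrict.
    + by move=> k b; split=> [Pb|[x []]//]; have [x Hx] := tH' _ _ Pb; exists x.
    + move=> k b x Pb Gb; split; first exact: P0.
      by apply: HH'; [exact: P0 | exact: GH].
    + by move=> k b x y [Pb Hb]; apply: H'V.
  exists (exist _ _ gd) => k b x /= Hx.
  have Pb : P n k b by apply/tH; exists x.
  by split; [exact: mP | apply: HH'].
pose nxt n (H : T n) := projT1 (cid (step n H)).
have nxtP n (H : T n) k b x : sval H k b x -> sval (nxt n H) k b x.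
  by rewrite /nxt; case: cid => H' /= h; apply: h.
pose S := fix S n : T n := if n is m.+1 then nxt m (S m) else T0.
have mono m n k b x : sval (S n) k b x -> sval (S (m + n)) k b x.
  by elim: m => // m IH /IH; apply: nxtP.
exists (fun k b x => exists n, sval (S n) k b x); split.
- split=> [k l t b x [n Hx]|k b x y [n Hx] [m Hy]].
    by exists n; have [pH _ _ _] := svalP (S n); apply: (pm_cl pH).
  move: (mono m _ _ _ _ Hx) (mono n _ _ _ _ Hy); rewrite addnC.
  by have [pH _ _ _] := svalP (S (n + m)); apply: (pm_fun pH).
- move=> k b [n Pb]; have [pH tH GH HV] := svalP (S n).
  by have [x Hx] := proj1 (tH _ _) Pb; exists x, n.
- by move=> k b x Pb Gb; exists 0; have [_ _ GH _] := svalP (S 0); apply: GH.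
- by move=> k b x y _ [n Hx]; have [_ _ _ HV] := svalP (S n); apply: HV.
Qed.

(** For [P] inside [P'], the source of the pushout product of the inclusion of [P] into [P'] with
    that of [Q] into [K]; its target is [onfst P']. *)
Definition pp (B K : sset) (P P' : forall k, B k -> Prop) (Q : forall k, K k -> Prop)
    k (z : prodS B K k) : Prop := P k z.1 \/ P' k z.1 /\ Q k z.2.

Definition onfst (B K : sset) (P : forall k, B k -> Prop) k (z : prodS B K k) : Prop :=
  P k z.1.

Lemma pp_closed (B K : sset) P P' Q : sub_closed (K := B) P -> sub_closed (K := B) P' ->
  sub_closed (K := K) Q -> sub_closed (@pp B K P P' Q).
Proof.
move=> cP cP' cQ l k t [b x] [Pb|[Pb Qx]]; [left | right].
  exact: cP.
by split; [apply: cP' | apply: cQ].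
Qed.

Lemma onfst_closed (B K : sset) P : sub_closed (K := B) P -> sub_closed (@onfst B K P).
Proof. by move=> cP l k t [b x]; apply: cP. Qed.

(** The relative skeleton with the dimension shifted by one, so that stage 0 is [Q] itself. *)
Definition skpred (K : sset) (Q : forall k, K k -> Prop) n k (x : K k) : Prop :=
  Q k x \/ exists i (t : Delta k i) (y : K i), i < n /\ x = K.[t] y.

Lemma skpred_closed (K : sset) Q n : sub_closed (K := K) Q -> sub_closed (skpred Q n).
Proof.
move=> cQ l k t x [Qx|[i [s [y [lt ->]]]]]; [left; exact: cQ | right].
by exists i, (dcmp s t), y; rewrite smapMx.
Qed.

(* Eilenberg-Zilber: x.s = y.t outside a subcomplex containing the boundaries of
   x and y only if x = y and s = t. *)
Lemma cell_unique (K : sset) (P : forall k, K k -> Prop) n (x y : K n) k (s t : Delta k n) :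
  sub_closed P ->
  (forall l (u : Delta l n), bd u -> P l (K.[u] x)) ->
  (forall l (u : Delta l n), bd u -> P l (K.[u] y)) ->
  K.[s] x = K.[t] y -> ~ P k (K.[s] x) -> x = y /\ s = t.
Proof.
move=> cP bx by_ e nP.
have nx : ~ P n x by move=> Px; apply: nP; apply: cP.
have ny : ~ P n y by move=> Py; apply: nP; rewrite e; apply: cP.
have ss : dsurjective s by apply: not_bd => /bx.
(* A section [d] of [s] is also one of [t]: otherwise [dcmp t d] lies in the boundary, and x =
   K.[dcmp t d] y would already belong to [P]. Common sections through every [i] then force [s] and
   [t] to coincide. *)
have key i : exists d : Delta n k, [/\ dcmp s d = did n, dcmp t d = did n & d (s i) = i].
  have [d [sd di]] := dsurj_section i ss; exists d; split=> //.
  apply: dsurj_endo; apply: not_bd => btd; apply: nx.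
  have -> : x = K.[dcmp t d] y by rewrite smapMx -e -smapMx sd smap1x.
  exact: by_.
split.
  have [d [sd td _]] := key ord0.
  by rewrite -(smap1x x) -(smap1x y) -{1}sd -td !smapMx e.
apply: Delta_ext => i; have [d [sd td di]] := key i.
by rewrite -[in RHS]di -dcmpE td didE.
Qed.

(** Induction over the relative skeleta of [Q] in [K]. All n-cells are attached at once: a lift is
    chosen for each cell, and by [cell_unique] two cells can overlap only in the previous stage,
    where the lifts agree with what is given. *)
Lemma cells (B K : sset) P P' (Q : forall k, K k -> Prop) (X Y : sset) (p : hom X Y) :
  sub_closed (K := B) P -> sub_closed (K := B) P' -> sub_closed Q ->
  (forall k b, P k b -> P' k b) ->
  (forall n, ext (@pp B (simplex n) P P' (@bd n)) (@onfst B (simplex n) P') p) ->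
  ext (@pp B K P P' Q) (@onfst B K P') p.
Proof.
move=> cP cP' cQ PP' e.
pose R n := @pp B K P P' (skpred Q n).
have cR n : sub_closed (R n) by apply: pp_closed => //; apply: skpred_closed.
have mR n k z : R n k z -> R n.+1 k z.
  case=> [Pb|[Pb [Qx|[i [t [y [lt ex]]]]]]]; first by left.
    by right; split=> //; left.
  by right; split=> //; right; exists i, t, y; split=> //; apply: ltnW.
suff eR : forall n, ext (R n) (R n.+1) p.
  apply: ext_sub (ext_union cR mR eR) => k [b x].
    split=> [[Pb|[Pb [Qx|[i [t [y [//]]]]]]]|[Pb|[Pb Qx]]]; rewrite /R /pp; [by left | by right
      | by left | by right; split=> //; left].
  split=> [[n [Pb|[Pb _]]]|Pb]; rewrite /onfst; [exact: PP' | by [] |].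
  exists k.+1; right; split=> //; right; exists k, (did k), x; by rewrite smap1x.
move=> n G V pG pV tG tV GV.
(* As [skpred Q n] contains the degenerate n-simplices, a cell is a nondegenerate n-simplex outside
   [Q]. *)
pose cell (x : K n) := ~ skpred Q n x.
have cell_bd (x : K n) l (u : Delta l n) : bd u -> skpred Q n (K.[u] x).
  move=> /bd_factor[m [u1 [u2 [mn ->]]]]; right; exists m, u2, (K.[u1] x).
  by rewrite smapMx.
have lft (x : K n) : exists h : forall k, prodS B (simplex n) k -> X k -> Prop,
  [/\ pmap h, forall k z, P' k z.1 -> exists y, h k z y,
   forall k b t y, R n k (b, K.[t] x) -> P k b \/ P' k b /\ bd t ->
     G k (b, K.[t] x) y -> h k (b, t) y &
   forall k b t y w, P' k b -> h k (b, t) y -> V k (b, K.[t] x) w -> p k y = w].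
  pose f : hom (prodS B (simplex n)) (prodS B K) :=
    pairS (mor_fst B (simplex n)) (yoneda x ∘ mor_snd B (simplex n)).
  have fP k (z : prodS B (simplex n) k) : @pp B (simplex n) P P' (@bd n) k z -> R n k (f k z).
    by case: z => b t [Pb|[Pb bt]]; [left | right; split=> //; apply: cell_bd].
  have [|||h [ph th Gh hV]] := e n _ _ (pmap_pre f pG) (pmap_pre f pV).
  - by move=> k z /fP; apply: tG.
  - move=> k [b t] Pb; apply: tV; right; split=> //; right.
    by exists n, t, x.
  - by move=> k z y w /fP; apply: GV.
  exists h; split=> //.
  - by move=> k b t y _ pb Gy; apply: Gh => //.
  - by move=> k b t y w Pb hy Vw; exact: (hV k (b, t) y w Pb hy Vw).
pose h x := projT1 (cid (lft x)).
have hP x : [/\ pmap (h x), forall k z, P' k z.1 -> exists y, h x k z y,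
   forall k b t y, R n k (b, K.[t] x) -> P k b \/ P' k b /\ bd t ->
     G k (b, K.[t] x) y -> h x k (b, t) y &
   forall k b t y w, P' k b -> h x k (b, t) y -> V k (b, K.[t] x) w -> p k y = w].
  by rewrite /h; case: cid.
pose N k (z : prodS B K k) y := exists (x : K n) (t : Delta k n),
  [/\ cell x, P' k z.1, z.2 = K.[t] x & h x k (z.1, t) y].
pose G0 k z y := R n k z /\ G k z y.
have G0N k z y w : G0 k z y -> N k z w -> y = w.
  case: z => b x' [Rz Gy] [x [t [/= cx Pb e2 hw]]].
  have [ph th Gh hV] := hP x; apply: (pm_fun ph _ hw); rewrite e2 in Rz Gy.
  apply: (Gh k b t y Rz _ Gy); case: Rz => [|[_ Sx]]; first by left.
  right; split=> //; apply: contrapT => /not_bd ts; apply: cx.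
  have [d [td _]] := dsurj_section ord0 ts.
  have -> : x = K.[d] (K.[t] x) by rewrite -smapMx td smap1x.
  exact: skpred_closed.
have pN : pmap N.
  split=> [k l u [b x'] y [x [t [/= cx Pb -> hy]]]|k [b x'] y w].
    exists x, (dcmp t u); split=> //=; [exact: cP' | by rewrite smapMx |].
    have [ph _ _ _] := hP x; exact: (pm_cl ph u hy).
  move=> N1 N2; have [x [t [/= cx Pb e1 hy]]] := N1.
  have [x2 [t2 [/= cx2 _ e2 hw]]] := N2.
  case: (pselect (R n k (b, x'))) => [Rz|nR].
    have [v Gv] := tG _ _ Rz.
    by rewrite -(G0N k (b, x') v y) // (G0N k (b, x') v w).
  have [|ex et] := @cell_unique K _ n x x2 k t t2 (@skpred_closed K Q n cQ)
     (@cell_bd x) (@cell_bd x2) (etrans (esym e1) e2).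
    by rewrite -e1 => Sx; apply: nR; right.
  subst x2 t2; have [ph _ _ _] := hP x; exact: (pm_fun ph hy hw).
exists (fun k z y => G0 k z y \/ N k z y); split.
- by apply: pmap_union => //; apply: pmap_restrict.
- move=> k [b x] Rz; case: (pselect (R n k (b, x))) => [Rz'|nR].
    by have [y Gy] := tG _ _ Rz'; exists y; left.
  case: Rz => [Pb|[/= Pb [Qx|[i [t [x0 [lt e2]]]]]]].
  - by case: nR; left.
  - by case: nR; right; split=> //; left.
  have : i = n.
    apply/eqP; rewrite eqn_leq -ltnS lt /= leqNgt; apply/negP => lt2; apply: nR.
    by right; split=> //; right; exists i, t, x0.
  move=> ei; subst i; have [_ th _ _] := hP x0; have [y hy] := th k (b, t) Pb.
  exists y; right; exists x0, t; split=> // Sx0; apply: nR; right; split=> //=.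
  by rewrite e2; apply: skpred_closed.
- by move=> k z y Rz Gy; left.
- move=> k z y w _ [[Rz Gy]|[x [t [cx Pb e2 hy]]]] Vw; first exact: GV Vw.
  have [_ _ _ hV] := hP x; apply: (hV _ _ _ _ _ Pb hy); rewrite -e2.
  by case: z Vw {Pb e2 hy}.
Qed.

End Ext.

(** * Horns and the decomposition of prisms *)

Section Prism.

Lemma ext_llp (B : sset) P (cP : sub_closed (K := B) P) (X Y : sset) (p : hom X Y) :
  llp (subS_incl cP) p -> ext P (@full B) p.
Proof.
move=> l G V pG pV tG tV GV.
have [v vV] := pmap_total pV (fun k b => tV k b I).
have [u uG] := pmap_total (pmap_pre (subS_incl cP) pG) (fun k b => tG k (sval b) (svalP b)).
have [|h [hu hv]] := l u v.
  by apply: sset_ext => k b; apply: (GV _ _ _ _ (svalP b) (uG k b)); apply: vV.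
exists (graph h); split.
- exact: graph_pmap.
- by move=> k b _; exists (h k b).
- move=> k b x Pb Gx; rewrite /graph; apply: (pm_fun pG Gx).
  have -> : h k b = u k (exist _ b Pb).
    exact: (congr1 (fun g : smor (subS cP) X => g k (exist _ b Pb)) hu).
  exact: (uG k (exist _ b Pb)).
- move=> k b x y _ -> Vy; apply: (pm_fun pV _ Vy).
  have -> : p k (h k b) = v k b by apply: (congr1 (fun g : smor B Y => g k b) hv).
  exact: vV.
Qed.

Lemma llp_ext (A B : sset) (i : hom A B) (X Y : sset) (p : hom X Y) :
  (forall k, injective (i k)) -> ext (fun k b => exists a, i k a = b) (@full B) p ->
  llp i p.
Proof.
move=> iI e u v uv.
have [|||h [hG hv]] := ext_total (G := fun k b x => exists a, i k a = b /\ u k a = x)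
   (v := v) e.
- split=> [k l t b x [a [<- <-]]|k b x y [a [<- <-]] [a' [/iI -> <-]]] //.
  by exists (A.[t] a); rewrite !smNx.
- by move=> k b [a <-]; exists (u k a), a.
- move=> k b x _ [a [<- <-]].
  exact: (congr1 (fun g : smor A Y => g k a) uv).
exists h; split; apply: sset_ext => k a; last exact: hv.
by apply: hG; exists a.
Qed.

Lemma llp_subS (B : sset) P (cP : sub_closed (K := B) P) (X Y : sset) (p : hom X Y) :
  ext P (@full B) p -> llp (subS_incl cP) p.
Proof.
move=> e; apply: llp_ext => [k x y|]; first exact: sig_ext.
apply: ext_sub e => // k b; split=> [Pb|[a <-]]; last exact: svalP.
by exists (exist _ b Pb).
Qed.

Lemma kan_fib_horn (X Y : sset) (p : hom X Y) n (i : 'I_n.+2) : kan_fib p ->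
  ext (B := simplex n.+1) (@in_horn n.+1 i) (@full _) p.
Proof. by move=> kp; apply: ext_llp (@horn_closed _ _) _ _ _ _; apply: kp. Qed.

(** Beyond [P] only the simplex [x0] is new, and it is glued along a horn. The horn filler gives the
    values on [x0]; as [x0] is embedded these are well defined, and they match the old ones because
    [x0] meets [P] in the horn only. *)
Lemma horn_attach (L X Y : sset) (p : hom X Y) P P' m (i : 'I_m.+2) (x0 : L m.+1) :
  kan_fib p -> sub_closed (K := L) P ->
  (forall k (t : Delta k m.+1), in_horn i t <-> P k (L.[t] x0)) ->
  (forall k (s t : Delta k m.+1), L.[s] x0 = L.[t] x0 -> s = t) ->
  (forall k b, P' k b -> P k b \/ exists t, b = L.[t] x0) ->
  P' m.+1 x0 -> ext P P' p.
Proof.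
move=> kp cP hP inj P'P P'x G V pG pV tG tV GV.
have [y0 Vy0] := tV _ _ P'x.
have [|||h [hG hv]] := ext_total (G := fun k t z => G k (yoneda x0 k t) z)
   (v := yoneda y0) (kan_fib_horn (i := i) kp).
- exact: pmap_pre.
- by move=> k t /hP/tG.
- move=> k t z /hP Pt Gz; apply: (GV _ _ _ _ Pt Gz); exact: (pm_cl pV).
exists (fun k b z => (P k b /\ G k b z) \/ exists t, b = L.[t] x0 /\ z = h k t); split.
- apply: pmap_union; first exact: pmap_restrict.
    split=> [k l t b x [s [-> ->]]|k b x y [s [-> ->]] [t [/inj -> ->]]] //.
    by exists (dcmp s t); rewrite smapMx -smNx.
  move=> k b x y [Pb Gx] [t [eb ->]]; apply: esym; apply: hG; rewrite eb in Pb Gx => //.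
  exact/hP.
- move=> k b /P'P[Pb|[t ->]]; first by have [z Gz] := tG _ _ Pb; exists z; left.
  by exists (h k t); right; exists t.
- by move=> k b z Pb Gz; left.
- move=> k b z y P'b [[Pb Gz]|[t [eb ->]]] Vy; first exact: GV Vy.
  rewrite hv; apply: (pm_fun pV _ Vy); rewrite eb; exact: (pm_cl pV).
Qed.

Definition dend (e : 'I_2) k (t : simplex 1 k) : Prop := forall s, dfun t s = e.

Lemma dend_closed e : sub_closed (K := simplex 1) (@dend e).
Proof. by move=> l k t x h s; rewrite dcmpE. Qed.

Definition ddeg_fun n (j : 'I_n.+1) (i : 'I_n.+2) : 'I_n.+1 := inord (i - (j < i)).
Lemma ddeg_homo n (j : 'I_n.+1) : {homo ddeg_fun j : i k / i <= k}.
Proof.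
by move=> i k ik; rewrite /ddeg_fun !inordK; have := ltn_ord i; have := ltn_ord k;
  have := ltn_ord j; lia.
Qed.
Definition ddeg n (j : 'I_n.+1) : Delta n.+1 n := mkDelta (@ddeg_homo n j).
Lemma ddegE n (j : 'I_n.+1) i : ddeg j i = i - (j < i) :> nat.
Proof.
by rewrite mkDeltaE /ddeg_fun inordK //; have := ltn_ord i; have := ltn_ord j; lia.
Qed.

(** Paired with [ddeg j] this spells the j-th maximal simplex (0,0), ..., (0,j), (1,j), ..., (1,n)
    of the prism. *)
Definition dthr_fun n (j : 'I_n.+1) (i : 'I_n.+2) : 'I_2 := inord (j < i).
Lemma dthr_homo n (j : 'I_n.+1) : {homo dthr_fun j : i k / i <= k}.
Proof. by move=> i k ik; rewrite /dthr_fun !inordK; lia. Qed.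
Definition dthr n (j : 'I_n.+1) : Delta n.+1 1 := mkDelta (@dthr_homo n j).
Lemma dthrE n (j : 'I_n.+1) i : dthr j i = (j < i) :> nat.
Proof. by rewrite mkDeltaE /dthr_fun inordK //; lia. Qed.

Lemma val_neq n (i j : 'I_n) : i != j -> (i : nat) <> j.
Proof. by move=> /eqP h e; apply: h; apply: val_inj. Qed.

Lemma neq_val n (i j : 'I_n) : (i : nat) <> j -> i != j.
Proof. by move=> h; apply/eqP => e; apply: h; rewrite e. Qed.

Lemma ord2E (e : 'I_2) : e = ord0 \/ e = ord_max.
Proof. by case: e => [[|[|//]] ?]; [left | right]; apply: val_inj. Qed.

(** The vertex (y, x) of the j-th maximal simplex sits at position x + y, which gives the operator
    [t]. *)
Lemma prism_chain n k (y : Delta k 1) (x : Delta k n) (j : 'I_n.+1) s0 s1 :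
  (forall s, y s = 0 :> nat -> x s <= j) -> (forall s, y s = 1 :> nat -> j <= x s) ->
  x s0 = j -> x s1 = j ->
  exists t : Delta k n.+1, (y, x) = (prodS (simplex 1) (simplex n)).[t] (dthr j, ddeg j).
Proof.
move=> h0 h1 _ _.
have tb s : x s + y s < n.+2 by have := ltn_ord (x s); have := ltn_ord (y s); lia.
pose t s : 'I_n.+2 := inord (x s + y s).
have tH : {homo t : i k / i <= k}.
  move=> a b ab; rewrite /t !inordK //.
  by have := Delta_homo x ab; have := Delta_homo y ab; lia.
exists (mkDelta tH); congr pair; apply: Delta_ext => s; apply: val_inj;
  rewrite /= dcmpE mkDeltaE ?dthrE ?ddegE inordK //;
  by have := h0 s; have := h1 s; have := ltn_ord (y s); lia.
Qed.

Lemma prism_inj n (j : 'I_n.+1) k (s t : Delta k n.+1) :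
  (prodS (simplex 1) (simplex n)).[s] (dthr j, ddeg j) =
  (prodS (simplex 1) (simplex n)).[t] (dthr j, ddeg j) -> s = t.
Proof.
move=> e.
have e1 : dcmp (dthr j) s = dcmp (dthr j) t := congr1 fst e.
have e2 : dcmp (ddeg j) s = dcmp (ddeg j) t := congr1 snd e.
apply: Delta_ext => a; apply: val_inj => /=.
have := congr1 val (Delta_eqE a e1); have := congr1 val (Delta_eqE a e2).
by rewrite !dcmpE /= !dthrE !ddegE; lia.
Qed.

(** The stages of a filtration of the prism that starts with the end [e] and the sides; admitting
    one more column in [c] attaches one maximal simplex along a horn. *)
Definition prism_pred n (e : 'I_2) (c : nat -> Prop) k
    (z : prodS (simplex 1) (simplex n) k) : Prop :=
  [\/ dend e z.1, bd z.2 | forall s, dfun z.1 s <> e -> c (dfun z.2 s)].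

Lemma prism_closed n e c : sub_closed (@prism_pred n e c).
Proof.
move=> l k t [y x] [h|h|h]; [apply: Or31 | apply: Or32 | apply: Or33].
- exact: dend_closed.
- exact: bd_closed.
- by move=> s /=; rewrite !dcmpE; apply: h.
Qed.

(** The maximal simplices are attached one by one, moving away from the given end. From the end 0
    the columns [j] are taken in decreasing order and the face opposite to position j is the missing
    one; from the end 1 they increase and the missing face is opposite to j+1. *)
Lemma prism_end (X Y : sset) (p : hom X Y) n (e : 'I_2) : kan_fib p ->
  ext (@pp (simplex 1) (simplex n) (@dend e) (@full _) (@bd n))
      (@onfst (simplex 1) (simplex n) (@full _)) p.
Proof.
move=> kp; have [->|->] := ord2E e.
- pose P a := @prism_pred n ord0 (fun i => n < i + a).
  have ind a : a <= n.+1 -> ext (P 0) (P a) p.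
    elim: a => [_|a IH an].
      move=> G V pG pV tG tV GV; exists (fun k b x => P 0 k b /\ G k b x); split=> //.
      + exact: pmap_restrict (@prism_closed _ _ _).
      + by move=> k b Pb; have [x Gx] := tG _ _ Pb; exists x.
      + by move=> k b x y Pb [_ Gx]; apply: GV.
    have mP b k z : b <= a -> P b k z -> P a k z.
      move=> ba [h|h|h]; [exact: Or31 | exact: Or32 | apply: Or33 => s /h]; lia.
    have jn : n - a < n.+1 by lia.
    pose j : 'I_n.+1 := Ordinal jn.
    have jE : (j : nat) = n - a by [].
    have jn2 : n - a < n.+2 by lia.
    apply: ext_trans (IH (ltnW an)) _; first by move=> k b; apply: mP.
      by move=> k b [h|h|h]; [exact: Or31 | exact: Or32 | apply: Or33 => s /h; lia].
    apply: (@horn_attach (prodS (simplex 1) (simplex n)) X Y p (P a) (P a.+1) n (Ordinal jn2) (dthr j, ddeg j)) => //.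
    + exact: prism_closed.
    + move=> k t; split=> [[c [cj ct]]|[h|[c ct]|h]].
      * have := val_neq cj => /= {}cj; have {}ct s := val_neq (ct s).
        have [cj'|cj'] : c < j \/ j < c by lia.
          have cn : c < n.+1 by lia.
          apply: Or32; exists (Ordinal cn) => s; apply: neq_val; rewrite dcmpE ddegE /=.
          by have := ct s; lia.
        have [cj2|cj2] : (c : nat) = j.+1 \/ j.+1 < c by lia.
          apply: Or33 => s /=; rewrite !dcmpE ddegE => h.
          have {}h : (dthr j (t s) : nat) <> 0 by move=> e0; apply: h; apply: val_inj.
          by move: h; rewrite dthrE; have := ct s; lia.
        have cn : c.-1 < n.+1 by have := ltn_ord c; lia.
        apply: Or32; exists (Ordinal cn) => s; apply: neq_val; rewrite dcmpE ddegE /=.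
        by have := ct s; lia.
      * have jn3 : j.+1 < n.+2 by lia.
        exists (Ordinal jn3); split=> [|s]; apply: neq_val => /=; first by lia.
        by have := congr1 val (h s); rewrite /= dcmpE dthrE; lia.
      * have {}ct s := val_neq (ct s).
        have cn : c + (j <= c) < n.+2 by have := ltn_ord c; lia.
        exists (Ordinal cn); split=> [|s]; apply: neq_val => /=; first by lia.
        by have := ct s; rewrite /= dcmpE ddegE; lia.
      * have jn3 : j.+1 < n.+2 by lia.
        exists (Ordinal jn3); split=> [|s]; apply: neq_val => /=; first by lia.
        move=> e1; have := h s; rewrite /= !dcmpE ddegE => {}h.
        have : n < t s - (j < t s) + a by apply: h => /(congr1 val); rewrite /= dthrE; lia.
        by lia.
    + exact: prism_inj.
    + move=> k [y x] Pz; case: (pselect (P a k (y, x))) => nP; [by left | right].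
      case: Pz => [h|h|h]; [by case: nP; apply: Or31 | by case: nP; apply: Or32 |].
      (* A simplex new at this stage must have a vertex in column [j] off the end; monotonicity then
         places it in the j-th maximal simplex. *)
      have [s0 s0P] : exists s, dfun y s <> ord0 /\ dfun x s = j.
        apply: contrapT => nex; apply: nP; apply: Or33 => s ys.
        have := h s ys => /= xs; have : dfun x s != j by apply/eqP => xj; apply: nex; exists s.
        by move=> /val_neq; lia.
      case: s0P => y0 x0.
      apply: (@prism_chain n k y x j s0 s0) => // s ys.
        have ss : s <= s0.
          rewrite leqNgt; apply/negP => /ltnW /(Delta_homo y); rewrite ys leqn0 => /eqP e0.
          by apply: y0; apply: val_inj.
        by rewrite -x0; apply: Delta_homo.
      by have := h s => /= {}h; have : n < dfun x s + a.+1 by [apply: h => e0; rewrite e0 in ys]; lia.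
    + by apply: Or33 => s /=; rewrite ddegE => h; have : (dthr j s : nat) <> 0;
        [by move=> e0; apply: h; apply: val_inj | rewrite dthrE; lia].
  apply: ext_sub (ind n.+1 (leqnn _)) => k [y x].
    split=> [[h|h|h]|[h|[_ h]]]; [by left | by right | | exact: Or31 | exact: Or32].
    left=> s; apply: contrapT => /h /=; have := ltn_ord (dfun x s); lia.
  by split=> // _; apply: Or33 => s _ /=; lia.
- pose P a := @prism_pred n ord_max (fun i => i < a).
  have ind a : a <= n.+1 -> ext (P 0) (P a) p.
    elim: a => [_|a IH an].
      move=> G V pG pV tG tV GV; exists (fun k b x => P 0 k b /\ G k b x); split=> //.
      + exact: pmap_restrict (@prism_closed _ _ _).
      + by move=> k b Pb; have [x Gx] := tG _ _ Pb; exists x.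
      + by move=> k b x y Pb [_ Gx]; apply: GV.
    have mP b k z : b <= a -> P b k z -> P a k z.
      move=> ba [h|h|h]; [exact: Or31 | exact: Or32 | apply: Or33 => s /h]; lia.
    pose j : 'I_n.+1 := Ordinal an.
    have jE : (j : nat) = a by [].
    have jn2 : a.+1 < n.+2 by lia.
    apply: ext_trans (IH (ltnW an)) _; first by move=> k b; apply: mP.
      by move=> k b [h|h|h]; [exact: Or31 | exact: Or32 | apply: Or33 => s /h; lia].
    have y1 (y : 'I_2) : y <> ord_max <-> (y : nat) = 0.
      by have [->|->] := ord2E y; split.
    apply: (@horn_attach (prodS (simplex 1) (simplex n)) X Y p (P a) (P a.+1) n (Ordinal jn2) (dthr j, ddeg j)) => //.
    + exact: prism_closed.
    + move=> k t; split=> [[c [cj ct]]|[h|[c ct]|h]].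
      * have := val_neq cj => /= {}cj; have {}ct s := val_neq (ct s).
        have [cj'|cj'] : c < j.+1 \/ j.+1 < c by lia.
          have [cj2|cj2] : (c : nat) = j \/ c < j by lia.
            apply: Or33 => s /=; rewrite !dcmpE ddegE y1 dthrE.
            by have := ct s; lia.
          have cn : c < n.+1 by lia.
          apply: Or32; exists (Ordinal cn) => s; apply: neq_val; rewrite dcmpE ddegE /=.
          by have := ct s; lia.
        have cn : c.-1 < n.+1 by have := ltn_ord c; lia.
        apply: Or32; exists (Ordinal cn) => s; apply: neq_val; rewrite dcmpE ddegE /=.
        by have := ct s; lia.
      * have jn3 : j < n.+2 by lia.
        exists (Ordinal jn3); split=> [|s]; apply: neq_val => /=; first by lia.
        by have := congr1 val (h s); rewrite /= dcmpE dthrE; lia.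
      * have {}ct s := val_neq (ct s).
        have cn : c + (j < c) < n.+2 by have := ltn_ord c; lia.
        exists (Ordinal cn); split=> [|s]; apply: neq_val => /=; first by lia.
        by have := ct s; rewrite /= dcmpE ddegE; lia.
      * have jn3 : j < n.+2 by lia.
        exists (Ordinal jn3); split=> [|s]; apply: neq_val => /=; first by lia.
        by move=> e1; have := h s; rewrite /= !dcmpE ddegE y1 dthrE; lia.
    + exact: prism_inj.
    + move=> k [y x] Pz; case: (pselect (P a k (y, x))) => nP; [by left | right].
      case: Pz => [h|h|h]; [by case: nP; apply: Or31 | by case: nP; apply: Or32 |].
      have [s0 [y0 x0]] : exists s, dfun y s <> ord_max /\ dfun x s = j.
        apply: contrapT => nex; apply: nP; apply: Or33 => s ys.
        have := h s ys => /= xs; have : dfun x s != j by apply/eqP => xj; apply: nex; exists s.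
        by move=> /val_neq; lia.
      apply: (@prism_chain n k y x j s0 s0) => // s ys.
        by have := h s; rewrite /= y1; lia.
      have ss : s0 <= s.
        rewrite leqNgt; apply/negP => /ltnW /(Delta_homo y).
        by move/y1: y0; lia.
      by rewrite -x0; apply: Delta_homo.
    + by apply: Or33 => s /=; rewrite ddegE y1 dthrE; lia.
  apply: ext_sub (ind n.+1 (leqnn _)) => k [y x].
    split=> [[h|h|h]|[h|[_ h]]]; [by left | by right | | exact: Or31 | exact: Or32].
    left=> s; apply: contrapT => /h /=; lia.
  by split=> // _; apply: Or33 => s _ /=; have := ltn_ord (dfun x s); lia.
Qed.

End Prism.

(** * Trivial cofibrations *)

Section TrivialCofibrations.

Lemma ext_image (A B : sset) (i : hom A B) P P' (X Y : sset) (p : hom X Y) :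
  (forall k, injective (i k)) -> (forall k b, P k b -> P' k b) ->
  (forall k b, P' k b -> exists a, i k a = b) ->
  ext (B := A) (fun k a => P k (i k a)) (fun k a => P' k (i k a)) p ->
  ext (B := B) P P' p.
Proof.
move=> iI PP' im e G V pG pV tG tV GV.
have [|||G' [pG' tG' GG' G'V]] := e _ _ (pmap_pre i pG) (pmap_pre i pV).
- by move=> k a; apply: tG.
- by move=> k a; apply: tV.
- by move=> k a x y; apply: GV.
exists (fun k b x => exists2 a, i k a = b & G' k a x); split.
- split=> [k l t b x [a <- Gx]|k b x y [a <- Gx] [a' /iI -> Gy]].
    by exists (A.[t] a); [rewrite smNx | apply: (pm_cl pG')].
  exact: (pm_fun pG' Gx Gy).
- move=> k b Pb; have [a ea] := im _ _ Pb; rewrite -ea in Pb.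
  by have [x Gx] := tG' _ _ Pb; exists x, a.
- move=> k b x Pb Gx; have [a ea] := im _ _ (PP' _ _ Pb); subst b.
  by exists a => //; apply: GG'.
- by move=> k b x y Pb [a ea Gx]; subst b; apply: G'V.
Qed.

Definition prod_swap (X Y : sset) : hom (prodS X Y) (prodS Y X) :=
  pairS (mor_snd X Y) (mor_fst X Y).

Definition prod_map (X Y X' Y' : sset) (f : hom X X') (g : hom Y Y') :
  hom (prodS X Y) (prodS X' Y') := pairS (f ∘ mor_fst X Y) (g ∘ mor_snd X Y).

(** The relative homotopy lifting property: [cells] with the factors exchanged, the interval with
    its end in the first place and the cells of [P'] outside [P] in the second, reduces it to
    [prism_end]. *)
Lemma kan_fib_hlp (X Y : sset) (p : hom X Y) (e : 'I_2) (B : sset) P P' : kan_fib p ->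
  sub_closed (K := B) P -> sub_closed (K := B) P' -> (forall k b, P k b -> P' k b) ->
  ext (@pp B (simplex 1) P P' (@dend e)) (@onfst B (simplex 1) P') p.
Proof.
move=> kp cP cP' PP'.
pose Q k (b : subS cP' k) := P k (sval b).
have cQ : sub_closed Q by move=> l k t b; apply: cP.
have := @cells (simplex 1) (subS cP') (@dend e) (@full _) Q X Y p (@dend_closed e)
  (@full_closed _) cQ (fun _ _ _ => I) (fun n => @prism_end X Y p n e kp).
set i := pairS (subS_incl cP' ∘ mor_snd (simplex 1) (subS cP')) (mor_fst (simplex 1) (subS cP')).
move=> h; apply: (@ext_image _ _ i).
- by move=> k [y b] [y' b'] /= [/sig_ext -> ->].
- by move=> k [b y] [/PP'|[]].
- by move=> k [b y] Pb; exists (y, exist _ b Pb).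
- apply: ext_sub h => k [y b]; split=> //=.
  + by case=> [h|[_ h]]; [right; split=> //; apply: (svalP b) | left].
  + by case=> [h|[_ h]]; [right | left].
  + by move=> _; apply: (svalP b).
Qed.

Section SimplexHomotopy.
Variables (n m : nat) (f g : Delta n m) (fg : forall i, f i <= g i).

Definition dhom_fun k (x : Delta k n) (y : Delta k 1) s := if y s == ord0 then f (x s) else g (x s).

Lemma dhom_homo k (x : Delta k n) (y : Delta k 1) : {homo dhom_fun x y : i j / i <= j}.
Proof.
move=> i j ij; have xij := Delta_homo x ij; rewrite /dhom_fun; case: eqP => yi; case: eqP => yj.
- exact: Delta_homo.
- by apply: (leq_trans (fg _)); apply: Delta_homo.
- by have := Delta_homo y ij; rewrite yj leqn0 => /eqP e; case: yi; apply: val_inj.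
- exact: Delta_homo.
Qed.

Program Definition dhom : hom (prodS (simplex n) (simplex 1)) (simplex m) :=
  @SMor Types (prodS (simplex n) (simplex 1)) (simplex m)
    (fun k z => mkDelta (dhom_homo z.1 z.2)) _.
Next Obligation.
move=> k l t; apply: functional_extensionality_dep => -[x y] /=.
by apply: Delta_ext => s; rewrite dcmpE !mkDeltaE /dhom_fun /= !dcmpE.
Qed.

Lemma dhomE k (x : Delta k n) (y : Delta k 1) s :
  dfun (dhom k (x, y)) s = if y s == ord0 then f (x s) else g (x s).
Proof. exact: mkDeltaE. Qed.

Lemma dhom0 k (x : Delta k n) : dhom k (x, dconst k ord0) = dcmp f x.
Proof. by apply: Delta_ext => s; rewrite dhomE dconstE dcmpE. Qed.

Lemma dhom1 k (x : Delta k n) : dhom k (x, dconst k ord_max) = dcmp g x.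
Proof. by apply: Delta_ext => s; rewrite dhomE dconstE dcmpE. Qed.

End SimplexHomotopy.

(** Truncations at [c] are comparable with the identity and so homotopic to it. The only value that
    they can add is [c], hence they preserve the horn at [c]. *)
Lemma dmin_homo n (c : 'I_n.+1) :
  {homo (fun i : 'I_n.+1 => if i <= c then i else c) : i j / i <= j}.
Proof. by move=> i j ij /=; case: (leqP i c) => ?; case: (leqP j c) => ?; lia. Qed.
Definition dmin n (c : 'I_n.+1) : Delta n n := mkDelta (@dmin_homo n c).

Lemma dmax_homo n (c : 'I_n.+1) :
  {homo (fun i : 'I_n.+1 => if c <= i then i else c) : i j / i <= j}.
Proof. by move=> i j ij /=; case: (leqP c i) => ?; case: (leqP c j) => ?; lia. Qed.
Definition dmax n (c : 'I_n.+1) : Delta n n := mkDelta (@dmax_homo n c).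

Lemma dmin_le n (c i : 'I_n.+1) : dmin c i <= did n i.
Proof. by rewrite didE mkDeltaE; case: (leqP i c) => ?; lia. Qed.

Lemma dmax_le n (c i : 'I_n.+1) : did n i <= dmax c i.
Proof. by rewrite didE mkDeltaE; case: (leqP c i) => ?; lia. Qed.

Lemma pp_sub (B K : sset) (P P' : forall k, B k -> Prop) Q : (forall k b, P k b -> P' k b) ->
  forall k z, @pp B K P P' Q k z -> onfst P' z.
Proof. by move=> PP' k z [/PP'|[]]. Qed.

(** The pushout product with a horn is a retract of its own pushout product with an end of the
    interval, which reduces the claim to homotopy lifting. The retraction is the homotopy from
    [dmin i] to the identity for i at most n, and from the identity to [dmax i] for the last
    vertex. *)
Lemma kan_fib_horn_pp (X Y : sset) (p : hom X Y) n (i : 'I_n.+2) (B : sset) P P' :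
  kan_fib p -> sub_closed (K := B) P -> sub_closed (K := B) P' ->
  (forall k b, P k b -> P' k b) ->
  ext (@pp B (simplex n.+1) P P' (@in_horn n.+1 i)) (@onfst B (simplex n.+1) P') p.
Proof.
move=> kp cP cP' PP'; set R := pp P P' _; set R' := onfst P'.
have cR : sub_closed R by apply: pp_closed (@horn_closed _ _).
have cR' : sub_closed R' by apply: onfst_closed.
have RR' k z : R k z -> R' k z by apply: pp_sub.
(* At the end [e] the homotopy misses some vertex other than [i], so it lands in the horn; at the
   other end it is the identity; throughout it preserves the horn. *)
have main (f g : Delta n.+1 n.+1) (fg : forall c, f c <= g c) (e : 'I_2) :
    (if e == ord0 then g else f) = did n.+1 ->
    (exists2 c, c != i & forall s, (if e == ord0 then f else g) s != c) ->
    (forall c s, c != i -> s != c -> f s != c /\ g s != c) -> ext R R' p.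
  move=> gd [c ci cm] hm.
  pose e' := if e == ord0 then ord_max else ord0 : 'I_2.
  pose inc : hom (prodS B (simplex n.+1)) (prodS (prodS B (simplex n.+1)) (simplex 1)) :=
    pairS (idm _) (yoneda (dconst 0 e' : simplex 1 0) ∘ simplex_map (dsurj n.+1)
                   ∘ mor_snd B (simplex n.+1)).
  pose r : hom (prodS (prodS B (simplex n.+1)) (simplex 1)) (prodS B (simplex n.+1)) :=
    pairS (mor_fst _ _ ∘ mor_fst _ _)
      (dhom fg ∘ prod_map (mor_snd B (simplex n.+1)) (idm (simplex 1))).
  have incE k z : inc k z = (z, dconst k e').
    by rewrite /=; congr pair; apply: Delta_ext => s; rewrite dcmpE !dconstE.
  refine (@ext_retract _ _ inc r _ _ R R' X Y p _ _ _ _ _ _ (@kan_fib_hlp X Y p e _ R R' kp cR cR' RR')).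
  - move=> k [b x] _; rewrite incE /=; congr pair; rewrite /e'.
    move: gd {cm}; case: (e == ord0) => gd.
      by rewrite [LHS]dhom1 gd dcmp1f.
    by rewrite [LHS]dhom0 gd dcmp1f.
  - by move=> k z Rz; rewrite incE; left.
  - exact: RR'.
  - by move=> k z Rz; rewrite incE.
  - move=> k [[b x] y] [[Pb|[Pb [c' [c'i c'x]]]]|[Pb ye]]; [by left | right | right].
      split=> //; exists c'; split=> // s; rewrite dhomE.
      by have [? ?] := hm _ _ c'i (c'x s); case: ifP.
    split=> //; exists c; split=> // s; rewrite dhomE (ye s).
    by have := cm (dfun x s); case: (e == ord0).
  - by [].
have [i0|i0] := leqP i n.
- apply: (main (dmin i) (did _) (@dmin_le _ i) ord0) => //=.
  + exists ord_max => [|s]; apply: neq_val => /=; first by lia.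
    by rewrite mkDeltaE; case: leqP => /= ?; lia.
  + move=> c s ci sc; rewrite didE; split=> //.
    by rewrite mkDeltaE; case: ifP => // _; rewrite eq_sym.
- apply: (main (did _) (dmax i) (@dmax_le _ i) ord_max) => //=.
  + exists ord0 => [|s]; apply: neq_val => /=; first by lia.
    by rewrite mkDeltaE; case: leqP => /= ?; lia.
  + move=> c s ci sc; rewrite didE; split=> //.
    by rewrite mkDeltaE; case: ifP => // _; rewrite eq_sym.
Qed.

(* P -> P' is a trivial cofibration: maps into Kan complexes extend along all the
   pushout products with boundary inclusions. *)
Record tc (B : sset) (P P' : forall k, B k -> Prop) : Prop := Tc {
  tc_cl : sub_closed P;
  tc_cl' : sub_closed P';
  tc_sub : forall k b, P k b -> P' k b;
  tc_bd : forall Z, kan Z -> forall n,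
    ext (@pp B (simplex n) P P' (@bd n)) (@onfst B (simplex n) P') (to_pt Z) }.

Arguments tc_bd {B P P'} t {Z} kZ n : rename.

Lemma ext_pt (B Z : sset) P P' :
  (forall G : forall k, B k -> Z k -> Prop, pmap G ->
    (forall k b, P k b -> exists x, G k b x) ->
    exists G' : forall k, B k -> Z k -> Prop, [/\ pmap G',
      forall k b, P' k b -> exists x, G' k b x &
      forall k b x, P k b -> G k b x -> G' k b x]) -> ext (B := B) P P' (to_pt Z).
Proof.
move=> h G V pG _ tG _ _; have [G' [pG' tG' GG']] := h G pG tG.
by exists G'; split=> // k b x [] _ _ _.
Qed.

Lemma pt_ext (B Z : sset) P P' (G : forall k, B k -> Z k -> Prop) :
  ext (B := B) P P' (to_pt Z) -> pmap G ->
  (forall k b, P k b -> exists x, G k b x) ->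
  exists G' : forall k, B k -> Z k -> Prop, [/\ pmap G',
      forall k b, P' k b -> exists x, G' k b x &
      forall k b x, P k b -> G k b x -> G' k b x].
Proof.
move=> e pG tG.
have [||G' [pG' tG' GG' _]] := e G (graph (to_pt B)) pG (graph_pmap _) tG.
- by move=> k b _; exists tt.
- by move=> k b x [].
by exists G'.
Qed.

Lemma tc_ppE (B : sset) P P' (K : sset) Q Z : tc (B := B) P P' -> sub_closed (K := K) Q ->
  kan Z -> ext (@pp B K P P' Q) (@onfst B K P') (to_pt Z).
Proof.
move=> t cQ kZ; apply: cells => //; [exact: tc_cl t | exact: tc_cl' t | exact: tc_sub t |].
exact: tc_bd.
Qed.

Lemma tc_iff (B : sset) P P' Q Q' : (forall k b, P k b <-> Q k b) ->
  (forall k b, P' k b <-> Q' k b) -> tc (B := B) P P' -> tc Q Q'.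
Proof.
move=> PQ PQ' t; split.
- by move=> l k s b /PQ h; apply/PQ; apply: (tc_cl t).
- by move=> l k s b /PQ' h; apply/PQ'; apply: (tc_cl' t).
- by move=> k b /PQ/(tc_sub t)/PQ'.
- move=> Z kZ n; refine (ext_sub _ _ (tc_bd t kZ n)) => k z; last exact: PQ'.
  by rewrite /pp PQ PQ'.
Qed.

(** Associativity of pushout products: those with [Q] and with the boundary combine into a single
    one with [Q2], the pushout product subcomplex of the second factor. *)
Lemma tc_pp (B K : sset) P P' Q : tc (B := B) P P' -> sub_closed (K := K) Q ->
  tc (@pp B K P P' Q) (@onfst B K P').
Proof.
move=> t cQ; split.
- by apply: pp_closed; [apply: tc_cl t | apply: tc_cl' t |].
- by apply: onfst_closed; apply: tc_cl' t.
- by apply: pp_sub; apply: tc_sub t.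
move=> Z kZ n; pose Q2 k (z : prodS K (simplex n) k) := Q k z.1 \/ @bd n k z.2.
have cQ2 : sub_closed Q2.
  by move=> l k s [x y] [h|h]; [left; apply: cQ | right; apply: bd_closed].
pose f : hom (prodS (prodS B K) (simplex n)) (prodS B (prodS K (simplex n))) :=
  pairS (mor_fst B K ∘ mor_fst _ _) (prod_map (mor_snd B K) (idm (simplex n))).
pose r : hom (prodS B (prodS K (simplex n))) (prodS (prodS B K) (simplex n)) :=
  pairS (prod_map (idm B) (mor_fst K (simplex n))) (mor_snd _ _ ∘ mor_snd _ _).
refine (@ext_retract _ _ f r _ _ _ _ _ _ _ _ _ _ _ _ _ (tc_ppE t cQ2 kZ)) => //.
- by move=> k [[b x] y].
- by move=> k [[b x] y] [[h|[h h']]|[h h']]; [left | right; split=> //; left | right; split=> //; right].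
- by move=> k [[b x] y] [/(pp_sub (tc_sub t))|[]].
- by move=> k [b [x y]] [h|[h [h'|h']]]; [left; left | left; right | right].
Qed.

(** The case n = 0 of [tc_bd], since the boundary of a point is empty. *)
Lemma tc_to_pt (B : sset) P P' Z : tc (B := B) P P' -> kan Z -> ext P P' (to_pt Z).
Proof.
move=> t kZ; have := tc_bd t kZ 0.
pose f : hom B (prodS B (simplex 0)) :=
  pairS (idm B) (@SMor Types B (simplex 0) (fun k _ => dsurj k)
     (fun m n s => functional_extensionality_dep (fun x => esym (dsurj_cmp s)))).
move=> e; refine (@ext_retract _ _ f (mor_fst _ _) _ _ _ _ _ _ _ _ _ _ _ _ _ e) => //.
- by move=> k b h; left.
- exact: tc_sub t.
- move=> k [b x] [//|[_ [j jx]]].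
  by have := jx ord0; rewrite (ord1 (dfun x ord0)) (ord1 j) eqxx.
Qed.

Lemma tc_extend (B : sset) P (Z : sset) (G : forall k, B k -> Z k -> Prop) :
  tc P (@full B) -> kan Z -> pmap G -> (forall k b, P k b -> exists x, G k b x) ->
  exists h : hom B Z, forall k b x, P k b -> G k b x -> h k b = x.
Proof.
move=> t kZ pG tG.
have [//|h [hG _]] := ext_total (v := to_pt B) (tc_to_pt t kZ) pG tG.
by exists h.
Qed.

Lemma tc_trans (B : sset) P1 P2 P3 : tc (B := B) P1 P2 -> tc P2 P3 -> tc P1 P3.
Proof.
move=> t1 t2; split; [exact: tc_cl t1 | exact: tc_cl' t2 | | ].
  by move=> k b /(tc_sub t1)/(tc_sub t2).
move=> Z kZ n; apply: ext_pt => G pG tG.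
have [|G1 [pG1 tG1 GG1]] := pt_ext (tc_bd t1 kZ n) pG.
  by move=> k z [h|[/(tc_sub t2) h h']]; apply: tG; [left | right].
pose H k z x := (onfst P2 z /\ G1 k z x) \/ (pp P1 P3 (@bd n) z /\ G k z x).
have pH : pmap H.
  apply: pmap_union.
  - by apply: pmap_restrict => //; apply: onfst_closed; apply: tc_cl' t1.
  - apply: pmap_restrict => //; apply: pp_closed (@bd_closed n); [exact: tc_cl t1 | exact: tc_cl' t2].
  - move=> k [b x] y w [P2b G1y] [h Gw]; apply: (pm_fun pG1 G1y); apply: GG1 => //.
    by case: h => [h|[h h']]; [left | right].
have [|G2 [pG2 tG2 GG2]] := pt_ext (tc_bd t2 kZ n) pH.
  move=> k z [h|h]; first by have [x hx] := tG1 _ _ h; exists x; left.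
  by have [|x hx] := tG k z; [right | exists x; right; split=> //; right].
exists G2; split=> // k z x h Gx; apply: GG2; last by right.
by case: h => [/(tc_sub t1) h|[h h']]; [left | right].
Qed.

Lemma tc_image (A B : sset) (i : hom A B) P P' : (forall k, injective (i k)) ->
  sub_closed (K := B) P -> sub_closed (K := B) P' -> (forall k b, P k b -> P' k b) ->
  (forall k b, P' k b -> exists a, i k a = b) ->
  tc (B := A) (fun k a => P k (i k a)) (fun k a => P' k (i k a)) -> tc P P'.
Proof.
move=> iI cP cP' PP' im t; split=> // Z kZ n.
apply: (ext_image (i := prod_map i (idm (simplex n)))).
- by move=> k [a x] [a' x'] /= [/iI -> ->].
- exact: pp_sub.
- by move=> k [b x] /im[a ea]; exists (a, x); rewrite /= ea.
- exact: (tc_bd t kZ n).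
Qed.

Lemma tc_union (B : sset) P W : sub_closed (K := B) P -> 
  tc (B := B) (fun k b => P k b /\ W k b) W -> tc P (fun k b => P k b \/ W k b).
Proof.
move=> cP t; have cW := tc_cl' t; split=> //.
- by move=> l k s b [h|h]; [left; apply: cP | right; apply: cW].
- by left.
move=> Z kZ n; apply: ext_pt => G pG tG.
have [|H [pH tH GH]] := pt_ext (tc_bd t kZ n) pG.
  by move=> k z [[h _]|[h h']]; apply: tG; [left | right; split=> //; right].
exists (fun k z x => (pp P (fun k b => P k b \/ W k b) (@bd n) z /\ G k z x) \/ (onfst W z /\ H k z x)).
split.
- apply: pmap_union.
  + apply: pmap_restrict => //; apply: pp_closed (@bd_closed n) => //.
    by move=> l k s b [h|h]; [left; apply: cP | right; apply: cW].
  + by apply: pmap_restrict => //; apply: onfst_closed.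
  + move=> k [b x] y w [h Gy] [Wb Hw]; apply: (pm_fun pH) Hw; apply: GH => //.
    by case: h => [h|[_ h]]; [left | right].
- move=> k [b x] [Pb|Wb].
    by have [|y Gy] := tG k (b, x); [left | exists y; left; split=> //; left].
  by have [y Hy] := tH k (b, x) Wb; exists y; right.
- by move=> k z x h Gx; left.
Qed.

Lemma kan_hlp (B : sset) P P' (e : 'I_2) Z : kan Z -> sub_closed (K := B) P ->
  sub_closed (K := B) P' -> (forall k b, P k b -> P' k b) ->
  ext (@pp B (simplex 1) P P' (@dend e)) (@onfst B (simplex 1) P') (to_pt Z).
Proof. exact: kan_fib_hlp. Qed.

Definition mor_const1 (B : sset) (e : 'I_2) : hom B (simplex 1) :=
  @SMor Types B (simplex 1) (fun k _ => dconst k e)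
     (fun m n s => functional_extensionality_dep (fun x => esym (dconst_cmp e s))).

Definition incl_end (B : sset) (e : 'I_2) : hom B (prodS B (simplex 1)) :=
  pairS (idm B) (mor_const1 B e).

Lemma dendP e k (y : Delta k 1) : dend e y <-> y = dconst k e.
Proof.
split=> [h|-> s]; last by rewrite dconstE.
by apply: Delta_ext => s; rewrite h dconstE.
Qed.

Lemma dend_neq k (y : Delta k 1) : dend ord0 y -> dend ord_max y -> False.
Proof. by move=> h /(_ ord0); rewrite h. Qed.

(* Two out of three, by correcting an extension with a relative homotopy. *)
Lemma tc_cancel (B : sset) P1 P2 P3 : tc (B := B) P1 P2 -> tc P1 P3 ->
  sub_closed (K := B) P2 -> (forall k b, P2 k b -> P3 k b) -> tc P2 P3.
Proof.
move=> t12 t13 c2 s23; have c3 := tc_cl' t13; have c1 := tc_cl t12; split=> //.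
have s12 := tc_sub t12; have s13 := tc_sub t13.
move=> Z kZ n; apply: ext_pt => G pG tG.
have [|H [pH tH GH]] := pt_ext (tc_bd t13 kZ n) pG.
  by move=> k z [/s12 h|[h h']]; apply: tG; [left | right].
pose W := prodS B (simplex n).
have cR := @pp_closed B (simplex n) P2 P3 _ c2 c3 (@bd_closed n).
pose K := prodS (simplex n) (simplex 1).
pose Q k (z : K k) := @bd n k z.1 \/ (dend ord0 z.2 \/ dend ord_max z.2).
have cQ : sub_closed Q.
  by move=> l k s [x y] [h|[h|h]]; [left; apply: bd_closed | right; left | right; right];
    rewrite //=; apply: dend_closed.
pose f : hom (prodS B K) W := prod_map (idm B) (mor_fst _ _).
(* A homotopy over [P2] from [H] at the end 0 to [G] at the end 1, constant over [P1] and over the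
   boundary, where the two agree. It exists because [P1] to [P2] is a trivial cofibration. *)
pose R k (z : prodS B K k) w :=
  ((pp P2 P3 (@bd n) (f k z) /\ (pp P1 P2 (@bd n) (f k z) \/ dend ord_max z.2.2)) /\ G k (f k z) w) \/
  ((P3 k z.1 /\ dend ord0 z.2.2) /\ H k (f k z) w).
have pR : pmap R.
  apply: pmap_union.
  - apply: pmap_restrict; first exact: pmap_pre.
    move=> l k s [b [x y]] [h [h'|h']]; split.
    + exact: (cR l k s (b, x)).
    + by left; apply: (@pp_closed B (simplex n) P1 P2 _ c1 c2 (@bd_closed n) l k s (b, x)).
    + exact: (cR l k s (b, x)).
    + by right; apply: dend_closed.
  - apply: pmap_restrict; first exact: pmap_pre.
    by move=> l k s [b [x y]] [h h']; split; [apply: c3 | apply: dend_closed].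
  - move=> k [b [x y]] u w [[h h2] Gu] [[P3b y0] Hw].
    apply: (pm_fun pH _ Hw); apply: GH Gu; case: h2 => [[h'|[_ h']]|y1]; [by left | by right |].
    by case: (dend_neq y0 y1).
have [|Hh [pHh tHh RHh]] := pt_ext (tc_ppE t12 cQ kZ) pR.
  move=> k [b [x y]] [P1b|[P2b [bx|[y0|y1]]]].
  - have [|w Gw] := tG k (b, x); first by left; apply: s12.
    by exists w; left; split=> //; split; [left; apply: s12 | left; left].
  - have [|w Gw] := tG k (b, x); first by left.
    by exists w; left; split=> //; split; left=> //; right.
  - have [|w Hw] := tH k (b, x); first exact: s23.
    by exists w; right; split=> //; split=> //; apply: s23.
  - have [|w Gw] := tG k (b, x); first by left.
    by exists w; left; split=> //; split; [left | right].
(* Homotopy extension: the homotopy is known over [P2] and the boundary, and starts at [H] on all of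
   [P3]. The other end of its extension is the corrected map. *)
pose F k (z : prodS W (simplex 1) k) w :=
  ((P2 k z.1.1 /\ Hh k (z.1.1, (z.1.2, z.2)) w) \/
   ((P3 k z.1.1 /\ @bd n k z.1.2) /\ G k z.1 w)) \/
  ((P3 k z.1.1 /\ dend ord0 z.2) /\ H k z.1 w).
pose g : hom (prodS W (simplex 1)) (prodS B K) :=
  pairS (mor_fst _ _ ∘ mor_fst _ _) (prod_map (mor_snd B (simplex n)) (idm (simplex 1))).
have pF : pmap F.
  apply: pmap_union; first apply: pmap_union.
  - apply: pmap_restrict; first exact: (pmap_pre g pHh).
    by move=> l k s z; apply: c2.
  - apply: pmap_restrict; first exact: (pmap_pre (mor_fst W (simplex 1)) pG).
    by move=> l k s z [h h']; split; [apply: c3 | apply: bd_closed].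
  - move=> k [[b x] y] u w [P2b Hu] [[P3b bx] Gw]; apply: (pm_fun pHh Hu); apply: RHh.
      by right; split=> //; left.
    by left; split=> //; split; [left | left; right].
  - apply: pmap_restrict; first exact: (pmap_pre (mor_fst W (simplex 1)) pH).
    by move=> l k s z [h h']; split; [apply: c3 | apply: dend_closed].
  - move=> k [[b x] y] u w [[P2b Hu]|[[P3b bx] Gu]] [[P3b' y0] Hw].
      apply: (pm_fun pHh Hu); apply: RHh; first by right; split=> //; right; left.
      by right; split.
    by apply: (pm_fun pH _ Hw); apply: GH Gu; right.
have [|F' [pF' tF' FF']] := pt_ext (@kan_hlp W _ _ ord0 Z kZ cR (onfst_closed c3) (pp_sub s23)) pF.
  move=> k [[b x] y] [[P2b|[P3b bx]]|[P3b y0]].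
  - have [w Hw] := tHh k (b, (x, y)) P2b.
    by exists w; left; left.
  - have [|w Gw] := tG k (b, x); first by right.
    by exists w; left; right.
  - by have [w Hw] := tH k (b, x) P3b; exists w; right.
exists (fun k z w => F' k (incl_end W ord_max k z) w); split.
- exact: pmap_pre.
- by move=> k [b x] P3b; apply: tF'.
- move=> k [b x] w h Gw; apply: FF'; first by left.
  have d1 : dend ord_max (dconst k ord_max : Delta k 1) by apply/dendP.
  case: h => [P2b|[P3b bx]]; left; [left; split=> // | right; split=> //].
  apply: RHh; first by right; split=> //; right; right.
  by left; split=> //; split; [left | right].
Qed.

(** Extend into [X] ignoring the base. The image in [Y] and the prescribed map agree on [P], hence
    are joined by a homotopy [K] constant on [P]; lifting [K] along [p] relative to [P], starting
    from the extension, ends in a solution. *)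
Lemma tc_kan_fib (B : sset) P P' (X Y : sset) (p : hom X Y) : tc (B := B) P P' ->
  kan X -> kan Y -> kan_fib p -> ext P P' p.
Proof.
move=> t kX kY kp G V pG pV tG tV GV.
have c1 := tc_cl t; have c2 := tc_cl' t; have s := tc_sub t.
have [H [pH tH GH]] := pt_ext (tc_to_pt t kX) pG tG.
pose Q k (y : simplex 1 k) := dend ord0 y \/ dend ord_max y.
have cQ : sub_closed Q.
  by move=> l k u y [h|h]; [left | right]; apply: dend_closed.
pose fs := mor_fst B (simplex 1).
pose R k (z : prodS B (simplex 1) k) w :=
  ((P' k z.1 /\ (P k z.1 \/ dend ord_max z.2)) /\ V k z.1 w) \/
  ((P' k z.1 /\ dend ord0 z.2) /\ exists2 x, H k z.1 x & p k x = w).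
have pR : pmap R.
  apply: pmap_union.
  - apply: pmap_restrict; first exact: (pmap_pre fs pV).
    move=> l k u z [h [h'|h']]; split; [exact: c2 | by left; apply: c1 | exact: c2 |].
    by right; apply: dend_closed.
  - apply: pmap_restrict; first exact: (pmap_pre fs (pmap_post p pH)).
    by move=> l k u z [h h']; split; [apply: c2 | apply: dend_closed].
  - move=> k [b y] u w [[h [Pb|y1]] Vu] [[Pb' y0] [x Hx <-]].
      have [x' Gx'] := tG _ _ Pb.
      by rewrite (pm_fun pH Hx (GH _ _ _ Pb Gx')) (GV _ _ _ _ Pb Gx' Vu).
    by case: (dend_neq y0 y1).
have [|K [pK tK RK]] := pt_ext (tc_ppE t cQ kY) pR.
  move=> k [b y] [Pb|[Pb [y0|y1]]].
  - have [w Vw] := tV _ _ (s _ _ Pb).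
    by exists w; left; split=> //; split; [apply: s | left].
  - by have [w Hw] := tH _ _ Pb; exists (p k w); right; split=> //; exists w.
  - by have [w Vw] := tV _ _ Pb; exists w; left; split=> //; split; [| right].
pose F k (z : prodS B (simplex 1) k) w :=
  (P k z.1 /\ G k z.1 w) \/ ((P' k z.1 /\ dend ord0 z.2) /\ H k z.1 w).
have pF : pmap F.
  apply: pmap_union.
  - apply: pmap_restrict; first exact: (pmap_pre fs pG).
    by move=> l k u z; apply: c1.
  - apply: pmap_restrict; first exact: (pmap_pre fs pH).
    by move=> l k u z [h h']; split; [apply: c2 | apply: dend_closed].
  - by move=> k [b y] u w [Pb Gu] [_ Hw]; apply: (pm_fun pH _ Hw); apply: GH Gu.
have [|||F' [pF' tF' FF' F'K]] := @kan_fib_hlp X Y p ord0 B P P' kp c1 c2 s F K pF pK.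
- move=> k [b y] [Pb|[Pb y0]]; first by have [w Gw] := tG _ _ Pb; exists w; left.
  by have [w Hw] := tH _ _ Pb; exists w; right.
- by move=> k [b y]; apply: tK.
- move=> k [b y] u w h [[Pb Gu]|[[Pb y0] Hu]] Kw; apply: (pm_fun pK _ Kw); apply: RK.
  + by left.
  + have [v Vv] := tV _ _ (s _ _ Pb).
    by left; split; [split; [apply: s | left] | rewrite (GV _ _ _ _ Pb Gu Vv)].
  + by right; split=> //; left.
  + by right; split=> //; exists u.
exists (fun k b w => F' k (incl_end B ord_max k b) w); split.
- exact: pmap_pre.
- by move=> k b Pb; apply: tF'.
- by move=> k b x Pb Gx; apply: FF'; left.
- move=> k b x y Pb Fx Vy; apply: (F'K k (incl_end B ord_max k b) x y Pb Fx); apply: RK; first by right; split=> //; right; apply/dendP.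
  by left; split=> //; split=> //; right; apply/dendP.
Qed.

Lemma tc_horn n (i : 'I_n.+2) : tc (B := simplex n.+1) (@in_horn n.+1 i) (@full _).
Proof.
split=> //; first exact: horn_closed.
move=> Z kZ m.
refine (@ext_retract _ _ (prod_swap _ _) (prod_swap _ _) _ _ _ _ _ _ _ _ _ _ _ _ _
  (@kan_fib_horn_pp Z pt _ n i (simplex m) (@bd m) (@full _) kZ (@bd_closed m)
     (@full_closed _) (fun _ _ _ => I))) => //.
- by move=> k [x y].
- by move=> k [x y] [h|[_ h]]; [right | left].
- by move=> k [x y] [h|[_ h]]; [right | left].
Qed.

Lemma tc_end (B : sset) P P' (e : 'I_2) : sub_closed (K := B) P -> sub_closed (K := B) P' ->
  (forall k b, P k b -> P' k b) ->
  tc (@pp B (simplex 1) P P' (@dend e)) (@onfst B (simplex 1) P').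
Proof.
move=> c1 c2 s; split; [exact: pp_closed (@dend_closed e) | exact: onfst_closed | exact: pp_sub |].
move=> Z kZ n.
have cR := @pp_closed B (simplex n) P P' _ c1 c2 (@bd_closed n).
pose f : hom (prodS (prodS B (simplex 1)) (simplex n)) (prodS (prodS B (simplex n)) (simplex 1)) :=
  pairS (prod_map (mor_fst _ _) (idm _)) (mor_snd _ _ ∘ mor_fst _ _).
pose r : hom (prodS (prodS B (simplex n)) (simplex 1)) (prodS (prodS B (simplex 1)) (simplex n)) :=
  pairS (prod_map (mor_fst _ _) (idm _)) (mor_snd _ _ ∘ mor_fst _ _).
refine (@ext_retract _ _ f r _ _ _ _ _ _ _ _ _ _ _ _ _ (@kan_hlp _ _ _ e Z kZ cR (onfst_closed c2) (pp_sub s))) => //.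
- by move=> k [[b x] y].
- move=> k [[b y] x] [[h|[h h']]|[h h']]; [by left; left | by right | by left; right].
- by move=> k [[b y] x] [/(pp_sub s)|[]].
- by move=> k [[b x] y] [[h|[h h']]|[h h']]; [left; left | right | left; right].
Qed.

End TrivialCofibrations.

(** * Homotopies and weak equivalences *)

Section Homotopy.

Definition nowhere (B : sset) k (b : B k) := False.

Lemma sset_eqx (X Y : sset) (f g : hom X Y) k x : f = g -> f k x = g k x.
Proof. by move=> ->. Qed.

Lemma cmpx (X Y Z : sset) (g : hom Y Z) (f : hom X Y) k x : (g ∘ f) k x = g k (f k x).
Proof. by []. Qed.

Definition face_map n (c : 'I_n.+2) := simplex_map (dface c).

Lemma dface_val n (c : 'I_n.+2) (i : 'I_n.+1) : (dface c i : nat) = bump c i.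
Proof. by rewrite dfaceE. Qed.

(** The edges of the horn carry homotopies, indexed by the opposite vertex; the last hypothesis is
    their agreement on the vertex shared by two edges. *)
Lemma horn2_fill (X E Y : sset) (p : hom E Y) (i : 'I_3) (H : 'I_3 -> hom (prodS X (simplex 1)) E)
    (T : hom (prodS X (simplex 2)) Y) : kan_fib p ->
  (forall c, c != i -> forall k x y, p k (H c k (x, y)) = T k (x, dcmp (dface c) y)) ->
  (forall c d, c != i -> d != i -> (c < d)%N -> forall k x y z,
     dcmp (dface c) y = dcmp (dface d) z -> H c k (x, y) = H d k (x, z)) ->
  exists F : hom (prodS X (simplex 2)) E, (forall k z, p k (F k z) = T k z) /\
    forall c, c != i -> forall k x y, F k (x, dcmp (dface c) y) = H c k (x, y).
Proof.
move=> kp HT HH.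
pose G k (z : prodS X (simplex 2) k) w :=
  exists c y, [/\ c != i, z.2 = dcmp (dface c) y & w = H c k (z.1, y)].
have pG : pmap G.
  split=> [k l t [x z] w [c [y [ci /= -> ->]]]|k [x z] w w' [c [y [ci /= e ->]]] [d [y' [di /= e' ->]]]].
    exists c, (dcmp y t); split=> //; first by rewrite /= dcmpA.
    by rewrite -smNx.
  rewrite e in e'; case: (ltngtP c d) => [cd|dc|/val_inj cd].
  - exact: HH.
  - exact/esym/HH.
  - subst d; congr (H c k (x, _)).
    by rewrite -(dcmp1f y) -(dcmp1f y') -(dretr_face c) -!dcmpA e'.
have e : ext (@pp X (simplex 2) (@nowhere X) (@full X) (@in_horn 2 i))
  (@onfst X (simplex 2) (@full X)) p by apply: kan_fib_horn_pp.
have [||F [FG Fp]] := ext_total (v := T) e pG.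
- move=> k [x z] [//|[_ [c [ci cz]]]].
  exists (H c k (x, dcmp (dretr c) z)), c, (dcmp (dretr c) z); split=> //.
  exact: miss_factor.
- by move=> k [x z] w _ [c [y [ci /= -> ->]]]; apply: HT.
exists F; split=> // c ci k x y; apply: FG; last by exists c, y.
right; split=> //; exists c; split=> // s; rewrite dcmpE dfaceE.
by rewrite eq_sym neq_lift.
Qed.

Lemma edge_meet k (c d : 'I_3) (y z : Delta k 1) : (c < d)%N ->
  dcmp (dface c) y = dcmp (dface d) z ->
  (forall s, (y s : nat) = (d != ord_max :> 'I_3)) /\ (forall s, (z s : nat) = (c == ord0 :> 'I_3)).
Proof.
move=> cd e; split=> s; have := congr1 val (Delta_eqE s e); rewrite /= !dcmpE !dface_val /bump;
  have := ltn_ord (y s); have := ltn_ord (z s); have := ltn_ord c; have := ltn_ord d;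
  rewrite -val_eqE /=; lia.
Qed.

Lemma const1E k (y : Delta k 1) (e : 'I_2) : (forall s, (y s : nat) = e) -> y = dconst k e.
Proof. by move=> h; apply: Delta_ext => s; rewrite dconstE; apply: val_inj; apply: h. Qed.

Definition at0 (X : sset) k (x : X k) : prodS X (simplex 1) k := (x, dconst k ord0).
Definition at1 (X : sset) k (x : X k) : prodS X (simplex 1) k := (x, dconst k ord_max).

Lemma face_const n k (c : 'I_n.+2) (e : 'I_n.+1) (v : 'I_n.+2) : bump c e = v ->
  dcmp (dface c) (dconst k e) = dconst k v.
Proof. by move=> h; rewrite cmp_dconst; congr dconst; apply: val_inj; rewrite /= dface_val. Qed.

Let o1 : 'I_3 := Ordinal (isT : (1 < 3)%N).

(** In this lemma and the next two, the digits name the vertices of the edge that carries a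
    homotopy, and [T] is the given triangle of homotopies in the base. *)
Lemma horn20 (X E Y : sset) (p : hom E Y) (H01 H02 : hom (prodS X (simplex 1)) E)
    (T : hom (prodS X (simplex 2)) Y) : kan_fib p ->
  (forall k x y, p k (H01 k (x, y)) = T k (x, dcmp (dface ord_max) y)) ->
  (forall k x y, p k (H02 k (x, y)) = T k (x, dcmp (dface o1) y)) ->
  (forall k x, H01 k (at0 x) = H02 k (at0 x)) ->
  exists H12 : hom (prodS X (simplex 1)) E,
    [/\ forall k x y, p k (H12 k (x, y)) = T k (x, dcmp (dface ord0) y),
        forall k x, H12 k (at0 x) = H01 k (at1 x) & forall k x, H12 k (at1 x) = H02 k (at1 x)].
Proof.
move=> kp p01 p02 e.
pose H (c : 'I_3) := if c == o1 then H02 else H01.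
have cE (c : 'I_3) : c != ord0 -> c = o1 \/ c = ord_max.
  by case: c => [[|[|[|//]]] ?] // _; [left | right]; apply: val_inj.
have [||F [Fp FH]] := @horn2_fill X E Y p ord0 H T kp.
- by move=> c /cE[->|->].
- move=> c d /cE[->|->] /cE[->|->] // _ k x y z /edge_meet[] // h1 h2.
  by rewrite (const1E (e := ord0) h1) (const1E (e := ord0) h2) /H /=; exact/esym/e.
exists (F ∘ prod_map (idm X) (face_map ord0)); split=> [k x y|k x|k x]; first exact: Fp.
- rewrite -(FH ord_max) // cmpx /=; congr (F k (x, _)).
  by rewrite (@face_const 1 k ord0 ord0 o1) // (@face_const 1 k ord_max ord_max o1).
- rewrite -(FH o1) // cmpx /=; congr (F k (x, _)).
  by rewrite (@face_const 1 k ord0 ord_max ord_max) // (@face_const 1 k o1 ord_max ord_max).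
Qed.

Lemma horn21 (X E Y : sset) (p : hom E Y) (H01 H12 : hom (prodS X (simplex 1)) E)
    (T : hom (prodS X (simplex 2)) Y) : kan_fib p ->
  (forall k x y, p k (H01 k (x, y)) = T k (x, dcmp (dface ord_max) y)) ->
  (forall k x y, p k (H12 k (x, y)) = T k (x, dcmp (dface ord0) y)) ->
  (forall k x, H01 k (at1 x) = H12 k (at0 x)) ->
  exists H02 : hom (prodS X (simplex 1)) E,
    [/\ forall k x y, p k (H02 k (x, y)) = T k (x, dcmp (dface o1) y),
        forall k x, H02 k (at0 x) = H01 k (at0 x) & forall k x, H02 k (at1 x) = H12 k (at1 x)].
Proof.
move=> kp p01 p12 e.
pose H (c : 'I_3) := if c == ord0 then H12 else H01.
have cE (c : 'I_3) : c != o1 -> c = ord0 \/ c = ord_max.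
  by case: c => [[|[|[|//]]] ?] // _; [left | right]; apply: val_inj.
have [||F [Fp FH]] := @horn2_fill X E Y p o1 H T kp.
- by move=> c /cE[->|->].
- move=> c d /cE[->|->] /cE[->|->] // _ k x y z /edge_meet[] // h1 h2.
  by rewrite (const1E (e := ord0) h1) (const1E (e := ord_max) h2) /H /=; exact/esym/e.
exists (F ∘ prod_map (idm X) (face_map o1)); split=> [k x y|k x|k x]; first exact: Fp.
- rewrite -(FH ord_max) // cmpx /=; congr (F k (x, _)).
  by rewrite (@face_const 1 k o1 ord0 ord0) // (@face_const 1 k ord_max ord0 ord0).
- rewrite -(FH ord0) // cmpx /=; congr (F k (x, _)).
  by rewrite (@face_const 1 k o1 ord_max ord_max) // (@face_const 1 k ord0 ord_max ord_max).
Qed.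

Lemma horn22 (X E Y : sset) (p : hom E Y) (H02 H12 : hom (prodS X (simplex 1)) E)
    (T : hom (prodS X (simplex 2)) Y) : kan_fib p ->
  (forall k x y, p k (H02 k (x, y)) = T k (x, dcmp (dface o1) y)) ->
  (forall k x y, p k (H12 k (x, y)) = T k (x, dcmp (dface ord0) y)) ->
  (forall k x, H02 k (at1 x) = H12 k (at1 x)) ->
  exists H01 : hom (prodS X (simplex 1)) E,
    [/\ forall k x y, p k (H01 k (x, y)) = T k (x, dcmp (dface ord_max) y),
        forall k x, H01 k (at0 x) = H02 k (at0 x) & forall k x, H01 k (at1 x) = H12 k (at0 x)].
Proof.
move=> kp p02 p12 e.
pose H (c : 'I_3) := if c == ord0 then H12 else H02.
have cE (c : 'I_3) : c != ord_max -> c = ord0 \/ c = o1.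
  by case: c => [[|[|[|//]]] ?] // _; [left | right]; apply: val_inj.
have [||F [Fp FH]] := @horn2_fill X E Y p ord_max H T kp.
- by move=> c /cE[->|->].
- move=> c d /cE[->|->] /cE[->|->] // _ k x y z /edge_meet[] // h1 h2.
  by rewrite (const1E (e := ord_max) h1) (const1E (e := ord_max) h2) /H /=; exact/esym/e.
exists (F ∘ prod_map (idm X) (face_map ord_max)); split=> [k x y|k x|k x]; first exact: Fp.
- rewrite -(FH o1) // cmpx /=; congr (F k (x, _)).
  by rewrite (@face_const 1 k ord_max ord0 ord0) // (@face_const 1 k o1 ord0 ord0).
- rewrite -(FH ord0) // cmpx /=; congr (F k (x, _)).
  by rewrite (@face_const 1 k ord_max ord_max o1) // (@face_const 1 k ord0 ord0 o1).
Qed.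

Lemma homotopic_refl (X Z : sset) (f : hom X Z) : homotopic f f.
Proof. by exists (f ∘ mor_fst X (simplex 1)). Qed.

Lemma homotopic_sym (X Z : sset) (f g : hom X Z) : kan Z -> homotopic f g -> homotopic g f.
Proof.
move=> kZ [H HP].
have [||k x|K [_ K0 K1]] := horn20 (H01 := H) (H02 := f ∘ mor_fst X (simplex 1))
  (T := to_pt _) kZ; try by [].
- by rewrite (proj1 (HP _ _)).
- by exists K => k x; split; [rewrite [LHS]K0 [LHS](proj2 (HP _ _)) | rewrite [LHS]K1].
Qed.

Lemma homotopic_trans (X Z : sset) (f g h : hom X Z) : kan Z ->
  homotopic f g -> homotopic g h -> homotopic f h.
Proof.
move=> kZ [H HP] [K KP].
have [||k x|L [_ L0 L1]] := horn21 (H01 := H) (H12 := K) (T := to_pt _) kZ; try by [].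
- by rewrite [LHS](proj2 (HP _ _)) [RHS](proj1 (KP _ _)).
- by exists L => k x; split;
    [rewrite [LHS]L0 [LHS](proj1 (HP _ _)) | rewrite [LHS]L1 [LHS](proj2 (KP _ _))].
Qed.

Lemma homotopic_pre (W X Z : sset) (f g : hom X Z) (h : hom W X) :
  homotopic f g -> homotopic (f ∘ h) (g ∘ h).
Proof.
move=> [H HP]; exists (H ∘ prod_map h (idm (simplex 1))) => k x.
by have := HP k (h k x).
Qed.

Lemma homotopic_post (X Z W : sset) (f g : hom X Z) (h : hom Z W) :
  homotopic f g -> homotopic (h ∘ f) (h ∘ g).
Proof.
by move=> [H HP]; exists (h ∘ H) => k x; have [/= -> ->] := HP k x.
Qed.

Definition hequiv (X Y : sset) (f : hom X Y) :=
  exists g : hom Y X, homotopic (g ∘ f) (idm X) /\ homotopic (f ∘ g) (idm Y).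

Lemma weak_eq_cmp (X Y W : sset) (f : hom X Y) (g : hom Y W) :
  weak_eq f -> weak_eq g -> weak_eq (g ∘ f).
Proof.
move=> wf wg Z kZ; have [fs fi] := wf Z kZ; have [gs gi] := wg Z kZ; split.
- move=> u; have [v vu] := fs u; have [w wv] := gs v; exists w.
  by apply: (homotopic_trans kZ _ vu); rewrite cmpA; apply: homotopic_pre.
- by move=> v w; rewrite !cmpA => /fi/gi.
Qed.

Lemma weak_eq_cancel_r (X Y W : sset) (f : hom X Y) (g : hom Y W) :
  weak_eq f -> weak_eq (g ∘ f) -> weak_eq g.
Proof.
move=> wf wgf Z kZ; have [fs fi] := wf Z kZ; have [gs gi] := wgf Z kZ; split.
- by move=> u; have [w wu] := gs (u ∘ f); exists w; apply: fi; rewrite -cmpA.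
- by move=> v w vw; apply: gi; rewrite !cmpA; apply: homotopic_pre.
Qed.

Lemma weak_eq_cancel_l (X Y W : sset) (f : hom X Y) (g : hom Y W) :
  weak_eq g -> weak_eq (g ∘ f) -> weak_eq f.
Proof.
move=> wg wgf Z kZ; have [fs fi] := wgf Z kZ; have [gs gi] := wg Z kZ; split.
- by move=> u; have [w wu] := fs u; exists (w ∘ g); rewrite -cmpA.
- move=> v w vw; have [v' v'v] := gs v; have [w' w'w] := gs w.
  apply: (homotopic_trans kZ (homotopic_sym kZ v'v) _).
  apply: (homotopic_trans kZ _ w'w); apply: homotopic_pre; apply: fi; rewrite !cmpA.
  apply: (homotopic_trans kZ (homotopic_pre f v'v) _).
  exact: homotopic_trans kZ vw (homotopic_sym kZ (homotopic_pre f w'w)).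
Qed.

Lemma hequiv_weak_eq (X Y : sset) (f : hom X Y) : hequiv f -> weak_eq f.
Proof.
move=> [g [gf fg]] Z kZ; split.
- move=> u; exists (u ∘ g); rewrite -cmpA -[u in homotopic _ u]cmpm1.
  exact: homotopic_post.
- move=> v w vw; have h (u : hom Y Z) : homotopic (u ∘ f ∘ g) u.
    by rewrite -cmpA -[u in homotopic _ u]cmpm1; apply: homotopic_post.
  apply: (homotopic_trans kZ (homotopic_sym kZ (h v)) _).
  exact: homotopic_trans kZ (homotopic_pre g vw) (h w).
Qed.

(** Whitehead's theorem is a Yoneda argument here: the inverse is the class over [Y] that restricts
    to the identity of [X]. *)
Lemma weak_eq_hequiv (X Y : sset) (f : hom X Y) : kan X -> kan Y -> weak_eq f -> hequiv f.
Proof.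
move=> kX kY w; have [fs _] := w X kX; have [_ fi] := w Y kY.
have [g gf] := fs (idm X); exists g; split=> //; apply: fi.
by rewrite cmp1m -[f in homotopic _ f]cmpm1 -cmpA; apply: homotopic_post.
Qed.

Lemma hequiv_id (X : sset) : hequiv (idm X).
Proof. by exists (idm X); rewrite cmp1m; split; apply: homotopic_refl. Qed.

Lemma weak_eq_id (X : sset) : weak_eq (idm X).
Proof. exact/hequiv_weak_eq/hequiv_id. Qed.

Lemma hequiv_bij (X Y : sset) (f : hom X Y) : (forall k, injective (f k)) ->
  (forall k y, exists x, f k x = y) -> hequiv f.
Proof.
move=> fI fS; have [|g gP] := @pmap_total Y X (fun k y x => f k x = y) _ fS.
  split=> [k l t y x <-|k y x x' <- /fI] //; by rewrite smNx.
exists g; suff [-> ->] : g ∘ f = idm X /\ f ∘ g = idm Y by split; apply: homotopic_refl.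
split; apply: sset_ext => k x; last exact: gP.
by apply: fI; apply: gP.
Qed.

Definition tfib (X Y : sset) (p : hom X Y) :=
  forall n, ext (B := simplex n) (@bd n) (@full _) p.

(** This is [cells] with first factor [simplex 0] and its empty subcomplex, for which the pushout
    product with [Q] is just [Q]. *)
Lemma tfib_ext (X Y : sset) (p : hom X Y) (B : sset) P P' : tfib p ->
  sub_closed (K := B) P -> sub_closed (K := B) P' -> (forall k b, P k b -> P' k b) ->
  ext P P' p.
Proof.
move=> tp cP cP' PP'.
pose Q k (b : subS cP' k) := P k (sval b).
have cQ : sub_closed Q by move=> l k t b; apply: cP.
apply: (ext_image (i := subS_incl cP')) => //.
- by move=> k x y; apply: sig_ext.
- by move=> k b Pb; exists (exist _ b Pb).
pose j (K : sset) : hom K (prodS (simplex 0) K) :=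
  pairS (@SMor Types K (simplex 0) (fun k _ => dsurj k)
     (fun m n s => functional_extensionality_dep (fun x => esym (dsurj_cmp s)))) (idm K).
have e n : ext (@pp (simplex 0) (simplex n) (fun _ _ => False) (@full _) (@bd n))
    (@onfst (simplex 0) (simplex n) (@full _)) p.
  refine (@ext_retract _ _ (mor_snd _ _) (j _) _ _ _ _ _ _ _ _ _ _ _ _ _ (tp n)) => //.
  - by move=> k [x y] _; congr pair; apply: Delta0_eq.
  - by move=> k [x y] [//|[]].
  - by move=> k x bx; right.
have c0 : sub_closed (K := simplex 0) (fun _ _ => False) by [].
have h := @cells (simplex 0) (subS cP') (fun _ _ => False) (@full _) Q X Y p c0
  (@full_closed _) cQ (fun _ _ => False_ind _) e.
refine (@ext_retract _ _ (j _) (mor_snd _ _) _ _ _ _ _ _ _ _ _ _ _ _ _ h) => //.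
- by move=> k x Qx; right.
- by move=> k x _; apply: (svalP x).
- by move=> k [x y] [//|[]].
- by move=> k [x y] _; apply: (svalP y).
Qed.

Lemma kan_fibI (X Y : sset) (p : hom X Y) :
  (forall n (i : 'I_n.+2), ext (B := simplex n.+1) (@in_horn n.+1 i) (@full _) p) -> kan_fib p.
Proof. by move=> e n i; apply: llp_subS; apply: e. Qed.

Lemma ext_cmp (B X Y W : sset) (p : hom X Y) (q : hom Y W) P P' :
  (forall k b, P k b -> P' k b) -> ext (B := B) P P' p -> ext P P' q -> ext P P' (q ∘ p).
Proof.
move=> PP' ep eq G V pG pV tG tV GV.
have [|||H [pH tH GH HV]] := eq _ V (pmap_post p pG) pV.
- by move=> k b /tG[x Gx]; exists (p k x), x.
- exact: tV.
- by move=> k b y w Pb [x Gx <-]; apply: GV.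
have [|K [pK tK GK KH]] := ep G H pG pH tG tH.
- move=> k b x y Pb Gx Hy; apply: (pm_fun pH _ Hy); apply: GH => //; by exists x.
exists K; split=> // k b x w Pb Kx Vw; have [y Hy] := tH _ _ Pb.
by rewrite cmpx (KH _ _ _ _ Pb Kx Hy); apply: HV Vw.
Qed.

Lemma kan_fib_cmp (X Y W : sset) (p : hom X Y) (q : hom Y W) :
  kan_fib p -> kan_fib q -> kan_fib (q ∘ p).
Proof. by move=> kp kq; apply: kan_fibI => n i; apply: ext_cmp => //; apply: kan_fib_horn. Qed.

Lemma to_pt_cmp (X Y : sset) (f : hom X Y) : to_pt Y ∘ f = to_pt X.
Proof. exact: sset_ext. Qed.

Lemma kan_fib_kan (X Y : sset) (p : hom X Y) : kan_fib p -> kan Y -> kan X.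
Proof. by move=> kp kY; rewrite /kan -(to_pt_cmp p); apply: kan_fib_cmp. Qed.

Definition is_pullback (X Y X' Y' : sset) (p : hom X Y) (q : hom X' Y') (a : hom X' X)
    (b : hom Y' Y) := (forall k x, p k (a k x) = b k (q k x)) /\
  forall k x y, p k x = b k y -> exists x', [/\ a k x' = x, q k x' = y &
    forall x'', a k x'' = x -> q k x'' = y -> x'' = x'].

Lemma ext_pullback (X Y X' Y' : sset) (p : hom X Y) (q : hom X' Y') (a : hom X' X)
    (b : hom Y' Y) (B : sset) P P' : is_pullback p q a b -> (forall k b, P k b -> P' k b) ->
  ext (B := B) P P' p -> ext P P' q.
Proof.
move=> [sq pb] PP' e G V pG pV tG tV GV.
have [|||H [pH tH GH HV]] := e _ _ (pmap_post a pG) (pmap_post b pV).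
- by move=> k z /tG[x Gx]; exists (a k x), x.
- by move=> k z /tV[y Vy]; exists (b k y), y.
- move=> k z x y Pz [x' Gx <-] [y' Vy <-]; rewrite sq; congr (b k _); exact: GV Vy.
exists (fun k z x' => H k z (a k x') /\ V k z (q k x')); split.
- split=> [k l t z x' [Hx Vx]|k z x x' [Hx Vx] [Hx' Vx']].
    by rewrite !smNx; split; [apply: (pm_cl pH) | apply: (pm_cl pV)].
  have [w [_ _ wU]] := pb k (a k x) (q k x) (sq _ _).
  by rewrite (wU x) // (wU x') //; [apply: (pm_fun pH Hx' Hx) | apply: (pm_fun pV Vx' Vx)].
- move=> k z Pz; have [x Hx] := tH _ _ Pz; have [y Vy] := tV _ _ Pz.
  have [|x' [ax qx _]] := pb k x y; first by apply: HV Hx _ => //; exists y.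
  by exists x'; rewrite ax qx.
- move=> k z x Pz Gx; have [y Vy] := tV _ _ (PP' _ _ Pz).
  by split; [apply: GH => //; exists x | rewrite (GV _ _ _ _ Pz Gx Vy)].
- by move=> k z x y Pz [Hx Vx] Vy; apply: (pm_fun pV Vx Vy).
Qed.

Lemma tfib_pullback (X Y X' Y' : sset) (p : hom X Y) (q : hom X' Y') (a : hom X' X)
    (b : hom Y' Y) : is_pullback p q a b -> tfib p -> tfib q.
Proof. by move=> pb tp n; apply: ext_pullback pb _ _. Qed.

Lemma kan_fib_pullback (X Y X' Y' : sset) (p : hom X Y) (q : hom X' Y') (a : hom X' X)
    (b : hom Y' Y) : is_pullback p q a b -> kan_fib p -> kan_fib q.
Proof.
move=> pb kp; apply: kan_fibI => n i; apply: ext_pullback pb _ _ => //.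
exact: kan_fib_horn.
Qed.

Lemma tfib_section (X Y : sset) (p : hom X Y) : tfib p ->
  exists s : hom Y X, p ∘ s = idm Y.
Proof.
move=> tp; have e : ext (B := Y) (@nowhere Y) (@full Y) p by apply: tfib_ext.
have [|||s [_ ps]] := ext_total (G := fun k (b : Y k) (x : X k) => False) (v := idm Y) e; try by [].
by exists s; apply: sset_ext.
Qed.

Lemma tfib_homotopic (B X Y : sset) (p : hom X Y) (f g : hom B X) : tfib p ->
  p ∘ f = p ∘ g -> homotopic f g.
Proof.
move=> tp e.
pose Q k (z : prodS B (simplex 1) k) := dend ord0 z.2 \/ dend ord_max z.2.
have eQ : ext Q (@full _) p.
  by apply: tfib_ext => // l k t [b y] [h|h]; [left | right]; apply: dend_closed.
pose G k (z : prodS B (simplex 1) k) x :=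
  (dend ord0 z.2 /\ x = f k z.1) \/ (dend ord_max z.2 /\ x = g k z.1).
have [|||H [HG _]] := ext_total (G := G) (v := p ∘ f ∘ mor_fst B (simplex 1)) eQ.
- apply: pmap_union.
  + apply: (pmap_restrict (pmap_pre (mor_fst B (simplex 1)) (graph_pmap f))).
    by move=> l k t z; apply: dend_closed.
  + apply: (pmap_restrict (pmap_pre (mor_fst B (simplex 1)) (graph_pmap g))).
    by move=> l k t z; apply: dend_closed.
  + by move=> k z x y [h _] [h' _]; case: (dend_neq h h').
- by move=> k [b y] [h|h]; [exists (f k b); left | exists (g k b); right].
- by move=> k [b y] x _ [[_ ->]|[_ ->]] //; rewrite e.
exists H => k x; split; apply: HG.
- by left; apply/dendP.
- by left; split=> //; apply/dendP.
- by right; apply/dendP.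
- by right; split=> //; apply/dendP.
Qed.

Lemma tfib_hequiv (X Y : sset) (p : hom X Y) : tfib p -> hequiv p.
Proof.
move=> tp; have [s ps] := tfib_section tp; exists s; split; last first.
  by rewrite ps; apply: homotopic_refl.
by apply: (tfib_homotopic tp); rewrite cmpA ps cmp1m cmpm1.
Qed.

Lemma tfib_weak_eq (X Y : sset) (p : hom X Y) : tfib p -> weak_eq p.
Proof. by move=> tp; apply/hequiv_weak_eq/tfib_hequiv. Qed.

(* Dold's trick: a section up to homotopy is deformed to a section, and the vertical
   homotopy is obtained by filling one horn Lambda^2_2 of homotopies. *)
Lemma kan_fib_tfib (X Y : sset) (p : hom X Y) : kan X -> kan_fib p -> hequiv p -> tfib p.
Proof.
move=> kX kp [g [gp [h hP]]].
have c0 (B : sset) : sub_closed (@nowhere B) by [].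
have e0 : ext (@pp Y (simplex 1) (@nowhere Y) (@full Y) (@dend ord0))
  (@onfst Y (simplex 1) (@full Y)) p by apply: kan_fib_hlp.
have [|||L [LG Lp]] := ext_total (G := fun k (z : prodS Y (simplex 1) k) x => dend ord0 z.2 /\ x = g k z.1) (v := h) e0.
- apply: (pmap_restrict (pmap_pre (mor_fst Y (simplex 1)) (graph_pmap g))).
  by move=> l k t z; apply: dend_closed.
- by move=> k [y t] [//|[_ h0]]; exists (g k y).
- by move=> k [y t] x _ [/= /dendP -> ->]; have [-> _] := hP k y.
pose s := L ∘ incl_end Y ord_max.
have ps k y : p k (s k y) = y by rewrite cmpx [LHS]Lp; have [_ ->] := hP k y.
have gs : homotopic g s.
  exists L => k y; split=> //; apply: LG; last by split=> //; apply/dendP.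
  by right; split=> //; apply/dendP.
have [H HP] : homotopic (idm X) (s ∘ p).
  apply: (homotopic_trans kX (homotopic_sym kX gp) _); exact: homotopic_pre.
have H0 k x : H k (at0 x) = x by have [->] := HP k x.
have H1 k x : H k (at1 x) = s k (p k x) by have [_ ->] := HP k x.
(* [sg] sends 0 and 1 to 0, and 2 to 1. Over it the edges 02 and 12 carry [p ∘ H] while the edge 01
   is constant, so the filler [K] is a vertical homotopy from the identity to [s ∘ p]. *)
pose sg := dthr (ord_max : 'I_2).
have sgE (c : 'I_3) (y : 'I_2) : c <> ord_max -> sg (dface c y) = y.
  move=> cm; apply: val_inj; rewrite /= dthrE dface_val /bump /=.
  have : (c : nat) <> 2 by move=> e; apply: cm; apply: val_inj.
  by have := ltn_ord c; have := ltn_ord y; lia.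
have [||k x|K [Kp K0 K1]] := horn22 (p := p) (H02 := H) (H12 := s ∘ p ∘ H)
  (T := p ∘ H ∘ prod_map (idm X) (simplex_map sg)) kp.
- move=> k x y; rewrite !cmpx; congr (p k (H k (x, _))).
  by apply: Delta_ext => a; rewrite !dcmpE sgE.
- move=> k x y; rewrite !cmpx ps; congr (p k (H k (x, _))).
  by apply: Delta_ext => a; rewrite !dcmpE sgE.
- by rewrite !cmpx H1 ps.
have {}Kp k x y : p k (K k (x, y)) = p k x.
  rewrite Kp !cmpx -[in RHS](H0 k x); congr (p k (H k (x, _))).
  apply: Delta_ext => a; rewrite !dcmpE dconstE; apply: val_inj; rewrite /= dthrE dface_val /bump /=.
  by have := ltn_ord (dfun y a); lia.
move=> n G V pG pV tG tV GV.
have [v vV] := pmap_total pV (fun k b => tV k b I).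
pose B := simplex n; pose P := @bd n.
(* The map [s ∘ v] is a lift with wrong boundary values. The homotopy [K] joins the right ones to
   these, and homotopy lifting from the end 1 carries the whole lift back. *)
pose F k (z : prodS B (simplex 1) k) w :=
  (P k z.1 /\ exists2 x, G k z.1 x & w = K k (x, z.2)) \/ (dend ord_max z.2 /\ w = s k (v k z.1)).
have pF : pmap F.
  apply: pmap_union.
  - split=> [k l t [b y] w [Pb [x Gx ->]]|k [b y] w w' [Pb [x Gx ->]] [_ [x' Gx' ->]]].
      split; first exact: bd_closed.
      by exists (X.[t] x); [apply: (pm_cl pG) | rewrite -smNx].
    by rewrite (pm_fun pG Gx Gx').
  - apply: (pmap_restrict (pmap_pre (mor_fst B (simplex 1)) (graph_pmap (s ∘ v)))).
    by move=> l k t z; apply: dend_closed.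
  - move=> k [b y] w w' [Pb [x Gx ->]] [/= /dendP -> ->].
    rewrite [LHS]K1 !cmpx H0; congr (s k _); exact: (GV _ _ _ _ Pb Gx (vV _ _)).
have e1 : ext (@pp B (simplex 1) P (@full B) (@dend ord_max))
  (@onfst B (simplex 1) (@full B)) p by apply: kan_fib_hlp => //; apply: bd_closed.
have [||M [MF Mp]] := ext_total (v := v ∘ mor_fst B (simplex 1)) e1 pF.
- move=> k [b y] [Pb|[_ y1]]; last by exists (s k (v k b)); right.
  by have [x Gx] := tG _ _ Pb; exists (K k (x, y)); left; split=> //; exists x.
- move=> k [b y] w _ [[Pb [x Gx ->]]|[_ ->]]; last by rewrite ps.
  by rewrite Kp; apply: (GV _ _ _ _ Pb Gx); apply: vV.
exists (graph (M ∘ incl_end B ord0)); split.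
- exact: graph_pmap.
- by move=> k b _; exists ((M ∘ incl_end B ord0) k b).
- move=> k b x Pb Gx; rewrite /graph cmpx; apply: esym; rewrite -[x in _ = x]H0 -[in RHS]K0.
  by apply: MF; [left | left; split=> //; exists x].
- move=> k b x y _ -> Vy; rewrite cmpx Mp; exact: (pm_fun pV (vV _ _) Vy).
Qed.

End Homotopy.

(** * Mapping spaces of simplicial sets *)

Section MappingSpace.

Program Definition homS (B Z : sset) : sset :=
  @Simplicial Types (fun k => @hom sset (prodS B (simplex k)) Z)
    (fun l k t u => u ∘ prod_map (idm B) (simplex_map t)) _ _.
Next Obligation.
move=> B Z k; apply: functional_extensionality_dep => u; apply: sset_ext => j [x y] /=.
by rewrite dcmp1f.
Qed.
Next Obligation.
move=> B Z l m n g f; apply: functional_extensionality_dep => u; apply: sset_ext => j [x y] /=.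
by rewrite dcmpA.
Qed.

Program Definition homS_pre (A B Z : sset) (i : hom A B) : hom (homS B Z) (homS A Z) :=
  @SMor Types (homS B Z) (homS A Z) (fun k u => u ∘ prod_map i (idm (simplex k))) _.
Next Obligation.
by move=> A B Z i m n t; apply: functional_extensionality_dep => u; apply: sset_ext.
Qed.

Program Definition curry (B K Z : sset) (f : hom (prodS B K) Z) : hom K (homS B Z) :=
  @SMor Types K (homS B Z) (fun k x => f ∘ prod_map (idm B) (yoneda x)) _.
Next Obligation.
move=> B K Z f m n t; apply: functional_extensionality_dep => x; apply: sset_ext => j [b s] /=.
by rewrite smapMx.
Qed.

Program Definition uncurry (B K Z : sset) (g : hom K (homS B Z)) : hom (prodS B K) Z :=
  @SMor Types (prodS B K) Z (fun k z => (g k z.2 : smor _ _) k (z.1, did k)) _.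
Next Obligation.
move=> B K Z g m n t; apply: functional_extensionality_dep => -[b x] /=.
rewrite -(smNx (g n x : hom (prodS B (simplex n)) Z)) smNx /=.
by rewrite dcmp1f dcmpf1.
Qed.

Lemma curryE (B K Z : sset) (f : hom (prodS B K) Z) k x l b t :
  (curry f k x : smor _ _) l (b, t) = f l (b, K.[t] x).
Proof. by []. Qed.

Lemma uncurryE (B K Z : sset) (g : hom K (homS B Z)) k x l b t :
  (g k x : smor _ _) l (b, t) = uncurry g l (b, K.[t] x).
Proof. by rewrite /= smNx /= dcmpf1. Qed.

Lemma curryK (B K Z : sset) (f : hom (prodS B K) Z) : uncurry (curry f) = f.
Proof.
apply: sset_ext => k [b x] /=.
by rewrite smap1x. Qed.

Lemma uncurryK (B K Z : sset) (g : hom K (homS B Z)) : curry (uncurry g) = g.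
Proof. by apply: sset_ext => k x; apply: sset_ext => l [b t]; exact: esym (uncurryE g x b t). Qed.

Lemma homotopic_curry (B K Z : sset) (f g : hom (prodS B K) Z) :
  homotopic f g -> homotopic (curry f) (curry g).
Proof.
move=> [H HP].
pose a : hom (prodS B (prodS K (simplex 1))) (prodS (prodS B K) (simplex 1)) :=
  pairS (prod_map (idm B) (mor_fst _ _)) (mor_snd _ _ ∘ mor_snd _ _).
exists (curry (H ∘ a)) => k x; split; apply: sset_ext => l [b t] /=.
- by rewrite dconst_cmp; have [] := HP l (b, K.[t] x).
- by rewrite dconst_cmp; have [] := HP l (b, K.[t] x).
Qed.

Lemma homotopic_uncurry (B K Z : sset) (f g : hom K (homS B Z)) :
  homotopic f g -> homotopic (uncurry f) (uncurry g).
Proof.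
move=> [H HP].
pose a : hom (prodS (prodS B K) (simplex 1)) (prodS B (prodS K (simplex 1))) :=
  pairS (mor_fst _ _ ∘ mor_fst _ _) (prod_map (mor_snd _ _) (idm _)).
exists (uncurry H ∘ a) => k [b x] /=; by have [-> ->] := HP k x.
Qed.

Definition flip (A K Z : sset) (f : hom A (homS K Z)) : hom K (homS A Z) :=
  curry (uncurry f ∘ prod_swap A K).

Lemma flipK (A K Z : sset) (f : hom A (homS K Z)) : flip (flip f) = f.
Proof.
rewrite /flip curryK -[in RHS](uncurryK f); congr curry.
by apply: sset_ext => k [x y].
Qed.

Lemma homotopic_flip (A K Z : sset) (f g : hom A (homS K Z)) :
  homotopic f g -> homotopic (flip f) (flip g).
Proof. by move=> h; apply/homotopic_curry/homotopic_pre/homotopic_uncurry. Qed.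

Lemma flip_pre (A B K Z : sset) (i : hom A B) (f : hom B (homS K Z)) :
  flip (f ∘ i) = homS_pre Z i ∘ flip f.
Proof. by apply: sset_ext => k x; apply: sset_ext. Qed.

(** The exponential law: a lifting problem against [homS_pre] is an extension problem on the product
    of [B] and [K], with data [G1] over [Q] and [G2] over the image of [A]. *)
Lemma homS_pre_ext (A B Z K : sset) (i : hom A B) Q : (forall k, injective (i k)) ->
  sub_closed Q ->
  ext (@pp B K (fun k b => exists a, i k a = b) (@full B) Q) (@full (prodS B K)) (to_pt Z) ->
  ext Q (@full K) (homS_pre Z i).
Proof.
move=> iI cQ e G V pG pV tG tV GV; have [v vV] := pmap_total pV (fun k x => tV k x I).
pose G1 k (z : prodS B K k) w := exists g : homS B Z k,
  [/\ Q k z.2, G k z.2 g & w = (g : smor _ _) k (z.1, did k)].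
pose G2 k (z : prodS B K k) w := exists2 a, i k a = z.1 & w = uncurry v k (a, z.2).
have gv k x (g : homS B Z k) l a (t : Delta l k) : Q k x -> G k x g ->
    (g : smor _ _) l (i l a, t) = uncurry v l (a, K.[t] x).
  by move=> Qx Gx; rewrite -uncurryE -(GV k x g (v k x) Qx Gx (vV k x)).
have pR : pmap (fun k z w => G1 k z w \/ G2 k z w).
  apply: pmap_union.
  - split=> [k l t [b x] w [g [Qx Gx ->]]|k [b x] w w' [g [Qx Gx ->]] [g' [_ Gx' ->]]].
      exists ((homS B Z).[t] g); split; [exact: cQ | exact: (pm_cl pG) |].
      by have := smNx (g : hom (prodS B (simplex k)) Z) t (b, did k); rewrite /= dcmp1f dcmpf1 => ->.
    by rewrite (pm_fun pG Gx Gx').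
  - split=> [k l t [b x] w [a /= <- ->]|k [b x] w w' [a /= <- ->] [a' /= /iI -> ->]] //.
    by exists (A.[t] a); [exact: smNx | exact: esym (smNx (uncurry v) t (a, x))].
  - move=> k [b x] w w' [g [Qx Gx ->]] [a /= <- ->].
    by rewrite (gv k x g k a (did k) Qx Gx) smap1x.
have [||h [hR _]] := ext_total (v := to_pt (prodS B K)) e pR.
- move=> k [b x] [[a ab]|[_ Qx]]; first by exists (uncurry v k (a, x)); right; exists a.
  by have [g Gx] := tG _ _ Qx; exists ((g : smor _ _) k (b, did k)); left; exists g.
- by [].
exists (graph (curry h)); split.
- exact: graph_pmap.
- by move=> k x _; exists (curry h k x).
- move=> k x g Qx Gx; apply: sset_ext => l [b t]; rewrite curryE; apply: esym; apply: hR.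
    by right; split=> //; apply: cQ.
  left; exists ((homS B Z).[t] g); split; [exact: cQ | exact: (pm_cl pG) |].
  by rewrite /= dcmpf1.
- move=> k x g y _ -> Vy; rewrite (pm_fun pV Vy (vV k x)).
  apply: sset_ext => l [a t]; rewrite [RHS]uncurryE; apply: (hR l (i l a, K.[t] x)); first by left; exists a.
  by right; exists a.
Qed.

Lemma homS_pre_ext_inv (A B Z : sset) (i : hom A B) n : (forall k, injective (i k)) ->
  ext (B := simplex n) (@bd n) (@full _) (homS_pre Z i) ->
  ext (@pp B (simplex n) (fun k b => exists a, i k a = b) (@full B) (@bd n))
    (@full (prodS B (simplex n))) (to_pt Z).
Proof.
move=> iI e; apply: ext_pt => R pR tR.
have tA k a (t : Delta k n) : exists w, R k (i k a, t) w by apply: tR; left; exists a.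
have [v vR] := @pmap_total (prodS A (simplex n)) Z _
  (pmap_pre (prod_map i (idm (simplex n))) pR) (fun k z => tA k z.1 z.2).
pose G k (x : simplex n k) (g : homS B Z k) := forall l b (t : Delta l k),
  R l (b, dcmp x t) ((g : smor _ _) l (b, t)).
have [|||h [hG hv]] := ext_total (G := G) (v := curry v) e.
- split=> [k l t x g Gx m b s|k x g g' Gx Gx'].
    by rewrite /= -dcmpA; apply: Gx.
  by apply: sset_ext => l [b t]; apply: (pm_fun pR (Gx _ _ _) (Gx' _ _ _)).
- move=> k x bx.
  have [||g gR] := @pmap_total (prodS B (simplex k)) Z
      (fun l z w => R l (z.1, dcmp x z.2) w) _ _.
  + exact: (pmap_pre (prod_map (idm B) (simplex_map x)) pR).
  + by move=> l [b t]; apply: tR; right; split=> //; apply: (@bd_closed n l k t x bx).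
  + by exists g => l b t; exact: (gR l (b, t)).
- move=> k x g bx Gx; apply: sset_ext => l [a t] /=.
  exact: (pm_fun pR (Gx _ _ _) (vR l (a, dcmp x t))).
exists (graph (uncurry h)); split.
- exact: graph_pmap.
- by move=> k z _; exists (uncurry h k z).
- move=> k [b x] w [[a ab]|[_ bx]] Rw; rewrite /graph.
    rewrite /= in ab; subst b; rewrite (pm_fun pR Rw (vR k (a, x))).
    have := hv k x => /(congr1 (fun g : homS A Z k => (g : smor _ _) k (a, did k))) /= ->.
    by rewrite dcmpf1.
  have [g Gg] : exists g, G k x g.
    have [||g gR] := @pmap_total (prodS B (simplex k)) Z
      (fun l z w => R l (z.1, dcmp x z.2) w) _ _.
    + exact: (pmap_pre (prod_map (idm B) (simplex_map x)) pR).
    + by move=> l [b' t]; apply: tR; right; split=> //; apply: (@bd_closed n l k t x bx).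
    + by exists g => l b' t; exact: (gR l (b', t)).
  rewrite /= (hG k x g bx Gg); apply: (pm_fun pR Rw).
  by have := Gg k b (did k); rewrite dcmpf1.
Qed.

Lemma homS_pre_kan_fib (A B Z : sset) (i : hom A B) : (forall k, injective (i k)) -> kan Z ->
  kan_fib (homS_pre Z i).
Proof.
move=> iI kZ; apply: kan_fibI => n c; apply: homS_pre_ext => //; first exact: horn_closed.
apply: (@kan_fib_horn_pp Z pt (to_pt Z) n c B _ (@full B)) => //.
by move=> l k t _ [a <-]; exists (A.[t] a); rewrite smNx.
Qed.

(** The lifting argument of [homS_pre_ext] for the inclusion of the empty subcomplex [E], as
    [homS E Z] is a point. *)
Lemma homS_kan (B Z : sset) : kan Z -> kan (homS B Z).
Proof.
move=> kZ; apply: kan_fibI => n c; apply: ext_pt => G pG tG.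
have cc : sub_closed (@nowhere B) by [].
have e : ext (@pp B (simplex n.+1) (@nowhere B) (@full B) (@in_horn n.+1 c))
   (@onfst B (simplex n.+1) (@full B)) (to_pt Z) by apply: kan_fib_horn_pp.
pose E := subS cc; pose i : hom E B := subS_incl cc.
have iI k : injective (i k) by move=> x y; apply: sig_ext.
have eE : ext (B := simplex n.+1) (@in_horn n.+1 c) (@full _) (homS_pre Z i).
  apply: homS_pre_ext => //; first exact: horn_closed.
  apply: ext_sub e => k z //.
  by split=> [[//|[_ h]]|[[[a //]]|[_ h]]]; right.
have empty m (f g : homS E Z m) : f = g by apply: sset_ext => k [[]].
have [|||G' [pG' tG' GG' _]] := eE G (fun _ _ _ => True) pG _ tG.
- by split=> // k b x y _ _; apply: empty.
- move=> k b _; have [//||g _] := @pmap_total (prodS E (simplex k)) Z (fun _ _ _ => False).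
    by move=> l [[]].
  by exists g.
- by move=> k b x y _ _ _; apply: empty.
by exists G'.
Qed.

(* A weak equivalence i induces homotopy equivalences of mapping spaces: transpose
   the identity of Map(A, Z) and use bijectivity of [B, Map(K, Z)] -> [A, Map(K, Z)]. *)
Lemma weak_eq_homS (A B Z : sset) (i : hom A B) : weak_eq i -> kan Z ->
  hequiv (homS_pre Z i).
Proof.
move=> wi kZ; pose phi := homS_pre Z i.
have [vs _] := wi _ (@homS_kan (homS A Z) Z kZ).
have [_ inj] := wi _ (@homS_kan (homS B Z) Z kZ).
have [v vi] := vs (flip (idm (homS A Z))).
have ps : homotopic (phi ∘ flip v) (idm (homS A Z)).
  by rewrite -flip_pre -[idm _]flipK; apply: homotopic_flip.
exists (flip v); split=> //.
rewrite -[flip v ∘ _]flipK -[idm _]flipK; apply: homotopic_flip; apply: inj.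
rewrite -[X in homotopic X _]flipK -[X in homotopic _ X]flipK; apply: homotopic_flip.
have -> : flip (flip (flip v ∘ homS_pre Z i) ∘ i) = phi ∘ flip v ∘ phi.
  by rewrite flip_pre flipK cmpA.
have -> : flip (flip (idm (homS B Z)) ∘ i) = idm _ ∘ phi.
  by rewrite flip_pre flipK cmpm1 cmp1m.
exact: homotopic_pre.
Qed.

Definition image (A B : sset) (i : hom A B) k (b : B k) : Prop := exists a, i k a = b.

Lemma image_closed (A B : sset) (i : hom A B) : sub_closed (image i).
Proof. by move=> l k t _ [a <-]; exists (A.[t] a); rewrite smNx. Qed.

(** The bridge from homotopy classes to strict extensions: [homS_pre Z i] is a Kan fibration and a
    homotopy equivalence, hence a trivial fibration, and lifting boundaries against it transposes to
    [tc_bd]. *)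
Lemma weak_eq_tc (A B : sset) (i : hom A B) : (forall k, injective (i k)) -> weak_eq i ->
  tc (image i) (@full B).
Proof.
move=> iI wi; split=> //; first exact: image_closed.
move=> Z kZ n; apply: homS_pre_ext_inv => //.
apply: kan_fib_tfib; [exact: homS_kan | exact: homS_pre_kan_fib | exact: weak_eq_homS].
Qed.

(** Surjectivity on homotopy classes is an extension along [i], injectivity one along its pushout
    product with the two ends of the interval. *)
Lemma tc_weak_eq (A B : sset) (i : hom A B) : (forall k, injective (i k)) ->
  tc (image i) (@full B) -> weak_eq i.
Proof.
move=> iI t Z kZ; split=> [u|v w [H HP]].
  have [||v vP] := tc_extend (G := fun k b z => exists2 a, i k a = b & u k a = z) t kZ.
  - split=> [k l s b z [a <- <-]|k b z z' [a <- <-] [a' /iI -> <-]] //.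
    by exists (A.[s] a); rewrite smNx.
  - by move=> k b [a <-]; exists (u k a), a.
  exists v; have -> : v ∘ i = u; last exact: homotopic_refl.
  by apply: sset_ext => k a; apply: vP; exists a.
pose Q k (y : simplex 1 k) := dend ord0 y \/ dend ord_max y.
have cQ : sub_closed Q.
  by move=> l k u y [h|h]; [left | right]; apply: dend_closed.
pose fs := mor_fst B (simplex 1).
pose R k (z : prodS B (simplex 1) k) x := (exists2 a, i k a = z.1 & H k (a, z.2) = x) \/
  ((dend ord0 z.2 /\ x = v k z.1) \/ (dend ord_max z.2 /\ x = w k z.1)).
have H0 k a : H k (a, dconst k ord0) = v k (i k a) by have [] := HP k a.
have H1 k a : H k (a, dconst k ord_max) = w k (i k a) by have [] := HP k a.
have pR : pmap R.
  apply: pmap_union; last first.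
  - move=> k [b y] x x' [a /= <- <-] [[/= /dendP -> ->]|[/= /dendP -> ->]]; [exact: H0 | exact: H1].
  - apply: pmap_union.
    + apply: (pmap_restrict (pmap_pre fs (graph_pmap v))) => l k s z; exact: dend_closed.
    + apply: (pmap_restrict (pmap_pre fs (graph_pmap w))) => l k s z; exact: dend_closed.
    + by move=> k z x y [h _] [h' _]; case: (dend_neq h h').
  - split=> [k l s [b y] x [a /= <- <-]|k [b y] x x' [a /= <- <-] [a' /= /iI -> <-]] //.
    by exists (A.[s] a); rewrite -smNx.
have [|R' [pR' tR' RR']] := pt_ext (tc_ppE t cQ kZ) pR.
  move=> k [b y] [[a ab]|[_ [h|h]]].
  - by exists (H k (a, y)); left; exists a.
  - by exists (v k b); right; left.
  - by exists (w k b); right; right.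
have [K KP] := pmap_total pR' (fun k z => tR' k z I).
exists K => k b; split; apply: (pm_fun pR' (KP _ _)); apply: RR'.
- by right; split=> //; left; apply/dendP.
- by right; left; split=> //; apply/dendP.
- by right; split=> //; right; apply/dendP.
- by right; right; split=> //; apply/dendP.
Qed.

End MappingSpace.

(** * Moore-Postnikov quotients *)

Section Moore.

(** Such a simplex misses at least two of the n+2 vertices, and one of them differs from [c]. *)
Lemma horn_small n i (c : 'I_n.+2) (t : simplex n.+1 i) : i < n -> in_horn c t.
Proof.
move=> lt; have [j jt] : bd t by rewrite -(dcmpf1 t); apply: contrapT => /not_bd ts;
  have := @lt_bd i n.+1 i t (did i) (ltnW lt); move: ts => /[swap]; case=> j jt /(_ j)[s sj];
  have := jt s; rewrite sj eqxx.
case: (eqVneq j c) => [jc|]; last by move=> jc; exists j.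
subst j; set u := dcmp (dretr c) t.
have [k ku] : bd u by have := @lt_bd i n i u (did i) lt; rewrite dcmpf1.
exists (lift c k); split; first by rewrite eq_sym neq_lift.
move=> s; apply/eqP => e; have := ku s; rewrite /u dcmpE e -dfaceE -dcmpE dretr_face didE.
by rewrite eqxx.
Qed.

Lemma in_skel_small m k i (t : simplex k i) : i <= m -> in_skel m t.
Proof. by move=> im; exists i => //; exists (did i), t; rewrite smap1x. Qed.

Definition skelt m k i (im : i <= m) (t : simplex k i) : skel m (simplex k) i :=
  exist _ t (in_skel_small t im).

Lemma skel_hom_eq m k (Z : sset) (u v : hom (skel m (simplex k)) Z) :
  (forall i (im : i <= m) (t : simplex k i), u i (skelt im t) = v i (skelt im t)) -> u = v.
Proof.
move=> e; apply: sset_ext => l [x xs]; have [i im [s [t xE]]] := xs.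
have -> : exist _ x xs = (skel m (simplex k)).[s] (skelt im t) by apply: sig_ext.
by rewrite !smNx e.
Qed.

Definition agree n (Z : sset) k (z z' : Z k) :=
  forall i (t : Delta i k), i <= n -> Z.[t] z = Z.[t] z'.

Lemma agreeP n (Z : sset) k (z z' : Z k) :
  cosk_unit n Z k z = cosk_unit n Z k z' <-> agree n z z'.
Proof.
split=> [e i t im|h].
  exact: (congr1 (fun u : hom (skel n (simplex k)) Z => u i (skelt im t)) e).
by apply: skel_hom_eq => i im t; apply: h.
Qed.

Lemma agree_full n (Z : sset) k (z z' : Z k) : k <= n -> agree n z z' -> z = z'.
Proof. by move=> kn /(_ k (did k) kn); rewrite !smap1x. Qed.

Definition mooreP n (Z : sset) k (u : cosk n Z k) : Prop := exists z, cosk_unit n Z k z = u.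

Lemma moore_closed n (Z : sset) : sub_closed (@mooreP n Z).
Proof. by move=> l k t _ [z <-]; exists (Z.[t] z); rewrite smNx. Qed.

Lemma moore_map_proof n (Z W : sset) (f : hom Z W) k (u : cosk n Z k) :
  mooreP u -> mooreP (fmap (cosk n) f k u).
Proof.
move=> [z <-]; exists (f k z); have := ntN (cosk_unit n) f.
by move=> /(congr1 (fun h : smor Z (cosk n W) => h k z)) /= ->.
Qed.

(* The image of Z in its n-coskeleton; the tower of these quotients of a Kan
   complex consists of Kan fibrations and has limit Z. *)
Program Definition moore n : functor sset sset :=
  @Functor sset sset (fun Z => subS (@moore_closed n Z))
    (fun Z W f => subS_map (@moore_closed n Z) (@moore_closed n W) (@moore_map_proof n Z W f)) _ _.
Next Obligation. by move=> n Z; apply: sset_ext => k u; apply: sig_ext; apply: sset_ext. Qed.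
Next Obligation. by move=> n Z W V g f; apply: sset_ext => k u; apply: sig_ext; apply: sset_ext. Qed.

Program Definition mq n : ntrans (id_functor sset) (moore n) :=
  @NTrans sset sset (id_functor sset) (moore n)
    (fun Z => @SMor Types Z (moore n Z)
      (fun k z => exist _ (cosk_unit n Z k z) (ex_intro _ z erefl)) _) _.
Next Obligation.
move=> n Z k l t; apply: functional_extensionality_dep => z; apply: sig_ext.
exact: (smNx (cosk_unit n Z)).
Qed.
Next Obligation.
move=> n Z W f; apply: sset_ext => k z; apply: sig_ext.
exact: (congr1 (fun h : smor Z (cosk n W) => h k z) (ntN (cosk_unit n) f)).
Qed.

Lemma mq_surj n (Z : sset) k (u : moore n Z k) : exists z, mq n Z k z = u.
Proof. by case: u => u [z e]; exists z; apply: sig_ext. Qed.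

Lemma mq_eq n (Z : sset) k (z z' : Z k) : mq n Z k z = mq n Z k z' <-> agree n z z'.
Proof.
split=> [e|/agreeP h]; last exact: sig_ext.
exact/agreeP/(congr1 sval e).
Qed.

Lemma mqN n (Z W : sset) (f : hom Z W) k z : fmap (moore n) f k (mq n Z k z) = mq n W k (f k z).
Proof. exact: (sset_eqx z (esym (ntN (mq n) f))). Qed.

Program Definition moore_tower n : ntrans (moore n.+1) (moore n) :=
  @NTrans sset sset (moore n.+1) (moore n)
    (fun Z => @subS_map _ _ _ (@moore_closed n.+1 Z) _ (@moore_closed n Z) (cosk_tower n Z) _) _.
Next Obligation. by move=> n Z k _ [z <-]; exists z; apply: sset_ext. Qed.
Next Obligation. by move=> n Z W f; apply: sset_ext => k u; apply: sig_ext; apply: sset_ext. Qed.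

Lemma moore_tower_mq n (Z : sset) k z : moore_tower n Z k (mq n.+1 Z k z) = mq n Z k z.
Proof. by apply: sig_ext; apply: sset_ext. Qed.

(** If the faces of the horn have dimension at most [n], they are determined by their images, so any
    preimage [z] of the target simplex restricts to them. Otherwise the horn contains all simplices
    of dimension at most [n], so any filler in [Z] has the right image. *)
Lemma mq_kan_fib n (Z : sset) : kan Z -> kan_fib (mq n Z).
Proof.
move=> kZ; apply: kan_fibI => m c G V pG pV tG tV GV.
have [v vV] := pmap_total pV (fun k b => tV k b I).
have [z zE] := mq_surj (v m.+1 (did m.+1)).
have vE l (t : simplex m.+1 l) : v l t = mq n Z l (Z.[t] z).
  by rewrite smNx zE -smNx /= dcmp1f.
have GvE l (t : simplex m.+1 l) y : in_horn c t -> G l t y -> agree n y (Z.[t] z).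
  by move=> ht Gy; apply/mq_eq; rewrite -vE; apply: (GV _ _ _ _ ht Gy).
have [mn|nm] := leqP m n.
  exists (graph (yoneda z)); split.
  - exact: graph_pmap.
  - by move=> k b _; exists (yoneda z k b).
  - move=> l t y [j [jc jt]] Gy; rewrite /graph.
    have hj : in_horn c (dface j) by exists j; split=> // s; rewrite dfaceE eq_sym neq_lift.
    have [w Gw] := tG _ _ hj.
    have wE := agree_full mn (GvE _ _ _ hj Gw).
    rewrite (miss_factor jt); apply: (pm_fun pG Gy); rewrite [in X in G _ X](miss_factor jt).
    by rewrite /= smapMx -wE; apply: (pm_cl pG (dcmp (dretr j) t) Gw).
  - by move=> l t y w _ -> Vw; rewrite -[yoneda z l t]/(Z.[t] z) -vE; apply: (pm_fun pV (vV _ _) Vw).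
have e : ext (B := simplex m.+1) (@in_horn m.+1 c) (@full _) (to_pt Z) by apply: kan_fib_horn.
have [//|h [hG _]] := ext_total (v := to_pt _) e pG tG.
have hz : mq n Z m.+1 (h m.+1 (did m.+1)) = mq n Z m.+1 z.
  apply/mq_eq => i t im; have ht : in_horn c t by apply: horn_small; lia.
  have [y Gy] := tG _ _ ht; rewrite -smNx /= dcmp1f (hG _ _ _ ht Gy).
  exact: agree_full im (GvE _ _ _ ht Gy).
exists (graph h); split.
- exact: graph_pmap.
- by move=> k b _; exists (h k b).
- by move=> l t y ht Gy; rewrite /graph (hG _ _ _ ht Gy).
- move=> l t y w _ -> Vw; rewrite -(pm_fun pV (vV _ _) Vw) vE smNx -hz -!smNx /=.
  by rewrite dcmp1f.
Qed.

(* Horns are contractible, so they lift through a fibration surjective on vertices. *)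
Lemma kan_fib_lift_horn (E B : sset) (q : hom E B) n (c : 'I_n.+2) (y : hom (horn (n := n.+1) c) B) :
  kan_fib q -> (forall b : B 0, exists e, q 0 e = b) ->
  exists u : hom (horn (n := n.+1) c) E, q ∘ u = y.
Proof.
move=> kq sq; pose H := horn (n := n.+1) c.
have stay (f g : Delta n.+1 n.+1) (fg : forall i, f i <= g i) :
    (forall j s, j != c -> s != j -> f s != j /\ g s != j) ->
    exists D : hom (prodS H (simplex 1)) H, forall k x t, sval (D k (x, t)) = dhom fg k (sval x, t).
  move=> h.
  have [||D DP] := @pmap_total (prodS H (simplex 1)) H
    (fun k z w => sval w = dhom fg k (sval z.1, z.2)).
  - split=> [k l t [x s] w /= wE|k z w w' e e']; last by apply: sig_ext; rewrite e e'.
    by rewrite wE; exact: esym (smNx (dhom fg) t (sval x, s)).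
  - move=> k [[x [j [jc jx]]] t].
    have hx : in_horn c (dhom fg k (x, t)).
      exists j; split=> // s; rewrite dhomE.
      by have [? ?] := h _ _ jc (jx s); case: ifP.
    by exists (exist _ _ hx).
  by exists D => k x t; apply: (DP k (x, t)).
have mc j s : j != c -> s != j -> dmax c s != j.
  by move=> jc sj; rewrite mkDeltaE; case: ifP => // _; rewrite eq_sym.
(* The identity and the constant map at [c] are in general not comparable, so the horn is contracted
   by a zigzag through [dmax c]; one homotopy lifting is spent on each half. *)
have [D1 D1E] := stay (did _) (dmax c) (@dmax_le _ c)
  (fun j s jc sj => conj (eq_ind_r (fun x => x != j) sj (didE s)) (mc j s jc sj)).
have cle s : dconst n.+1 c s <= dmax c s by rewrite dconstE mkDeltaE; case: ifP.
have [|D2 D2E] := stay (dconst _ c) (dmax c) cle.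
  by move=> j s jc sj; rewrite dconstE eq_sym; split=> //; apply: mc.
have vc : in_horn c (vertex c).
  pose j : 'I_n.+2 := if c == ord0 then ord_max else ord0.
  have jc : j != c by rewrite /j; case: (eqVneq c ord0) => [->|]; rewrite // eq_sym.
  by exists j; split=> // s; rewrite dconstE eq_sym.
have [e0 e0P] := sq (y 0 (exist _ _ vc)).
pose k0 : hom H E := yoneda e0 ∘ @SMor Types H (simplex 0) (fun k _ => dsurj k)
     (fun m n s => functional_extensionality_dep (fun x => esym (dsurj_cmp s))).
have e1 i : ext (@pp H (simplex 1) (@nowhere H) (@full H) (@dend i))
  (@onfst H (simplex 1) (@full H)) q by apply: kan_fib_hlp.
have step (i : 'I_2) (D : hom (prodS H (simplex 1)) H) (u : hom H E) :
    (forall k x, q k (u k x) = y k (D k (x, dconst k i))) ->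
    exists w : hom H E, forall k x, q k (w k x) = y k (D k (x, dconst k (rev_ord i))).
  move=> uq.
  have [|||L [LG Lq]] := ext_total (G := fun k (z : prodS H (simplex 1) k) x => dend i z.2 /\ x = u k z.1)
    (v := y ∘ D) (e1 i).
  - apply: (pmap_restrict (pmap_pre (mor_fst H (simplex 1)) (graph_pmap u))) => l k t z; exact: dend_closed.
  - by move=> k [x t] [//|[_ ti]]; exists (u k x).
  - by move=> k [x t] z _ [/= /dendP -> ->].
  by exists (L ∘ incl_end H (rev_ord i)) => k x; rewrite [LHS]Lq.
have r0 : rev_ord (ord0 : 'I_2) = ord_max by apply: val_inj.
have r1 : rev_ord (ord_max : 'I_2) = ord0 by apply: val_inj.
have [|u1 u1q] := step ord0 D2 k0.
  move=> k x; rewrite /= smNx e0P -smNx; congr (y k _); apply: sig_ext; rewrite D2E dhom0.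
  by rewrite /= !dconst_cmp.
have [|u uq] := step ord_max D1 u1.
  move=> k x; rewrite u1q r0; congr (y k _); apply: sig_ext.
  by rewrite D1E D2E !dhom1.
exists u; apply: sset_ext => k x; rewrite [LHS]uq r1; congr (y k _); apply: sig_ext.
by rewrite D1E dhom0 dcmp1f.
Qed.

Lemma kan_fib_factor (E B Y : sset) (q : hom E B) (p : hom B Y) : kan_fib q ->
  (forall b : B 0, exists e, q 0 e = b) -> kan_fib (p ∘ q) -> kan_fib p.
Proof.
move=> kq sq kpq n c u v uv.
have [w wu] := @kan_fib_lift_horn E B q n c u kq sq.
have [|h [hw hv]] := kpq n c w v; first by rewrite -cmpA wu.
by exists (q ∘ h); split; [rewrite -cmpA hw | rewrite cmpA].
Qed.

Lemma moore_kan n (Z : sset) : kan Z -> kan (moore n Z).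
Proof.
move=> kZ; have k : kan_fib (to_pt (moore n Z) ∘ mq n Z) by rewrite to_pt_cmp.
exact: (kan_fib_factor (mq_kan_fib kZ) (@mq_surj n Z 0) k).
Qed.

Lemma moore_tower_kan_fib n (Z : sset) : kan Z -> kan_fib (moore_tower n Z).
Proof.
move=> kZ; have e : moore_tower n Z ∘ mq n.+1 Z = mq n Z.
  by apply: sset_ext => k z; apply: moore_tower_mq.
have k : kan_fib (moore_tower n Z ∘ mq n.+1 Z) by rewrite e; apply: mq_kan_fib.
exact: (kan_fib_factor (mq_kan_fib kZ) (@mq_surj n.+1 Z 0) k).
Qed.

(* The simplices with image in {0} u im t for some t of dimension at most n: this
   subcomplex contracts to the vertex 0 and lies between the n- and (n+1)-skeleton. *)
Definition cone_skel n k l (x : simplex k l) : Prop :=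
  exists m (t : Delta m k), m <= n /\ forall s, dfun x s = ord0 \/ exists a, dfun x s = t a.

Lemma cone_skel_closed n k : sub_closed (@cone_skel n k).
Proof.
by move=> l j u x [m [t [mn h]]]; exists m, t; split=> // s; rewrite dcmpE.
Qed.

Lemma cone_skel_skel n k l (x : simplex k l) : cone_skel n x -> in_skel n.+1 x.
Proof.
move=> [m [t [mn h]]].
pose g (v : 'I_k.+1) : 'I_m.+1 := odflt ord0 [pick a | t a == v].
have gP v a : t a = v -> t (g v) = v.
  by move=> ta; rewrite /g; case: pickP => [b /eqP //|/(_ a)]; rewrite ta eqxx.
(* [t'] puts the vertex 0 in front of [t]. As [t] may hit 0 itself, [x'] sends everything over 0 to
   the new vertex, which keeps it monotone. *)
pose t' (i : 'I_m.+2) : 'I_k.+1 := if unlift ord0 i is Some a then t a else ord0.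
have t'H : {homo t' : i j / i <= j}.
  move=> i j; rewrite /t'; case: unliftP => [a|] ->; case: unliftP => [b|] -> //=.
  by rewrite /bump /= !add1n ltnS => ab; apply: Delta_homo.
pose x' s : 'I_m.+2 := if dfun x s == ord0 then ord0 else lift ord0 (g (dfun x s)).
have gE s : dfun x s != ord0 -> t (g (dfun x s)) = dfun x s.
  by move=> x0; case: (h s) => [e|[a e]]; [rewrite e eqxx in x0 | apply: (gP _ a)].
have x'H : {homo x' : i j / i <= j}.
  move=> i j ij; rewrite /x'; case: eqP => xi //; case: eqP => xj.
    have := Delta_homo (x : Delta _ _) ij; rewrite xj leqn0 => /eqP e; case: xi.
    exact: val_inj.
  rewrite leq_bump2 leqNgt; apply/negP => lt; case: (eqVneq (dfun x i) (dfun x j)) => [e|ne].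
    by rewrite e ltnn in lt.
  have := Delta_homo t (ltnW lt); rewrite !gE; try exact/eqP.
  move=> le; case/eqP: ne; apply: val_inj; apply/eqP; rewrite eqn_leq le andbT.
  exact: (Delta_homo (x : Delta _ _) ij).
exists m.+1; first by [].
exists (mkDelta x'H), (mkDelta t'H); apply: Delta_ext => s.
rewrite dcmpE !mkDeltaE /t' /x'; case: eqP => [->|/eqP x0]; first by rewrite unlift_none.
by rewrite liftK gE.
Qed.

Lemma cone_skel_weq n k : weak_eq (subS_incl (@cone_skel_closed n k)).
Proof.
set K := subS (@cone_skel_closed n k).
pose f := dconst k (ord0 : 'I_k.+1).
have fg (i : 'I_k.+1) : f i <= did k i by rewrite dconstE.
have c0 l : cone_skel n (dconst l (ord0 : 'I_k.+1)).
  by exists 0, (dconst 0 ord0); split=> // s; left; rewrite dconstE.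
have rN m l (t : Delta m l) : (fun x : simplex k l => exist _ _ (c0 m) : K m) =
   (fun x => K.[t] (exist _ _ (c0 l))).
  by apply: functional_extensionality_dep => x; apply: sig_ext; rewrite /= dconst_cmp.
pose r : hom (simplex k) K := @SMor Types (simplex k) K (fun l _ => exist _ _ (c0 l)) rN.
apply: hequiv_weak_eq; exists r; split.
- have [||D DP] := @pmap_total (prodS K (simplex 1)) K
    (fun l z w => sval w = dhom fg l (sval z.1, z.2)).
  + split=> [l m t [x s] w /= wE|l z w w' e e']; last by apply: sig_ext; rewrite e e'.
    by rewrite wE; exact: esym (smNx (dhom fg) t (sval x, s)).
  + move=> l [[x [m [t [mn h]]]] y].
    have hx : cone_skel n (dhom fg l (x, y)).
      exists m, t; split=> // s; rewrite dhomE; case: ifP => _; first by left; rewrite dconstE.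
      by rewrite didE.
    by exists (exist _ _ hx).
  exists D => l x; split; apply: sig_ext; rewrite DP.
  + by rewrite [LHS]dhom0 dconst_cmp.
  + by rewrite [LHS]dhom1 dcmp1f.
- exists (dhom fg) => l x; split; first by rewrite [LHS]dhom0 dconst_cmp.
  by rewrite [LHS]dhom1 dcmp1f.
Qed.

(** On the cone complex [u] is defined, and the inclusion of this complex in the simplex is a
    trivial cofibration. So [u] extends from there to a simplex of [Z] with the same n-skeleton.
    This is why one dimension is lost. *)
Lemma kappa_proof n (Z : sset) : kan Z -> forall k u, mooreP (cosk_tower n Z k u).
Proof.
move=> kZ k u; have t := @weak_eq_tc _ _ (subS_incl (@cone_skel_closed n k)) (fun l x y => @sig_ext _ _ x y) (@cone_skel_weq n k).
have := @tc_extend _ _ Z (fun l x w => cone_skel n x /\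
  exists h : in_skel n.+1 x, w = (u : smor _ _) l (exist _ x h)) t kZ.
case.
- split=> [l m s x w [cx [h ->]]|l x w w' [_ [h ->]] [_ [h' ->]]]; last first.
    by congr (smf u l _); apply: sig_ext.
  split; first exact: cone_skel_closed.
  exists (skel_closed s h); rewrite -smNx; congr (smf u m _); exact: sig_ext.
- move=> l x [[y cy] <-]; exists ((u : smor _ _) l (exist _ y (cone_skel_skel cy))).
  by split=> //; exists (cone_skel_skel cy).
move=> h hP; exists (h k (did k)); apply: skel_hom_eq => i im x.
have cx : cone_skel n x by exists i, x; split=> // s; right; exists s.
rewrite /= -smNx /= dcmp1f; apply: hP; first by exists (exist _ x cx).
by split=> //; exists (cone_skel_skel cx); congr (smf u i _); apply: sig_ext.
Qed.

Program Definition kappa n (Z : sset) (kZ : kan Z) : hom (cosk n.+1 Z) (moore n Z) :=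
  @SMor Types (cosk n.+1 Z) (moore n Z)
    (fun k u => exist _ (cosk_tower n Z k u) (kappa_proof kZ u)) _.
Next Obligation.
move=> n Z kZ k l t; apply: functional_extensionality_dep => u; apply: sig_ext.
exact: (smNx (cosk_tower n Z) t u).
Qed.

Lemma epi_mono k n (x : Delta k n) : exists i (t : Delta i n) (s : Delta k i) (d : Delta i k),
  [/\ x = dcmp t s, injective t & dcmp s d = did i].
Proof.
elim: k x => [|k IH] x.
  by exists 0, x, (did 0), (did 0); rewrite dcmpf1 dcmp1f; split=> // a b _; rewrite !ord1.
case: (pselect (injective x)) => [xI|nI].
  by exists k.+1, x, (did _), (did _); rewrite dcmpf1 dcmp1f.
have [a [b [ab xab]]] : exists a b : 'I_k.+2, a < b /\ x a = x b.
  apply: contrapT => h; apply: nI => a b e.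
  case: (ltngtP a b) => [ab|ba|/val_inj //]; case: h; [by exists a, b | by exists b, a].
have ak : a < k.+1 by have := ltn_ord b; lia.
have ak2 : a.+1 < k.+2 by lia.
pose j : 'I_k.+1 := Ordinal ak; pose c : 'I_k.+2 := Ordinal ak2.
(* By monotonicity a repeated value is repeated at adjacent places, so [x] factors through a
   codegeneracy. *)
have xc : x c = x a.
  have h1 := Delta_homo x (leqnSn a : a <= c); have h2 := Delta_homo x (ab : c <= b).
  by apply: val_inj; apply/eqP; rewrite eqn_leq h1 andbT; rewrite xab.
have xE : x = dcmp (dcmp x (dface c)) (ddeg j).
  apply: Delta_ext => s; rewrite !dcmpE.
  case: (eqVneq s c) => [->|sc].
    rewrite xc; congr (x _); apply: val_inj; rewrite /= dface_val ddegE /= /bump; lia.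
  congr (x _); apply: val_inj; rewrite /= dface_val ddegE /= /bump.
  by have := val_neq sc => /=; lia.
have [i [t [s [d [e tI sd]]]]] := IH (dcmp x (dface c)).
exists i, t, (dcmp s (ddeg j)), (dcmp (dface c) d); split=> //.
  by rewrite [LHS]xE e dcmpA.
rewrite -dcmpA (dcmpA (ddeg j)); have -> : dcmp (ddeg j) (dface c) = did k; last by rewrite dcmp1f.
apply: Delta_ext => v; apply: val_inj; rewrite /= dcmpE ddegE dface_val didE /= /bump.
lia.
Qed.

Lemma delta_inj_leq i n (t : Delta i n) : injective t -> i <= n.
Proof. by move=> tI; have := leq_card _ tI; rewrite !card_ord. Qed.

Lemma small_bd i n (t : simplex n i) : i < n -> bd t.
Proof. by move=> lt; rewrite -(dcmpf1 t); apply: lt_bd. Qed.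

(** For m at most n+1 the boundary data are determined by their n-skeleta, hence by the target, and
    a representative [z] of the target is a solution. For larger m the (n+1)-skeleton of the
    m-simplex lies in its boundary, so the data already amount to an m-simplex [u] of the
    coskeleton. *)
Lemma kappa_tfib n (Z : sset) (kZ : kan Z) : tfib (kappa n kZ).
Proof.
move=> m G V pG pV tG tV GV.
have [v vV] := pmap_total pV (fun k b => tV k b I).
have [z zE] := mq_surj (v m (did m)).
have vE l (t : simplex m l) : v l t = mq n Z l (Z.[t] z).
  by rewrite smNx zE -smNx /= dcmp1f.
have GvE l (t : simplex m l) (w : cosk n.+1 Z l) : bd t -> G l t w ->
    forall i (im : i <= n) (s : Delta i l), (w : smor _ _) i (skelt (leqW im) s) = Z.[s] (Z.[t] z).
  move=> bt Gw i im s; have := GV _ _ _ _ bt Gw (vV l t); rewrite vE => /(congr1 sval) /= e.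
  have := congr1 (fun h : hom (skel n (simplex l)) Z => h i (skelt im s)) e => /= <-.
  by congr (smf w i _); apply: sig_ext.
suff [u [uG uz]] : exists u : cosk n.+1 Z m,
   (forall l (t : simplex m l) w, bd t -> G l t w -> w = (cosk n.+1 Z).[t] u) /\
   kappa n kZ m u = mq n Z m z.
  exists (graph (yoneda u)); split.
  - exact: graph_pmap.
  - by move=> k b _; exists (yoneda u k b).
  - exact: uG.
  - move=> k t w y _ -> Vy; rewrite -(pm_fun pV (vV _ _) Vy) vE.
    rewrite -[yoneda u k t]/((cosk n.+1 Z).[t] u) (smNx (kappa n kZ)) uz.
    by rewrite -(smNx (mq n Z)).
have [mn|nm] := leqP m n.+1.
  exists (cosk_unit n.+1 Z m z); split; last by apply: sig_ext; apply: sset_ext.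
  move=> l t w bt Gw; have [j jt] := bt.
  clear v vV zE vE V pV tV GV.
  move: GvE; case: m z mn G pG tG t bt Gw j jt => [|m] z mn G pG tG t bt Gw j jt GvE.
    by have := jt ord0; rewrite (ord1 (dfun t ord0)) (ord1 j) eqxx.
  have bj : bd (dface j : simplex m.+1 m) by apply: small_bd.
  have [wj Gj] := tG _ _ bj.
  have wjE : wj = cosk_unit n.+1 Z m (Z.[dface j] z).
    apply: skel_hom_eq => i im s.
    have -> : skelt im s = (skel n.+1 (simplex m)).[s] (skelt (leqW (mn : m <= n)) (did m)).
      by apply: sig_ext; rewrite /= dcmp1f.
    rewrite !smNx; congr (Z.[s] _); rewrite (GvE _ _ _ bj Gj) /=.
    by rewrite smap1x dcmpf1.
  apply: (pm_fun pG Gw); rewrite -smNx (miss_factor jt) smapMx [in X in G l _ X]smNx -wjE.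
  exact: (pm_cl pG _ Gj).
have [i0 mi0] : exists i0, i0 = n.+1 by exists n.+1.
(* The value of [u] at [x] is read off from [G] on any injective face of dimension at most n+1
   through which [x] factors. *)
pose U l (x : skel n.+1 (simplex m) l) w := exists i (t : Delta i m) (s : Delta l i)
  (g : cosk n.+1 Z i) (im : i <= n.+1), [/\ injective t, sval x = dcmp t s, G i t g &
   forall h : in_skel n.+1 (s : simplex i l), w = (g : smor _ _) l (exist _ s h)].
have skd l i (s : Delta l i) (im : i <= n.+1) : in_skel n.+1 (s : simplex i l).
  by exists i => //; exists s, (did i); rewrite /= dcmp1f.
have bdi i (t : Delta i m) : i <= n.+1 -> bd (t : simplex m i).
  by move=> im; apply: small_bd; lia.
have pU : pmap U.
  split.
    move=> l j r [x xs] w [i [t [s [g [im [tI /= xE Gt wE]]]]]].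
    exists i, t, (dcmp s r), g, im; split=> //; first by rewrite /= xE dcmpA.
    move=> h; rewrite (wE (skd _ _ s im)) -smNx; congr (smf g j _); exact: sig_ext.
  move=> l [x xs] w w' [i [t [s [g [im [tI /= xE Gt wE]]]]]] [i' [t' [s' [g' [im' [tI' /= xE' Gt' wE']]]]]].
  have [j [t0 [s0 [d0 [x0 t0I sd]]]]] := epi_mono x.
  have jm : j <= n.+1.
    apply: leq_trans im; apply: (@delta_inj_leq _ _ (dcmp s d0)) => a b e; apply: t0I.
    have t0E : t0 = dcmp x d0 by rewrite x0 -dcmpA sd dcmpf1.
    by rewrite t0E xE !dcmpE; congr (t _); rewrite -!dcmpE.
  (* Independence of the face is tested on the value of [G] at [x] itself. The identity of [l] may
     lie outside the skeleton, but the idempotent [dcmp d0 s0] lies in it and fixes [x]. *)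
  have al : in_skel n.+1 (dcmp d0 s0 : simplex l l).
    by exists j => //; exists s0, (d0 : simplex l j).
  have xal : dcmp x (dcmp d0 s0) = x by rewrite x0 -!dcmpA (dcmpA s0) sd dcmp1f.
  have key k1 (t1 : Delta k1 m) (s1 : Delta l k1) (g1 : cosk n.+1 Z k1) (im1 : k1 <= n.+1) (h1 : in_skel n.+1 (s1 : simplex k1 l)) gx :
      injective t1 -> x = dcmp t1 s1 -> G k1 t1 g1 -> G l x gx ->
      (g1 : smor _ _) l (exist _ s1 h1) = (gx : smor _ _) l (exist _ _ al).
    move=> t1I e1 G1 Gx.
    have -> : gx = (cosk n.+1 Z).[s1] g1.
      by apply: (pm_fun pG Gx); rewrite e1; apply: (pm_cl pG s1 G1).
    rewrite /=; congr (smf g1 l _); apply: sig_ext => /=; apply: Delta_ext => a.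
    apply: t1I; have e2 : dcmp t1 (dcmp s1 (dcmp d0 s0)) = dcmp t1 s1 by rewrite dcmpA -e1 xal.
    by have := Delta_eqE a e2; rewrite !(dcmpE t1) => ->.
  have [gx Gx] : exists gx, G l x gx.
    by apply: tG; rewrite xE; apply: (@bd_closed m _ _ s); apply: bdi.
  rewrite (wE (skd _ _ s im)) (wE' (skd _ _ s' im')).
  by rewrite (key _ _ _ _ im _ _ tI xE Gt Gx) (key _ _ _ _ im' _ _ tI' xE' Gt' Gx).
have [|u uU] := pmap_total pU.
  move=> l [x xs]; have [i im [s1 [t1 e1]]] := xs.
  have [j [t0 [s0 [d0 [x0 t0I sd]]]]] := epi_mono t1.
  have jm : j <= n.+1.
    apply: leq_trans im; apply: (@delta_inj_leq _ _ d0) => a b e.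
    by rewrite -(didE a) -(didE b) -sd !dcmpE e.
  have [g Gg] := tG _ _ (bdi _ t0 jm).
  exists ((g : smor _ _) l (exist _ _ (skd _ _ (dcmp s0 s1) jm))), j, t0, (dcmp s0 s1), g, jm.
  split=> //; first by rewrite /= e1 x0 dcmpA.
  by move=> h; congr (smf g l _); apply: sig_ext.
have uG l (t : simplex m l) w : bd t -> G l t w -> w = (cosk n.+1 Z).[t] (u : cosk n.+1 Z m).
  move=> bt Gw; apply: skel_hom_eq => i im y.
  have [j [t0 [s0 [d0 [x0 t0I sd]]]]] := epi_mono (dcmp t y).
  have jm : j <= n.+1.
    apply: leq_trans im; apply: (@delta_inj_leq _ _ d0) => a b e.
    by rewrite -(didE a) -(didE b) -sd !dcmpE e.
  have [g Gg] := tG _ _ (bdi _ t0 jm).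
  apply: (pm_fun pU); last exact: uU.
  exists j, t0, s0, g, jm; split=> // h.
  have e : (cosk n.+1 Z).[y] w = (cosk n.+1 Z).[s0] g.
    apply: (pm_fun pG (pm_cl pG y Gw)); have := pm_cl pG s0 Gg.
    by rewrite /= x0.
  have := congr1 (fun h : hom (skel n.+1 (simplex i)) Z => h i (skelt im (did i))) e => /=.
  move=> e2; apply: etrans (etrans _ e2) _.
    by congr (smf w i _); apply: sig_ext; rewrite /= dcmpf1.
  by congr (smf g i _); apply: sig_ext; rewrite /= dcmpf1.
exists u; split=> //; apply: sig_ext; apply: skel_hom_eq => i im t /=.
have bt : bd (t : simplex m i) by apply: small_bd; lia.
have [w Gw] := tG _ _ bt.
have := GvE _ _ _ bt Gw i im (did i); rewrite (uG _ _ _ bt Gw) /= => e.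
rewrite smap1x in e; rewrite -[RHS]e; congr (smf u i _); apply: sig_ext.
by rewrite /= dcmpf1.
Qed.

End Moore.

(** * Moore-Postnikov quotients of homotopy equivalences and products *)

Section MooreProducts.

Lemma moore_homotopic n (Z W : sset) (f g : hom Z W) :
  homotopic f g -> homotopic (fmap (moore n) f) (fmap (moore n) g).
Proof.
move=> [H HP].
have [||K KP] := @pmap_total (prodS (moore n Z) (simplex 1)) (moore n W)
  (fun k x w => exists2 z, mq n Z k z = x.1 & w = mq n W k (H k (z, x.2))).
- split=> [k l t [x y] w [z /= <- ->]|k [x y] w w' [z /= <- ->] [z' /= /mq_eq e ->]].
    exists (Z.[t] z); first exact: (smNx (mq n Z)).
    by apply: etrans (esym (smNx (mq n W) t _)) _; congr (mq n W l _); rewrite -(smNx H).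
  apply/mq_eq => i t im; rewrite -!smNx /= e //.
- by move=> k [x y]; have [z zx] := mq_surj x; exists (mq n W k (H k (z, y))), z.
exists K => k x; split.
- have [z zx ->] := KP k (x, dconst k ord0); change (mq n Z k z = x) in zx; rewrite -zx (mqN n f).
  by rewrite (proj1 (HP _ _)).
- have [z zx ->] := KP k (x, dconst k ord_max); change (mq n Z k z = x) in zx; rewrite -zx (mqN n g).
  by rewrite (proj2 (HP _ _)).
Qed.

Lemma moore_hequiv n (Z W : sset) (f : hom Z W) : hequiv f -> hequiv (fmap (moore n) f).
Proof.
move=> [g [gf fg]]; exists (fmap (moore n) g); rewrite -!fmapM -!fmap1.
by split; apply: moore_homotopic.
Qed.

Lemma hequiv_cmp (X Y W : sset) (f : hom X Y) (g : hom Y W) : kan X -> kan Y -> kan W ->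
  hequiv f -> hequiv g -> hequiv (g ∘ f).
Proof.
move=> kX kY kW hf hg; apply: weak_eq_hequiv => //.
by apply: weak_eq_cmp; apply: hequiv_weak_eq.
Qed.

Lemma kan_prodS (X Y : sset) : kan X -> kan Y -> kan (prodS X Y).
Proof.
move=> kX kY; apply: kan_fibI => n c; apply: ext_pt => G pG tG.
have e (Z : sset) : kan Z -> ext (B := simplex n.+1) (@in_horn n.+1 c) (@full _) (to_pt Z).
  by move=> kZ; apply: kan_fib_horn.
have [|//|f [fG _]] := ext_total (v := to_pt _) (e _ kX) (pmap_post (mor_fst X Y) pG).
  by move=> k b /tG[x Gx]; exists x.1, x.
have [|//|g [gG _]] := ext_total (v := to_pt _) (e _ kY) (pmap_post (mor_snd X Y) pG).
  by move=> k b /tG[x Gx]; exists x.2, x.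
exists (graph (pairS f g)); split; [exact: graph_pmap | by move=> k b _; exists (pairS f g k b) |].
move=> k b [x y] hb Gx; rewrite /graph /= (fG _ _ x hb) ?(gG _ _ y hb) //.
  by exists (x, y).
by exists (x, y).
Qed.

Lemma kan_powS (X : sset) (I : Type) : kan X -> kan (powS X I).
Proof.
move=> kX; apply: kan_fibI => n c; apply: ext_pt => G pG tG.
have ev (i : I) : exists f : hom (simplex n.+1) X, forall k b x, in_horn c b -> G k b x -> f k b = x i.
  have e : ext (B := simplex n.+1) (@in_horn n.+1 c) (@full _) (to_pt X) by apply: kan_fib_horn.
  have [|||f [fG _]] := ext_total (v := to_pt _) (G := fun k b y => exists2 x, G k b x & x i = y) e.
  - split=> [k l t b y [x Gx <-]|k b y y' [x Gx <-] [x' Gx' <-]].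
      by exists ((powS X I).[t] x) => //; apply: (pm_cl pG).
    by rewrite (pm_fun pG Gx Gx').
  - by move=> k b /tG[x Gx]; exists (x i), x.
  - by [].
  by exists f => k b x hb Gx; apply: fG => //; exists x.
pose f i := projT1 (cid (ev i)).
have fP i k b x : in_horn c b -> G k b x -> f i k b = x i by rewrite /f; case: cid => g /= h; apply: h.
exists (graph (tupleS f)); split; [exact: graph_pmap | by move=> k b _; exists (tupleS f k b) |].
by move=> k b x hb Gx; apply: functional_extensionality_dep => i; rewrite /= (fP _ _ _ _ hb Gx).
Qed.

Lemma hequiv_prodS (X X' Y Y' : sset) (f : hom X X') (g : hom Y Y') :
  hequiv f -> hequiv g -> hequiv (prod_map f g).
Proof.
have pr (A A' B B' : sset) (a a' : hom A A') (b b' : hom B B') :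
    homotopic a a' -> homotopic b b' -> homotopic (prod_map a b) (prod_map a' b').
  move=> [H HP] [K KP].
  exists (pairS (H ∘ prod_map (mor_fst A B) (idm _)) (K ∘ prod_map (mor_snd A B) (idm _))).
  by move=> k [x y] /=; have [-> ->] := HP k x; have [-> ->] := KP k y.
move=> [f' [h1 h2]] [g' [h3 h4]]; exists (prod_map f' g'); split.
- by have [K KP] := pr _ _ _ _ _ _ _ _ h1 h3; exists K => k [x y]; apply: (KP k (x, y)).
- by have [K KP] := pr _ _ _ _ _ _ _ _ h2 h4; exists K => k [x y]; apply: (KP k (x, y)).
Qed.

Program Definition pow_map (X Y : sset) (I : Type) (f : hom X Y) : hom (powS X I) (powS Y I) :=
  @SMor Types (powS X I) (powS Y I) (fun k x i => f k (x i)) _.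
Next Obligation.
move=> X Y I f m n t; apply: functional_extensionality_dep => x /=.
by apply: functional_extensionality_dep => i; rewrite smNx.
Qed.

Lemma hequiv_powS (X Y : sset) (I : Type) (f : hom X Y) : hequiv f -> hequiv (pow_map I f).
Proof.
have pr (A B : sset) (a a' : hom A B) : homotopic a a' -> homotopic (pow_map I a) (pow_map I a').
  move=> [H HP]; have hN m n (t : Delta m n) : (fun z : powS A I n * Delta n 1 =>
       (fun i => H m (A.[t] (z.1 i), dcmp z.2 t)) : powS B I m) =
     (fun z => (powS B I).[t] (fun i => H n (z.1 i, z.2))).
    apply: functional_extensionality_dep => -[x y] /=; apply: functional_extensionality_dep => i.
    by rewrite -smNx.
  exists (@SMor Types (prodS (powS A I) (simplex 1)) (powS B I) (fun k z i => H k (z.1 i, z.2)) hN).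
  by move=> k x; split; apply: functional_extensionality_dep => i /=; have [] := HP k (x i).
by move=> [g [h1 h2]]; exists (pow_map I g); split; [apply: (pr _ _ _ _ h1) | apply: (pr _ _ _ _ h2)].
Qed.

(** Since [agree n] is tested in each coordinate, [moore n] commutes with products: the comparison
    [c] is a bijection. *)
Lemma moore_pair n (X Y W : sset) (a : hom X Y) (b : hom X W) : hequiv (pairS a b) ->
  kan X -> kan Y -> kan W ->
  hequiv (pairS (fmap (moore n) a) (fmap (moore n) b)).
Proof.
move=> h kX kY kW.
pose c := pairS (fmap (moore n) (mor_fst Y W)) (fmap (moore n) (mor_snd Y W)).
have -> : pairS (fmap (moore n) a) (fmap (moore n) b) = c ∘ fmap (moore n) (pairS a b).
  apply: sset_ext => k u; congr pair; apply: sig_ext; exact: sset_ext.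
have kYW := kan_prodS kY kW.
apply: hequiv_cmp; [exact: moore_kan | exact: moore_kan | | exact: moore_hequiv |].
  by apply: kan_prodS; apply: moore_kan.
apply: hequiv_bij => k.
- move=> u v; have [[y w] <-] := mq_surj u; have [[y' w'] <-] := mq_surj v.
  move=> e; have e1 := congr1 fst e; have e2 := congr1 snd e.
  rewrite [LHS]mqN [RHS]mqN in e1; rewrite [LHS]mqN [RHS]mqN in e2.
  move/mq_eq: e1 => e1; move/mq_eq: e2 => e2.
  by apply/mq_eq => i t im; congr pair; [apply: e1 | apply: e2].
- move=> [u v]; have [y <-] := mq_surj u; have [w <-] := mq_surj v.
  exists (mq n (prodS Y W) k ((y, w) : prodS Y W k)); congr pair.
    exact: (mqN n (mor_fst Y W)).
  exact: (mqN n (mor_snd Y W)).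
Qed.

Lemma moore_tuple n (X Y : sset) (I : Type) (a : I -> hom X Y) : hequiv (tupleS a) ->
  kan X -> kan Y -> hequiv (tupleS (fun i => fmap (moore n) (a i))).
Proof.
move=> h kX kY.
pose ev (i : I) : hom (powS Y I) Y :=
  @SMor Types (powS Y I) Y (fun k x => x i) (fun _ _ _ => erefl).
pose c := tupleS (fun i => fmap (moore n) (ev i)).
have -> : tupleS (fun i => fmap (moore n) (a i)) = c ∘ fmap (moore n) (tupleS a).
  apply: sset_ext => k u; apply: functional_extensionality_dep => i; apply: sig_ext; exact: sset_ext.
apply: hequiv_cmp; [exact: moore_kan | by apply: moore_kan; apply: kan_powS | | exact: moore_hequiv |].
  by apply: kan_powS; apply: moore_kan.
apply: hequiv_bij => k.
- move=> u v; have [y <-] := mq_surj u; have [y' <-] := mq_surj v => e.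
  apply/mq_eq => j t im; apply: functional_extensionality_dep => i.
  have := congr1 (fun z : powS (moore n Y) I k => z i) e => ei.
  by rewrite [LHS]mqN [RHS]mqN in ei; move/mq_eq: ei; apply.
- move=> u; pose y i := projT1 (cid (mq_surj (u i))).
  have yP i : mq n Y k (y i) = u i by rewrite /y; case: cid.
  exists (mq n (powS Y I) k y); apply: functional_extensionality_dep => i.
  by rewrite -yP; apply: (mqN n (ev i)).
Qed.

End MooreProducts.

(** * Reedy fibrations *)

Section SimplicialSpaces.

Lemma ssNx (X Y : sspace) (h : hom X Y) j k (t : Delta j k) l (x : X k l) :
  h j l (X.[t] l x) = Y.[t] l (h k l x).
Proof. exact: (congr1 (fun u : smor (X k) (Y j) => u l x) (smN h t)). Qed.

Lemma ssmap1 (X : sspace) k l (x : X k l) : X.[did k] l x = x.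
Proof. by rewrite (smap1 X). Qed.

Lemma ssmapM (X : sspace) i j k (g : Delta j k) (f : Delta i j) l (x : X k l) :
  X.[dcmp g f] l x = X.[f] l (X.[g] l x).
Proof. by rewrite (smapM X). Qed.

Lemma sspace_ext (X Y : sspace) (f g : hom X Y) : (forall k l x, f k l x = g k l x) -> f = g.
Proof. by move=> e; apply: smor_ext => k; apply: sset_ext. Qed.

Lemma sspace_eqx (X Y : sspace) (f g : hom X Y) k l x : f = g -> f k l x = g k l x.
Proof. by move=> ->. Qed.

Definition scl (B : sspace) (P : forall k l, B k l -> Prop) :=
  (forall k, sub_closed (P k)) /\
  forall j k (t : Delta j k) l x, P k l x -> P j l (B.[t] l x).

Record spmap (B X : sspace) (G : forall k l, B k l -> X k l -> Prop) : Prop := SPMap {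
  spm_in : forall k, pmap (G k);
  spm_out : forall j k (t : Delta j k) l b x, G k l b x -> G j l (B.[t] l b) (X.[t] l x) }.

Lemma spmap_total (B X : sspace) (G : forall k l, B k l -> X k l -> Prop) : spmap G ->
  (forall k l b, exists x, G k l b x) -> exists h : hom B X, forall k l b, G k l b (h k l b).
Proof.
move=> pG tG; pose f k := projT1 (cid (pmap_total (spm_in pG k) (tG k))).
have fP k l b : G k l b (f k l b).
  by rewrite /f; case: cid => g /= h; apply: h.
have fN m n (t : Delta m n) : f m ∘ B.[t] = X.[t] ∘ f n.
  apply: sset_ext => l b; apply: (pm_fun (spm_in pG m) (fP _ _ _)); exact: (spm_out pG).
by exists (@SMor sset B X f fN).
Qed.

(* Reedy fibrations, with lifting problems posed for partial maps. *)
Definition rfib (X Y : sspace) (q : hom X Y) :=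
  forall (B : sspace) (P : forall k l, B k l -> Prop) (G : forall k l, B k l -> X k l -> Prop)
    (v : hom B Y), scl P -> (forall k, tc (P k) (@full (B k))) -> spmap G ->
    (forall k l b, P k l b -> exists x, G k l b x) ->
    (forall k l b x, P k l b -> G k l b x -> q k l x = v k l b) ->
  exists h : hom B X, (forall k l b x, P k l b -> G k l b x -> h k l b = x) /\
    forall k l b, q k l (h k l b) = v k l b.

Program Definition subSS (B : sspace) (P : forall k l, B k l -> Prop) (cP : scl P) : sspace :=
  @Simplicial sset (fun k => subS (proj1 cP k))
    (fun j k t => subS_map (proj1 cP k) (proj1 cP j) (f := B.[t]) (proj2 cP j k t)) _ _.
Next Obligation. by move=> B P cP k; apply: sset_ext => l x; apply: sig_ext; apply: ssmap1. Qed.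
Next Obligation. by move=> B P cP i j k g f; apply: sset_ext => l x; apply: sig_ext; apply: ssmapM. Qed.

Program Definition subSS_incl (B : sspace) (P : forall k l, B k l -> Prop) (cP : scl P) :
    hom (subSS cP) B :=
  @SMor sset (subSS cP) B (fun k => subS_incl (proj1 cP k)) _.
Next Obligation. by move=> B P cP j k t; apply: sset_ext. Qed.

Lemma fib_reedy_rfib (X Y : sspace) (q : hom X Y) : fib reedy q -> rfib q.
Proof.
move=> fq B P G v cP tP pG tG Gv.
have [||u uG] := @spmap_total (subSS cP) X (fun k l b x => G k l (sval b) x).
- split=> [k|j k t l b x]; last exact: (spm_out pG).
  exact: (pmap_pre (subS_incl (proj1 cP k)) (spm_in pG k)).
- by move=> k l b; apply: tG; apply: svalP b.
have iI k l : injective (subSS_incl cP k l) by move=> x y; apply: sig_ext.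
have [|||h [hu hv]] := fq _ _ (subSS_incl cP) _ _ u v.
- by move=> k l; apply: iI.
- move=> k; apply: tc_weak_eq; first exact: iI.
  apply: tc_iff (tP k) => // l b; split=> [Pb|[a <-]]; last exact: svalP a.
  by exists (exist _ b Pb).
- apply: sspace_ext => k l b; exact: (Gv _ _ _ _ (svalP b) (uG k l b)).
exists h; split=> [k l b x Pb Gx|k l b]; last exact: (sspace_eqx b hv).
apply: (pm_fun (spm_in pG k) _ Gx).
have -> : h k l b = u k l (exist _ b Pb) by apply: (@sspace_eqx (subSS cP) X _ _ k l (exist _ b Pb) hu).
exact: (uG k l (exist _ b Pb)).
Qed.

Lemma rfib_fib_reedy (X Y : sspace) (q : hom X Y) : rfib q -> fib reedy q.
Proof.
move=> fq A B i mi wi u v uv.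
have [|||||h [hu hv]] := fq B (fun k l b => exists a, i k l a = b)
  (fun k l b x => exists a, i k l a = b /\ u k l a = x) v.
- split=> [k l m t _ [a <-]|j k t l _ [a <-]]; first by exists ((A k).[t] a); rewrite smNx.
  by exists (A.[t] l a); rewrite ssNx.
- by move=> k; apply: weak_eq_tc; [apply: mi | apply: wi].
- split=> [k|j k t l b x [a [<- <-]]]; last by exists (A.[t] l a); rewrite !ssNx.
  split=> [l m t b x [a [<- <-]]|l b x y [a [<- <-]] [a' [/mi -> <-]]] //.
  by exists ((A k).[t] a); rewrite !smNx.
- by move=> k l b [a <-]; exists (u k l a), a.
- by move=> k l b x _ [a [<- <-]]; apply: (sspace_eqx a uv).
exists h; split; apply: sspace_ext => k l b; last exact: hv.
by apply: hu; exists b.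
Qed.

Definition spt : sspace := @Simplicial sset (fun _ => pt) (fun _ _ _ => idm pt)
  (fun _ => erefl) (fun _ _ _ _ _ => esym (cmp1m (idm pt))).

Lemma spt_reduced : reduced spt. Proof. exact: pt_point. Qed.
Definition rpt : rsspace := exist _ spt spt_reduced.

Program Definition to_spt (X : sspace) : hom X spt :=
  @SMor sset X spt (fun k => to_pt (X k)) _.
Next Obligation. by move=> X m n t; apply: sset_ext. Qed.

Lemma rpt_terminal : is_terminal rpt.
Proof.
move=> X; exists (to_spt (incl X) : @hom rsspace X rpt); split=> // f _.
by apply: sspace_ext => k l x; case: ((f : hom (incl X) spt) k l x).
Qed.

Definition spoint (X : sspace) := forall k, is_point (X k).

(** Fibrancy is phrased with some terminal object; this moves it to the standard one [spt]. *)
Lemma rfib_spoint (X Y : sspace) (q : hom X Y) : spoint Y -> rfib q -> rfib (to_spt X).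
Proof.
move=> pY fq B P G v cP tP pG tG _.
have [||w _] := @spmap_total B Y (fun _ _ _ _ => True).
- split=> // k; split=> // l b x y _ _.
  by have [z [_ zU]] := pY k l; rewrite -(zU x I) (zU y I).
- by move=> k l b; have [z _] := pY k l; exists z.
have [|h [hG _]] := fq B P G w cP tP pG tG.
  by move=> k l b x _ _; have [z [_ zU]] := pY k l; rewrite -(zU (q k l x) I) (zU (w k l b) I).
by exists h; split=> // k l b; case: (v k l b).
Qed.

Lemma terminal_spoint (t : sspace) : is_terminal t -> spoint t.
Proof.
move=> tt' k l; have [f _] := tt' spt; have [u [_ uU]] := tt' t.
have e : f ∘ to_spt t = idm t by rewrite -(uU (f ∘ to_spt t) I) (uU (idm t) I).
exists (f k l tt); split=> // x _.
by rewrite -[RHS](sspace_eqx x e).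
Qed.

Lemma rterminal_spoint (t : rsspace) : is_terminal t -> spoint (incl t).
Proof.
move=> tt' k l; have [f _] := tt' rpt; have [u [_ uU]] := tt' t.
pose g : @hom rsspace t rpt := to_spt (incl t).
have e : f ∘ g = idm t by rewrite -(uU (f ∘ g) I) (uU (idm t) I).
exists ((f : hom spt (incl t)) k l tt); split=> // x _.
by rewrite -[RHS](@sspace_eqx (incl t) (incl t) _ _ k l x e).
Qed.

Lemma fibrant_reedy_rfib (X : sspace) : fibrant reedy X -> rfib (to_spt X).
Proof.
by move=> [t [f [/terminal_spoint pt' /fib_reedy_rfib]]]; apply: rfib_spoint.
Qed.

Lemma fibrant_reduced_rfib (X : rsspace) : fibrant reduced_reedy X -> rfib (to_spt (incl X)).
Proof.
by move=> [t [f [/rterminal_spoint pt' /fib_reedy_rfib]]]; apply: rfib_spoint.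
Qed.

Lemma rfib_cmp (X Y W : sspace) (p : hom X Y) (q : hom Y W) : rfib p -> rfib q -> rfib (q ∘ p).
Proof.
move=> fp fq B P G v cP tP pG tG Gv.
have [|||h [hG hv]] := fq B P (fun k l b y => exists2 x, G k l b x & p k l x = y) v cP tP.
- split=> [k|j k t l b y [x Gx <-]]; first exact: pmap_post (spm_in pG k).
  by exists (X.[t] l x); [apply: (spm_out pG) | rewrite ssNx].
- by move=> k l b /tG[x Gx]; exists (p k l x), x.
- by move=> k l b y Pb [x Gx <-]; apply: (Gv _ _ _ _ Pb Gx).
have [|g [gG gh]] := fp B P G h cP tP pG tG.
  by move=> k l b x Pb Gx; rewrite (hG _ _ _ (p k l x) Pb) //; exists x.
by exists g; split=> // k l b; rewrite [LHS](congr1 (q k l) (gh k l b)).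
Qed.

(* L x Delta^m with Delta^m discrete in the inner direction. *)
Program Definition cellS (L : sset) m : sspace :=
  @Simplicial sset (fun k => prodS L (fob const_sset (Delta k m)))
    (fun j k t => prod_map (idm L) (fmap const_sset (fun x : Delta k m => dcmp x t))) _ _.
Next Obligation. by move=> L m k; apply: sset_ext => l [y x] /=; rewrite dcmpf1. Qed.
Next Obligation. by move=> L m i j k g f; apply: sset_ext => l [y x] /=; rewrite dcmpA. Qed.

Program Definition cell_map (L : sset) m (Y : sspace) (v : hom L (Y m)) : hom (cellS L m) Y :=
  @SMor sset (cellS L m) Y (fun k => @SMor Types (cellS L m k) (Y k)
     (fun l z => Y.[z.2 : Delta k m] l (v l z.1)) _) _.
Next Obligation.
by move=> L m Y v k l j s; apply: functional_extensionality_dep => z /=; rewrite !smNx.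
Qed.
Next Obligation.
by move=> L m Y v j k s; apply: sset_ext => l [y x] /=; rewrite ssmapM.
Qed.

(** Reedy lifting against the pushout product of the trivial cofibration [L'] in [L] with the union
    of the outer faces [t i] of the m-simplex. On these faces the maps [w i] are prescribed over all
    of [L]; the last hypothesis is their compatibility on intersections. *)
Lemma rfib_cell (X Y : sspace) (q : hom X Y) m (L : sset) (L' : forall l, L l -> Prop)
    (I : Type) (d : I -> nat) (t : forall i, Delta (d i) m) (w : forall i, hom L (X (d i)))
    (G : forall l, L l -> X m l -> Prop) (v : hom L (Y m)) :
  rfib q -> tc L' (@full L) -> pmap G -> (forall l y, L' l y -> exists x, G l y x) ->
  (forall l y x, L' l y -> G l y x -> q m l x = v l y) ->
  (forall i l y x, L' l y -> G l y x -> X.[t i] l x = w i l y) ->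
  (forall i l y, q (d i) l (w i l y) = Y.[t i] l (v l y)) ->
  (forall i j k (a : Delta k (d i)) (b : Delta k (d j)) l y,
     dcmp (t i) a = dcmp (t j) b -> X.[a] l (w i l y) = X.[b] l (w j l y)) ->
  exists h : hom L (X m), [/\ forall l y x, L' l y -> G l y x -> h l y = x,
    forall l y, q m l (h l y) = v l y & forall i l y, X.[t i] l (h l y) = w i l y].
Proof.
move=> fq tL pG tG Gv Gw wv ww.
pose K k (x : Delta k m) := exists i (a : Delta k (d i)), x = dcmp (t i) a.
pose P k l (z : cellS L m k l) := L' l z.1 \/ K k z.2.
pose G1 k l (z : cellS L m k l) (x : X k l) :=
  exists x0, [/\ L' l z.1, G l z.1 x0 & x = X.[z.2] l x0].
pose G2 k l (z : cellS L m k l) (x : X k l) :=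
  exists i (a : Delta k (d i)), z.2 = dcmp (t i) a /\ x = X.[a] l (w i l z.1).
have cL := tc_cl tL.
have cP : scl P.
  split=> [k l j s [y x] [h|h]|j k s l [y x] [h|[i [a /= ->]]]].
  + by left; apply: cL.
  + by right.
  + by left.
  + by right; exists i, (dcmp a s); rewrite dcmpA.
have tP k : tc (P k) (@full (cellS L m k)).
  have cQ : sub_closed (K := fob const_sset (Delta k m)) (fun l => @K k) by [].
  apply: tc_iff (tc_pp tL cQ) => l [y x] //.
  by split=> [[h|[_ h]]|[h|h]]; [left | right | left | right].
have [|||h [hG hv]] := fq (cellS L m) P (fun k l z x => G1 k l z x \/ G2 k l z x)
   (cell_map v) cP tP.
- split=> [k|j k s l [y x] z [[x0 [/= h Gx ->]]|[i [a [/= -> ->]]]]].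
  + apply: pmap_union.
    * split=> [l j s [y x] z [x0 [/= h Gx ->]]|l [y x] z z' [x0 [/= h Gx ->]] [x1 [/= _ Gx' ->]]].
        by exists ((X m).[s] x0); split; [apply: cL | apply: (pm_cl pG) | rewrite -smNx].
      by rewrite (pm_fun pG Gx Gx').
    * split=> [l j s [y x] z [i [a [/= -> ->]]]|l [y x] z z' [i [a [/= -> ->]]] [i' [a' [/= e ->]]]].
        by exists i, a; split=> //=; rewrite -smNx -smNx.
      exact: ww.
    * move=> l [y x] z z' [x0 [/= h Gx ->]] [i [a [/= -> ->]]].
      by rewrite ssmapM (Gw i _ _ _ h Gx).
  + by left; exists x0; split=> //; rewrite -ssmapM.
  + by right; exists i, (dcmp a s); rewrite dcmpA ssmapM.
- move=> k l [y x] [h|[i [a /= ->]]].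
    by have [x0 Gx] := tG _ _ h; exists (X.[x] l x0); left; exists x0.
  by exists (X.[a] l (w i l y)); right; exists i, a.
- move=> k l [y x] z _ [[x0 [/= h Gx ->]]|[i [a [/= -> ->]]]].
    by rewrite ssNx (Gv _ _ _ h Gx).
  by rewrite ssNx wv ssmapM.
pose g : hom L (X m) := h m ∘ pairS (idm L)
  (@SMor Types L (fob const_sset (Delta m m)) (fun l _ => did m) (fun _ _ _ => erefl)).
exists g; split=> [l y x L'y Gx|l y|i l y].
- by apply: hG; [left | left; exists x; rewrite ssmap1].
- by rewrite [LHS]hv /= ssmap1.
- have -> : X.[t i] l (g l y) = h (d i) l (y, t i).
    by rewrite -[LHS](ssNx h) /= dcmp1f.
  by apply: hG; right; exists i, (did _); rewrite ?dcmpf1 ?ssmap1.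
Qed.

Lemma rfib_ext (X Y : sspace) (q : hom X Y) m (L : sset) (L' : forall l, L l -> Prop) :
  rfib q -> tc L' (@full L) -> ext L' (@full L) (q m).
Proof.
move=> fq tL G V pG pV tG tV GV.
have [v vV] := pmap_total pV (fun k b => tV k b I).
have [||||h [hG hv _]] := @rfib_cell X Y q m L L' False (fun i => match i with end)
  (fun i => match i with end) (fun i => match i with end) G v fq tL pG tG; try by case.
- by move=> l y x h Gx; apply: (GV _ _ _ _ h Gx (vV l y)).
exists (graph h); split.
- exact: graph_pmap.
- by move=> k b _; exists (h k b).
- by move=> k b x h' Gx; rewrite /graph (hG _ _ _ h' Gx).
- by move=> k b x y _ -> Vy; rewrite hv; apply: (pm_fun pV (vV _ _) Vy).
Qed.

Lemma rfib_kan_fib (X Y : sspace) (q : hom X Y) m : rfib q -> kan_fib (q m).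
Proof. by move=> fq; apply: kan_fibI => n c; apply: rfib_ext => //; apply: tc_horn. Qed.

Lemma rfib_kan (X : sspace) m : rfib (to_spt X) -> kan (X m).
Proof. exact: (@rfib_kan_fib X spt (to_spt X) m). Qed.

End SimplicialSpaces.

(** * Segal spaces and the shear map *)

Section Segal.

(* A Kan fibration with contractible fibres over vertices is a trivial fibration:
   contract the simplex in the base to its vertex 0. *)
Lemma tfib_fibres (E B : sset) (p : hom E B) : kan_fib p ->
  (forall (b : B 0) n (G : forall k, simplex n k -> E k -> Prop), pmap G ->
     (forall k x, bd x -> exists e, G k x e) ->
     (forall k x e, bd x -> G k x e -> p k e = B.[dsurj k] b) ->
     exists h : hom (simplex n) E, (forall k x e, bd x -> G k x e -> h k x = e) /\
       forall k x, p k (h k x) = B.[dsurj k] b) -> tfib p.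
Proof.
move=> kp fibs n G V pG pV tG tV GV.
have [v vV] := pmap_total pV (fun k b => tV k b I).
have fg (i : 'I_n.+1) : dconst n (ord0 : 'I_n.+1) i <= did n i by rewrite dconstE.
have dh0 k (x : Delta k n) : dhom fg k (x, dconst k ord0) = dconst k ord0.
  by rewrite dhom0 dconst_cmp.
have dh1 k (x : Delta k n) : dhom fg k (x, dconst k ord_max) = x.
  by rewrite dhom1 dcmp1f.
pose D := simplex n.
pose W := v ∘ dhom fg.
pose G1 k (z : prodS D (simplex 1) k) e := (@bd n k z.1 /\ dend ord_max z.2) /\ G k z.1 e.
have pG1 : pmap G1.
  apply: pmap_restrict; first exact: (pmap_pre (mor_fst D (simplex 1)) pG).
  by move=> l k t [x y] [h h']; split; [apply: bd_closed | apply: dend_closed].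
(* The boundary data are transported along the contraction from the end 1 to the end 0, where the
   base simplex is constant and the hypothesis on fibres applies. *)
have [|||K [pK tK GK KW]] := @kan_fib_hlp E B p ord_max D (@nowhere D) (@bd n) kp
  (fun _ _ _ _ => id) (@bd_closed n) (fun _ _ => @False_ind _) G1 (graph W) pG1 (graph_pmap W).
- by move=> k [x y] [//|[bx y1]]; have [e Ge] := tG _ _ bx; exists e.
- by move=> k z _; exists (W k z).
- move=> k [x y] e w _ [[bx y1] Gx] ->; move/dendP: y1 => y1; rewrite /= in y1.
  rewrite y1 /W cmpx dh1.
  exact: (GV _ _ _ _ bx Gx (vV _ _)).
have [||h0 [h0G h0p]] := fibs (v 0 (dconst 0 ord0)) n (fun k x e => K k (x, dconst k ord0) e)
    (pmap_pre (incl_end D ord0) pK).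
- by move=> k x bx; apply: tK.
- move=> k x e bx Kx; rewrite (KW k (x, dconst k ord0) e _ bx Kx erefl) /W cmpx dh0.
  by rewrite -smNx /= dconst_cmp.
(* The solution [h0] over the constant simplex is moved back to the end 1, following [K] on the
   boundary. *)
pose G2 k (z : prodS D (simplex 1) k) e := (@bd n k z.1 /\ K k z e) \/ (dend ord0 z.2 /\ e = h0 k z.1).
have pG2 : pmap G2.
  apply: pmap_union.
  - by apply: pmap_restrict => // l k t z; apply: bd_closed.
  - apply: (pmap_restrict (pmap_pre (mor_fst D (simplex 1)) (graph_pmap h0))).
    by move=> l k t z; apply: dend_closed.
  - move=> k [x y] e e' [bx Ke] [/= /dendP y0 ->]; apply: esym; apply: h0G => //.
    by rewrite -y0.
have e0 : ext (@pp D (simplex 1) (@bd n) (@full D) (@dend ord0))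
  (@onfst D (simplex 1) (@full D)) p by apply: kan_fib_hlp => //; apply: bd_closed.
have [||M [MG Mp]] := ext_total (v := W) e0 pG2.
- move=> k [x y] [bx|[_ y0]]; last by exists (h0 k x); right.
  by have [e Ke] := tK k (x, y) bx; exists e; left.
- move=> k [x y] e _ [[bx Ke]|[/dendP y0 ->]]; first exact: (KW _ _ _ _ bx Ke).
  rewrite /= in y0; by rewrite h0p y0 /W cmpx dh0 -smNx /= dconst_cmp.
exists (graph (M ∘ incl_end D ord_max)); split.
- exact: graph_pmap.
- by move=> k x _; exists ((M ∘ incl_end D ord_max) k x).
- move=> k x e bx Gx; rewrite /graph cmpx; apply: esym; apply: MG; first by left.
  left; split=> //; apply: GK; first by right; split=> //; apply/dendP.
  by split=> //; split=> //; apply/dendP.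
- move=> k x e y _ -> Vy; rewrite cmpx Mp /W cmpx dh1.
  exact: (pm_fun pV (vV _ _) Vy).
Qed.

Section Reduced.
Variables (A : sspace) (rA : reduced A).

Lemma dconst_factor k n (j : 'I_n.+1) : dconst k j = dcmp (vertex j) (dsurj k).
Proof. by rewrite /vertex dconst_cmp. Qed.

Lemma reduced_eq l (x y : A 0 l) : x = y.
Proof. by have [z [_ zU]] := rA l; rewrite -(zU x I) (zU y I). Qed.

Lemma reduced_const k m n (i : 'I_m.+1) (j : 'I_n.+1) l (x : A m l) (y : A n l) :
  A.[dconst k i] l x = A.[dconst k j] l y.
Proof.
rewrite !dconst_factor !ssmapM; congr (A.[dsurj k] l _); exact: reduced_eq.
Qed.

Hypothesis fA : rfib (to_spt A).

Lemma reduced_kan m : kan (A m).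
Proof. exact: rfib_kan. Qed.

Definition meets_in_vertex a b m (s : Delta a m) (t : Delta b m) :=
  forall k (x : Delta k a) (y : Delta k b), dcmp s x = dcmp t y ->
    exists i j, x = dconst k i /\ y = dconst k j.

Lemma meets_sym a b m (s : Delta a m) (t : Delta b m) :
  meets_in_vertex s t -> meets_in_vertex t s.
Proof. by move=> h k x y /esym/h[i [j [-> ->]]]; exists j, i. Qed.

Lemma dcmp_inj a m (s : Delta a m) k (x y : Delta k a) : injective s ->
  dcmp s x = dcmp s y -> x = y.
Proof. by move=> sI e; apply: Delta_ext => i; apply: sI; rewrite -!dcmpE e. Qed.

(* As A is reduced, prescribed faces that meet in vertices only are compatible. *)
Lemma reduced_cell m (L : sset) (L' : forall l, L l -> Prop)
    (I : Type) (d : I -> nat) (t : forall i, Delta (d i) m) (w : forall i, hom L (A (d i)))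
    (G : forall l, L l -> A m l -> Prop) :
  tc L' (@full L) -> pmap G -> (forall l y, L' l y -> exists x, G l y x) ->
  (forall i l y x, L' l y -> G l y x -> A.[t i] l x = w i l y) ->
  (forall i, injective (t i)) -> (forall i j, i = j \/ meets_in_vertex (t i) (t j)) ->
  exists h : hom L (A m), (forall l y x, L' l y -> G l y x -> h l y = x) /\
    forall i l y, A.[t i] l (h l y) = w i l y.
Proof.
move=> tL pG tG Gw tI tt'.
have [||||h [hG _ hw]] := @rfib_cell A spt (to_spt A) m L L' I d t w G (to_pt L) fA tL pG tG.
- by [].
- exact: Gw.
- by [].
- move=> i j k a b l y e; case: (tt' i j) => [ij|mt].
    by subst j; rewrite (dcmp_inj (tI i) e).
  by have [p [q [-> ->]]] := mt _ _ _ e; apply: reduced_const.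
by exists h.
Qed.

Lemma pair_kan_fib a b m (s : Delta a m) (t : Delta b m) : injective s -> injective t ->
  meets_in_vertex s t -> kan_fib (pairS A.[s] A.[t]).
Proof.
move=> sI tI mt; apply: kan_fibI => n c G V pG pV tG tV GV.
have [v vV] := pmap_total pV (fun k x => tV k x I).
pose d (i : bool) := if i then a else b.
pose st (i : bool) : Delta (d i) m := match i return Delta (d i) m with true => s | false => t end.
pose w (i : bool) : hom (simplex n.+1) (A (d i)) :=
  match i return hom (simplex n.+1) (A (d i)) with
  | true => mor_fst _ _ ∘ v | false => mor_snd _ _ ∘ v end.
have [|||h [hG hw]] := @reduced_cell m _ _ bool d st w G (tc_horn c) pG tG.
- by case=> l y x hy Gx; have := GV _ _ _ _ hy Gx (vV l y) => /= <-.
- by case.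
- by case=> [] []; [left | right | right; apply: meets_sym | left].
exists (graph h); split.
- exact: graph_pmap.
- by move=> k x _; exists (h k x).
- by move=> k x e hx Gx; rewrite /graph (hG _ _ _ hx Gx).
- move=> k x e y _ -> Vy; rewrite -(pm_fun pV (vV k x) Vy).
  have e1 := hw true k x; have e2 := hw false k x.
  by rewrite /= in e1 e2; rewrite /= e1 e2; case: (v k x).
Qed.

Let o1 : 'I_3 := Ordinal (isT : (1 < 3)%N).
Definition e01 : Delta 1 2 := dface ord_max.
Definition e02 : Delta 1 2 := dface o1.
Definition e12 : Delta 1 2 := dface ord0.

Lemma dface_inj n (c : 'I_n.+2) : injective (dface c).
Proof. by move=> i j; rewrite !dfaceE; apply: lift_inj. Qed.

Lemma faces_meet (c d : 'I_3) : (c < d)%N -> meets_in_vertex (dface c) (dface d).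
Proof.
move=> cd k x y /(edge_meet cd)[h1 h2].
exists (inord (d != ord_max)), (inord (c == ord0)).
by split; apply: const1E => s; rewrite ?h1 ?h2 inordK //; case: (_ == _).
Qed.

Lemma spine_pair_kan_fib : kan_fib (pairS A.[e01] A.[e12]).
Proof. by apply: pair_kan_fib; [apply: dface_inj.. | apply: meets_sym; apply: faces_meet]. Qed.

Lemma shear_kan_fib : kan_fib (pairS A.[e01] A.[e02]).
Proof. by apply: pair_kan_fib; [apply: dface_inj.. | apply: meets_sym; apply: faces_meet]. Qed.

Lemma pb_pullback (X Y Z : sset) (f : hom X Z) (g : hom Y Z) :
  is_pullback g (pb1 sset_pb f g) (pb2 sset_pb f g) f.
Proof.
split=> [k x|k y x e]; first exact: (esym (sset_eqx x (pb_sq sset_pb f g))).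
exists (exist (fun p : X k * Y k => f k p.1 = g k p.2) (x, y) (esym e)); split=> // x'' e1 e2.
by apply: sig_ext; rewrite /= -e1 -e2; case: x'' {e1 e2} => -[].
Qed.

Lemma edge_e01 : spine (ord0 : 'I_2) = e01.
Proof.
by apply: Delta_ext => i; apply: val_inj; case: (ord2E i) => ->; rewrite /= mkDeltaE dface_val.
Qed.

Lemma edge_e12 : spine (ord_max : 'I_2) = e12.
Proof.
by apply: Delta_ext => i; apply: val_inj; case: (ord2E i) => ->; rewrite /= mkDeltaE dface_val.
Qed.

Lemma edge_e02 : @edge 2 ord0 ord_max erefl = e02.
Proof.
by apply: Delta_ext => i; apply: val_inj; case: (ord2E i) => ->; rewrite /= mkDeltaE dface_val.
Qed.

Lemma same_component_homotopic (X : sset) (x y : X 0) : kan X -> same_component x y ->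
  homotopic (yoneda x) (yoneda y).
Proof.
move=> kX; elim=> {x y} [x y [e [ex ey]]|x|x y _ h|x y z _ h1 _ h2].
- exists (yoneda e ∘ mor_snd _ _) => k x0; rewrite -ex -ey /= -!smapMx /vertex !dconst_cmp.
  by [].
- exact: homotopic_refl.
- exact: homotopic_sym.
- exact: homotopic_trans h1 h2.
Qed.

(** A product in the monoid of components is witnessed by edges in the right components only. The
    three edges of the triangle meet in vertices, so by [reduced_cell] homotopies of the edges
    extend to a homotopy of [t], whose other end has the exact edges. *)
Lemma pi0_mul_strict (a b c : A 1 0) : pi0_mul a b c ->
  exists t : A 2 0, [/\ A.[e01] 0 t = a, A.[e12] 0 t = b & A.[e02] 0 t = c].
Proof.
move=> [t]; rewrite edge_e01 edge_e12 edge_e02 => -[].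
move=> /(same_component_homotopic (@reduced_kan 1))[Ha HaP].
move=> /(same_component_homotopic (@reduced_kan 1))[Hb HbP].
move=> /(same_component_homotopic (@reduced_kan 1))[Hc HcP].
pose L := prodS (simplex 0) (simplex 1).
have tL := @tc_end (simplex 0) (@nowhere _) (@full _) ord0 (fun _ _ _ _ => id)
  (@full_closed _) (fun _ _ => @False_ind _).
pose H (i : 'I_3) := if i == ord0 then Hb else if i == o1 then Hc else Ha.
have HP (i : 'I_3) k : H i k (dsurj k, dconst k ord0) = (A 1).[dsurj k] (A.[dface i] 0 t).
  rewrite /H; case: i => [[|[|[|//]]] hi]; rewrite -?val_eqE /=.
  - rewrite (proj1 (HbP k (dsurj k))) /=; congr ((A 1).[_] (A.[_] 0 t)); congr dface; exact: val_inj.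
  - rewrite (proj1 (HcP k (dsurj k))) /=; congr ((A 1).[_] (A.[_] 0 t)); congr dface; exact: val_inj.
  - rewrite (proj1 (HaP k (dsurj k))) /=; congr ((A 1).[_] (A.[_] 0 t)); congr dface; exact: val_inj.
have [|||||h [hG hw]] := @reduced_cell 2 L _ 'I_3 (fun _ => 1) (fun i => dface i) H
  (fun l (y : L l) x => dend ord0 y.2 /\ x = (A 2).[dsurj l] t) tL.
- split=> [l k s [y1 y2] x [h ->]|l y x x' [_ ->] [_ ->]] //.
  by split; [apply: dend_closed | rewrite -smapMx dsurj_cmp].
- by move=> l [y1 y2] [//|[_ h]]; exists ((A 2).[dsurj l] t).
- move=> i l [y1 y2] x _ [/= /dendP -> ->]; rewrite smNx (Delta0_eq y1 (dsurj l)) HP //.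
- by move=> i; apply: dface_inj.
- move=> i j; case: (ltngtP i j) => [ij|ji|/val_inj ->]; [right | right | by left].
    exact: faces_meet.
  by apply: meets_sym; apply: faces_meet.
exists (h 0 (dsurj 0, dconst 0 ord_max)); split.
- rewrite (hw ord_max) /H /=; have [_ ->] := HaP 0 (dsurj 0).
  by rewrite /= (Delta0_eq (dsurj 0) (did 0)) smap1x.
- rewrite (hw ord0) /H /=; have [_ ->] := HbP 0 (dsurj 0).
  by rewrite /= (Delta0_eq (dsurj 0) (did 0)) smap1x.
- rewrite (hw o1) /H /=; have [_ ->] := HcP 0 (dsurj 0).
  by rewrite /= (Delta0_eq (dsurj 0) (did 0)) smap1x.
Qed.

End Reduced.
End Segal.

(** * Left multiplication in a Segal group *)

Section Shear.
Variables (A : sspace) (rA : reduced A).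
Hypothesis fA : rfib (to_spt A).

Let kA m : kan (A m).
Proof. exact: reduced_kan. Qed.

Lemma spineE n (i : 'I_n) s : (spine i s : nat) = i + s.
Proof.
rewrite mkDeltaE /edge_fun; case: (ord2E s) => ->; rewrite ?lift0 /= ?addn0 ?addn1 //.
Qed.

Lemma spine_inj n (i : 'I_n) : injective (spine i).
Proof.
move=> s s' /(congr1 val); rewrite /= !spineE => h; apply: val_inj => /=; lia.
Qed.

Lemma last_edge_meet n : meets_in_vertex (dface (ord_max : 'I_n.+2)) (spine (ord_max : 'I_n.+1)).
Proof.
move=> k x y e.
have h s : (y s : nat) = 0 /\ (x s : nat) = n.
  have := congr1 val (Delta_eqE s e); rewrite /= !dcmpE dface_val spineE /= /bump.
  by have := ltn_ord (x s); have := ltn_ord (y s); lia.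
exists ord_max, ord0; split; last by apply: const1E => s; rewrite (h s).1.
by apply: Delta_ext => s; rewrite dconstE; apply: val_inj; rewrite /= (h s).2.
Qed.

Hypothesis segA : forall k, 2 <= k -> hequiv (tupleS (fun i : 'I_k => A.[spine i])).

Lemma seg_tuple k : 1 <= k -> hequiv (tupleS (fun i : 'I_k => A.[spine i])).
Proof.
case: k => [//|[_|k _]]; last exact: segA.
have sE : spine (ord0 : 'I_1) = did 1.
  by apply: Delta_ext => s; apply: val_inj; rewrite /= spineE didE.
apply: hequiv_bij => l.
- move=> x y e; have := congr1 (fun f : powS (A 1) 'I_1 l => f ord0) e.
  by rewrite /= sE !ssmap1.
- move=> f; exists (f ord0); apply: functional_extensionality_dep => i.
  by rewrite (ord1 i) /= sE ssmap1.
Qed.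

Definition last_pair n : hom (A n.+1) (prodS (A n) (A 1)) :=
  pairS A.[dface (ord_max : 'I_n.+2)] A.[spine (ord_max : 'I_n.+1)].

(** Splitting off the last edge factors the Segal map of degree n+1 through the Segal map of degree
    n, up to the bijection [u]; two out of three. *)
Lemma last_pair_weq n : 1 <= n -> weak_eq (last_pair n).
Proof.
move=> n1.
pose T := tupleS (fun i : 'I_n => A.[spine i]).
pose uf k (x : powS (A 1) 'I_n.+1 k) : prodS (powS (A 1) 'I_n) (A 1) k :=
  ((fun i => x (widen_ord (leqnSn n) i)), x ord_max).
have uN j k (t : Delta j k) : (fun x => uf j ((powS (A 1) 'I_n.+1).[t] x)) =
   (fun x => (prodS (powS (A 1) 'I_n) (A 1)).[t] (uf k x)) by [].
pose u : hom (powS (A 1) 'I_n.+1) (prodS (powS (A 1) 'I_n) (A 1)) :=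
  @SMor Types (powS (A 1) 'I_n.+1) (prodS (powS (A 1) 'I_n) (A 1)) uf uN.
have hu : hequiv u.
  apply: hequiv_bij => k.
  - move=> x y e; have e1 := congr1 fst e; have e2 := congr1 snd e.
    apply: functional_extensionality_dep => i; case: (ltnP i n) => [lt|ge].
      have := congr1 (fun f : 'I_n -> A 1 k => f (Ordinal lt)) e1 => /=.
      by rewrite (_ : widen_ord _ _ = i) //; apply: val_inj.
    have -> : i = ord_max by apply: val_inj => /=; have := ltn_ord i; lia.
    exact: e2.
  - move=> [f g]; exists (fun i => if insub (i : nat) is Some j then f j else g).
    congr pair; last by rewrite insubF //= ltnn.
    by apply: functional_extensionality_dep => i; rewrite /= valK.
have e : prod_map T (idm (A 1)) ∘ last_pair n = u ∘ tupleS (fun i : 'I_n.+1 => A.[spine i]).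
  apply: sset_ext => k x; congr pair; apply: functional_extensionality_dep => i /=.
  rewrite -ssmapM; congr (A.[_] k x); apply: Delta_ext => s; apply: val_inj.
  rewrite /= dcmpE dface_val !spineE /= /bump.
  by have := ltn_ord i; have := ltn_ord s; lia.
apply: (@weak_eq_cancel_l _ _ _ (last_pair n) (prod_map T (idm (A 1)))).
  by apply/hequiv_weak_eq/hequiv_prodS; [apply: seg_tuple | apply: hequiv_id].
rewrite e; apply: weak_eq_cmp; apply: hequiv_weak_eq => //.
exact: seg_tuple.
Qed.

Lemma last_pair_tfib n : 1 <= n -> tfib (last_pair n).
Proof.
move=> n1; apply: kan_fib_tfib => //.
- apply: pair_kan_fib => //; [exact: dface_inj | exact: spine_inj | exact: last_edge_meet].
- by apply: weak_eq_hequiv => //; [apply: kan_prodS | apply: last_pair_weq].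
Qed.

Definition constS (K X : sset) (a : X 0) : hom K X :=
  @SMor Types K X (fun k _ => X.[dsurj k] a)
    (fun m n t => functional_extensionality_dep
       (fun _ => etrans (congr1 (fun s => X.[s] a) (esym (dsurj_cmp t))) (smapMx (dsurj n) t a))).

Lemma fibre_closed m (a b : nat) (s : Delta a m) (t : A a 0) :
  sub_closed (fun k (x : A m k) => A.[s] k x = (A a).[dsurj k] t).
Proof. by move=> l k u x e; rewrite smNx e -smapMx dsurj_cmp. Qed.

(** The ways to add a last vertex to [t]. By [star_last_tfib] these are, up to a trivial fibration,
    the possible last edges. *)
Definition star n (t : A n 0) : sset :=
  subS (@fibre_closed n.+1 n 0 (dface ord_max) t).

Definition star_incl n (t : A n 0) : hom (star t) (A n.+1) :=
  subS_incl (@fibre_closed n.+1 n 0 (dface ord_max) t).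

Definition star_last n (t : A n 0) : hom (star t) (A 1) :=
  A.[spine (ord_max : 'I_n.+1)] ∘ star_incl t.

Lemma star_last_tfib n (t : A n 0) : 1 <= n -> tfib (star_last t).
Proof.
move=> n1; apply: (@tfib_pullback _ _ _ _ (last_pair n) (star_last t) (star_incl t)
  (pairS (constS _ t) (idm (A 1)))); last exact: last_pair_tfib.
split=> [k x|k x y e]; first by congr pair; apply: (svalP x).
have e1 := congr1 fst e; have e2 := congr1 snd e.
exists (exist _ x e1); split=> // x'' ex _; exact: sig_ext.
Qed.

(* Left multiplication by a, as a span of a trivial fibration and a fibration. *)
Definition lmul (a : A 1 0) : hom (star a) (A 1) := A.[e02] ∘ star_incl a.

Definition lsec (a : A 1 0) : hom (A 1) (star a) :=
  projT1 (cid (tfib_section (@star_last_tfib 1 a isT))).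

Lemma lsecP a : star_last a ∘ lsec a = idm (A 1).
Proof. by rewrite /lsec; case: cid. Qed.

Definition mulop (a : A 1 0) : hom (A 1) (A 1) := lmul a ∘ lsec a.

(** As [star_last] is a trivial fibration, maps into [star a] with the same last edge are homotopic.
    So any family of triangles with first edge [a] computes multiplication by [a]. *)
Lemma mulop_homotopic a (B : sset) (s : hom B (star a)) (g : hom B (A 1)) :
  star_last a ∘ s = g -> homotopic (lmul a ∘ s) (mulop a ∘ g).
Proof.
move=> e; rewrite /mulop -cmpA; apply: homotopic_post.
by apply: (tfib_homotopic (@star_last_tfib 1 a isT)); rewrite cmpA lsecP cmp1m.
Qed.

Lemma map_into_star n (t : A n 0) (B : sset) (f : hom B (A n.+1)) :
  (forall k x, A.[dface ord_max] k (f k x) = (A n).[dsurj k] t) ->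
  exists s : hom B (star t), star_incl t ∘ s = f.
Proof.
move=> h.
have sN j k (u : Delta j k) : (fun x => exist _ (f j (B.[u] x)) (h j (B.[u] x)) : star t j) =
  (fun x => (star t).[u] (exist _ (f k x) (h k x))).
  by apply: functional_extensionality_dep => x; apply: sig_ext; rewrite /= smNx.
by exists (@SMor Types B (star t) (fun k x => exist _ (f k x) (h k x)) sN); apply: sset_ext.
Qed.

(** Associativity read off from tetrahedra with face 012 equal to [t] and edge 23 equal to x. The
    faces opposite to 0, 1 and 2 exhibit the edge 13 as bx, and the edge 03 both as cx and as
    a(bx). *)
Lemma mulop_cmp (t : A 2 0) (a b c : A 1 0) :
  A.[e01] 0 t = a -> A.[e12] 0 t = b -> A.[e02] 0 t = c ->
  homotopic (mulop a ∘ mulop b) (mulop c).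
Proof.
move=> ta tb tc.
have [sg sgP] := tfib_section (@star_last_tfib 2 t isT).
pose f := star_incl t ∘ sg.
have f3 k x : A.[dface (ord_max : 'I_4)] k (f k x) = (A 2).[dsurj k] t by apply: svalP (sg k x).
have fl k x : A.[spine (ord_max : 'I_3)] k (f k x) = x by apply: (sset_eqx x sgP).
pose i1 : 'I_4 := Ordinal (isT : 1 < 4); pose i2 : 'I_4 := Ordinal (isT : 2 < 4).
have sq (i j : 'I_4) (i' j' : 'I_3) k (x : A 3 k) :
   dcmp (dface i) (dface i') = dcmp (dface j) (dface j') ->
   A.[dface i'] k (A.[dface i] k x) = A.[dface j'] k (A.[dface j] k x).
  by rewrite -!ssmapM => ->.
have fq n (i i' : 'I_n.+3) (j j' : 'I_n.+2) :
    (forall s : 'I_n.+1, bump i (bump j s) = bump i' (bump j' s)) ->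
    dcmp (dface i) (dface j) = dcmp (dface i') (dface j').
  by move=> h; apply: Delta_ext => s; apply: val_inj; rewrite /= !dcmpE !dface_val.
have last k (i : 'I_4) (x : A 3 k) : i < 2 -> A.[spine (ord_max : 'I_2)] k (A.[dface i] k x) = A.[spine (ord_max : 'I_3)] k x.
  move=> i2'; rewrite -ssmapM; congr (A.[_] k x); apply: Delta_ext => s; apply: val_inj.
  by rewrite /= dcmpE dface_val !spineE /= /bump; lia.
have [s0 s0P] : exists s : hom (A 1) (star b), star_incl b ∘ s = A.[dface ord0] ∘ f.
  apply: map_into_star => k x; rewrite cmpx (sq _ ord_max _ ord0).
    by rewrite f3 -tb -smNx.
  by apply: fq => s; rewrite /bump /=; have := ltn_ord s; lia.
have [s1 s1P] : exists s : hom (A 1) (star c), star_incl c ∘ s = A.[dface i1] ∘ f.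
  apply: map_into_star => k x; rewrite cmpx (sq _ ord_max _ (Ordinal (isT : 1 < 3))).
    by rewrite f3 -tc -smNx.
  by apply: fq => s; rewrite /bump /=; have := ltn_ord s; lia.
have [s2 s2P] : exists s : hom (A 1) (star a), star_incl a ∘ s = A.[dface i2] ∘ f.
  apply: map_into_star => k x; rewrite cmpx (sq _ ord_max _ ord_max).
    by rewrite f3 -ta -smNx.
  by apply: fq => s; rewrite /bump /=; have := ltn_ord s; lia.
have h0 : homotopic (lmul b ∘ s0) (mulop b).
  rewrite -[mulop b]cmpm1; apply: mulop_homotopic; rewrite /star_last -cmpA s0P.
  by apply: sset_ext => k x; rewrite !cmpx last // fl.
have h1 : homotopic (lmul c ∘ s1) (mulop c).
  rewrite -[mulop c]cmpm1; apply: mulop_homotopic; rewrite /star_last -cmpA s1P.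
  by apply: sset_ext => k x; rewrite !cmpx last // fl.
have h2 : homotopic (lmul a ∘ s2) (mulop a ∘ (lmul b ∘ s0)).
  apply: mulop_homotopic; rewrite /star_last /lmul -!cmpA s2P s0P.
  apply: sset_ext => k x; rewrite !cmpx -!ssmapM; congr (A.[_] k _).
  apply: Delta_ext => s; apply: val_inj; rewrite /= !dcmpE !dface_val spineE /= /bump.
  by have := ltn_ord s; lia.
have e12 : lmul a ∘ s2 = lmul c ∘ s1.
  rewrite /lmul -!cmpA s2P s1P; apply: sset_ext => k x; rewrite !cmpx; apply: sq.
  by apply: fq => s; rewrite /bump /=; have := ltn_ord s; lia.
apply: (homotopic_trans (@kA 1) (homotopic_post (mulop a) (homotopic_sym (@kA 1) h0))).
apply: (homotopic_trans (@kA 1) (homotopic_sym (@kA 1) h2)).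
by rewrite e12.
Qed.

(** The degenerate triangles along [sg] have edge 01 at the base point, and their edges 12 and 02
    are both the given edge. *)
Lemma mulop_unit (o : A 0 0) : homotopic (mulop (A.[dsurj 1] 0 o)) (idm (A 1)).
Proof.
set u := A.[dsurj 1] 0 o; pose sg := ddeg (ord0 : 'I_2).
have sgE (d : Delta 1 2) : (forall s, d s - (0 < d s) = s :> nat) -> A.[d] ∘ A.[sg] = idm (A 1).
  move=> h; apply: sset_ext => k x; rewrite cmpx -ssmapM -[RHS](ssmap1 x); congr (A.[_] k x).
  by apply: Delta_ext => s; apply: val_inj; rewrite /= dcmpE ddegE didE h.
have [s sP] : exists s : hom (A 1) (star u), star_incl u ∘ s = A.[sg].
  apply: map_into_star => k x; rewrite -ssmapM /u -smNx.
  have -> : dcmp sg (dface ord_max) = dconst 1 ord0.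
    apply: Delta_ext => i; apply: val_inj; rewrite /= dcmpE ddegE dface_val dconstE /= /bump.
    by have := ltn_ord i; lia.
  exact: (@reduced_const A rA _ _ _ ord0 ord0).
have e : lmul u ∘ s = idm (A 1).
  rewrite /lmul -cmpA sP; apply: sgE => i; rewrite dface_val /= /bump.
  by have := ltn_ord i; lia.
rewrite -[X in homotopic _ X]e -[mulop u]cmpm1; apply: homotopic_sym (@kA 1) _; apply: mulop_homotopic.
rewrite /star_last -cmpA sP; apply: sgE => i; rewrite spineE /=.
by have := ltn_ord i; lia.
Qed.

Hypothesis gA : pi0_group A.

Lemma mulop_left_inverse (a : A 1 0) : exists b, homotopic (mulop b ∘ mulop a) (idm (A 1)).
Proof.
have [o _] := rA 0; have [b [_ /(pi0_mul_strict rA fA)[t [tb ta tu]]]] := gA o a.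
exists b; apply: (homotopic_trans (@kA 1) (mulop_cmp tb ta tu)); exact: mulop_unit.
Qed.

(** Left inverses suffice: if b inverts a and c inverts b, both from the left, then a is homotopic
    to cba, hence to c, and so ab to cb. *)
Lemma mulop_hequiv a : hequiv (mulop a).
Proof.
have [b ba] := mulop_left_inverse a; have [c cb] := mulop_left_inverse b.
exists (mulop b); split=> //.
have ca : homotopic (mulop a) (mulop c).
  rewrite -[mulop c]cmpm1.
  apply: (homotopic_trans (@kA 1) _ (homotopic_post (mulop c) ba)).
  rewrite cmpA -[X in homotopic X _]cmp1m; apply: homotopic_pre.
  exact: homotopic_sym (@kA 1) cb.
exact: (homotopic_trans (@kA 1) (homotopic_pre (mulop b) ca) cb).
Qed.

(** A Kan fibration as a base change of the shear map, and a weak equivalence because [mulop a] is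
    one and [lsec a] is a section of a trivial fibration. *)
Lemma lmul_tfib a : tfib (lmul a).
Proof.
have pb : is_pullback (pairS A.[e01] A.[e02]) (lmul a) (star_incl a)
    (pairS (constS _ a) (idm (A 1))).
  split=> [k x|k x y e]; first by congr pair; apply: (svalP x).
  have e1 := congr1 fst e; have e2 := congr1 snd e.
  exists (exist _ x e1); split=> // x'' ex _; exact: sig_ext.
have kl : kan_fib (lmul a) := kan_fib_pullback pb (shear_kan_fib rA fA).
have kE := kan_fib_kan kl (@kA 1).
apply: kan_fib_tfib => //; apply: weak_eq_hequiv => //.
apply: (@weak_eq_cancel_r _ _ _ (lsec a)); last exact/hequiv_weak_eq/mulop_hequiv.
apply: (@weak_eq_cancel_l _ _ _ _ (star_last a)); first exact/tfib_weak_eq/star_last_tfib.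
by rewrite lsecP; apply: weak_eq_id.
Qed.

(** By [tfib_fibres] only fibres over vertices (a, c) matter, and such a fibre is that of [lmul a]
    over c. *)
Lemma shear_tfib : tfib (pairS A.[e01] A.[e02]).
Proof.
apply: (tfib_fibres (shear_kan_fib rA fA)) => -[a c] n G pG tG Gp.
pose H k x (e : star a k) := bd x /\ G k x (sval e).
have [|||h [hG hp]] := ext_total (G := H) (v := constS (simplex n) c) (@lmul_tfib a n).
- split=> [k l t x e [bx Ge]|k x e e' [_ Ge] [_ Ge']].
    by split; [apply: bd_closed | apply: (pm_cl pG t Ge)].
  by apply: sig_ext; apply: (pm_fun pG Ge Ge').
- move=> k x bx; have [e Ge] := tG k x bx.
  have e1 : A.[e01] k e = (A 1).[dsurj k] a := congr1 fst (Gp _ _ _ bx Ge).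
  by exists (exist _ e e1).
- by move=> k x e _ [bx Ge]; apply: (congr1 snd (Gp _ _ _ bx Ge)).
exists (star_incl a ∘ h); split=> [k x e bx Ge|k x].
- have e1 : A.[e01] k e = (A 1).[dsurj k] a := congr1 fst (Gp _ _ _ bx Ge).
  by rewrite cmpx (hG k x (exist _ e e1) bx).
- congr pair; [apply: (svalP (h k x)) | exact: hp].
Qed.

End Shear.

(** * Gluing an edge to an arbitrary vertex *)

Section OuterPairs.
Variables (A : sspace) (rA : reduced A).
Hypothesis fA : rfib (to_spt A).
Hypothesis segA : forall k, 2 <= k -> hequiv (tupleS (fun i : 'I_k => A.[spine i])).
Hypothesis shearA : hequiv (pairS A.[e01] A.[e02]).

Lemma oedge_le n (i : 'I_n.+1) : widen_ord (leqnSn n.+1) i <= (ord_max : 'I_n.+2).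
Proof. by rewrite /=; have := ltn_ord i; lia. Qed.

Definition oedge n (i : 'I_n.+1) : Delta 1 n.+1 := edge (oedge_le i).

Lemma oedgeE n (i : 'I_n.+1) s : (oedge i s : nat) = if s == ord0 then i : nat else n.+1.
Proof. by rewrite mkDeltaE /edge_fun; case: ifP. Qed.

Lemma oedge_inj n (i : 'I_n.+1) : injective (oedge i).
Proof.
move=> s t /(congr1 val) /=; rewrite !oedgeE.
by case: (ord2E s) => ->; case: (ord2E t) => -> //=; have := ltn_ord i; lia.
Qed.

Lemma oedge_meet n (i : 'I_n.+1) : meets_in_vertex (dface (ord_max : 'I_n.+2)) (oedge i).
Proof.
move=> k x y e.
have h s : (y s : nat) = 0 /\ (x s : nat) = i.
  have := congr1 val (Delta_eqE s e); rewrite /= !dcmpE dface_val oedgeE /= /bump.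
  by case: (ord2E (y s)) => -> /=; have := ltn_ord (x s); lia.
exists i, ord0; split; last by apply: const1E => s; rewrite (h s).1.
by apply: Delta_ext => s; rewrite dconstE; apply: val_inj; rewrite /= (h s).2.
Qed.

Definition outer_pair n (i : 'I_n.+1) : hom (A n.+1) (prodS (A n) (A 1)) :=
  pairS A.[dface (ord_max : 'I_n.+2)] A.[oedge i].

(** The Segal condition handles the edge from n to n+1. The triangle on i, n, n+1 exchanges it for
    the edge from i to n+1: its spine map and its shear map are both trivial fibrations. *)
Lemma outer_pair_weq n (i : 'I_n.+1) : 1 <= n -> weak_eq (outer_pair i).
Proof.
move=> n1; have := last_pair_weq segA n1; rewrite /last_pair /outer_pair.
case: (eqVneq (i : nat) n) => [iN|iN].
  suff -> : spine (ord_max : 'I_n.+1) = oedge i by [].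
  by apply: Delta_ext => s; apply: val_inj; rewrite /= spineE oedgeE iN; case: (ord2E s) => -> /=; lia.
move=> wl; have lt : i < n by have := ltn_ord i; lia.
have le : (i : nat) <= (ord_max : 'I_n.+1) by rewrite /=; lia.
pose ed : Delta 1 n := edge le.
have edE s : (ed s : nat) = if s == ord0 then i : nat else n by rewrite mkDeltaE /edge_fun; case: ifP.
pose tf (s : 'I_3) : 'I_n.+2 := inord (if (s : nat) == 0 then i : nat else n + s.-1).
have tfE s : (tf s : nat) = if (s : nat) == 0 then i : nat else n + s.-1.
  by rewrite /tf inordK //; have := ltn_ord s; case: ifP => _; lia.
have tH : {homo tf : s t / s <= t}.
  by move=> s t st; rewrite !tfE; case: (_ =P 0); case: (_ =P 0); lia.
pose tri := mkDelta tH.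
have triE s : (tri s : nat) = if (s : nat) == 0 then i : nat else n + s.-1 by rewrite mkDeltaE tfE.
have t01 : dcmp tri e01 = dcmp (dface ord_max) ed.
  apply: Delta_ext => s; apply: val_inj; rewrite /= !dcmpE triE !dface_val edE /= /bump.
  by case: (ord2E s) => -> /=; lia.
have t12 : dcmp tri e12 = spine (ord_max : 'I_n.+1).
  apply: Delta_ext => s; apply: val_inj; rewrite /= !dcmpE triE !dface_val spineE /= /bump.
  by case: (ord2E s) => -> /=; lia.
have t02 : dcmp tri e02 = oedge i.
  apply: Delta_ext => s; apply: val_inj; rewrite /= !dcmpE triE !dface_val oedgeE /= /bump.
  by case: (ord2E s) => -> /=; lia.
(* An n-simplex with a triangle glued on along the edge from i to n. Both pairs of restrictions
   factor through [f] into this space. *)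
pose E := pb sset_pb A.[ed] A.[e01].
have fN : A.[ed] ∘ A.[dface (ord_max : 'I_n.+2)] = A.[e01] ∘ A.[tri].
  by rewrite -!smapM t01.
pose f : hom (A n.+1) E := pb_map sset_pb fN.
have kA m : kan (A m) by apply: rfib_kan.
have tf2 (d : Delta 1 2) : tfib (pairS A.[e01] A.[d]) ->
    tfib (pairS (pb1 sset_pb A.[ed] A.[e01]) (A.[d] ∘ pb2 sset_pb A.[ed] A.[e01])).
  apply: (@tfib_pullback _ _ _ _ _ _ (pb2 sset_pb A.[ed] A.[e01]) (prod_map A.[ed] (idm (A 1)))).
  split=> [k x|k x [y z] e]; first by congr pair; exact: (esym (sset_eqx x (pb_sq sset_pb A.[ed] A.[e01]))).
  have e1 : A.[ed] k y = A.[e01] k x := esym (congr1 fst e).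
  exists (exist (fun p : A n k * A 2 k => A.[ed] k p.1 = A.[e01] k p.2) (y, x) e1); split=> //.
    by congr pair; apply: (congr1 snd e).
  move=> x'' ex ey; apply: sig_ext; rewrite /= -ex; have := congr1 fst ey => /= <-.
  by case: x'' {ex ey} => -[].
have s2 : tfib (pairS A.[e01] A.[e12]).
  apply: kan_fib_tfib => //; first exact: spine_pair_kan_fib.
  apply: weak_eq_hequiv => //; first exact: kan_prodS.
  have := last_pair_weq segA (leqnn 1); rewrite /last_pair edge_e12.
  by [].
have s2' : tfib (pairS A.[e01] A.[e02]).
  by apply: kan_fib_tfib => //; apply: shear_kan_fib.
have wf : weak_eq f.
  apply: (weak_eq_cancel_l (tfib_weak_eq (tf2 _ s2))).
  have -> : pairS (pb1 sset_pb A.[ed] A.[e01]) (A.[e12] ∘ pb2 sset_pb A.[ed] A.[e01]) ∘ f =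
    pairS A.[dface (ord_max : 'I_n.+2)] A.[spine (ord_max : 'I_n.+1)]; last by [].
  by apply: sset_ext => k x /=; rewrite -t12 ssmapM.
have -> : pairS A.[dface (ord_max : 'I_n.+2)] A.[oedge i] =
    pairS (pb1 sset_pb A.[ed] A.[e01]) (A.[e02] ∘ pb2 sset_pb A.[ed] A.[e01]) ∘ f.
  by apply: sset_ext => k x /=; rewrite -t02 ssmapM.
exact: weak_eq_cmp wf (tfib_weak_eq (tf2 _ s2')).
Qed.

End OuterPairs.

(** * Mapping spaces of simplicial spaces *)

Section MapSpaces.

Program Definition tensor_fst (C : sspace) (K : sset) : hom (tensor C K) C :=
  @SMor sset (tensor C K) C (fun k => mor_fst (C k) K) _.
Next Obligation. by move=> C K j k t; apply: sset_ext. Qed.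

Program Definition Mcurry (B Z : sspace) (K : sset) (f : hom (tensor B K) Z) : hom K (Map B Z) :=
  @SMor Types K (Map B Z)
    (fun k x => @cmp sspace _ _ _ f (levelwise_nt (prodF_nt (yoneda x)) B)) _.
Next Obligation.
move=> B Z K f m n t; apply: functional_extensionality_dep => x; apply: sspace_ext => k j [b s] /=.
by rewrite smapMx.
Qed.

Program Definition Muncurry (B Z : sspace) (K : sset) (g : hom K (Map B Z)) : hom (tensor B K) Z :=
  @SMor sset (tensor B K) Z (fun k => @SMor Types (tensor B K k) (Z k)
    (fun l z => (g l z.2 : hom (tensor B (simplex l)) Z) k l (z.1, did l)) _) _.
Next Obligation.
move=> B Z K g k m n t; apply: functional_extensionality_dep => -[b x] /=.
rewrite -(smNx ((g n x : hom (tensor B (simplex n)) Z) k)) smNx /=.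
by rewrite dcmp1f dcmpf1.
Qed.
Next Obligation.
move=> B Z K g j k t; apply: sset_ext => l [b x] /=.
exact: (ssNx (g l x : hom (tensor B (simplex l)) Z) t (b, did l)).
Qed.

Lemma MuncurryE (B Z : sspace) (K : sset) (g : hom K (Map B Z)) l (x : K l) k j (b : B k j) t :
  (g l x : hom (tensor B (simplex l)) Z) k j (b, t) = Muncurry g k j (b, K.[t] x).
Proof. by rewrite /= smNx /= dcmpf1. Qed.

Lemma tc_pp_swap (B K : sset) Q : tc (B := K) Q (@full K) -> forall R, sub_closed (K := B) R ->
  tc (@pp B K R (@full B) Q) (@full (prodS B K)).
Proof.
move=> t R cR; apply: (@tc_image (prodS K B) (prodS B K) (prod_swap K B)).
- by move=> k [x y] [x' y'] /= [-> ->].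
- by apply: pp_closed => //; apply: tc_cl t.
- by [].
- by [].
- by move=> k [x y] _; exists (y, x).
- apply: tc_iff (tc_pp t cR) => k [x y] //.
  by split=> [[h|[_ h]]|[h|[_ h]]]; [right | left | right | left].
Qed.

(** The transposition of [homS_pre_ext], now for simplicial spaces; the trivial cofibration has to
    be verified in each outer degree separately. *)
Lemma Map_pre_ext (A B Z : sspace) (K : sset) (i : hom A B) Q :
  (forall k l, injective (i k l)) -> sub_closed (K := K) Q -> rfib (to_spt Z) ->
  (forall k, tc (@pp (B k) K (image (i k)) (@full (B k)) Q) (@full _)) ->
  ext Q (@full K) (Map_pre (A := A) (B := B) Z i).
Proof.
move=> iI cQ fZ tP G V pG pV tG tV GV; have [v vV] := pmap_total pV (fun k x => tV k x I).
pose P k l (z : tensor B K k l) := @pp (B k) K (image (i k)) (@full (B k)) Q l z.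
pose G1 k l (z : tensor B K k l) w := exists g : Map B Z l,
  [/\ Q l z.2, G l z.2 g & w = (g : hom (tensor B (simplex l)) Z) k l (z.1, did l)].
pose G2 k l (z : tensor B K k l) w := exists2 a, i k l a = z.1 & w = Muncurry v k l (a, z.2).
have gv l x (g : Map B Z l) k j a (t : Delta j l) : Q l x -> G l x g ->
    (g : hom (tensor B (simplex l)) Z) k j (i k j a, t) = Muncurry v k j (a, K.[t] x).
  by move=> Qx Gx; rewrite -MuncurryE -(GV l x g (v l x) Qx Gx (vV l x)).
have pR : spmap (fun k l z w => G1 k l z w \/ G2 k l z w).
  split=> [k|j k t l [b x] w [[g [Qx Gx ->]]|[a /= <- ->]]].
  - apply: pmap_union.
    + split=> [l m t [b x] w [g [Qx Gx ->]]|l [b x] w w' [g [Qx Gx ->]] [g' [_ Gx' ->]]].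
        exists ((Map B Z).[t] g); split; [exact: cQ | exact: (pm_cl pG) |].
        by have := smNx ((g : hom (tensor B (simplex l)) Z) k) t (b, did l);
          rewrite /= dcmp1f dcmpf1 => ->.
      by rewrite (pm_fun pG Gx Gx').
    + split=> [l m t [b x] w [a /= <- ->]|l [b x] w w' [a /= <- ->] [a' /= /iI -> ->]] //.
      by exists ((A k).[t] a); [exact: smNx | exact: esym (smNx (Muncurry v k) t (a, x))].
    + move=> l [b x] w w' [g [Qx Gx ->]] [a /= <- ->].
      by rewrite (gv l x g k l a (did l) Qx Gx) smap1x.
  - left; exists g; split=> //.
    exact: esym (ssNx (g : hom (tensor B (simplex l)) Z) t (b, did l)).
  - right; exists (A.[t] l a); first exact: ssNx.
    exact: esym (ssNx (Muncurry v) t (a, x)).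
have cP : scl P.
  split=> [k|j k t l [b x] [[a ab]|[_ Qx]]]; last by right.
    by apply: pp_closed => //; apply: image_closed.
  by left; exists (A.[t] l a); rewrite ssNx ab.
have [||h [hR _]] := fZ (tensor B K) P _ (to_spt _) cP tP pR.
- move=> k l [b x] [[a ab]|[_ Qx]]; first by exists (Muncurry v k l (a, x)); right; exists a.
  have [g Gx] := tG _ _ Qx.
  by exists ((g : hom (tensor B (simplex l)) Z) k l (b, did l)); left; exists g.
- by [].
exists (graph (Mcurry h)); split.
- exact: graph_pmap.
- by move=> l x _; exists (Mcurry h l x).
- move=> l x g Qx Gx; apply: sspace_ext => k j [b t]; apply: esym; apply: hR.
    by right; split=> //; apply: cQ.
  left; exists ((Map B Z).[t] g); split; [exact: cQ | exact: (pm_cl pG) |].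
  by rewrite /= dcmpf1.
- move=> l x g y _ -> Vy; rewrite (pm_fun pV Vy (vV l x)).
  apply: sspace_ext => k j [a t]; rewrite [RHS]MuncurryE.
  apply: (hR k j (i k j a, K.[t] x)); first by left; exists a.
  by right; exists a.
Qed.

Lemma Map_pre_kan_fib (A B Z : sspace) (i : hom A B) : (forall k l, injective (i k l)) ->
  rfib (to_spt Z) -> kan_fib (Map_pre (A := A) (B := B) Z i).
Proof.
move=> iI fZ; apply: kan_fibI => n c; apply: Map_pre_ext => //; first exact: horn_closed.
by move=> k; apply: tc_pp_swap; [apply: tc_horn | apply: image_closed].
Qed.

Lemma Map_pre_tfib (A B Z : sspace) (i : hom A B) : (forall k l, injective (i k l)) ->
  (forall k, tc (image (i k)) (@full (B k))) ->
  rfib (to_spt Z) -> tfib (Map_pre (A := A) (B := B) Z i).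
Proof.
move=> iI ti fZ n; apply: Map_pre_ext => //; first exact: bd_closed.
by move=> k; apply: (tc_pp (ti k) (@bd_closed n)).
Qed.

(** Restriction to the empty simplicial space is a Kan fibration, and maps out of the empty one form
    a point. *)
Lemma Map_kan (A Z : sspace) : rfib (to_spt Z) -> kan (Map A Z).
Proof.
move=> fZ; have c0 : scl (fun k l (x : A k l) => False) by split=> [k l m t x|].
pose i := subSS_incl c0.
have ki : kan_fib (Map_pre (A := subSS c0) (B := A) Z i).
  by apply: Map_pre_kan_fib => // k l x y; apply: sig_ext.
apply: kan_fib_kan ki _; apply: kan_fibI => n c; apply: ext_pt => G pG tG.
have em m (f g : Map (subSS c0) Z m) : f = g by apply: sspace_ext => k l [[]].
have [||h _] := @pmap_total (simplex n.+1) (Map (subSS c0) Z) (fun _ _ _ => True).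
- by split=> // k x y z _ _; apply: em.
- move=> k x; have [||g _] := @spmap_total (tensor (subSS c0) (simplex k)) Z (fun _ _ _ _ => False).
  + by split=> // j; split.
  + by move=> j l [[y []]].
  + by exists g.
exists (graph h); split; [exact: graph_pmap | by move=> k x _; exists (h k x) |].
by move=> k x g _ _; apply: em.
Qed.

End MapSpaces.

(** * Maps out of a reduction *)

Section Reduction.
Variables (A Z : sspace) (rZ : reduced Z).

Program Definition red_unit : hom A (red_obj A) :=
  @SMor sset A (red_obj A) (fun k => @SMor Types (A k) (red_obj A k)
    (fun l x => cls A.[dsurj k] (Some x)) _) _.
Next Obligation.
move=> k m n t; apply: functional_extensionality_dep => x /=.
by rewrite collapse_funE.
Qed.
Next Obligation.
move=> j k t; apply: sset_ext => l x /=; by rewrite collapse_funE.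
Qed.

Lemma red_none k j (c : red_obj A k j) : c = cls A.[dsurj k] None \/ exists x, c = red_unit k j x.
Proof. by have [[x|] ->] := cls_surj c; [right; exists x | left]. Qed.

Lemma red_none_act j k (t : Delta j k) l :
  (red_obj A).[t] l (cls A.[dsurj k] None) = cls A.[dsurj j] None.
Proof. exact: collapse_funE. Qed.

Lemma red_none_in k j l (t : Delta j l) :
  (red_obj A k).[t] (cls A.[dsurj k] (k := l) None) = cls A.[dsurj k] None.
Proof. exact: collapse_funE. Qed.

Lemma Map_red_inj l (u u' : Map (red_obj A) Z l) :
  Map_pre (A := A) (B := red_obj A) Z red_unit l u = Map_pre (A := A) (B := red_obj A) Z red_unit l u' -> u = u'.
Proof.
move=> e; apply: sspace_ext => k j [c y].
case: (red_none c) => [->|[x ->]].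
  rewrite -(red_none_act (dsurj k)).
  rewrite -[LHS]/((u : hom (tensor (red_obj A) (simplex l)) Z) k j ((tensor (red_obj A) (simplex l)).[dsurj k] j (cls A.[dsurj 0] None, y))).
  rewrite -[RHS]/((u' : hom (tensor (red_obj A) (simplex l)) Z) k j ((tensor (red_obj A) (simplex l)).[dsurj k] j (cls A.[dsurj 0] None, y))).
  rewrite !ssNx; congr (Z.[_] j _); exact: reduced_eq.
exact: (congr1 (fun g : hom (tensor A (simplex l)) Z => g k j (x, y)) e).
Qed.

(** The collapsed point can only go to the base point of [Z]; simplices from degree 0 of [A] go
    there already, because degree 0 of [Z] is a point. So [w] descends to the quotient. *)
Lemma Map_red_surj l (w : Map A Z l) :
  exists u, Map_pre (A := A) (B := red_obj A) Z red_unit l u = w.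
Proof.
pose w' : hom (tensor A (simplex l)) Z := w.
have [o _] := rZ 0.
pose base k j : Z k j := (Z k).[dsurj j] (Z.[dsurj k] 0 o).
pose R k j (z : tensor (red_obj A) (simplex l) k j) v :=
  (exists2 x, z.1 = red_unit k j x & v = w' k j (x, z.2)) \/
  (z.1 = cls A.[dsurj k] None /\ v = base k j).
have baseE k j (a : Z 0 j) : Z.[dsurj k] j a = base k j.
  by rewrite /base -smNx; congr (Z.[_] j _); apply: reduced_eq.
have inb k j x y : in_base A.[dsurj k] (Some x) -> w' k j (x, y) = base k j.
  case=> x0 <-; rewrite -[(_, y)]/((tensor A (simplex l)).[dsurj k] j (x0, y)) ssNx.
  exact: baseE.
have fR k j (c : red_obj A k j) y v v' : R k j (c, y) v -> R k j (c, y) v' -> v = v'.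
  case=> [[x /= -> ->]|[/= -> ->]] [[x' /= e ->]|[/= e ->]] //.
  - by move/eq_cls: e => [[->] //|[h h']]; rewrite !inb.
  - by move/eq_cls: e => [//|[h h']]; rewrite inb.
  - by move/eq_cls: e => [//|[h h']]; rewrite inb.
have [||u uR] := @spmap_total (tensor (red_obj A) (simplex l)) Z R.
- split=> [k|i k t j [c y] v [[x /= -> ->]|[/= -> ->]]].
  + split=> [j m t [c y] v [[x /= -> ->]|[/= -> ->]]|j [c y] v v'].
    * by left; exists ((A k).[t] x); [exact: esym (smNx (red_unit k) t x) | rewrite -smNx].
    * by right; split; [exact: red_none_in | rewrite /base -smapMx dsurj_cmp].
    * exact: fR.
  + left; exists (A.[t] j x); first exact: esym (ssNx red_unit t x).
    exact: esym (ssNx w' t (x, y)).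
  + right; split; first exact: red_none_act.
    rewrite /base smNx; congr ((Z i).[_] _).
    by rewrite -ssmapM dsurj_cmp.
- move=> k j [c y]; case: (red_none c) => [->|[x ->]].
    by exists (base k j); right.
  by exists (w' k j (x, y)); left; exists x.
exists u; apply: sspace_ext => k j [x y].
by apply: fR (uR k j (red_unit k j x, y)) _; left; exists x.
Qed.

Lemma Map_red_weq : weak_eq (Map_pre (A := A) (B := red_obj A) Z red_unit).
Proof.
by apply/hequiv_weak_eq/hequiv_bij => l; [apply: Map_red_inj | apply: Map_red_surj].
Qed.

End Reduction.

(** * Local objects *)

Section SegLocal.

Program Definition Map_ev (K : sset) (Z : sspace) m (x : K m) : hom (Map (disc K) Z) (Z m) :=
  @SMor Types (Map (disc K) Z) (Z m)
    (fun l u => (u : hom (tensor (disc K) (simplex l)) Z) m l (x, did l)) _.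
Next Obligation.
move=> K Z m x i j t; apply: functional_extensionality_dep => u /=.
have := smNx ((u : hom (tensor (disc K) (simplex j)) Z) m) t (x, did j).
by rewrite /= dcmp1f dcmpf1.
Qed.

Lemma Map_evE (K : sset) (Z : sspace) m (x : K m) l (u : Map (disc K) Z l) k (s : Delta k m) j (y : Delta j l) :
  (u : hom (tensor (disc K) (simplex l)) Z) k j (K.[s] x, y) =
  Z.[s] j ((Z m).[y] (Map_ev Z x l u)).
Proof.
have := smNx ((u : hom (tensor (disc K) (simplex l)) Z) m) y (x, did l).
rewrite /= dcmp1f => <-.
exact: (ssNx (u : hom (tensor (disc K) (simplex l)) Z) s (x, y)).
Qed.

Lemma Map_simplex_weq n (Z : sspace) : weak_eq (Map_ev (K := simplex n) Z (did n)).
Proof.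
apply/hequiv_weak_eq/hequiv_bij => l.
- move=> u u' e; apply: sspace_ext => k j [x y].
  have xE : x = (simplex n).[x : Delta k n] (did n) by rewrite /= dcmp1f.
  by rewrite xE !Map_evE e.
- move=> z; have [||u uE] := @spmap_total (tensor (disc (simplex n)) (simplex l)) Z
    (fun k j v w => w = Z.[v.1 : Delta k n] j ((Z n).[v.2] z)).
  + split=> [k|i k t j [x y] w ->]; last by rewrite -ssmapM.
    split=> [j m t [x y] w ->|j [x y] w w' -> ->] //.
    by rewrite -smNx -smapMx.
  + by move=> k j [x y]; eexists.
  exists u; rewrite /= uE /=; by rewrite ssmap1 smap1x.
Qed.

(** The two faces forming the source of [fni i] meet in a single vertex. Into a reduced [Z] this
    imposes no condition, so a map is an arbitrary pair of values, one on each face. *)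
Lemma Map_ext_weq n (i : 'I_n.+1) (Z : sspace) (rZ : reduced Z)
    (fc : in_ext i (dface (ord_max : 'I_n.+2))) (oe : in_ext i (oedge i)) :
  weak_eq (pairS (Map_ev (K := subS (@ext_closed n i)) Z (exist _ _ fc))
                 (Map_ev (K := subS (@ext_closed n i)) Z (exist _ _ oe))).
Proof.
set K := subS (@ext_closed n i).
set f : K n := exist _ _ fc; set g : K 1 := exist _ _ oe.
have cov k (x : K k) : (exists s : Delta k n, x = K.[s] f) \/ (exists s : Delta k 1, x = K.[s] g).
  case: x => x [h|h].
    left; exists (dcmp (dretr ord_max) x); apply: sig_ext; apply: miss_factor => s.
    by apply/eqP => e; have := h s; rewrite e /= ltnn.
  right; pose y s : 'I_2 := if (dfun x s : nat) == n.+1 then ord_max else ord0.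
  have yH : {homo y : s t / s <= t}.
    move=> s t st; rewrite /y; case: eqP => // es; case: eqP => // et.
    by have := Delta_homo (x : Delta _ _) st; have := ltn_ord (dfun x t); lia.
  exists (mkDelta yH); apply: sig_ext; apply: Delta_ext => s; apply: val_inj.
  rewrite /= dcmpE oedgeE mkDeltaE /y.
  by case: ((dfun x s : nat) =P n.+1) => [->|ne] //=; case: (h s) => // e; case: ne.
apply/hequiv_weak_eq/hequiv_bij => l.
- move=> u u' e; have e1 := congr1 fst e; have e2 := congr1 snd e.
  apply: sspace_ext => k j [x y]; case: (cov k x) => -[s ->]; rewrite !Map_evE.
    by congr (Z.[s] j ((Z n).[y] _)).
  by congr (Z.[s] j ((Z 1).[y] _)).
- move=> [z w].
  pose R k j (v : tensor (disc K) (simplex l) k j) r :=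
    (exists2 s : Delta k n, v.1 = K.[s] f & r = Z.[s] j ((Z n).[v.2] z)) \/
    (exists2 s : Delta k 1, v.1 = K.[s] g & r = Z.[s] j ((Z 1).[v.2] w)).
  have fR k j v r r' : R k j v r -> R k j v r' -> r = r'.
    move=> [[s e ->]|[s e ->]] [[s' e' ->]|[s' e' ->]]; rewrite e in e';
      move/(congr1 sval): e' => e'; rewrite /= in e'.
    + by rewrite (dcmp_inj (@dface_inj _ _) e').
    + have [a [b [-> ->]]] := oedge_meet e'; exact: reduced_const.
    + have [a [b [-> ->]]] := oedge_meet (esym e'); exact: reduced_const.
    + by rewrite (dcmp_inj (@oedge_inj _ _) e').
  have [||u uR] := @spmap_total (tensor (disc K) (simplex l)) Z R.
  + split=> [k|a k t j [x y] r [[s /= -> ->]|[s /= -> ->]]].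
    * split=> [j m t [x y] r [[s /= -> ->]|[s /= -> ->]]|j v r r'].
      -- by left; exists s => //; rewrite -smNx -smapMx.
      -- by right; exists s => //; rewrite -smNx -smapMx.
      -- exact: fR.
    * by left; exists (dcmp s t); [rewrite smapMx | rewrite ssmapM].
    * by right; exists (dcmp s t); [rewrite smapMx | rewrite ssmapM].
  + move=> k j [x y]; case: (cov k x) => -[s ->].
      by exists (Z.[s] j ((Z n).[y] z)); left; exists s.
    by exists (Z.[s] j ((Z 1).[y] w)); right; exists s.
  exists u; congr pair; apply: fR (uR _ _ _) _.
  + by left; exists (did n); rewrite ?smap1x // ssmap1.
  + by right; exists (did 1); rewrite ?smap1x // ssmap1.
Qed.

Lemma Map_pre_cmp (A B C Z : sspace) (f : hom A B) (g : hom B C) :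
  Map_pre (A := A) (B := C) Z (g ∘ f) = Map_pre (A := A) (B := B) Z f ∘ Map_pre (A := B) (B := C) Z g.
Proof. by apply: sset_ext => l u; apply: sspace_ext => k j [x y]. Qed.

(** After undoing the reduction by [Map_red_weq] and evaluating at the generating simplices,
    restriction along the reduced [fni i] becomes [outer_pair i]. *)
Lemma segal_seg_local (Z : rsspace) :
  rfib (to_spt (incl Z)) ->
  (forall k, 2 <= k -> hequiv (tupleS (fun i : 'I_k => (incl Z).[spine i]))) ->
  hequiv (pairS (incl Z).[e01] (incl Z).[e02]) -> seg_local Z.
Proof.
move=> fZ sZ hZ; split.
  exists rpt, (to_spt (incl Z)); split; first exact: rpt_terminal.
  exact: rfib_fib_reedy.
move=> n i n1; have rZ : reduced (incl Z) := svalP Z.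
pose E := disc (subS (@ext_closed n i)); pose D := disc (simplex n.+1).
have fc : in_ext i (dface (ord_max : 'I_n.+2)).
  by left=> s; rewrite dface_val /= /bump; have := ltn_ord s; lia.
have oe : in_ext i (oedge i).
  by right=> s; rewrite oedgeE; case: eqP => _; [left | right].
have sq : Map_pre (A := E) (B := red_obj E) (incl Z) (red_unit E) ∘
    Map_pre (A := red_obj E) (B := red_obj D) (incl Z) (red_map (fni i)) =
    Map_pre (A := E) (B := D) (incl Z) (fni i) ∘ Map_pre (A := D) (B := red_obj D) (incl Z) (red_unit D).
  rewrite -!Map_pre_cmp; congr (Map_pre _ _); apply: sspace_ext => k l x.
  exact: collapse_funE.
apply: (weak_eq_cancel_l (Map_red_weq E rZ)).
rewrite sq; apply: (weak_eq_cmp (Map_red_weq D rZ)).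
apply: (weak_eq_cancel_l (Map_ext_weq rZ fc oe)).
have -> : pairS (Map_ev (K := subS (@ext_closed n i)) (incl Z) (exist _ _ fc))
    (Map_ev (K := subS (@ext_closed n i)) (incl Z) (exist _ _ oe)) ∘
    Map_pre (A := E) (B := D) (incl Z) (fni i) =
  outer_pair (incl Z) i ∘ Map_ev (K := simplex n.+1) (incl Z) (did n.+1).
  apply: sset_ext => l u; congr pair.
  - have := @Map_evE (simplex n.+1) (incl Z) n.+1 (did n.+1) l u n (dface ord_max) l (did l).
    by rewrite /= smap1x => <-; rewrite dcmp1f.
  - have := @Map_evE (simplex n.+1) (incl Z) n.+1 (did n.+1) l u 1 (oedge i) l (did l).
    by rewrite /= smap1x => <-; rewrite dcmp1f.
by apply: weak_eq_cmp; [apply: Map_simplex_weq | apply: outer_pair_weq].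
Qed.

Lemma tfib_surj (X Y : sset) (p : hom X Y) (y : Y 0) : tfib p -> exists x, p 0 x = y.
Proof.
move=> /tfib_section[s ps]; exists (s 0 y); exact: (sset_eqx y ps).
Qed.

Lemma seg_local_tfib (A B Z : rsspace) (i : hom A B) : (forall k l, injective (incl_map i k l)) ->
  seg_eq i -> seg_local Z -> tfib (Map_pre (A := incl A) (B := incl B) (incl Z) (incl_map i)).
Proof.
move=> iI wi lZ; have fZ := fibrant_reduced_rfib (proj1 lZ).
apply: kan_fib_tfib; [exact: Map_kan | exact: Map_pre_kan_fib |].
by apply: weak_eq_hequiv; [apply: Map_kan.. | apply: wi].
Qed.

(* A Reedy fibration between local objects is a fibration of the localization:
   extend over the total space, then correct with a homotopy relative to A. *)
Lemma seg_local_fib (Z W : rsspace) (q : hom Z W) : seg_local Z -> seg_local W ->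
  rfib (incl_map q) -> fib seg q.
Proof.
move=> lZ lW fq A B i ci wi u v uv.
have iI k l : injective (incl_map i k l) by apply: ci.
pose u' : hom (incl A) (incl Z) := u; pose v' : hom (incl B) (incl W) := v.
pose i' : hom (incl A) (incl B) := i; pose q' : hom (incl Z) (incl W) := q.
have uvE k l a : q' k l (u' k l a) = v' k l (i' k l a) by apply: (@sspace_eqx _ _ _ _ k l a uv).
have tZ := seg_local_tfib iI wi lZ; have tW := seg_local_tfib iI wi lW.
(* An extension of [u] over [B] that ignores [v]. *)
have [w wE] := @tfib_surj _ _ _ (u' ∘ tensor_fst (incl A) (simplex 0) : Map (incl A) (incl Z) 0) tZ.
pose w0 k l (b : incl B k l) := (w : hom (tensor (incl B) (simplex 0)) (incl Z)) k l (b, dsurj l).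
have w0i k l a : w0 k l (i' k l a) = u' k l a.
  exact: (congr1 (fun g : hom (tensor (incl A) (simplex 0)) (incl Z) => g k l (a, dsurj l)) wE).
have w0in k l j (t : Delta j l) b : (incl Z k).[t] (w0 k l b) = w0 k j ((incl B k).[t] b).
  by rewrite /w0 -smNx /= dsurj_cmp.
have w0out j k (t : Delta j k) l b : (incl Z).[t] l (w0 k l b) = w0 j l ((incl B).[t] l b).
  by rewrite /w0 -(ssNx (w : hom (tensor (incl B) (simplex 0)) (incl Z))).
have [||w1 w1E] := @spmap_total (incl B) (incl Z) (fun k l b z => z = w0 k l b).
- split=> [k|j k t l b x ->]; last exact: w0out.
  by split=> [l m t b x ->|l b x y -> ->]; first exact: w0in.
- by move=> k l b; exists (w0 k l b).
pose g0 : Map (incl B) (incl W) 0 := q' ∘ w1 ∘ tensor_fst (incl B) (simplex 0).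
pose g1 : Map (incl B) (incl W) 0 := v' ∘ tensor_fst (incl B) (simplex 0).
pose M := Map (incl B) (incl W).
(* The composite [q' ∘ w1] and [v'] agree on [A]. Lifting the constant homotopy there, with both
   ends prescribed, joins them by a homotopy constant on [A]. *)
pose G k (t : simplex 1 k) (g : M k) :=
  (dend ord0 t /\ g = M.[dsurj k] g0) \/ (dend ord_max t /\ g = M.[dsurj k] g1).
have [|||H [HG Hv]] := ext_total (G := G)
  (v := Mcurry (K := simplex 1) (q' ∘ u' ∘ tensor_fst (incl A) (simplex 1))) (tW 1).
- apply: pmap_union; last by move=> k t x y [h _] [h' _]; case: (dend_neq h h').
  + split=> [k l s t g [h ->]|k t g g' [_ ->] [_ ->]] //.
    by split; [apply: dend_closed | rewrite -smapMx dsurj_cmp].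
  + split=> [k l s t g [h ->]|k t g g' [_ ->] [_ ->]] //.
    by split; [apply: dend_closed | rewrite -smapMx dsurj_cmp].
- move=> k t [j jt]; case: (ord2E j) => ej; rewrite ej in jt.
    exists (M.[dsurj k] g1); right; split=> // s.
    by case: (ord2E (dfun t s)) => // e; have := jt s; rewrite e.
  exists (M.[dsurj k] g0); left; split=> // s.
  by case: (ord2E (dfun t s)) => // e; have := jt s; rewrite e.
- move=> k t g _ [[h ->]|[h ->]]; apply: sspace_ext => a l [b s] /=.
  + by rewrite w1E w0i.
  + by rewrite -uvE.
pose HH := Muncurry H.
have bdc k (e : 'I_2) : @bd 1 k (dconst k e).
  by exists (rev_ord e) => s; rewrite dconstE; case: (ord2E e) => ->.
have HH0 k l b : HH k l (b, dconst l ord0) = q' k l (w1 k l b).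
  have e : H l (dconst l ord0) = M.[dsurj l] g0 by apply: HG => //; left; split=> //; apply/dendP.
  by rewrite /= e.
have HH1 k l b : HH k l (b, dconst l ord_max) = v' k l b.
  have e : H l (dconst l ord_max) = M.[dsurj l] g1 by apply: HG => //; right; split=> //; apply/dendP.
  by rewrite /= e.
have HHi k l a t : HH k l (i' k l a, t) = q' k l (u' k l a).
  exact: (congr1 (fun g : hom (tensor (incl A) (simplex l)) (incl W) => g k l (a, did l)) (Hv l t)).
pose T := tensor (incl B) (simplex 1).
pose P k l (z : T k l) := @pp (incl B k) (simplex 1) (image (i' k)) (@full _) (@dend ord0) l z.
(* Reedy lifting of this homotopy from its start [w1], constant on [A]; its other end [r] is the
   solution. *)
pose G2 k l (z : T k l) x := (exists2 a, i' k l a = z.1 & x = u' k l a) \/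
   (dend ord0 z.2 /\ x = w1 k l z.1).
have cP : scl P.
  split=> [k|j k t l [b x] [[a ab]|[_ h]]]; last by right.
    by apply: pp_closed => //; [apply: image_closed | apply: dend_closed].
  by left; exists ((incl A).[t] l a); rewrite ssNx ab.
have tP k : tc (P k) (@full (T k)).
  exact: (@tc_end (incl B k) (image (i' k)) (@full _) ord0 (@image_closed _ _ (i' k)) (@full_closed _) (fun _ _ _ => I)).
have [|||F [FG Fq]] := fq T P G2 HH cP tP.
- split=> [k|j k t l [b x] y [[a /= <- ->]|[h ->]]].
  + apply: pmap_union.
    * split=> [l m t [b x] y [a /= <- ->]|l [b x] y y' [a /= <- ->] [a' /= /iI -> ->]] //.
      by exists ((incl A k).[t] a); rewrite ?smNx.
    * apply: (pmap_restrict (pmap_pre (mor_fst (incl B k) (simplex 1)) (graph_pmap (w1 k)))).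
      by move=> l m t z; apply: dend_closed.
    * by move=> l [b x] y y' [a /= <- ->] [_ /= ->]; rewrite w1E w0i.
  + by left; exists ((incl A).[t] l a); rewrite ?ssNx.
  + by right; split=> //=; rewrite ssNx.
- move=> k l [b x] [[a ab]|[_ h]]; first by exists (u' k l a); left; exists a.
  by exists (w1 k l b); right.
- move=> k l [b x] y _ [[a ab ->]|[/dendP h ->]]; first by rewrite /= in ab; rewrite -ab HHi.
  by rewrite /= in h; rewrite h HH0.
have [||r rE] := @spmap_total (incl B) (incl Z) (fun k l b z => z = F k l (b, dconst l ord_max)).
- split=> [k|j k t l b x ->]; last by rewrite -ssNx.
  by split=> [l m t b x ->|l b x y -> ->] //; rewrite -smNx /= dconst_cmp.
- by move=> k l b; eexists.
exists r; split; apply: sspace_ext => k l b.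
- rewrite [LHS]rE; apply: FG; first by left; exists b.
  by left; exists b.
- by rewrite [LHS](congr1 (q' k l) (rE k l b)) [LHS]Fq HH1.
Qed.

End SegLocal.

(** * Degreewise equivalences *)

Section LevelEquivalences.

Program Definition prodSS (X Y : sspace) : sspace :=
  @Simplicial sset (fun k => prodS (X k) (Y k)) (fun j k t => prod_map X.[t] Y.[t]) _ _.
Next Obligation. by move=> X Y k; apply: sset_ext => l [x y] /=; rewrite !ssmap1. Qed.
Next Obligation. by move=> X Y i j k g f; apply: sset_ext => l [x y] /=; rewrite !ssmapM. Qed.

Program Definition ss_fst (X Y : sspace) : hom (prodSS X Y) X :=
  @SMor sset (prodSS X Y) X (fun k => mor_fst (X k) (Y k)) _.
Next Obligation. by move=> X Y j k t; apply: sset_ext. Qed.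

Program Definition ss_pair (W X Y : sspace) (f : hom W X) (g : hom W Y) : hom W (prodSS X Y) :=
  @SMor sset W (prodSS X Y) (fun k => pairS (f k) (g k)) _.
Next Obligation. by move=> W X Y f g j k t; apply: sset_ext => l x /=; rewrite !ssNx. Qed.

(* A contractible simplicial space containing A: bisimplicial functions into the
   pointed sets of simplices of A. *)
Program Definition hull (A : sspace) : sspace :=
  @Simplicial sset (fun k => @Simplicial Types
      (fun l => forall m n, Delta m k -> Delta n l -> option (A m n))
      (fun j l t e m n s u => e m n s (dcmp t u)) _ _)
    (fun j k t => @SMor Types _ _ (fun l e m n s u => e m n (dcmp t s) u) _) _ _.
Next Obligation.
move=> A k n; apply: functional_extensionality_dep => e.
by do 4![apply: functional_extensionality_dep => ?]; rewrite dcmp1f.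
Qed.
Next Obligation.
move=> A k l m n g f; apply: functional_extensionality_dep => e.
by do 4![apply: functional_extensionality_dep => ?]; rewrite /= dcmpA.
Qed.
Next Obligation. by []. Qed.
Next Obligation.
move=> A k; apply: sset_ext => l e.
by do 4![apply: functional_extensionality_dep => ?]; rewrite /= dcmp1f.
Qed.
Next Obligation.
move=> A i j k g f; apply: sset_ext => l e.
by do 4![apply: functional_extensionality_dep => ?]; rewrite /= dcmpA.
Qed.

(** A map into the hull is a family of values without any naturality constraint, so undefined values
    are simply set to [None]. *)
Lemma hull_tfib (A : sspace) k : tfib (to_pt (hull A k)).
Proof.
move=> n; apply: ext_pt => G pG tG.
pose h l (x : simplex n l) : hull A k l := fun m i s u =>
  if pselect (exists e, G i (dcmp x u) e) is left ex then projT1 (cid ex) m i s (did i) else None.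
have hE l (x : simplex n l) m i s (u : Delta i l) e : G i (dcmp x u) e -> h l x m i s u = e m i s (did i).
  rewrite /h => Ge; case: pselect => [ex|[]]; last by exists e.
  by case: cid => e' /= Ge'; rewrite (pm_fun pG Ge Ge').
have hN j l (t : Delta j l) : (fun x => h j ((simplex n).[t] x)) = (fun x => (hull A k).[t] (h l x)).
  apply: functional_extensionality_dep => x; do 4![apply: functional_extensionality_dep => ?].
  by rewrite /h /= dcmpA.
exists (graph (@SMor Types (simplex n) (hull A k) h hN)); split.
- exact: graph_pmap.
- by move=> l x _; exists (h l x).
- move=> l x e bx Ge; do 4![apply: functional_extensionality_dep => ?].
  rewrite /= (hE _ _ _ _ _ _ _ (pm_cl pG _ Ge)) /=.
  by rewrite dcmpf1.
Qed.

Program Definition hull_map (A : sspace) : hom A (hull A) :=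
  @SMor sset A (hull A) (fun k => @SMor Types (A k) (hull A k)
     (fun l a m n s u => Some (A.[s] n ((A k).[u] a))) _) _.
Next Obligation.
move=> A k j l t; apply: functional_extensionality_dep => a.
by do 4![apply: functional_extensionality_dep => ?]; rewrite /= smapMx.
Qed.
Next Obligation.
move=> A j k t; apply: sset_ext => l a.
do 4![apply: functional_extensionality_dep => ?]; congr Some; rewrite /= ssmapM.
by congr (A.[_] _ _); apply: esym; apply: (smNx A.[t]).
Qed.

Lemma hull_map_inj (A : sspace) k l : injective (hull_map A k l).
Proof.
move=> a b /(congr1 (fun e : hull A k l => e k l (did k) (did l))) /= [].
by rewrite !ssmap1 !smap1x.
Qed.

Program Definition hull_point (A B : sspace) : hom B (hull A) :=
  @SMor sset B (hull A) (fun k => @SMor Types (B k) (hull A k) (fun l _ _ _ _ _ => None) _) _.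
Next Obligation. by []. Qed.
Next Obligation. by move=> A B j k t; apply: sset_ext. Qed.

(* Ken Brown's lemma: Phi inverts all levelwise weak equivalences as soon as it
   inverts the monomorphisms among them. *)
Lemma level_weq_ind (Phi : forall X Y : sspace, hom X Y -> Prop) :
  (forall (X Y : sspace) (i : hom X Y), (forall k l, injective (i k l)) ->
     (forall k, tc (image (i k)) (@full (Y k))) -> Phi X Y i) ->
  (forall (X Y W : sspace) (f : hom X Y) (g : hom Y W), Phi _ _ f -> Phi _ _ g -> Phi _ _ (g ∘ f)) ->
  (forall (X Y : sspace) (f : hom X Y) (g : hom Y X), f ∘ g = idm Y -> Phi _ _ g -> Phi _ _ f) ->
  forall (A B : sspace) (f : hom A B), (forall k, weak_eq (f k)) -> Phi A B f.
Proof.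
move=> Pm Pc Pr A B f wf; pose E := hull A.
have fst_weq k : weak_eq (ss_fst B E k).
  apply: tfib_weak_eq; apply: (@tfib_pullback _ _ _ _ (to_pt (E k)) _
    (mor_snd (B k) (E k)) (to_pt (B k))); last exact: hull_tfib.
  by split=> // l e b _; exists (b, e); split=> // -[b' e'] /= -> ->.
(* [f] is the projection after the monomorphism [i], and the projection has the monic section [s];
   [i] and [s] are levelwise weak equivalences together with the projection. *)
pose i := ss_pair f (hull_map A); pose s := ss_pair (idm B) (hull_point A B).
have -> : f = ss_fst B E ∘ i by apply: sspace_ext.
apply: Pc.
  have iI k l : injective (i k l) by move=> a b /(congr1 snd) /= /hull_map_inj.
  apply: Pm => // k; apply: weak_eq_tc => //.
  apply: (weak_eq_cancel_l (fst_weq k)); have -> : ss_fst B E k ∘ i k = f k by apply: sset_ext.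
  exact: wf.
apply: (Pr _ _ _ s); first exact: sspace_ext.
have sI k l : injective (s k l) by move=> a b /(congr1 fst).
apply: Pm => // k; apply: weak_eq_tc => //.
apply: (weak_eq_cancel_l (fst_weq k)); have -> : ss_fst B E k ∘ s k = idm (B k) by apply: sset_ext.
exact: weak_eq_id.
Qed.

Lemma Map_pre_id (A Z : sspace) : Map_pre (A := A) (B := A) Z (idm A) = idm (Map A Z).
Proof. by apply: sset_ext => l u; apply: sspace_ext => k j [x y]. Qed.

Lemma Map_pre_weq (A B Z : sspace) (f : hom A B) : rfib (to_spt Z) ->
  (forall k, weak_eq (f k)) -> weak_eq (Map_pre (A := A) (B := B) Z f).
Proof.
move=> fZ; apply: (@level_weq_ind (fun (X Y : sspace) (g : hom X Y) => weak_eq (Map_pre (A := X) (B := Y) Z g))).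
- by move=> X Y i iI ti; apply: tfib_weak_eq; apply: Map_pre_tfib.
- by move=> X Y W g h wg wh; rewrite Map_pre_cmp; apply: weak_eq_cmp.
- move=> X Y g h gh wh; apply: (weak_eq_cancel_l wh).
  by rewrite -Map_pre_cmp gh Map_pre_id; apply: weak_eq_id.
Qed.

End LevelEquivalences.

(** * Latching objects and the skeletal filtration of the diagonal *)

Section Latching.

Lemma tc_refl (B : sset) P : sub_closed (K := B) P -> tc P P.
Proof.
move=> cP; split=> // Z kZ n; apply: ext_pt => G pG tG.
exists G; split=> // k b Pb; apply: tG; by left.
Qed.

Lemma noninj_factor k n (x : Delta k.+1 n) : ~ injective x ->
  exists (j : 'I_k.+1) (y : Delta k n), x = dcmp y (ddeg j).
Proof.
move=> nI.
have [a [b [ab xab]]] : exists a b : 'I_k.+2, a < b /\ x a = x b.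
  apply: contrapT => h; apply: nI => a b e.
  case: (ltngtP a b) => [ab|ba|/val_inj //]; case: h; [by exists a, b | by exists b, a].
have ak : a < k.+1 by have := ltn_ord b; lia.
have ak2 : a.+1 < k.+2 by lia.
pose j : 'I_k.+1 := Ordinal ak; pose c : 'I_k.+2 := Ordinal ak2.
have xc : x c = x a.
  have h1 := Delta_homo x (leqnSn a : a <= c); have h2 := Delta_homo x (ab : c <= b).
  by apply: val_inj; apply/eqP; rewrite eqn_leq h1 andbT; rewrite xab.
exists j, (dcmp x (dface c)); apply: Delta_ext => s; rewrite !dcmpE.
case: (eqVneq s c) => [->|sc].
  rewrite xc; congr (x _); apply: val_inj; rewrite /= dface_val ddegE /= /bump; lia.
congr (x _); apply: val_inj; rewrite /= dface_val ddegE /= /bump.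
by have := val_neq sc => /=; lia.
Qed.

Variables (V : sspace) (P : forall k l, V k l -> Prop).
Arguments P : clear implicits.
Hypotheses (cP : scl P) (tP : forall k, tc (P k) (@full (V k))).

(** In outer degree n this is the relative latching object: [P] together with the degenerate
    part. *)
Definition osk n k l (x : V k l) : Prop :=
  P k l x \/ exists i (t : Delta k i) (y : V i l), i < n /\ x = V.[t] l y.

Definition degs m j l (w : V m.+1 l) : Prop :=
  P m.+1 l w \/ exists (i : 'I_m.+1) (y : V m l), i < j /\ w = V.[ddeg i] l y.

Lemma degs_closed m j : sub_closed (@degs m j).
Proof.
move=> k l t w [h|[i [y [ij ->]]]]; [left; exact: (proj1 cP) | right].
by exists i, ((V m).[t] y); rewrite smNx.
Qed.

Lemma ddeg_face n (j : 'I_n.+1) (c : 'I_n.+2) : (c : nat) = j \/ (c : nat) = j.+1 ->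
  dcmp (ddeg j) (dface c) = did n.
Proof.
move=> h; apply: Delta_ext => s; apply: val_inj; rewrite /= dcmpE ddegE dface_val didE /bump.
by case: h => ->; lia.
Qed.

Lemma degs_deg m (j : 'I_m.+2) l (y : V m.+1 l) :
  degs j (V.[ddeg j] l y) <-> degs j y.
Proof.
pose c : 'I_m.+3 := lift ord0 j; pose c' : 'I_m.+3 := widen_ord (leqnSn _) j.
have cE : (c : nat) = j.+1 by [].
split=> [[h|[i [x [ij e]]]]|[h|[i [x [ij ->]]]]].
- left; have -> : y = V.[dface c] l (V.[ddeg j] l y).
    by rewrite -ssmapM ddeg_face ?ssmap1 //; right.
  exact: (proj2 cP).
- right; have im : i < m.+1 by have := ltn_ord j; lia.
  pose i' : 'I_m.+1 := Ordinal im.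
  exists i', (V.[dface j] l x); split=> //.
  have -> : y = V.[dface c] l (V.[ddeg j] l y).
    by rewrite -ssmapM ddeg_face ?ssmap1 //; right.
  rewrite e -!ssmapM; congr (V.[_] l x); apply: Delta_ext => s; apply: val_inj.
  by rewrite /= !dcmpE ddegE !dface_val ddegE /= /bump; lia.
- by left; apply: (proj2 cP).
- right; have im : i < m.+2 by have := ltn_ord i; lia.
  have jm : j.-1 < m.+1 by have := ltn_ord j; lia.
  exists (Ordinal im), (V.[ddeg (Ordinal jm)] l x); split=> //.
  rewrite -!ssmapM; congr (V.[_] l x); apply: Delta_ext => s; apply: val_inj.
  by rewrite /= !dcmpE !ddegE /=; lia.
Qed.

Lemma deg_inj m (j : 'I_m.+1) l : injective (V.[ddeg j] l).
Proof.
move=> x y e; rewrite -(ssmap1 x) -(ssmap1 y).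
have <- : dcmp (ddeg j) (dface (lift ord0 j)) = did m by apply: ddeg_face; right.
by rewrite !ssmapM e.
Qed.

(* Adjoin the degeneracies s_0, ..., s_m one at a time; the intersection of s_j with
   the previous ones consists of the degeneracies s_i, i < j, one dimension lower. *)
Lemma degs_tc m j : j <= m.+1 -> tc (P m.+1) (@degs m j).
Proof.
have cl n := proj1 cP n; have subP n i l (x : V n.+1 l) : P n.+1 l x -> @degs n i l x by left.
elim: m j => [|m IHm] j; elim: j => [_|j IHj jm].
- by apply: tc_iff (tc_refl (cl 1)) => // l x; split=> [|[//|[i [y []]]]]; first exact: subP.
- have j0 : j = 0 by lia.
  subst j; pose jo : 'I_1 := ord0; pose W := image (V.[ddeg jo]).
  apply: (tc_trans (IHj isT)).
  have cW : sub_closed W by apply: image_closed.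
  have tW : tc (fun l b => @degs 0 0 l b /\ W l b) W.
    apply: (@tc_image _ _ (V.[ddeg jo])) => //.
    + by move=> l; apply: deg_inj.
    + by move=> k l t x [h h']; split; [apply: degs_closed | apply: cW].
    + by move=> l b [].
    + apply: tc_iff (tP 0) => l y; last by split=> // _; exists y.
      split=> [h|[[h|[i [x []]]] _] //]; last first.
        have -> : y = V.[dface (lift ord0 jo)] l (V.[ddeg jo] l y).
          by rewrite -ssmapM ddeg_face ?ssmap1 //; right.
        exact: (proj2 cP).
      by split; [left; apply: (proj2 cP) | exists y].
  apply: tc_iff (tc_union (@degs_closed 0 0) tW) => // l b.
  split=> [[[h|[i [y [//]]]]|[y <-]]|[h|[i [y [i1 ->]]]]].
  + by left.
  + by right; exists jo, y.
  + by left; left.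
  + by right; exists y; rewrite (ord1 i) (ord1 jo).
- by apply: tc_iff (tc_refl (cl m.+2)) => // l x; split=> [|[//|[i [y []]]]]; first exact: subP.
- pose jo : 'I_m.+2 := Ordinal jm; pose W := image (V.[ddeg jo]).
  apply: (tc_trans (IHj (ltnW jm))).
  have cW : sub_closed W by apply: image_closed.
  have jm' : j <= m.+1 by lia.
  (* Two out of three one degree lower: both [P] to [degs j] and [P] to everything are trivial
     cofibrations. *)
  have tj : tc (@degs m j) (@full (V m.+1)).
    exact: tc_cancel (IHm j jm') (tP m.+1) (@degs_closed m j) (fun _ _ _ => I).
  have tW : tc (fun l b => @degs m.+1 j l b /\ W l b) W.
    apply: (@tc_image _ _ (V.[ddeg jo])) => //.
    + by move=> l; apply: deg_inj.
    + by move=> k l t x [h h']; split; [apply: degs_closed | apply: cW].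
    + by move=> l b [].
    + apply: tc_iff tj => l y; last by split=> // _; exists y.
      rewrite -[j]/(nat_of_ord jo) degs_deg; split=> [h|[]//].
      by split=> //; exists y.
  apply: tc_iff (tc_union (@degs_closed m.+1 j) tW) => // l b.
  split=> [[[h|[i [y [ij ->]]]]|[y <-]]|[h|[i [y [ij ->]]]]].
  + by left.
  + by right; exists i, y; split=> //; apply: ltnW.
  + by right; exists jo, y.
  + by left; left.
  + case: (ltngtP i j) => [lt|gt|e]; [by left; right; exists i, y | by lia | right].
    by exists y; congr (V.[_] l y); congr ddeg; apply: val_inj.
Qed.

Lemma osk_closed n k : sub_closed (@osk n k).
Proof.
move=> j l t x [h|[i [s [y [lt ->]]]]]; [left; exact: (proj1 cP) | right].
by exists i, s, ((V i).[t] y); rewrite smNx.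
Qed.

Lemma osk_out n j k (t : Delta j k) l (x : V k l) : osk n x -> osk n (V.[t] l x).
Proof.
move=> [h|[i [s [y [lt ->]]]]]; [left; exact: (proj2 cP) | right].
by exists i, (dcmp s t), y; rewrite ssmapM.
Qed.

(** All degeneracies together generate the degenerate part, so [degs_tc] and cancellation apply. *)
Lemma latching_tc n : tc (fun l => @osk n n l) (@full (V n)).
Proof.
case: n => [|m].
  by apply: tc_iff (tP 0) => // l x; split=> [|[//|[i [s [y []]]]]]; first by left.
have t := tc_cancel (degs_tc (leqnn m.+1)) (tP m.+1) (@degs_closed m m.+1) (fun _ _ _ => I).
apply: tc_iff t => // l x; split=> [[h|[i [y [_ ->]]]]|[h|[i [s [y [lt ->]]]]]].
- by left.
- by right; exists m, (ddeg i), y.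
- by left.
- right; have [|j [s' ->]] := @noninj_factor m i s.
    by move=> /delta_inj_leq; lia.
  by exists j, (V.[s'] l y); rewrite ssmapM.
Qed.

Program Definition column l : sset :=
  @Simplicial Types (fun k => V k l) (fun j k t => V.[t] l) _ _.
Next Obligation. by move=> l k; apply: functional_extensionality_dep => x; apply: ssmap1. Qed.
Next Obligation. by move=> l i j k g f; apply: functional_extensionality_dep => x; apply: ssmapM. Qed.

Program Definition diag_cell n : hom (prodS (V n) (simplex n)) (diag V) :=
  @SMor Types (prodS (V n) (simplex n)) (diag V) (fun l z => V.[z.2 : Delta l n] l z.1) _.
Next Obligation.
by move=> n j l t; apply: functional_extensionality_dep => -[x y] /=; rewrite ssmapM -smNx.
Qed.

(** The outer skeleta filter the diagonal. Stage n glues in the product of [V n] with the n-simplex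
    along the pushout product of the relative latching inclusion with the boundary, a trivial
    cofibration by [latching_tc]. *)
Lemma diag_ext Z : kan Z -> ext (B := diag V) (fun k (x : V k k) => P k k x) (@full _) (to_pt Z).
Proof.
move=> kZ; pose D n k (x : diag V k) := @osk n k k x.
have cD n : sub_closed (D n).
  by move=> j k t x h; apply: osk_out; apply: osk_closed.
have mD n k x : D n k x -> D n.+1 k x.
  by case=> [h|[i [s [y [lt e]]]]]; [left | right; exists i, s, y; split=> //; apply: ltnW].
suff step n : ext (D n) (D n.+1) (to_pt Z).
  apply: ext_sub (ext_union cD mD step) => k x.
    by split=> [[//|[i [s [y []]]]//]|h]; left.
  split=> // _; exists k.+1; right; exists k, (did k), x; split=> //.
  by rewrite (smap1 V).
apply: ext_pt => G pG tG.
have cell_D k (w : V n k) (t : Delta k n) :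
    @pp (V n) (simplex n) (fun l => @osk n n l) (@full _) (@bd n) k (w, t) -> D n k (V.[t] k w).
  case=> [h|[_ /bd_factor[m [u [v [mn]]]]]]; first exact: osk_out.
  move=> /= ->.
  by right; exists m, v, (V.[u] k w); rewrite ssmapM.
have D_cell k (w : V n k) (t : Delta k n) : D n k (V.[t] k w) ->
    @pp (V n) (simplex n) (fun l => @osk n n l) (@full _) (@bd n) k (w, t).
  move=> h; case: (pselect (@bd n k t)) => [b|/not_bd ts]; [by right | left].
  have [d [td _]] := dsurj_section ord0 ts.
  by rewrite /= -(ssmap1 w) -td ssmapM; apply: osk_out.
have [||g gG] := @tc_extend (prodS (V n) (simplex n)) _ Z (fun k z y => G k (diag_cell n k z) y)
   (tc_pp (latching_tc n) (@bd_closed n)) kZ.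
- exact: pmap_pre.
- by move=> k [w t] /cell_D/tG.
have G_cell k (w : V n k) (t : Delta k n) y : D n k (V.[t] k w) -> G k (V.[t] k w) y -> y = g k (w, t).
  by move=> h Gy; apply: esym; apply: gG => //; apply: D_cell.
exists (fun k x y => (D n k x /\ G k x y) \/ exists (w : V n k) (t : Delta k n),
  x = V.[t] k w /\ y = g k (w, t)); split.
- apply: pmap_union; first exact: pmap_restrict.
  + split=> [j k s x y [w [t [-> ->]]]|k x y y' [w [t [-> ->]]] [w' [t' [e ->]]]].
      exists ((V n).[s] w), (dcmp t s); split.
        by rewrite /= -smNx ssmapM.
      by rewrite -smNx.
    case: (pselect (D n k (V.[t] k w))) => [h|nD].
      have [v Gv] := tG _ _ h; rewrite -(G_cell _ _ _ _ h Gv).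
      by rewrite e in h Gv; rewrite -(G_cell _ _ _ _ h Gv).
    have bdo (v : V n k) l (u : Delta l n) : bd (u : simplex n l) -> osk n (V.[u] k v).
      move=> /bd_factor[m [u1 [u2 [mn ->]]]].
      by right; exists m, u2, (V.[u1] k v); rewrite ssmapM.
    (* For fixed inner degree this is the Eilenberg-Zilber uniqueness in the outer direction, so the
       new values are well defined. *)
    have [|-> ->//] := @cell_unique (column k) (fun l => @osk n l k) n w w' k t t' _
      (bdo w) (bdo w') e nD.
    by move=> l j u z h; apply: osk_out.
  + by move=> k x y y' [h Gy] [w [t [ex ->]]]; subst x; apply: G_cell.
- move=> k x [h|[i [s [y [lt ex]]]]].
    by have [|z Gz] := tG k x; [left | exists z; left; split=> //; left].
  case: (ltngtP i n) => [li|gi|ei]; last 2 first.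
  + by lia.
  + by subst i; exists (g k (y, s)); right; exists y, s.
  + have Dx : D n k x by right; exists i, s, y.
    by have [z Gz] := tG k x Dx; exists z; left.
- by move=> k x y h Gy; left.
Qed.

End Latching.

Section Diagonal.

(** The pushout products with boundaries demanded by [tc] are diagonals again, of
    [tensor B (simplex n)], so [diag_ext] covers all of them. *)
Lemma diag_mono_weq (A B : sspace) (i : hom A B) : (forall k l, injective (i k l)) ->
  (forall k, tc (image (i k)) (@full (B k))) -> weak_eq (diag_map i).
Proof.
move=> iI ti; apply: tc_weak_eq; first by move=> k; apply: iI.
split=> //; first exact: image_closed.
move=> Z kZ n.
pose T := tensor B (simplex n).
pose P k l (z : T k l) := @pp (B k) (simplex n) (image (i k)) (@full _) (@bd n) l z.
have cP : scl P.
  split=> [k|j k t l [b x] [[a ab]|[_ h]]]; last by right.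
    by apply: pp_closed => //; [apply: image_closed | apply: bd_closed].
  by left; exists (A.[t] l a); rewrite ssNx ab.
have tP k : tc (P k) (@full (T k)) := tc_pp (ti k) (@bd_closed n).
have swp k l (t : Delta k l) : (fun z : (B l l * Delta l n)%type => (diag T).[t] z) =
   (fun z => (prodS (diag B) (simplex n)).[t] z).
  by apply: functional_extensionality_dep => -[x y].
have := diag_ext cP tP kZ.
pose f : hom (prodS (diag B) (simplex n)) (diag T) :=
  @SMor Types (prodS (diag B) (simplex n)) (diag T) (fun k z => z) (fun k l t => esym (swp k l t)).
pose r : hom (diag T) (prodS (diag B) (simplex n)) :=
  @SMor Types (diag T) (prodS (diag B) (simplex n)) (fun k z => z) (fun k l t => swp k l t).
move=> e; refine (@ext_retract _ _ f r _ _ _ _ _ _ _ _ _ _ _ _ _ e) => //.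
Qed.

Lemma diag_weq (A B : sspace) (f : hom A B) : (forall k, weak_eq (f k)) -> weak_eq (diag_map f).
Proof.
apply: (@level_weq_ind (fun (X Y : sspace) (g : hom X Y) => weak_eq (diag_map g))).
- exact: diag_mono_weq.
- move=> X Y W g h wg wh; have -> : diag_map (h ∘ g) = diag_map h ∘ diag_map g by apply: sset_ext.
  exact: weak_eq_cmp.
- move=> X Y g h gh wh; apply: (weak_eq_cancel_r wh).
  have -> : diag_map g ∘ diag_map h = idm (diag Y).
    by apply: sset_ext => k x; apply: (sspace_eqx x gh).
  exact: weak_eq_id.
Qed.

End Diagonal.

(** * Totalization *)

Section Tot.

(* A semi-cosimplicial simplicial space; cofaces are indexed by all of nat, and only
   cs_d r i with i <= r.+1 is meaningful. *)
Record cosim := Cosim {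
  cs_ob :> nat -> sspace;
  cs_d : forall r, nat -> hom (cs_ob r) (cs_ob r.+1);
  cs_dd : forall r i j, i <= j -> j <= r.+1 ->
    cs_d r.+1 j.+1 ∘ cs_d r i = cs_d r.+1 i ∘ cs_d r j }.

Record cosim_map (E F : cosim) := CosimMap {
  cm_f :> forall r, hom (E r) (F r);
  cm_N : forall r i, cm_f r.+1 ∘ cs_d E r i = cs_d F r i ∘ cm_f r }.

(* The (k, l)-simplices of Tot E are families of maps Delta^r x Delta^l -> E r k that are
   compatible with the cofaces; tot_raw omits naturality and compatibility. *)
Program Definition tot_raw (E : nat -> sspace) : sspace :=
  @Simplicial sset (fun k => @Simplicial Types
      (fun l => forall r j, Delta j r -> Delta j l -> E r k j)
      (fun l' l s e r j t u => e r j t (dcmp s u)) _ _)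
    (fun k' k s => @SMor Types _ _ (fun l e r j t u => (E r).[s] j (e r j t u)) _) _ _.
Next Obligation.
move=> E k l; apply: functional_extensionality_dep => e.
by do 4![apply: functional_extensionality_dep => ?]; rewrite dcmp1f.
Qed.
Next Obligation.
move=> E k l m n g f; apply: functional_extensionality_dep => e.
by do 4![apply: functional_extensionality_dep => ?]; rewrite /= dcmpA.
Qed.
Next Obligation. by []. Qed.
Next Obligation.
move=> E k; apply: sset_ext => l e.
by do 4![apply: functional_extensionality_dep => ?]; rewrite /= ssmap1.
Qed.
Next Obligation.
move=> E i j k g f; apply: sset_ext => l e.
by do 4![apply: functional_extensionality_dep => ?]; rewrite /= ssmapM.
Qed.

Definition tot_ok (E : cosim) k l (e : tot_raw E k l) : Prop :=
  (forall r j j' (a : Delta j' j) t u, e r j' (dcmp t a) (dcmp u a) = (E r k).[a] (e r j t u)) /\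
  (forall r (i : 'I_r.+2) j (t : Delta j r) u,
     e r.+1 j (dcmp (dface i) t) u = cs_d E r i k j (e r j t u)).

Lemma tot_scl (E : cosim) : scl (@tot_ok E).
Proof.
split=> [k l' l s e [eN eD]|k' k s l e [eN eD]]; split=> /= *.
- by rewrite dcmpA eN.
- exact: eD.
- by rewrite eN smNx.
- by rewrite eD ssNx.
Qed.

Definition Tot (E : cosim) : sspace := subSS (tot_scl E).

Lemma tot_map_ok (E F : cosim) (q : cosim_map E F) k l (e : tot_raw E k l) :
  tot_ok e -> tot_ok (E := F) ((fun r j t u => q r k j (e r j t u)) : tot_raw F k l).
Proof.
case=> eN eD; split=> [r j j' a t u|r i j t u].
- by rewrite eN smNx.
- by rewrite eD; apply: (sspace_eqx _ (@cm_N _ _ q r i)).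
Qed.

Program Definition Tot_map (E F : cosim) (q : cosim_map E F) : hom (Tot E) (Tot F) :=
  @SMor sset (Tot E) (Tot F) (fun k => @SMor Types (Tot E k) (Tot F k)
     (fun l e => exist _ _ (tot_map_ok q (svalP e))) _) _.
Next Obligation.
move=> E F q k l l' s; apply: functional_extensionality_dep => e.
exact: sig_ext.
Qed.
Next Obligation.
move=> E F q k' k s; apply: sset_ext => l e; apply: sig_ext.
by do 4![apply: functional_extensionality_dep => ?]; apply: ssNx.
Qed.

(** Two distinct facets meet in a face of codimension two, reached through the two sides of a
    cosimplicial identity. *)
Lemma faces_overlap r k (i i' : 'I_r.+3) (t t' : Delta k r.+1) : i < i' ->
  dcmp (dface i) t = dcmp (dface i') t' ->
  exists (a b : 'I_r.+2) (s : Delta k r), [/\ (a : nat) = i, b.+1 = i',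
    t = dcmp (dface b) s & t' = dcmp (dface a) s].
Proof.
move=> ii' e.
have al : i < r.+2 by have := ltn_ord i'; lia.
have bl : i'.-1 < r.+2 by have := ltn_ord i'; lia.
have ev x : (dface i (t x) : nat) = dface i' (t' x).
  by rewrite -!dcmpE e.
exists (Ordinal al), (Ordinal bl), (dcmp (dretr (Ordinal bl)) t).
have te : t = dcmp (dface (Ordinal bl)) (dcmp (dretr (Ordinal bl)) t).
  apply: miss_factor => x; apply/eqP => tx.
  have := ev x; rewrite !dface_val tx /= /bump; lia.
split=> //=; first by lia.
apply: Delta_ext => x; apply: val_inj => /=.
have := ev x; rewrite {1}te !dcmpE !dface_val /= /bump; set y := nat_of_ord _; lia.
Qed.

Section Lifting.
Variables (E F : cosim) (q : cosim_map E F).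
Hypothesis fq : forall r, rfib (q r).
Variables (B : sspace) (P : forall k l, B k l -> Prop) (G : forall k l, B k l -> Tot E k l -> Prop).
Arguments P : clear implicits.
Arguments G : clear implicits.
Variable v : hom B (Tot F).
Hypotheses (cP : scl P) (tP : forall k, tc (P k) (@full (B k))) (pG : spmap G)
  (tG : forall k l b, P k l b -> exists x, G k l b x)
  (Gv : forall k l b x, P k l b -> G k l b x -> Tot_map q k l x = v k l b).

(* The last field ensures that f prescribes a map on the boundary of the next simplex. *)
Record partial_lift r (f : hom (tensor B (simplex r)) (E r)) : Prop := PartialLift {
  pl_G : forall k j b t e, P k j b -> G k j b e -> f k j (b, t) = sval e r j t (did j);
  pl_v : forall k j b t, q r k j (f k j (b, t)) = sval (v k j b) r j t (did j);
  pl_bd : forall k j b (i i' : 'I_r.+2) (t t' : Delta j r),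
    dcmp (dface i) t = dcmp (dface i') t' ->
    cs_d E r i k j (f k j (b, t)) = cs_d E r i' k j (f k j (b, t')) }.

Lemma tot_at (H : cosim) k l j (a : Delta j l) (e : Tot H k l) r (t : Delta l r) :
  sval ((Tot H k).[a] e) r j (dcmp t a) (did j) = (H r k).[a] (sval e r l t (did l)).
Proof. by rewrite /= dcmpf1 -(proj1 (svalP e)) dcmp1f. Qed.

Program Definition tot_target r : hom (tensor B (simplex r)) (F r) :=
  @SMor sset (tensor B (simplex r)) (F r) (fun k => @SMor Types (tensor B (simplex r) k) (F r k)
    (fun j z => sval (v k j z.1) r j z.2 (did j)) _) _.
Next Obligation.
move=> r k l j a; apply: functional_extensionality_dep => -[b t] /=.
by rewrite smNx tot_at.
Qed.
Next Obligation.
by move=> r k' k s; apply: sset_ext => j [b t] /=; rewrite ssNx.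
Qed.

(** One step of the induction on r: the Reedy lifting property of [q r] against the pushout product
    of [P] with [Q], where [H] carries the values forced on [Q] by the previous step. *)
Lemma partial_lift_exists r (Q : forall j, Delta j r -> Prop)
    (H : forall k j, tensor B (simplex r) k j -> E r k j -> Prop) :
  sub_closed (K := simplex r) Q -> spmap H ->
  (forall k j b t, Q j t -> exists x, H k j (b, t) x) ->
  (forall k j b t x, H k j (b, t) x -> Q j t /\ q r k j x = sval (v k j b) r j t (did j)) ->
  (forall k j b t x e, H k j (b, t) x -> P k j b -> G k j b e -> x = sval e r j t (did j)) ->
  exists f : hom (tensor B (simplex r)) (E r), [/\
    forall k j b t e, P k j b -> G k j b e -> f k j (b, t) = sval e r j t (did j),
    forall k j b t, q r k j (f k j (b, t)) = sval (v k j b) r j t (did j) &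
    forall k j b t x, H k j (b, t) x -> f k j (b, t) = x].
Proof.
move=> cQ pH tH Hv HG.
pose H1 k j (z : tensor B (simplex r) k j) (x : E r k j) :=
  exists e, [/\ P k j z.1, G k j z.1 e & x = sval e r j z.2 (did j)].
have [|||||f [fH fv]] := @fq r (tensor B (simplex r))
  (fun k j (z : tensor B (simplex r) k j) => @pp (B k) (simplex r) (P k) (@full _) Q j z)
  (fun k j z x => H1 k j z x \/ H k j z x) (tot_target r).
- split=> [k|k' k s j [b t] [h|h]]; last by right.
    by apply: pp_closed => //; apply: (proj1 cP).
  by left; apply: (proj2 cP).
- by move=> k; apply: tc_pp.
- split=> [k|k' k s j [b t] x [[e [/= h Ge ->]]|h]]; last by right; apply: (spm_out pH).
  + apply: pmap_union; last 1 first.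
    * by move=> j [b t] x y [e [/= h Ge ->]] /HG-/(_ _ h Ge).
    * split=> [l j a [b t] x [e [/= h Ge ->]]|j [b t] x y [e [/= h Ge ->]] [e' [/= _ Ge' ->]]].
        exists ((Tot E k).[a] e); split; [exact: (proj1 cP) | exact: (pm_cl (spm_in pG k)) |].
        by rewrite tot_at.
      by rewrite (pm_fun (spm_in pG k) Ge Ge').
    * exact: spm_in pH k.
  + left; exists ((Tot E).[s] j e); split; [exact: (proj2 cP) | exact: (spm_out pG) | by []].
- move=> k j [b t] [/= Pb|[_ Qt]]; last by have [x Hx] := tH k j b t Qt; exists x; right.
  by have [e Ge] := tG Pb; exists (sval e r j t (did j)); left; exists e.
- move=> k j [b t] x _ [[e [/= h Ge ->]]|/Hv[]//].
  by rewrite -(Gv h Ge).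
exists f; split=> [k j b t e h Ge|k j b t|k j b t x h].
- by apply: fH; left=> //; exists e.
- exact: fv.
- by apply: fH; right=> //; split=> //; case: (Hv _ _ _ _ _ h).
Qed.

(** The boundary of a point is empty, so nothing is forced yet; [pl_bd] holds because the two
    vertices of the interval are disjoint. *)
Lemma partial_lift0 : exists f : hom (tensor B (simplex 0)) (E 0), partial_lift f.
Proof.
have [|||||f [fG fv _]] := @partial_lift_exists 0 (fun _ _ => False) (fun _ _ _ _ => False) => //.
exists f; split=> // k j b i i' t t' e.
suff -> : i = i' by rewrite (_ : t = t') //; apply: Delta_ext => x; rewrite !ord1.
have /(congr1 val) := congr1 (fun a : Delta j 1 => a ord0) e.
rewrite /= !dcmpE !dface_val (ord1 (t _)) (ord1 (t' _)) /bump => h; apply: val_inj => /=.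
move: i i' h {e} => [[|[|//]] ?] [[|[|//]] ?] //=.
Qed.

Definition next_lift r (f : hom (tensor B (simplex r)) (E r))
    (g : hom (tensor B (simplex r.+1)) (E r.+1)) :=
  forall k j b (i : 'I_r.+2) (t : Delta j r),
    g k j (b, dcmp (dface i) t) = cs_d E r i k j (f k j (b, t)).

Lemma partial_liftS r f : @partial_lift r f -> exists g, @partial_lift r.+1 g /\ next_lift f g.
Proof.
move=> [fG fv fbd].
pose H k j (z : tensor B (simplex r.+1) k j) (x : E r.+1 k j) :=
  exists (i : 'I_r.+2) (t : Delta j r), z.2 = dcmp (dface i) t /\
    x = cs_d E r i k j (f k j (z.1, t)).
have [|||||g [gG gv gH]] := @partial_lift_exists r.+1 (@bd r.+1) H.
- exact: bd_closed.
- split=> [k|k' k s j [b t] x [i [u [/= -> ->]]]]; last first.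
    by exists i, u; split=> //; rewrite -(ssNx (cs_d E r i)) -(ssNx f).
  split=> [l j a [b t] x [i [u [/= -> ->]]]|j [b t] x y [i [u [/= -> ->]]] [i' [u' [/= e ->]]]].
    by exists i, (dcmp u a); split; [rewrite /= dcmpA | rewrite -!smNx].
  exact: fbd.
- move=> k j b t [i /miss_factor bt].
  exists (cs_d E r i k j (f k j (b, dcmp (dretr i) t))).
  by exists i, (dcmp (dretr i) t); split; [exact: bt | reflexivity].
- move=> k j b t x [i [u [/= -> ->]]]; split; first by apply: lt_bd.
  rewrite [LHS](sspace_eqx (f k j (b, u)) (@cm_N _ _ q r i)) /= fv.
  by rewrite (proj2 (svalP (v k j b))).
- move=> k j b t x e [i [u [/= -> ->]]] Pb Ge.
  by rewrite (fG _ _ _ _ _ Pb Ge) (proj2 (svalP e)).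
exists g; split; last by move=> k j b i t; apply: gH; exists i, t.
have gN k j b (i : 'I_r.+2) (t : Delta j r) :
    g k j (b, dcmp (dface i) t) = cs_d E r i k j (f k j (b, t)) by apply: gH; exists i, t.
have main k j b (i i' : 'I_r.+3) (t t' : Delta j r.+1) : i < i' ->
    dcmp (dface i) t = dcmp (dface i') t' ->
    cs_d E r.+1 i k j (g k j (b, t)) = cs_d E r.+1 i' k j (g k j (b, t')).
  move=> ii' /(faces_overlap ii')[a [c [s [ai ci -> ->]]]].
  rewrite !gN -ai -ci.
  have ac : a <= c by lia.
  exact: esym (sspace_eqx (f k j (b, s)) (@cs_dd E r a c ac (leq_ord c))).
split=> // k j b i i' t t' e; case: (ltngtP i i') => [lt|gt|/val_inj ii].
- exact: main.
- by apply: esym; apply: main.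
- subst i'; suff -> : t = t' by [].
  apply: Delta_ext => x; apply: (@dface_inj _ i).
  by rewrite -!dcmpE e.
Qed.

Lemma partial_lift_seq : exists f : forall r, hom (tensor B (simplex r)) (E r),
  (forall r, partial_lift (f r)) /\ forall r, next_lift (f r) (f r.+1).
Proof.
pose S r := {f : hom (tensor B (simplex r)) (E r) | partial_lift f}.
pose step r (s : S r) : S r.+1 :=
  let h := cid (partial_liftS (svalP s)) in exist _ (projT1 h) (proj1 (projT2 h)).
pose s := nat_rect S (let h := cid partial_lift0 in exist _ (projT1 h) (projT2 h)) step.
exists (fun r => sval (s r)); split=> r; first exact: svalP (s r).
rewrite /= /step /=; case: cid => g [] //.
Qed.

Lemma Tot_lift : exists h : hom B (Tot E), (forall k l b x, P k l b -> G k l b x -> h k l b = x) /\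
  forall k l b, Tot_map q k l (h k l b) = v k l b.
Proof.
have [f [fP fN]] := partial_lift_seq.
have ok k l (b : B k l) : tot_ok (E := E)
    ((fun r j t u => f r k j ((B k).[u] b, t)) : tot_raw E k l).
  split=> [r j j' a t u|r i j t u]; last exact: fN.
  by rewrite -[RHS]smNx smapMx.
have hN k l m (s : Delta l m) : (fun b => exist _ _ (ok k l ((B k).[s] b)) : Tot E k l) =
    (fun b => (Tot E k).[s] (exist _ _ (ok k m b) : Tot E k m)).
  apply: functional_extensionality_dep => b; apply: sig_ext.
  by do 4![apply: functional_extensionality_dep => ?]; rewrite /= smapMx.
have hO j k (s : Delta j k) :
    @cmp sset _ _ _ (@SMor Types (B j) (Tot E j) (fun l b => exist _ _ (ok j l b)) (hN j)) B.[s] =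
    @cmp sset _ _ _ (Tot E).[s] (@SMor Types (B k) (Tot E k) (fun l b => exist _ _ (ok k l b)) (hN k)).
  apply: sset_ext => l b; apply: sig_ext.
  apply: functional_extensionality_dep => r; apply: functional_extensionality_dep => i.
  apply: functional_extensionality_dep => t; apply: functional_extensionality_dep => u.
  rewrite /= -smNx.
  exact: (ssNx (f r) s (((B k).[u] b, t) : tensor B (simplex r) k i)).
exists (@SMor sset B (Tot E) _ hO); split=> [k l b e Pb Ge|k l b]; apply: sig_ext;
  do 4![apply: functional_extensionality_dep => ?] => /=.
- set u := (X in (B k).[X]).
  rewrite (pl_G (fP _) _ (proj1 cP _ _ _ _ _ Pb) (pm_cl (spm_in pG k) u Ge)) /=.
  by rewrite dcmpf1.
- by rewrite (pl_v (fP _)) smNx /= dcmpf1.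
Qed.

End Lifting.

Lemma Tot_rfib (E F : cosim) (q : cosim_map E F) : (forall r, rfib (q r)) -> rfib (Tot_map q).
Proof. by move=> fq B P G v cP tP pG tG Gv; apply: (Tot_lift fq cP tP pG). Qed.

End Tot.

(** * The cobar construction *)

Section Cofree.

(* cofree X is the right Kan extension of the family of spaces X_m along the inclusion
   of the discrete category of objects, so lifting against it is a levelwise matter. *)
Program Definition cofree (X : sspace) : sspace :=
  @Simplicial sset (fun k => @Simplicial Types (fun l => forall m, Delta m k -> X m l)
      (fun j l t e m s => (X m).[t] (e m s)) _ _)
    (fun j k t => @SMor Types _ _ (fun l e m s => e m (dcmp t s)) _) _ _.
Next Obligation.
move=> X k l; apply: functional_extensionality_dep => e.
by do 2![apply: functional_extensionality_dep => ?]; rewrite smap1x.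
Qed.
Next Obligation.
move=> X k i j l g f; apply: functional_extensionality_dep => e.
by do 2![apply: functional_extensionality_dep => ?]; rewrite /= smapMx.
Qed.
Next Obligation. by []. Qed.
Next Obligation.
move=> X k; apply: sset_ext => l e.
by do 2![apply: functional_extensionality_dep => ?]; rewrite /= dcmp1f.
Qed.
Next Obligation.
move=> X i j k g f; apply: sset_ext => l e.
by do 2![apply: functional_extensionality_dep => ?]; rewrite /= dcmpA.
Qed.

Program Definition cofree_adj (B X : sspace) (g : forall m, hom (B m) (X m)) : hom B (cofree X) :=
  @SMor sset B (cofree X) (fun k => @SMor Types (B k) (cofree X k) (fun l b m s => g m l (B.[s] l b)) _) _.
Next Obligation.
move=> B X g k l m t; apply: functional_extensionality_dep => b.
do 2![apply: functional_extensionality_dep => ?]; rewrite /= -smNx.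
by congr (g _ _ _); apply: (smNx B.[_]).
Qed.
Next Obligation.
move=> B X g j k t; apply: sset_ext => l b.
by do 2![apply: functional_extensionality_dep => ?]; rewrite /= ssmapM.
Qed.

Definition cofree_unit (X : sspace) : hom X (cofree X) := cofree_adj (fun m => idm (X m)).

Program Definition cofree_map (X Y : sspace) (f : hom X Y) : hom (cofree X) (cofree Y) :=
  @SMor sset (cofree X) (cofree Y) (fun k => @SMor Types (cofree X k) (cofree Y k) (fun l e m s => f m l (e m s)) _) _.
Next Obligation.
move=> X Y f k l m t; apply: functional_extensionality_dep => b.
by do 2![apply: functional_extensionality_dep => ?]; rewrite /= smNx.
Qed.
Next Obligation. by move=> X Y f j k t; apply: sset_ext. Qed.

Definition cofree_ev (X : sspace) k : hom (cofree X k) (X k) :=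
  @SMor Types (cofree X k) (X k) (fun l e => e k (did k)) (fun _ _ _ => erefl).

Lemma cofree_rfib (X Y : sspace) (q : hom X Y) : (forall k, kan (X k)) -> (forall k, kan (Y k)) ->
  (forall k, kan_fib (q k)) -> rfib (cofree_map q).
Proof.
move=> kX kY fq B P G v cP tP pG tG Gv.
have level m : exists g : hom (B m) (X m),
    (forall l b e, P m l b -> G m l b e -> g l b = e m (did m)) /\
    forall l b, q m l (g l b) = v m l b m (did m).
  pose H l b x := exists2 e, G m l b e & cofree_ev X m l e = x.
  have [|||g [gH gv]] := @ext_total _ _ _ _ _ H (cofree_ev Y m ∘ v m)
    (tc_kan_fib (tP m) (kX m) (kY m) (fq m)).
  - exact: (pmap_post (cofree_ev X m) (spm_in pG m)).
  - by move=> l b /tG[e Ge]; exists (cofree_ev X m l e), e.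
  - by move=> l b x Pb [e Ge <-]; rewrite /= -(Gv _ _ _ _ Pb Ge).
  by exists g; split=> // l b e Pb Ge; apply: gH => //; exists e.
pose g m := projT1 (cid (level m)).
have gP m l b e : P m l b -> G m l b e -> g m l b = e m (did m).
  by rewrite /g; case: cid => h /= [hP _]; apply: hP.
have gv m l b : q m l (g m l b) = v m l b m (did m) by rewrite /g; case: cid => h /= [].
exists (cofree_adj g); split=> [k l b e Pb Ge|k l b]; do 2![apply: functional_extensionality_dep => ?] => /=.
- by rewrite (gP _ _ _ _ (proj2 cP _ _ _ _ _ Pb) (spm_out pG _ Ge)) /= dcmpf1.
- by rewrite gv ssNx /= dcmpf1.
Qed.

Definition rpoint (A : rsspace) l : incl A 0 l := projT1 (cid (svalP A l)).

Lemma rpointE (A : rsspace) l (x : incl A 0 l) : x = rpoint A l.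
Proof. by rewrite /rpoint; case: cid => u [_ uU] /=; rewrite (uU x). Qed.

Definition basept (A : rsspace) m l : incl A m l := (incl A).[dsurj m] l (rpoint A l).

Lemma basept_inner (A : rsspace) m j l (t : Delta j l) :
  (incl A m).[t] (basept A m l) = basept A m j.
Proof. by rewrite /basept -(smNx (incl A).[dsurj m]); congr (_ _ _); apply: rpointE. Qed.

Lemma basept_map (A B : rsspace) (f : hom A B) m l : incl_map f m l (basept A m l) = basept B m l.
Proof. by rewrite /basept ssNx; congr (_ _ _); apply: rpointE. Qed.

Lemma basept_const (A : rsspace) m k l (j : 'I_k.+1) (x : incl A k l) :
  (incl A).[dconst m j] l x = basept A m l.
Proof.
have -> : dconst m j = dcmp (vertex j) (dsurj m).
  by apply: Delta_ext => s; rewrite dcmpE !dconstE.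
by rewrite ssmapM /basept; congr (_ _ _); apply: rpointE.
Qed.

(* The reduced variant of cofree: constant maps [m] -> [k] have to go to the base point. *)
Definition based (A : rsspace) k l (e : cofree (incl A) k l) : Prop :=
  forall m (j : 'I_k.+1), e m (dconst m j) = basept A m l.

Lemma based_scl A : scl (@based A).
Proof.
split=> [k l j t e be|j k t l e be] m i /=; first by rewrite be basept_inner.
by rewrite cmp_dconst be.
Qed.

Lemma based_reduced A : reduced (subSS (based_scl A)).
Proof.
move=> l; pose e : cofree (incl A) 0 l := fun m _ => basept A m l.
have be : based e by [].
exists (exist _ e be); split=> // -[e' be'] _; apply: sig_ext.
do 2![apply: functional_extensionality_dep => ?] => /=.
apply: etrans (esym (be' _ ord0)) _; congr (e' _ _).
by apply: Delta_ext => s; rewrite !ord1.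
Qed.

Definition cofree_red (A : rsspace) : rsspace := exist _ (subSS (based_scl A)) (based_reduced A).

Lemma based_map (A B : rsspace) (f : hom A B) k l (e : cofree (incl A) k l) :
  based e -> based (A := B) (cofree_map (incl_map f) k l e).
Proof. by move=> be m j /=; rewrite be basept_map. Qed.

Program Definition cofree_red_lift (B : sspace) (A : rsspace) (g : hom B (cofree (incl A)))
    (bg : forall k l b, based (A := A) (g k l b)) : hom B (incl (cofree_red A)) :=
  @SMor sset B (incl (cofree_red A)) (fun k => @SMor Types (B k) (incl (cofree_red A) k)
    (fun l b => exist _ (g k l b) (bg k l b)) _) _.
Next Obligation.
by move=> B A g bg k l m t; apply: functional_extensionality_dep => b; apply: sig_ext; apply: (smNx (g k) t b).
Qed.
Next Obligation.
by move=> B A g bg j k t; apply: sset_ext => l b; apply: sig_ext; apply: (ssNx g t b).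
Qed.

Definition cofree_red_incl (A : rsspace) : hom (incl (cofree_red A)) (cofree (incl A)) := subSS_incl (based_scl A).

Definition cofree_red_map (A B : rsspace) (f : hom A B) : hom (cofree_red A) (cofree_red B) :=
  cofree_red_lift (g := cofree_map (incl_map f) ∘ cofree_red_incl A)
    (fun k l b => @based_map A B f k l _ (svalP b)).

Definition cofree_red_unit (A : rsspace) : hom A (cofree_red A) :=
  cofree_red_lift (g := cofree_unit (incl A)) (fun k l b m j => basept_const m j b).

(** Basedness adds a constraint in each degree m: the totally degenerate part [D m] must go to the
    base point. Adding [D m] to [P] keeps a trivial cofibration, because [P] is one in degree 0 as
    well. *)
Lemma cofree_red_rfib (A C : rsspace) (q : hom A C) : (forall k, kan (incl A k)) ->
  (forall k, kan (incl C k)) -> (forall k, kan_fib (incl_map q k)) -> rfib (incl_map (cofree_red_map q)).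
Proof.
move=> kX kY fq B P G v cP tP pG tG Gv.
pose D m l (b : B m l) := exists w : B 0 l, B.[dsurj m] l w = b.
have dsect m l (w : B 0 l) : B.[vertex ord0] l (B.[dsurj m] l w) = w.
  by rewrite -ssmapM (Delta0_eq (dcmp _ _) (did 0)) ssmap1.
have cD m : sub_closed (D m) by move=> l j t _ [w <-]; exists ((B 0).[t] w); apply: smNx.
have tD m : tc (fun l b => P m l b \/ D m l b) (@full (B m)).
  have cl := proj1 cP m.
  apply: tc_cancel (tP m) _ _ => //; last first.
    by move=> l j t b [h|h]; [left; apply: cl | right; apply: cD].
  apply: tc_union => //.
  apply: (@tc_image _ _ B.[dsurj m]) => //.
  - by move=> l w w' e; rewrite -(dsect m l w) -(dsect m l w') e.
  - by move=> l j t b [h h']; split; [apply: cl | apply: cD].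
  - by move=> l b [].
  - apply: tc_iff (tP 0) => l w; last by split=> // _; exists w.
    split=> [h|[h _]]; first by split; [apply: (proj2 cP) | exists w].
    by rewrite -(dsect m l w); apply: (proj2 cP).
have level m : exists g : hom (B m) (incl A m),
    [/\ forall l b e, P m l b -> G m l b e -> g l b = sval e m (did m),
    forall l b, q m l (g l b) = sval (v m l b) m (did m) &
    forall l w, g l (B.[dsurj m] l w) = basept A m l].
  pose H l (b : B m l) x := (P m l b /\ exists2 e, G m l b e & sval e m (did m) = x) \/
    D m l b /\ x = basept A m l.
  have [|||g [gH gv]] := @ext_total _ _ _ _ _ H (cofree_ev (incl C) m ∘ (cofree_red_incl C m ∘ v m))
    (tc_kan_fib (tD m) (kX m) (kY m) (fq m)).
  - apply: pmap_union.
    + split=> [l j t b x [Pb [e Ge <-]]|l b x x' [_ [e Ge <-]] [_ [e' Ge' <-]]].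
        split; first exact: (proj1 cP).
        by exists ((incl (cofree_red A) m).[t] e); first exact: (pm_cl (spm_in pG m)).
      by rewrite (pm_fun (spm_in pG m) Ge Ge').
    + split=> [l j t b x [Db ->]|l b x x' [_ ->] [_ ->]] //.
      by split; [apply: cD | rewrite basept_inner].
    + move=> l b x x' [Pb [e Ge <-]] [[w wb] ->]; subst b.
      have Pw : P 0 l w by rewrite -(dsect m l w); apply: (proj2 cP).
      have [y Gy] := tG _ _ _ Pw.
      rewrite (pm_fun (spm_in pG m) Ge (spm_out pG (dsurj m) Gy)) /= dcmpf1.
      by rewrite (svalP y).
  - move=> l b [Pb|Db]; last by exists (basept A m l); right.
    by have [e Ge] := tG _ _ _ Pb; exists (sval e m (did m)); left; split=> //; exists e.
  - move=> l b x _ [[Pb [e Ge <-]]|[[w <-] ->]].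
      by rewrite /= -(Gv _ _ _ _ Pb Ge).
    rewrite /= basept_map ssNx /= dcmpf1.
    by rewrite (svalP (v 0 l w)).
  exists g; split=> [l b e Pb Ge|//|l w].
  - by apply: gH; [left | left; split=> //; exists e].
  - by apply: gH; [right; exists w | right; split=> //; exists w].
pose g m := projT1 (cid (level m)).
have gP m l b e : P m l b -> G m l b e -> g m l b = sval e m (did m).
  by rewrite /g; case: cid => h /= [hP _ _]; apply: hP.
have gv m l b : q m l (g m l b) = sval (v m l b) m (did m) by rewrite /g; case: cid => h /= [].
have gD m l w : g m l (B.[dsurj m] l w) = basept A m l by rewrite /g; case: cid => h /= [].
have bg k l b : based (A := A) (cofree_adj g k l b).
  move=> m j /=; have -> : dconst m j = dcmp (vertex j) (dsurj m).
    by apply: Delta_ext => s; rewrite dcmpE !dconstE.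
  by rewrite ssmapM gD.
exists (cofree_red_lift bg); split=> [k l b e Pb Ge|k l b]; apply: sig_ext;
  do 2![apply: functional_extensionality_dep => ?] => /=.
- by rewrite (gP _ _ _ _ (proj2 cP _ _ _ _ _ Pb) (spm_out pG _ Ge)) /= dcmpf1.
- by rewrite gv ssNx /= dcmpf1.
Qed.

End Cofree.

(** * The iterated functor and its cofaces *)

Section Resolution.
Variables (C : category) (G : functor C C) (eta : ntrans (id_functor C) G).

Fixpoint res (Z : C) r : C := if r is r'.+1 then G (res Z r') else Z.

(* The cofaces G^i eta G^(r-i) of the cobar construction (junk for i > r). *)
Fixpoint coface (Z : C) r : nat -> hom (res Z r) (res Z r.+1) :=
  match r return nat -> hom (res Z r) (res Z r.+1) with
  | 0 => fun _ => eta Z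
  | r'.+1 => fun i => if i is i'.+1 then fmap G (coface Z r' i') else eta (G (res Z r'))
  end.

Fixpoint res_map (Z W : C) (f : hom Z W) r : hom (res Z r) (res W r) :=
  match r return hom (res Z r) (res W r) with
  | 0 => f
  | r'.+1 => fmap G (res_map f r')
  end.

Lemma coface0 Z r : coface Z r 0 = eta (res Z r).
Proof. by case: r. Qed.

Lemma coface_coface Z r i j : i <= j -> j <= r ->
  coface Z r.+1 j.+1 ∘ coface Z r i = coface Z r.+1 i ∘ coface Z r j.
Proof.
elim: r i j => [|r IH] [|i] [|j] // ij jr; try exact: esym (ntN eta _).
by rewrite /= -!fmapM; congr (fmap G _); apply: IH.
Qed.

Lemma res_map_coface (Z W : C) (f : hom Z W) r i :
  res_map f r.+1 ∘ coface Z r i = coface W r i ∘ res_map f r.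
Proof.
elim: r i => [|r IH] [|i]; try exact: esym (ntN eta _).
by rewrite /= -!fmapM; congr (fmap G _); apply: IH.
Qed.

Lemma res_map_cmp (Z W T : C) (g : hom W T) (f : hom Z W) r :
  res_map (g ∘ f) r = res_map g r ∘ res_map f r.
Proof. by elim: r => //= r ->; rewrite fmapM. Qed.

End Resolution.

Section CofreeInt.

Program Definition ss_snd (X Y : sspace) : hom (prodSS X Y) Y :=
  @SMor sset (prodSS X Y) Y (fun k => mor_snd (X k) (Y k)) _.
Next Obligation. by move=> X Y j k t; apply: sset_ext. Qed.

Definition ss_prod (X Y X' Y' : sspace) (f : hom X X') (g : hom Y Y') :
    hom (prodSS X Y) (prodSS X' Y') := ss_pair (f ∘ ss_fst X Y) (g ∘ ss_snd X Y).

(** Taking the product with the base makes the adjunct of an induced map a base change of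
    [cofree_map], and a map into this object over the base is an unconstrained map into
    [cofree (itot P)]. *)
Definition icofree_ob (P : iobj) : iobj := IObj (ss_snd (cofree (itot P)) (incl (cofree_red (ibase P)))).

Program Definition icofree_map (P Q : iobj) (f : imor P Q) : imor (icofree_ob P) (icofree_ob Q) :=
  @IMor (icofree_ob P) (icofree_ob Q) (cofree_red_map (imb f))
    (ss_prod (cofree_map (imt f)) (incl_map (cofree_red_map (imb f)))) _.
Next Obligation. by move=> P Q f; apply: sspace_ext. Qed.

Program Definition icofree : functor integral_cat integral_cat :=
  @Functor integral_cat integral_cat icofree_ob icofree_map _ _.
Next Obligation.
move=> P; apply: imor_ext; apply: sspace_ext => k l x //=; first exact: sig_ext.
by case: x => a b; congr pair; apply: sig_ext.
Qed.
Next Obligation.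
move=> P Q T g f; apply: imor_ext; apply: sspace_ext => k l x //=; first exact: sig_ext.
by case: x => a b; congr pair; apply: sig_ext.
Qed.

Program Definition icofree_unit_at (P : iobj) : imor P (icofree_ob P) :=
  @IMor P (icofree_ob P) (cofree_red_unit (ibase P))
    (ss_pair (cofree_unit (itot P)) (incl_map (cofree_red_unit (ibase P)) ∘ iproj P)) _.
Next Obligation. by move=> P; apply: sspace_ext. Qed.

Program Definition icofree_unit : ntrans (id_functor integral_cat) icofree :=
  @NTrans integral_cat integral_cat (id_functor integral_cat) icofree icofree_unit_at _.
Next Obligation.
move=> P Q f; apply: imor_ext; apply: sspace_ext => k l x /=.
  by apply: sig_ext; do 2![apply: functional_extensionality_dep => ?]; rewrite /= ssNx.
congr pair; first by do 2![apply: functional_extensionality_dep => ?]; rewrite /= ssNx.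
apply: sig_ext; do 2![apply: functional_extensionality_dep => ?] => /=.
by have /= <- := sspace_eqx x (imC f); rewrite ssNx.
Qed.

End CofreeInt.

Section TotInt.

Lemma imb_sq (P Q Q' T : iobj) (g : imor Q T) (f : imor P Q) (g' : imor Q' T) (f' : imor P Q') :
  @cmp integral_cat _ _ _ g f = @cmp integral_cat _ _ _ g' f' ->
  incl_map (imb g) ∘ incl_map (imb f) = incl_map (imb g') ∘ incl_map (imb f').
Proof. exact: (congr1 (fun h : imor P T => incl_map (imb h))). Qed.

Lemma imt_sq (P Q Q' T : iobj) (g : imor Q T) (f : imor P Q) (g' : imor Q' T) (f' : imor P Q') :
  @cmp integral_cat _ _ _ g f = @cmp integral_cat _ _ _ g' f' ->
  imt g ∘ imt f = imt g' ∘ imt f'.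
Proof. exact: (congr1 (fun h : imor P T => imt h)). Qed.

(* Coaugmented semi-cosimplicial simplicial spaces, degree -1 being shifted to 0. *)
Record aug := Aug {
  ag_ob :> nat -> sspace;
  ag_d : forall r, nat -> hom (ag_ob r) (ag_ob r.+1);
  ag_dd : forall r i j, i <= j -> j <= r ->
    ag_d r.+1 j.+1 ∘ ag_d r i = ag_d r.+1 i ∘ ag_d r j }.

(** Dropping the coaugmentation shifts r by one, which turns the bound j <= r of [ag_dd] into the
    bound j <= r.+1 of [cs_dd]. *)
Definition tail (X : aug) : cosim :=
  @Cosim (fun r => X r.+1) (fun r => ag_d X r.+1) (fun r => @ag_dd X r.+1).

Lemma baug_dd P r i j : i <= j -> j <= r ->
  incl_map (imb (coface icofree_unit P r.+1 j.+1)) ∘ incl_map (imb (coface icofree_unit P r i)) =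
  incl_map (imb (coface icofree_unit P r.+1 i)) ∘ incl_map (imb (coface icofree_unit P r j)).
Proof. by move=> ij jr; apply: imb_sq; apply: coface_coface. Qed.

Lemma taug_dd P r i j : i <= j -> j <= r ->
  imt (coface icofree_unit P r.+1 j.+1) ∘ imt (coface icofree_unit P r i) =
  imt (coface icofree_unit P r.+1 i) ∘ imt (coface icofree_unit P r j).
Proof. by move=> ij jr; apply: imt_sq; apply: coface_coface. Qed.

Definition baug (P : iobj) : aug :=
  @Aug (fun r => incl (ibase (res icofree P r))) (fun r i => incl_map (imb (coface icofree_unit P r i)))
    (baug_dd P).

Definition taug (P : iobj) : aug :=
  @Aug (fun r => itot (res icofree P r)) (fun r i => imt (coface icofree_unit P r i)) (taug_dd P).

Definition bcos (P : iobj) := tail (baug P).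
Definition tcos (P : iobj) := tail (taug P).

Definition pcos (P : iobj) : cosim_map (tcos P) (bcos P) :=
  @CosimMap (tcos P) (bcos P) (fun r => iproj (res icofree P r.+1))
    (fun r i => esym (imC (coface icofree_unit P r.+1 i))).

Definition bcos_map (P Q : iobj) (f : imor P Q) : cosim_map (bcos P) (bcos Q) :=
  @CosimMap (bcos P) (bcos Q) (fun r => incl_map (imb (res_map icofree f r.+1)))
    (fun r i => imb_sq (res_map_coface icofree_unit f r.+1 i)).

Definition tcos_map (P Q : iobj) (f : imor P Q) : cosim_map (tcos P) (tcos Q) :=
  @CosimMap (tcos P) (tcos Q) (fun r => imt (res_map icofree f r.+1))
    (fun r i => imt_sq (res_map_coface icofree_unit f r.+1 i)).

Lemma Tot_point (E : cosim) k : (forall r, is_point (E r k)) -> is_point (Tot E k).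
Proof.
move=> rE l.
have pE r j (x y : E r k j) : x = y.
  by have [z [_ zU]] := rE r j; rewrite -(zU x I) (zU y I).
pose e : tot_raw E k l := fun r j _ _ => projT1 (cid (rE r j)).
have ok : tot_ok e by split=> *; apply: pE.
exists (exist _ e ok); split=> // -[e' ok'] _; apply: sig_ext.
by do 4![apply: functional_extensionality_dep => ?]; apply: pE.
Qed.

Definition cobar (P : iobj) : iobj :=
  @IObj (exist _ (Tot (bcos P)) (@Tot_point (bcos P) 0 (fun r => svalP (ibase (res icofree P r.+1)))))
    (Tot (tcos P)) (Tot_map (pcos P)).

Program Definition cobar_map (P Q : iobj) (f : imor P Q) : imor (cobar P) (cobar Q) :=
  @IMor (cobar P) (cobar Q) (Tot_map (bcos_map f)) (Tot_map (tcos_map f)) _.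
Next Obligation.
move=> P Q f; apply: sspace_ext => k l e; apply: sig_ext.
do 4![apply: functional_extensionality_dep => ?].
exact: (sspace_eqx _ (imC (res_map icofree f _))).
Qed.

End TotInt.

(** * Fibrations under the cobar construction *)

Section ResFib.

Definition level_kan (P : iobj) := (forall k, kan (itot P k)) /\ forall k, kan (incl (ibase P) k).

Definition level_kan_fib (P Q : iobj) (f : imor P Q) :=
  (forall k, kan_fib (imt f k)) /\ forall k, kan_fib (incl_map (imb f) k).

Lemma spt_point : spoint spt. Proof. by move=> k; apply: pt_point. Qed.

Lemma kan_point (X : sset) : is_point X -> kan X.
Proof.
move=> pX; apply: kan_fibI => n i; apply: ext_pt => G pG tG.
have [f _] := point_map (simplex n.+1) pX.
exists (graph f); split; [exact: graph_pmap | by move=> k b _; exists (f k b) |].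
by move=> k b x _ _; have [z [_ zU]] := pX k; rewrite /graph -(zU x I) (zU (f k b) I).
Qed.

Lemma spoint_cofree (X : sspace) : spoint X -> spoint (cofree X).
Proof.
move=> pX k l; have pE m (x y : X m l) : x = y.
  by have [z [_ zU]] := pX m l; rewrite -(zU x I) (zU y I).
exists (fun m _ => projT1 (cid (pX m l))); split=> // x _.
by do 2![apply: functional_extensionality_dep => ?]; apply: pE.
Qed.

Lemma spoint_cofree_red (A : rsspace) : spoint (incl A) -> spoint (incl (cofree_red A)).
Proof.
move=> pA k l; have pE m (x y : incl A m l) : x = y.
  by have [z [_ zU]] := pA m l; rewrite -(zU x I) (zU y I).
have be : @based A k l (fun m _ => basept A m l) by [].
exists (exist _ _ be); split=> // x _; apply: sig_ext.
by do 2![apply: functional_extensionality_dep => ?]; apply: pE.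
Qed.

Lemma rfib_prod (X Y X' Y' : sspace) (f : hom X X') (g : hom Y Y') :
  rfib f -> rfib g -> rfib (ss_prod f g).
Proof.
move=> ff fg B P G v cP tP pG tG Gv.
have side (Z Z' : sspace) (h : hom Z Z') (p : hom (prodSS X Y) Z) (p' : hom (prodSS X' Y') Z') :
    rfib h -> p' ∘ ss_prod f g = h ∘ p -> exists w : hom B Z,
    (forall k l b x, P k l b -> G k l b x -> w k l b = p k l x) /\
    forall k l b, h k l (w k l b) = p' k l (v k l b).
  move=> fh e.
  have [|||w [wG wv]] := fh B P (fun k l b z => exists2 x, G k l b x & p k l x = z) (p' ∘ v) cP tP.
  - split=> [k|j k t l b z [x Gx <-]]; first exact: pmap_post (spm_in pG k).
    by exists ((prodSS X Y).[t] l x); [apply: (spm_out pG) | rewrite ssNx].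
  - by move=> k l b /tG[x Gx]; exists (p k l x), x.
  - by move=> k l b z Pb [x Gx <-]; rewrite -[LHS](sspace_eqx x e) /= -(Gv _ _ _ _ Pb Gx).
  by exists w; split=> // k l b x Pb Gx; apply: wG => //; exists x.
have [|wf [wfG wfv]] := @side _ _ f (ss_fst X Y) (ss_fst X' Y') ff; first exact: sspace_ext.
have [|wg [wgG wgv]] := @side _ _ g (ss_snd X Y) (ss_snd X' Y') fg; first exact: sspace_ext.
exists (ss_pair wf wg); split=> [k l b x Pb Gx|k l b] /=.
  by rewrite (wfG _ _ _ _ Pb Gx) (wgG _ _ _ _ Pb Gx); case: x {Gx}.
by rewrite wfv wgv; case: (v k l b).
Qed.

Lemma cofree_kan (X : sspace) k : (forall m, kan (X m)) -> kan (cofree X k).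
Proof.
move=> kX; apply: rfib_kan; apply: (rfib_spoint (spoint_cofree spt_point)).
apply: (@cofree_rfib X spt (to_spt X)) => // m.
by apply: kan_point; apply: pt_point.
Qed.

Lemma cofree_red_kan (A : rsspace) k : (forall m, kan (incl A m)) -> kan (incl (cofree_red A) k).
Proof.
move=> kX; apply: rfib_kan; apply: (rfib_spoint (@spoint_cofree_red rpt spt_point)).
apply: (@cofree_red_rfib A rpt (to_spt (incl A))) => // m.
by apply: kan_point; apply: pt_point.
Qed.

Lemma icofree_level_kan P : level_kan P -> level_kan (icofree P).
Proof.
move=> [kt kb]; split=> k; last exact: cofree_red_kan.
by apply: kan_prodS; [apply: cofree_kan | apply: cofree_red_kan].
Qed.

Lemma icofree_base_rfib (P Q : iobj) (f : imor P Q) : level_kan P -> level_kan Q -> level_kan_fib f ->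
  rfib (incl_map (imb (fmap icofree f : imor (icofree P) (icofree Q)))).
Proof. by move=> [_ kP] [_ kQ] [_ fb]; apply: cofree_red_rfib. Qed.

Lemma icofree_level_kan_fib (P Q : iobj) (f : imor P Q) : level_kan P -> level_kan Q -> level_kan_fib f ->
  level_kan_fib (fmap icofree f : imor (icofree P) (icofree Q)).
Proof.
move=> kP kQ lf; have fb := icofree_base_rfib kP kQ lf.
split=> k; apply: rfib_kan_fib => //; apply: rfib_prod => //.
by case: kP kQ lf => [? _] [? _] [? _]; apply: cofree_rfib.
Qed.

(** Between product projections the pullback is the product of [A] and [Y], so the adjunct is a base
    change of [f]: only the first coordinate has to be lifted. *)
Lemma prod_adjunct_rfib (X Y A C : sspace) (f : hom X Y) (g : hom A C)
    (sq : g ∘ ss_snd X A = ss_snd Y C ∘ ss_prod f g) : rfib f -> rfib (pb_map sspace_pb sq).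
Proof.
move=> ff B P G v cP tP pG tG Gv.
have [|||w [wG wv]] := ff B P (fun k l b z => exists2 x, G k l b x & x.1 = z)
    (ss_fst Y C ∘ (pb2 sspace_pb _ _ ∘ v)) cP tP.
- split=> [k|j k t l b z [x Gx <-]].
    exact: pmap_post (ss_fst X A k) (spm_in pG k).
  by exists ((prodSS X A).[t] l x); [apply: (spm_out pG) | ].
- by move=> k l b /tG[x Gx]; exists x.1, x.
- by move=> k l b z Pb [x Gx <-]; rewrite /= -(Gv _ _ _ _ Pb Gx).
exists (ss_pair w (pb1 sspace_pb _ _ ∘ v)); split=> [k l b x Pb Gx|k l b].
  rewrite /= (wG _ _ _ x.1 Pb); last by exists x.
  by rewrite -(Gv _ _ _ _ Pb Gx) /=; case: x {Gx}.
apply: sig_ext; have e2 := svalP (v k l b); have e1 := wv k l b.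
change (((sval (v k l b)).1, (f k l (w k l b), g k l (sval (v k l b)).1)) = sval (v k l b)).
rewrite e1 /=; move: e2; case: (sval (v k l b)) => a [b1 b2] /= e2.
by congr (_, (_, _)).
Qed.

Lemma icofree_adjunct_rfib (P Q : iobj) (f : imor P Q) : level_kan P -> level_kan Q -> level_kan_fib f ->
  rfib (adjunct (fmap icofree f : imor (icofree P) (icofree Q))).
Proof.
move=> [kP _] [kQ _] [ft _]; apply: prod_adjunct_rfib.
exact: cofree_rfib.
Qed.

Lemma res_level_kan P r : level_kan P -> level_kan (res icofree P r).
Proof. by move=> kP; elim: r => // r IH; apply: icofree_level_kan. Qed.

Lemma res_level_kan_fib (P Q : iobj) (f : imor P Q) r : level_kan P -> level_kan Q -> level_kan_fib f ->
  level_kan_fib (res_map icofree f r : imor (res icofree P r) (res icofree Q r)).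
Proof.
move=> kP kQ lf; elim: r => // r IH.
by apply: icofree_level_kan_fib => //; apply: res_level_kan.
Qed.

Lemma cobar_base_rfib (P Q : iobj) (f : imor P Q) : level_kan P -> level_kan Q -> level_kan_fib f ->
  rfib (incl_map (imb (cobar_map f))).
Proof.
move=> kP kQ lf; apply: Tot_rfib => r.
by apply: icofree_base_rfib; [apply: res_level_kan | apply: res_level_kan | apply: res_level_kan_fib].
Qed.

Section PullbackTot.
Variables (E1 E2 F : cosim) (a : cosim_map E1 F) (b : cosim_map E2 F).

Lemma pbcos_sq r i : a r.+1 ∘ (cs_d E1 r i ∘ pb1 sspace_pb (a r) (b r)) =
  b r.+1 ∘ (cs_d E2 r i ∘ pb2 sspace_pb (a r) (b r)).
Proof. by rewrite !cmpA !cm_N -!cmpA pb_sq. Qed.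

Program Definition pbcos : cosim :=
  @Cosim (fun r => pb sspace_pb (a r) (b r)) (fun r i => pb_map sspace_pb (pbcos_sq r i)) _.
Next Obligation.
move=> r i j ij jr; apply: sspace_ext => k l e; apply: sig_ext => /=; congr pair.
- exact: sspace_eqx (@cs_dd E1 r i j ij jr).
- exact: sspace_eqx (@cs_dd E2 r i j ij jr).
Qed.

Variables (T : cosim) (p1 : cosim_map T E1) (p2 : cosim_map T E2).
Hypothesis sq : forall r, a r ∘ p1 r = b r ∘ p2 r.

Program Definition pbcos_map : cosim_map T pbcos :=
  @CosimMap T pbcos (fun r => pb_map sspace_pb (sq r)) _.
Next Obligation.
move=> r i; apply: sspace_ext => k l e; apply: sig_ext => /=; congr pair.
- exact: sspace_eqx (@cm_N _ _ p1 r i).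
- exact: sspace_eqx (@cm_N _ _ p2 r i).
Qed.

Hypothesis Tsq : Tot_map a ∘ Tot_map p1 = Tot_map b ∘ Tot_map p2.

(** Totalization commutes with pullbacks: through [i] the problem becomes one for the totalization
    of the levelwise pullbacks, where [Tot_rfib] applies. *)
Lemma Tot_pb_rfib : (forall r, rfib (pb_map sspace_pb (sq r))) -> rfib (pb_map sspace_pb Tsq).
Proof.
move=> fr; have fT : rfib (Tot_map pbcos_map) by apply: Tot_rfib.
pose Y := pb sspace_pb (Tot_map a) (Tot_map b).
have ysq k l (y : Y k l) r j t u :
    a r k j (sval (sval y).1 r j t u) = b r k j (sval (sval y).2 r j t u).
  exact: (congr1 (fun e : Tot F k l => sval e r j t u) (svalP y)).
have ok k l (y : Y k l) : tot_ok (E := pbcos) ((fun r j t u => exist _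
    (sval (sval y).1 r j t u, sval (sval y).2 r j t u) (ysq k l y r j t u)) : tot_raw pbcos k l).
  have [y1N y1D] := svalP (sval y).1; have [y2N y2D] := svalP (sval y).2.
  split=> *; apply: sig_ext; congr pair; [exact: y1N | exact: y2N | exact: y1D | exact: y2D].
have iN k l m (s : Delta l m) : (fun y => exist _ _ (ok k l ((Y k).[s] y)) : Tot pbcos k l) =
    (fun y => (Tot pbcos k).[s] (exist _ _ (ok k m y) : Tot pbcos k m)).
  apply: functional_extensionality_dep => y; apply: sig_ext.
  by do 4![apply: functional_extensionality_dep => ?]; apply: sig_ext.
have iO j k (s : Delta j k) :
    @cmp sset _ _ _ (@SMor Types (Y j) (Tot pbcos j) (fun l y => exist _ _ (ok j l y)) (iN j)) Y.[s] =
    @cmp sset _ _ _ (Tot pbcos).[s] (@SMor Types (Y k) (Tot pbcos k) (fun l y => exist _ _ (ok k l y)) (iN k)).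
  apply: sset_ext => l y; apply: sig_ext.
  by do 4![apply: functional_extensionality_dep => ?]; apply: sig_ext.
pose i : hom Y (Tot pbcos) := @SMor sset Y (Tot pbcos) _ iO.
move=> B P' G v cP tP pG tG Gv.
have [|h [hG hv]] := fT B P' G (i ∘ v) cP tP pG tG.
  move=> k l x y Px Gy; rewrite /= -(Gv _ _ _ _ Px Gy); apply: sig_ext.
  by do 4![apply: functional_extensionality_dep => ?]; apply: sig_ext.
exists h; split=> // k l x; apply: sig_ext; rewrite [RHS]surjective_pairing.
have hb r j t u := congr1 (fun e : Tot pbcos k l => sval (sval e r j t u)) (hv k l x).
congr pair; apply: sig_ext;
  apply: functional_extensionality_dep => r; apply: functional_extensionality_dep => j;
  apply: functional_extensionality_dep => t; apply: functional_extensionality_dep => u.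
- by have e := hb r j t u; exact (congr1 fst e).
- by have e := hb r j t u; exact (congr1 snd e).
Qed.

End PullbackTot.

Lemma cobar_adjunct_rfib (P Q : iobj) (f : imor P Q) : level_kan P -> level_kan Q -> level_kan_fib f ->
  rfib (adjunct (cobar_map f)).
Proof.
move=> kP kQ lf.
apply: (@Tot_pb_rfib _ _ _ (bcos_map f) (pcos Q) _ (pcos P) (tcos_map f)
   (fun r => imC (res_map icofree f r.+1))) => r.
by apply: icofree_adjunct_rfib; [apply: res_level_kan | apply: res_level_kan | apply: res_level_kan_fib].
Qed.

End ResFib.

(** * The coaugmentation of the cobar construction is a degreewise equivalence *)

Section Contraction.

Definition dcone_fun r j (t : Delta j r) (w : Delta j 1) (s : 'I_j.+1) : 'I_r.+2 :=
  inord (if w s == ord0 then 0 else (t s).+1).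

Lemma dcone_homo r j (t : Delta j r) (w : Delta j 1) : {homo dcone_fun t w : i k / i <= k}.
Proof.
move=> i k ik; rewrite /dcone_fun; have ht := Delta_homo t ik; have hw := Delta_homo w ik.
have bd s : (if w s == ord0 then 0 else (t s).+1) < r.+2.
  by case: ifP => // _; apply: (ltn_ord (t s)).
rewrite !inordK ?bd //; case: ifP => hi; case: ifP => hk //.
by move/eqP: hk hw hi => -> /=; rewrite leqn0 -val_eqE /= => ->.
Qed.

(* The contraction of Delta^(r+1), restricted to its face opposite to the vertex 0. *)
Definition dcone r j (t : Delta j r) (w : Delta j 1) : Delta j r.+1 := mkDelta (dcone_homo t w).

Lemma dconeE r j (t : Delta j r) (w : Delta j 1) s :
  dcone t w s = (if w s == ord0 then 0 else (t s).+1) :> nat.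
Proof. by rewrite mkDeltaE /dcone_fun inordK //; case: ifP => // _; apply: (ltn_ord (t s)). Qed.

Lemma dcone_cmp r j j' (t : Delta j r) (w : Delta j 1) (a : Delta j' j) :
  dcmp (dcone t w) a = dcone (dcmp t a) (dcmp w a).
Proof. by apply: Delta_ext => s; apply: val_inj; rewrite /= dcmpE !dconeE !dcmpE. Qed.

Lemma dcone0 r j (t : Delta j r) :
  dcone t (dconst j ord0) = dcmp (dface ord_max) (dconst j ord0).
Proof.
apply: Delta_ext => s; apply: val_inj.
by rewrite /= dcmpE dconeE dface_val !dconstE eqxx /= /bump; lia.
Qed.

Lemma dcone1 r j (t : Delta j r) : dcone t (dconst j ord_max) = dcmp (dface ord0) t.
Proof. by apply: Delta_ext => s; apply: val_inj; rewrite /= dcmpE dconeE dface_val !dconstE. Qed.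

Lemma dcone_face r j (i : 'I_r.+2) (t : Delta j r) (w : Delta j 1) :
  dcone (dcmp (dface i) t) w = dcmp (dface (lift ord0 i)) (dcone t w).
Proof.
apply: Delta_ext => s; apply: val_inj.
rewrite /= dcmpE dconeE dface_val dconeE dcmpE dface_val lift0 /bump.
by case: ifP => _; lia.
Qed.

Section Unit.
Variable X : aug.

Fixpoint iter_unit r : hom (X 0) (X r) :=
  match r return hom (X 0) (X r) with
  | 0 => idm (X 0)
  | r'.+1 => ag_d X r' 0 ∘ iter_unit r'
  end.

(** All cofaces agree on elements coming from the coaugmentation, which is why these give compatible
    families. *)
Lemma iter_unit_coface r i : i <= r -> ag_d X r i ∘ iter_unit r = iter_unit r.+1.
Proof.
elim: r i => [|r IH] [|i] // ir.
by rewrite [iter_unit r.+1]/= cmpA ag_dd // -cmpA (IH i).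
Qed.

Lemma aug_unit_ok k l (z : X 0 k l) : tot_ok (E := tail X)
  ((fun r j t u => iter_unit r.+1 k j ((X 0 k).[u] z)) : tot_raw (tail X) k l).
Proof.
split=> [r j j' a t u|r i j t u]; first by rewrite smapMx smNx.
by rewrite -[LHS](sspace_eqx _ (@iter_unit_coface r.+1 i (leq_ord i))).
Qed.

Program Definition aug_unit : hom (X 0) (Tot (tail X)) :=
  @SMor sset (X 0) (Tot (tail X)) (fun k => @SMor Types (X 0 k) (Tot (tail X) k)
    (fun l z => exist _ _ (aug_unit_ok z)) _) _.
Next Obligation.
move=> k l m s; apply: functional_extensionality_dep => z; apply: sig_ext.
by do 4![apply: functional_extensionality_dep => ?]; rewrite /= smapMx.
Qed.
Next Obligation.
move=> j k s; apply: sset_ext => l z; apply: sig_ext.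
apply: functional_extensionality_dep => r; apply: functional_extensionality_dep => i.
apply: functional_extensionality_dep => t; apply: functional_extensionality_dep => u.
apply: etrans (ssNx (iter_unit r.+1) s ((X 0 k).[u] z)).
exact: (congr1 (iter_unit r.+1 j i) (esym (smNx (X 0).[s] u z))).
Qed.

Variables (k : nat) (rho : forall r, hom (X r.+1 k) (X r k)).
(* Evaluation at the identity of [k] is an extra codegeneracy in each fixed degree k. *)
Hypothesis rho0 : forall r, rho r ∘ ag_d X r 0 k = idm (X r k).
Hypothesis rhoS : forall r i, rho r.+1 ∘ ag_d X r.+1 i.+1 k = ag_d X r i k ∘ rho r.

Lemma rho0x r l x : rho r l (ag_d X r 0 k l x) = x.
Proof. exact: (sset_eqx x (rho0 r)). Qed.

Lemma rhoSx r i l x : rho r.+1 l (ag_d X r.+1 i.+1 k l x) = ag_d X r i k l (rho r l x).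
Proof. exact: (sset_eqx x (rhoS r i)). Qed.

Program Definition aug_retr : hom (Tot (tail X) k) (X 0 k) :=
  @SMor Types (Tot (tail X) k) (X 0 k)
    (fun l e => rho 0 l (sval e 0 l (dsurj l) (did l))) _.
Next Obligation.
move=> l m s; apply: functional_extensionality_dep => e /=.
by rewrite -smNx -(proj1 (svalP e)) dcmpf1 dcmp1f (Delta0_eq (dcmp _ _) (dsurj l)).
Qed.

(** Evaluate on the cone and return one level down by the extra codegeneracy: coning shifts face
    indices up by one and [rho] shifts them down again. At the end 1 this gives back [e], at the end
    0 only the cone point is seen. *)
Lemma aug_htpy_ok l (e : Tot (tail X) k l) (w : Delta l 1) : tot_ok (E := tail X)
  ((fun r j t u => rho r.+1 j (sval e r.+1 j (dcone t (dcmp w u)) u)) : tot_raw (tail X) k l).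
Proof.
have [eN eD] := svalP e.
split=> [r j j' a t u|r i j t u].
- by rewrite dcmpA -dcone_cmp eN smNx.
- by rewrite dcone_face eD lift0 -rhoSx.
Qed.

Program Definition aug_htpy : hom (prodS (Tot (tail X) k) (simplex 1)) (Tot (tail X) k) :=
  @SMor Types (prodS (Tot (tail X) k) (simplex 1)) (Tot (tail X) k)
    (fun l z => exist _ _ (aug_htpy_ok z.1 z.2)) _.
Next Obligation.
move=> l m s; apply: functional_extensionality_dep => z; apply: sig_ext.
by do 4![apply: functional_extensionality_dep => ?]; rewrite /= dcmpA.
Qed.

(** The vertex 0 of each simplex is reached from that of the point by last cofaces only, and [rho]
    lowers each of these to a last coface one level below. *)
Lemma aug_iter l (e : Tot (tail X) k l) r j (u : Delta j l) :
  rho r.+1 j (sval e r.+1 j (dconst j ord0) u) = iter_unit r.+1 k j (rho 0 j (sval e 0 j (dsurj j) u)).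
Proof.
have [eN eD] := svalP e.
have st q : rho q.+1 j (sval e q.+1 j (dconst j ord0) u) =
    ag_d X q q k j (rho q j (sval e q j (dconst j ord0) u)).
  have -> : dconst j (ord0 : 'I_q.+2) = dcmp (dface ord_max) (dconst j ord0).
    by rewrite -(dcone0 (dconst j ord0)); apply: Delta_ext => s; apply: val_inj;
      rewrite /= dconeE !dconstE.
  by rewrite eD rhoSx.
elim: r => [|r IH]; rewrite st.
  by rewrite /=; congr (ag_d _ _ _ _ _ _).
by rewrite IH -[LHS]/((ag_d X r.+1 r.+1 ∘ iter_unit r.+1) k j _) iter_unit_coface.
Qed.

Lemma aug_unit_hequiv : hequiv (aug_unit k).
Proof.
exists aug_retr; split.
  have -> : aug_retr ∘ aug_unit k = idm (X 0 k); last exact: homotopic_refl.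
  by apply: sset_ext => l z; rewrite /= rho0x smap1x.
exists aug_htpy => l e; split; apply: sig_ext;
  apply: functional_extensionality_dep => r; apply: functional_extensionality_dep => j;
  apply: functional_extensionality_dep => t; apply: functional_extensionality_dep => u.
- rewrite /= dconst_cmp dcone0.
  have -> : dcmp (dface ord_max) (dconst j (ord0 : 'I_r.+1)) = dconst j ord0.
    by rewrite -(dcone0 (dconst j ord0)); apply: Delta_ext => s; apply: val_inj;
      rewrite /= dconeE !dconstE.
  rewrite aug_iter /= -smNx -(proj1 (svalP e)).
  by rewrite dcmp1f (Delta0_eq (dcmp _ _) (dsurj j)).
- by rewrite /= dconst_cmp dcone1 (proj2 (svalP e)) rho0x.
Qed.

End Unit.

Lemma base_unit_hequiv P k : hequiv (aug_unit (baug P) k).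
Proof.
pose rho r : hom (baug P r.+1 k) (baug P r k) :=
  cofree_ev (incl (ibase (res icofree P r))) k ∘ cofree_red_incl (ibase (res icofree P r)) k.
apply: (@aug_unit_hequiv (baug P) k rho) => [r|r i]; apply: sset_ext => l x //.
by rewrite /= coface0 /= ssmap1.
Qed.

Lemma tot_unit_hequiv P k : hequiv (aug_unit (taug P) k).
Proof.
pose rho r : hom (taug P r.+1 k) (taug P r k) :=
  cofree_ev (itot (res icofree P r)) k ∘ ss_fst (cofree (itot (res icofree P r))) (incl (cofree_red (ibase (res icofree P r)))) k.
apply: (@aug_unit_hequiv (taug P) k rho) => [r|r i]; apply: sset_ext => l x //.
by rewrite /= coface0 /= ssmap1.
Qed.

Lemma cobar_unit_sq P : incl_map (aug_unit (baug P) : hom (ibase P) (ibase (cobar P))) ∘ iproj P =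
  iproj (cobar P) ∘ (aug_unit (taug P) : hom (itot P) (itot (cobar P))).
Proof.
have it r : iter_unit (baug P) r ∘ iproj P = iproj (res icofree P r) ∘ iter_unit (taug P) r.
  elim: r => [|r IH]; first by apply: sspace_ext.
  rewrite [iter_unit (baug P) r.+1]/= -cmpA IH !cmpA.
  by congr (_ ∘ _); exact: (imC (coface icofree_unit P r 0)).
apply: sspace_ext => k l x; apply: sig_ext.
apply: functional_extensionality_dep => r; apply: functional_extensionality_dep => j.
apply: functional_extensionality_dep => t; apply: functional_extensionality_dep => u.
exact (etrans (congr1 (iter_unit (baug P) r.+1 k j) (esym (smNx (iproj P k) u x)))
  (sspace_eqx ((itot P k).[u] x) (it r.+1))).
Qed.

Definition cobar_unit P : imor P (cobar P) := IMor (cobar_unit_sq P).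

Lemma cobar_unit_nat (P Q : iobj) (f : imor P Q) :
  (cobar_unit Q : @hom integral_cat _ _) ∘ f = (cobar_map f : @hom integral_cat _ _) ∘ cobar_unit P.
Proof.
have bN r : incl_map (imb (res_map icofree f r)) ∘ iter_unit (baug P) r =
    iter_unit (baug Q) r ∘ incl_map (imb f).
  elim: r => [|r IH]; first by apply: sspace_ext.
  rewrite [iter_unit (baug P) r.+1]/= [iter_unit (baug Q) r.+1]/= -cmpA -IH !cmpA.
  by congr (_ ∘ _); exact: imb_sq (@res_map_coface _ _ icofree_unit P Q f r 0).
have tN r : imt (res_map icofree f r) ∘ iter_unit (taug P) r = iter_unit (taug Q) r ∘ imt f.
  elim: r => [|r IH]; first by apply: sspace_ext.
  rewrite [iter_unit (taug P) r.+1]/= [iter_unit (taug Q) r.+1]/= -cmpA -IH !cmpA.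
  by congr (_ ∘ _); exact: imt_sq (@res_map_coface _ _ icofree_unit P Q f r 0).
apply: imor_ext; apply: sspace_ext => k l x; apply: sig_ext;
apply: functional_extensionality_dep => r; apply: functional_extensionality_dep => j;
apply: functional_extensionality_dep => t; apply: functional_extensionality_dep => u.
- exact (etrans (congr1 (iter_unit (baug Q) r.+1 k j) (esym (smNx (incl_map (imb f) k) u x)))
  (esym (sspace_eqx ((incl (ibase P) k).[u] x) (bN r.+1)))).
- exact (etrans (congr1 (iter_unit (taug Q) r.+1 k j) (esym (smNx (imt f k) u x)))
  (esym (sspace_eqx ((itot P k).[u] x) (tN r.+1)))).
Qed.

End Contraction.

(** * Strict limits *)

Section Limits.

(** Limits of simplicial spaces are computed simplex by simplex; in this form they visibly pass
    through constructions made of families of simplices. *)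
Record plim (L : sspace) (T : nat -> sspace) (tm : forall n, hom (T n.+1) (T n))
    (l : forall n, hom L (T n)) : Prop := Slim {
  plim_ex : forall k j (x : forall n, T n k j), (forall n, tm n k j (x n.+1) = x n) ->
    exists z, forall n, l n k j z = x n;
  plim_inj : forall k j z z', (forall n, l n k j z = l n k j z') -> z = z' }.

Lemma plim_map (L : sspace) (T : nat -> sspace) (tm : forall n, hom (T n.+1) (T n))
    (l : forall n, hom L (T n)) (W : sspace) (c : forall n, hom W (T n)) : plim tm l ->
  (forall n, tm n ∘ c n.+1 = c n) ->
  exists2 h : hom W L, forall n, l n ∘ h = c n & forall h', (forall n, l n ∘ h' = c n) -> h' = h.
Proof.
move=> [lex linj] cN.
have [||h hP] := @spmap_total W L (fun k j w z => forall n, l n k j z = c n k j w).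
- split=> [k|k' k t j w z h n]; last by rewrite !ssNx h.
  split=> [j j' t w z h n|j w z z' h h']; first by rewrite !smNx h.
  by apply: linj => n; rewrite h h'.
- move=> k j w; apply: lex => n; exact: sspace_eqx (cN n).
exists h => [n|h' h'P]; first by apply: sspace_ext => k j w; apply: hP.
by apply: sspace_ext => k j w; apply: linj => n; rewrite hP; apply: sspace_eqx (h'P n).
Qed.

Lemma plim_cofree (L : sspace) (T : nat -> sspace) (tm : forall n, hom (T n.+1) (T n))
    (l : forall n, hom L (T n)) : plim tm l -> plim (fun n => cofree_map (tm n)) (fun n => cofree_map (l n)).
Proof.
move=> [lex linj]; split=> [k j x xN|k j z z' e].
- have ex m (s : Delta m k) : exists z, forall n, l n m j z = x n m s.
    by apply: lex => n; rewrite -[RHS](congr1 (fun e : cofree (T n) k j => e m s) (xN n)).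
  exists (fun m s => projT1 (cid (ex m s))) => n.
  by do 2![apply: functional_extensionality_dep => ?] => /=; case: cid => z /= ->.
- apply: functional_extensionality_dep => m; apply: functional_extensionality_dep => s.
  by apply: linj => n; apply: (congr1 (fun e : cofree (T n) k j => e m s) (e n)).
Qed.

Lemma plim_cofree_red (L : rsspace) (T : nat -> rsspace) (tm : forall n, hom (T n.+1) (T n))
    (l : forall n, hom L (T n)) : plim (fun n => incl_map (tm n)) (fun n => incl_map (l n)) ->
  plim (fun n => incl_map (cofree_red_map (tm n))) (fun n => incl_map (cofree_red_map (l n))).
Proof.
move=> h; have [lex linj] := plim_cofree h; split=> [k j x xN|k j z z' e].
- have [|z zP] := lex k j (fun n => sval (x n)).
    by move=> n; rewrite -[in RHS]xN.
  have bz : based (A := L) z.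
    move=> m i; apply: (plim_inj h) => n; rewrite basept_map.
    by rewrite -(svalP (x n) m i) -zP.
  by exists (exist _ z bz) => n; apply: sig_ext; apply: zP.
- by apply: sig_ext; apply: linj => n; apply: (congr1 sval (e n)).
Qed.

Lemma plim_prod (L L' : sspace) (T T' : nat -> sspace) (tm : forall n, hom (T n.+1) (T n))
    (tm' : forall n, hom (T' n.+1) (T' n)) (l : forall n, hom L (T n))
    (l' : forall n, hom L' (T' n)) : plim tm l -> plim tm' l' ->
  plim (fun n => ss_prod (tm n) (tm' n)) (fun n => ss_prod (l n) (l' n)).
Proof.
move=> [lex linj] [lex' linj']; split=> [k j x xN|k j [z w] [z' w'] e].
- have [|z zP] := lex k j (fun n => (x n).1); first by move=> n; rewrite -[in RHS]xN.
  have [|w wP] := lex' k j (fun n => (x n).2); first by move=> n; rewrite -[in RHS]xN.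
  by exists (z, w) => n; rewrite /= zP wP; case: (x n).
- congr pair; [apply: linj => n | apply: linj' => n].
    exact (congr1 fst (e n)).
  exact (congr1 snd (e n)).
Qed.

Lemma plim_Tot (L : cosim) (T : nat -> cosim) (tm : forall n, cosim_map (T n.+1) (T n))
    (l : forall n, cosim_map L (T n)) : (forall r, plim (fun n => tm n r) (fun n => l n r)) ->
  plim (fun n => Tot_map (tm n)) (fun n => Tot_map (l n)).
Proof.
move=> h; split=> [k m x xN|k m z z' e].
- have ex r j (t : Delta j r) (u : Delta j m) :
      exists z, forall n, l n r k j z = sval (x n) r j t u.
    by apply: (plim_ex (h r)) => n; rewrite -[in RHS]xN.
  pose z : tot_raw L k m := fun r j t u => projT1 (cid (ex r j t u)).
  have zP r j t u n : l n r k j (z r j t u) = sval (x n) r j t u by rewrite /z; case: cid.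
  have ok : tot_ok z.
    split=> [r j j' a t u|r i j t u]; apply: (plim_inj (h _)) => n; rewrite zP.
    + by rewrite smNx zP (proj1 (svalP (x n))).
    + rewrite (proj2 (svalP (x n))) -zP.
      by apply: esym; apply: (sspace_eqx (z r j t u) (@cm_N _ _ (l n) r i)).
  exists (exist _ z ok) => n; apply: sig_ext.
  by do 4![apply: functional_extensionality_dep => ?]; apply: zP.
- apply: sig_ext; apply: functional_extensionality_dep => r.
  apply: functional_extensionality_dep => j; apply: functional_extensionality_dep => t.
  apply: functional_extensionality_dep => u; apply: (plim_inj (h r)) => n.
  exact: (congr1 (fun y : Tot (T n) k m => sval y r j t u) (e n)).
Qed.

Definition ilim (L : iobj) (T : nat -> iobj) (tm : forall n, imor (T n.+1) (T n))
    (l : forall n, imor L (T n)) :=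
  plim (fun n => incl_map (imb (tm n))) (fun n => incl_map (imb (l n))) /\
  plim (fun n => imt (tm n)) (fun n => imt (l n)).

Lemma ilim_res (L : iobj) (T : nat -> iobj) (tm : forall n, imor (T n.+1) (T n))
    (l : forall n, imor L (T n)) r : ilim tm l ->
  ilim (L := res icofree L r) (T := fun n => res icofree (T n) r)
    (fun n => res_map icofree (tm n) r) (fun n => res_map icofree (l n) r).
Proof.
move=> h; elim: r => // r [IHb IHt].
have hb := plim_cofree_red IHb; split; first exact: hb.
exact: plim_prod (plim_cofree IHt) hb.
Qed.

Lemma ilim_cobar (L : iobj) (T : nat -> iobj) (tm : forall n, imor (T n.+1) (T n))
    (l : forall n, imor L (T n)) : ilim tm l ->
  ilim (L := cobar L) (T := fun n => cobar (T n)) (fun n => cobar_map (tm n)) (fun n => cobar_map (l n)).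
Proof.
move=> h; split; apply: plim_Tot => r; first exact: (proj1 (ilim_res r.+1 h)).
exact: (proj2 (ilim_res r.+1 h)).
Qed.

Lemma ilim_limit (T : tower integral_cat) (L : integral_cat) (l : cone L T) :
  ilim (tmap T) l -> is_limit l.
Proof.
move=> [hb ht] w c.
have cb n : incl_map (imb (tmap T n)) ∘ incl_map (imb (c n.+1)) = incl_map (imb (c n)).
  exact (congr1 (fun h : imor w (T n) => incl_map (imb h)) (legN c n)).
have ct n : imt (tmap T n) ∘ imt (c n.+1) = imt (c n).
  exact (congr1 (fun h : imor w (T n) => imt h) (legN c n)).
have [b bP bU] := plim_map hb cb; have [t tP tU] := plim_map ht ct.
have sq : incl_map (b : @hom rsspace (ibase w) (ibase L)) ∘ iproj w = iproj L ∘ t.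
  apply: sspace_ext => k j x; apply: (plim_inj hb) => n.
  rewrite -[LHS]/((incl_map (imb (l n)) ∘ b) k j (iproj w k j x)) bP.
  have e1 := sspace_eqx x (imC (c n)); have e2 := sspace_eqx (t k j x) (imC (l n)).
  apply: etrans e1 _; apply: etrans _ (esym e2).
  by rewrite -tP.
exists (IMor sq : @hom integral_cat w L); split.
  by move=> n; apply: imor_ext; [apply: bP | apply: tP].
move=> h hP; apply: imor_ext.
- apply: esym; apply: bU => n; exact (congr1 (fun u : imor w (T n) => incl_map (imb u)) (hP n)).
- apply: esym; apply: tU => n; exact (congr1 (fun u : imor w (T n) => imt u) (hP n)).
Qed.

End Limits.

(** * The tower of Moore-Postnikov quotients in the integral category *)

Section MooreTower.

Lemma moore_pt n (X : sset) : is_point X -> is_point (moore n X).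
Proof.
move=> pX k; have [x [_ xU]] := pX k; exists (mq n X k x); split=> // u _.
by have [z <-] := mq_surj u; rewrite (xU z).
Qed.

Definition moore_red n (A : rsspace) : rsspace :=
  exist _ (levelwise (moore n) (incl A)) (@moore_pt n (incl A 0) (svalP A)).

Definition imoore n (P : iobj) : iobj :=
  @IObj (moore_red n (ibase P)) (levelwise (moore n) (itot P)) (fmap (levelwise (moore n)) (iproj P)).

Definition imoore_tower n (P : iobj) : imor (imoore n.+1 P) (imoore n P) :=
  @IMor (imoore n.+1 P) (imoore n P) (levelwise_nt (moore_tower n) (incl (ibase P)))
    (levelwise_nt (moore_tower n) (itot P)) (ntN (levelwise_nt (moore_tower n)) (iproj P)).

Definition imoore_unit n (P : iobj) : imor P (imoore n P) :=
  @IMor P (imoore n P) (levelwise_unit (mq n) (incl (ibase P)))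
    (levelwise_unit (mq n) (itot P)) (ntN (levelwise_unit (mq n)) (iproj P)).

(** In inner degree j the quotient map to stage j is injective, so the entry [x j] alone determines
    the simplex [z]. Stages above j follow by this injectivity, stages below by applying the tower
    maps. *)
Lemma plim_moore (X : sspace) :
  plim (fun n => levelwise_nt (moore_tower n) X) (fun n => levelwise_unit (mq n) X).
Proof.
split=> [k j x xN|k j z z' e]; last first.
  by have /mq_eq/agree_full := e j; apply.
have [z zE] := mq_surj (x j); exists z => n.
have dn d : mq (j + d) (X k) j z = x (j + d).
  elim: d => [|d IH]; first by rewrite addn0.
  rewrite addnS; have [z' z'E] := mq_surj (x (j + d).+1); rewrite -z'E.
  have zz : mq (j + d) (X k) j z = mq (j + d) (X k) j z'.
    rewrite IH -(xN (j + d)) -z'E; exact: moore_tower_mq.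
  by have /mq_eq/(agree_full (leq_addr d j)) -> := zz.
have [jn|nj] := leqP j n; first by rewrite -(subnKC jn); apply: dn.
have up d i : i + d = j -> mq i (X k) j z = x i.
  elim: d i => [|d IH] i e; first by move: e; rewrite addn0 => ->.
  by rewrite -xN -IH ?addSnnS //; apply: esym; apply: moore_tower_mq.
by apply: (up (j - n)); rewrite subnKC // ltnW.
Qed.

Lemma imoore_ilim (P : iobj) : ilim (fun n => imoore_tower n P) (fun n => imoore_unit n P).
Proof. by split; apply: plim_moore. Qed.

Lemma imoore_unitN n (P : iobj) :
  (imoore_tower n P : @hom integral_cat _ _) ∘ imoore_unit n.+1 P = imoore_unit n P.
Proof. by apply: imor_ext; apply: sspace_ext => k j x; apply: moore_tower_mq. Qed.

Lemma imoore_level_kan n P : level_kan P -> level_kan (imoore n P).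
Proof. by move=> [kt kb]; split=> k; apply: moore_kan. Qed.

Lemma imoore_level_kan_fib n P : level_kan P -> level_kan_fib (imoore_tower n P).
Proof. by move=> [kt kb]; split=> k; apply: moore_tower_kan_fib. Qed.

End MooreTower.

(** * Segal groups and actions *)

Section SegalConditions.

(** The shear condition replaces the group condition on components: it passes along degreewise
    equivalences of degreewise Kan objects and through [moore n]. Reedy fibrancy is left out, since
    it is restored by the cobar construction. *)
Definition segal_cond (A : sspace) := [/\ forall k, kan (A k),
  forall k, 2 <= k -> hequiv (tupleS (fun i : 'I_k => A.[spine i])) &
  hequiv (pairS A.[e01] A.[e02])].

Lemma segal_cond_weq (A B : sspace) (f : hom A B) : (forall k, kan (B k)) ->
  (forall k, weak_eq (f k)) -> segal_cond A -> segal_cond B.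
Proof.
move=> kB wf [kA sA hA]; have hf k : hequiv (f k) by apply: weak_eq_hequiv.
split=> // [k k2|]; apply: weak_eq_hequiv => //; try apply: kan_powS => //;
  try apply: kan_prodS => //; apply: (weak_eq_cancel_r (wf _)); apply: hequiv_weak_eq.
- have -> : tupleS (fun i : 'I_k => B.[spine i]) ∘ f k =
      pow_map 'I_k (f 1) ∘ tupleS (fun i : 'I_k => A.[spine i]).
    apply: sset_ext => l x; apply: functional_extensionality_dep => i.
    by rewrite /= ssNx.
  by apply: hequiv_cmp; rewrite ?kan_powS //; [apply: kan_powS | apply: kan_powS | apply: sA | apply: hequiv_powS].
- have -> : pairS B.[e01] B.[e02] ∘ f 2 = prod_map (f 1) (f 1) ∘ pairS A.[e01] A.[e02].
    by apply: sset_ext => l x; rewrite /= !ssNx.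
  by apply: hequiv_cmp => //; [apply: kan_prodS | apply: kan_prodS | apply: hequiv_prodS].
Qed.

Lemma segal_cond_moore n (A : sspace) : segal_cond A -> segal_cond (levelwise (moore n) A).
Proof.
move=> [kA sA hA]; split=> [k|k k2|]; first exact: moore_kan.
- exact: (moore_tuple n (sA k k2)).
- exact: (moore_pair n hA).
Qed.

Lemma segal_group_cond (A : rsspace) : segal_group A -> segal_cond (incl A).
Proof.
move=> [fA sA gA]; have rA := fibrant_reedy_rfib fA.
have kA k : kan (incl A k) by apply: rfib_kan.
have hA k : 2 <= k -> hequiv (tupleS (fun i : 'I_k => (incl A).[spine i])).
  by move=> k2; apply: weak_eq_hequiv => //; [apply: kan_powS | apply: sA].
split=> //; apply: tfib_hequiv; exact: (shear_tfib (svalP A) rA hA gA).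
Qed.

Lemma point_hequiv (X Y : sset) (f : hom X Y) : is_point X -> is_point Y -> hequiv f.
Proof.
move=> pX pY; apply: hequiv_bij => [k x x' _|k y].
  by have [z [_ zU]] := pX k; rewrite -(zU x I) (zU x' I).
have [x _] := pX k; exists x; have [z [_ zU]] := pY k.
by rewrite -(zU (f k x) I) (zU y I).
Qed.

Lemma point_pow (X : sset) (I : Type) : is_point X -> is_point (powS X I).
Proof.
move=> pX k; have [z [_ zU]] := pX k; exists (fun _ => z); split=> // x _.
by apply: functional_extensionality_dep => i; apply: zU.
Qed.

Lemma point_prod (X Y : sset) : is_point X -> is_point Y -> is_point (prodS X Y).
Proof.
move=> pX pY k; have [z [_ zU]] := pX k; have [w [_ wU]] := pY k.
by exists (z, w); split=> // -[x y] _; rewrite (zU x) ?(wU y).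
Qed.

Lemma spoint_segal_cond (A : sspace) : spoint A -> segal_cond A.
Proof.
move=> pA; split=> [k|k _|]; first exact: kan_point.
- by apply: point_hequiv => //; apply: point_pow.
- by apply: point_hequiv => //; apply: point_prod.
Qed.

End SegalConditions.

Section ActionConditions.

Definition action_cond (P : iobj) := forall k,
  hequiv (pairS (itot P).[vertex (ord0 : 'I_k.+1)] (iproj P k)) /\
  hequiv (pairS (itot P).[vertex (ord_max : 'I_k.+1)] (iproj P k)).

Definition level_weq (P Q : iobj) (f : imor P Q) :=
  (forall k, weak_eq (imt f k)) /\ forall k, weak_eq (incl_map (imb f) k).

Lemma action_cond_weq (P Q : iobj) (f : imor P Q) : level_kan P -> level_kan Q -> level_weq f ->
  action_cond P -> action_cond Q.
Proof.
move=> [ktP kbP] [ktQ kbQ] [wt wb] aP k.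
have ht j : hequiv (imt f j) by apply: weak_eq_hequiv.
have hb j : hequiv (incl_map (imb f) j) by apply: weak_eq_hequiv.
have main (t : Delta 0 k) : hequiv (pairS (itot P).[t] (iproj P k)) ->
    hequiv (pairS (itot Q).[t] (iproj Q k)).
  move=> h; apply: weak_eq_hequiv => //; first exact: kan_prodS.
  apply: (weak_eq_cancel_r (wt k)); apply: hequiv_weak_eq.
  have -> : pairS (itot Q).[t] (iproj Q k) ∘ imt f k =
      prod_map (imt f 0) (incl_map (imb f) k) ∘ pairS (itot P).[t] (iproj P k).
    apply: sset_ext => l x; rewrite /= ssNx; congr pair.
    exact: esym (sspace_eqx x (imC f)).
  by apply: hequiv_cmp => //; [apply: kan_prodS | apply: kan_prodS | apply: hequiv_prodS].
by have [h0 h1] := aP k; split; apply: main.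
Qed.

Lemma action_cond_imoore n P : level_kan P -> action_cond P -> action_cond (imoore n P).
Proof.
by move=> [kt kb] aP k; have [h0 h1] := aP k; split; [exact: (moore_pair n h0) | exact: (moore_pair n h1)].
Qed.

End ActionConditions.

(** * Fibrancy over the terminal object *)

Section TerminalObject.

Definition ipt : iobj := @IObj rpt spt (to_spt spt).

Program Definition to_ipt (P : iobj) : imor P ipt :=
  @IMor P ipt (to_spt (incl (ibase P))) (to_spt (itot P)) _.
Next Obligation. by move=> P; apply: sspace_ext. Qed.

Lemma ipt_level_kan : level_kan ipt.
Proof. by split=> k; apply: kan_point; apply: pt_point. Qed.

Lemma to_ipt_level_kan_fib P : level_kan P -> level_kan_fib (to_ipt P).
Proof. by case=> kt kb; split=> k; [apply: kt | apply: kb]. Qed.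

Lemma res_ipt_spoint r : spoint (incl (ibase (res icofree ipt r))) /\ spoint (itot (res icofree ipt r)).
Proof.
elim: r => [|r [IHb IHt]]; first by split; apply: spt_point.
have pb := spoint_cofree_red IHb; split=> // k.
by apply: point_prod; [apply: spoint_cofree | apply: pb].
Qed.

Lemma cobar_ipt_spoint : spoint (incl (ibase (cobar ipt))) /\ spoint (itot (cobar ipt)).
Proof.
by split=> k; apply: Tot_point => r; [apply: (proj1 (res_ipt_spoint r.+1)) |
  apply: (proj2 (res_ipt_spoint r.+1))].
Qed.

Lemma rfib_bij (X Y : sspace) (q : hom X Y) : (forall k l, injective (q k l)) ->
  (forall k l y, exists x, q k l x = y) -> rfib q.
Proof.
move=> qI qS B P G v cP tP pG tG Gv.
have [||h hP] := @spmap_total B X (fun k l b x => q k l x = v k l b).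
- split=> [k|j k t l b x e]; last by rewrite !ssNx e.
  split=> [l m t b x e|l b x x' e e']; first by rewrite !smNx e.
  by apply: qI; rewrite e e'.
- by move=> k l b; apply: qS.
exists h; split=> // k l b x Pb Gx; apply: qI.
by rewrite hP (Gv _ _ _ _ Pb Gx).
Qed.

(** The cobar construction of [ipt] consists of points, so the adjunct of the map to it is the
    projection up to a bijection. *)
Lemma cobar_proj_rfib P : level_kan P -> rfib (iproj (cobar P)).
Proof.
move=> kP; have fa := cobar_adjunct_rfib kP ipt_level_kan (to_ipt_level_kan_fib kP).
have [pb pt'] := cobar_ipt_spoint.
set f := cobar_map (to_ipt P) in fa.
have -> : iproj (cobar P) = pb1 sspace_pb (incl_map (imb f)) (iproj (cobar ipt)) ∘ adjunct f.
  by rewrite pb_map1.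
apply: rfib_cmp fa _; apply: rfib_bij => k l.
- move=> x y e; apply: sig_ext; rewrite [LHS]surjective_pairing [RHS]surjective_pairing.
  congr pair; first exact: e.
  have [z [_ zU]] := pt' k l.
  by rewrite -(zU (sval x).2 I) (zU (sval y).2 I).
- move=> b; have [z _] := pt' k l.
  have e : incl_map (imb f) k l b = iproj (cobar ipt) k l z.
    by have [w [_ wU]] := pb k l; rewrite -(wU (incl_map (imb f) k l b) I) (wU (iproj _ k l z) I).
  by exists (exist _ (b, z) e).
Qed.

Lemma cobar_base_fibrant P : level_kan P -> rfib (to_spt (incl (ibase (cobar P)))).
Proof.
move=> kP; apply: rfib_spoint (proj1 cobar_ipt_spoint) _.
exact: (cobar_base_rfib kP ipt_level_kan (to_ipt_level_kan_fib kP)).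
Qed.

Lemma cobar_level_kan P : level_kan P -> level_kan (cobar P).
Proof.
move=> kP; have kb k : kan (incl (ibase (cobar P)) k).
  by apply: rfib_kan; apply: cobar_base_fibrant.
split=> // k; apply: kan_fib_kan (kb k); apply: rfib_kan_fib; exact: cobar_proj_rfib.
Qed.

Lemma cobar_unit_level_weq P : level_weq (cobar_unit P).
Proof.
by split=> k; apply: hequiv_weak_eq; [apply: tot_unit_hequiv | apply: base_unit_hequiv].
Qed.

Lemma cobar_ipt_terminal : @is_terminal integral_cat (cobar ipt).
Proof.
have [pb pt'] := cobar_ipt_spoint; move=> P.
pose f : imor P (cobar ipt) := imor_cmp (cobar_unit ipt) (to_ipt P).
exists (f : @hom integral_cat P (cobar ipt)); split=> // g _.
apply: imor_ext; apply: sspace_ext => k l x.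
- have [w [_ wU]] := pb k l.
  by rewrite -(wU (incl_map (imb f) k l x) I) (wU (incl_map (imb g) k l x) I).
- have [w [_ wU]] := pt' k l.
  by rewrite -(wU (imt f k l x) I) (wU (imt g k l x) I).
Qed.

Lemma cobar_seg_local P : level_kan P -> segal_cond (incl (ibase P)) -> seg_local (ibase (cobar P)).
Proof.
move=> kP sP.
have [kR sR hR] : segal_cond (incl (ibase (cobar P))).
  apply: (segal_cond_weq _ _ sP); first exact: (proj2 (cobar_level_kan kP)).
  exact: (proj2 (cobar_unit_level_weq P)).
by apply: segal_seg_local => //; apply: cobar_base_fibrant.
Qed.

Lemma cobar_action_cond P : level_kan P -> action_cond P -> action_cond (cobar P).
Proof. by move=> kP; apply: action_cond_weq (cobar_level_kan kP) (cobar_unit_level_weq P). Qed.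

End TerminalObject.

(** * Gap maps of actions and equifibred maps *)

Section Gap.

Definition gap (P : iobj) m k (t : Delta m k) :
    hom (itot P k) (pb sset_pb (incl (ibase P)).[t] (iproj P m)) :=
  pb_map sset_pb (esym (smN (iproj P) t)).

Section Action.
Variable P : iobj.
Hypotheses (fp : rfib (iproj P)) (kP : level_kan P) (aP : action_cond P).
Local Notation X := (itot P).
Local Notation A := (incl (ibase P)).
Local Notation p := (iproj P).

Lemma gap_kan k m (t : Delta m k) : kan (pb sset_pb A.[t] (p m)).
Proof.
apply: (@kan_fib_kan _ _ (pb1 sset_pb A.[t] (p m))); last exact: (proj2 kP).
by apply: (kan_fib_pullback (pb_pullback _ _)); apply: rfib_kan_fib.
Qed.

Lemma gap_kan_fib k m (t : Delta m k) : injective t -> kan_fib (gap P t).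
Proof.
move=> tI; apply: kan_fibI => n c G V pG pV tG tV GV.
have [v vV] := pmap_total pV (fun k b => tV k b I).
have [||||h [hG hv hw]] := @rfib_cell X A p k (simplex n.+1) (@in_horn n.+1 c) unit
  (fun _ => m) (fun _ => t) (fun _ => pb2 sset_pb A.[t] (p m) ∘ v) G
  (pb1 sset_pb A.[t] (p m) ∘ v) fp (@tc_horn n c) pG tG.
- by move=> l y x Py Gx; have /= <- := GV _ _ _ _ Py Gx (vV l y).
- by move=> _ l y x Py Gx; have /= <- := GV _ _ _ _ Py Gx (vV l y).
- by move=> _ l y; apply: esym (svalP (v l y)).
- move=> _ _ j a b l y e; congr (X.[_] l _); apply: Delta_ext => s; apply: tI.
  by rewrite -!dcmpE e.
exists (graph h); split.
- exact: graph_pmap.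
- by move=> l b _; exists (h l b).
- by move=> l b x Pb Gx; rewrite /graph (hG _ _ _ Pb Gx).
- move=> l b x y _ -> Vy; rewrite -(pm_fun pV (vV l b) Vy); apply: sig_ext.
  rewrite [RHS]surjective_pairing; congr pair; first exact: hv.
  exact: (hw tt).
Qed.

Lemma gap_tfib k m (t : Delta m k) : injective t -> weak_eq (gap P t) -> tfib (gap P t).
Proof.
move=> tI w; apply: kan_fib_tfib; [exact: (proj1 kP) | exact: gap_kan_fib |].
by apply: weak_eq_hequiv => //; [apply: (proj1 kP) | apply: gap_kan].
Qed.

(* The gap map of t o s is the composite of that of t with a base change of that of s. *)
Lemma gap_cmp l m k (s : Delta l m) (t : Delta m k) : tfib (gap P s) ->
  weak_eq (gap P (dcmp t s)) <-> weak_eq (gap P t).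
Proof.
move=> ts.
have sq : A.[dcmp t s] ∘ pb1 sset_pb A.[t] (p m) = p l ∘ (X.[s] ∘ pb2 sset_pb A.[t] (p m)).
  by rewrite (smapM A) -cmpA pb_sq !cmpA smN.
pose c := pb_map sset_pb sq.
have sq' : A.[s] ∘ (A.[t] ∘ pb1 sset_pb A.[dcmp t s] (p l)) = p l ∘ pb2 sset_pb A.[dcmp t s] (p l).
  by rewrite cmpA -smapM pb_sq.
have tcc : tfib c.
  apply: (tfib_pullback _ ts (a := pb2 sset_pb A.[t] (p m)) (b := pb_map sset_pb sq')).
  split=> [j [[a x] e]|j x [[a y] e] /(congr1 sval) /= [e1 e2]].
    by apply: sig_ext => /=; congr pair; apply: esym.
  exists (exist _ (a, x) (esym e1)); split=> //; first by apply: sig_ext; rewrite /= e2.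
  by move=> [[a' x'] e'] /= ex /(congr1 sval) /= [ea _]; apply: sig_ext; rewrite /= ex ea.
have e : c ∘ gap P t = gap P (dcmp t s).
  by apply: sset_ext => j x; apply: sig_ext; rewrite /= (smapM X).
rewrite -e; split=> w; last exact: weak_eq_cmp w (tfib_weak_eq tcc).
exact: weak_eq_cancel_l (tfib_weak_eq tcc) w.
Qed.

(** The base is reduced, so the pullback over its degree 0 is a product and the gap map is the
    action map. *)
Lemma gap_vertex k (j : 'I_k.+1) : hequiv (pairS X.[vertex j] (p k)) -> weak_eq (gap P (vertex j)).
Proof.
move=> h; pose i := pairS (pb2 sset_pb A.[vertex j] (p 0)) (pb1 sset_pb A.[vertex j] (p 0)).
have hi : hequiv i.
  apply: hequiv_bij => l.
    by move=> [[a x] e] [[a' x'] e'] /= [ex ea]; apply: sig_ext; rewrite /= ex ea.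
  move=> [x a]; have e : A.[vertex j] l a = p 0 l x.
    by rewrite (rpointE (A.[vertex j] l a)) (rpointE (p 0 l x)).
  by exists (exist _ (a, x) e).
apply: (weak_eq_cancel_l (hequiv_weak_eq hi)); apply: hequiv_weak_eq.
by have -> : i ∘ gap P (vertex j) = pairS X.[vertex j] (p k) by apply: sset_ext.
Qed.

Lemma vertex_inj k (j : 'I_k.+1) : injective (vertex j).
Proof. by move=> a b _; rewrite !ord1. Qed.

(** The action condition covers the first and the last vertex. A middle vertex j is the last one of
    the initial face [j], whose first vertex is 0, so two cancellations by [gap_cmp] reach it. For a
    general injection, compose with the first vertex of its source. *)
Lemma gap_injective k m (t : Delta m k) : injective t -> tfib (gap P t).
Proof.
have first_ n : tfib (gap P (vertex (ord0 : 'I_n.+1))).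
  by apply: gap_tfib; [apply: vertex_inj | apply: gap_vertex; case: (aP n)].
have last_ n : tfib (gap P (vertex (ord_max : 'I_n.+1))).
  by apply: gap_tfib; [apply: vertex_inj | apply: gap_vertex; case: (aP n)].
have vert n (j : 'I_n.+1) : weak_eq (gap P (vertex j)).
  have jn : j.+1 <= n.+1 := ltn_ord j.
  have wh : {homo widen_ord jn : a b / a <= b} by [].
  pose w : Delta j n := mkDelta wh.
  have -> : vertex j = dcmp w (vertex (ord_max : 'I_j.+1)).
    by apply: Delta_ext => s; apply: val_inj; rewrite dcmpE !dconstE mkDeltaE.
  apply/(gap_cmp w (last_ j)); apply/(gap_cmp w (first_ j)).
  have -> : dcmp w (vertex (ord0 : 'I_j.+1)) = vertex ord0; last exact: tfib_weak_eq.
  by apply: Delta_ext => s; apply: val_inj; rewrite dcmpE !dconstE mkDeltaE.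
move=> tI; apply: gap_tfib => //; apply/(gap_cmp t (first_ m)).
by rewrite cmp_dconst; apply: vert.
Qed.

End Action.

(** The comparison map of the square, followed by the base change [c] of the gap map of [Q], is the
    gap map of [P]; two out of three. *)
Lemma adjunct_equifibred (P Q : iobj) (f : imor P Q) : rfib (adjunct f) ->
  (forall m k (t : Delta m k), injective t -> tfib (gap P t)) ->
  (forall m k (t : Delta m k), injective t -> tfib (gap Q t)) -> equifibred (adjunct f).
Proof.
move=> fa gP gQ m k t tI.
set Y := pb sspace_pb (incl_map (imb f)) (iproj Q).
pose g : hom (itot P) Y := adjunct f.
split; first exact (smN g t).
have gN : Y.[t] ∘ g k = g m ∘ (itot P).[t] := esym (smN g t).
(* In each degree the adjunct is already a Kan fibration, so the strict pullback is a homotopy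
   pullback. *)
exists (itot P m), (idm (itot P m)), (g m), (pb_map sset_pb gN); split.
- by split; [apply: weak_eq_id | apply: rfib_kan_fib].
- by rewrite cmpm1.
- by rewrite pb_map1.
- by rewrite pb_map2 cmp1m.
have sq : (incl (ibase P)).[t] ∘ (pb1 sspace_pb (incl_map (imb f)) (iproj Q) k ∘
    pb1 sset_pb Y.[t] (g m)) = iproj P m ∘ pb2 sset_pb Y.[t] (g m).
  apply: sset_ext => l x; exact: (congr1 (fun y : Y m l => (sval y).1) (svalP x)).
pose c := pb_map sset_pb sq.
have qsq : (incl (ibase Q)).[t] ∘ (incl_map (imb f) k ∘
    pb1 sset_pb (incl (ibase P)).[t] (iproj P m)) =
    iproj Q m ∘ (imt f m ∘ pb2 sset_pb (incl (ibase P)).[t] (iproj P m)).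
  apply: sset_ext => l x /=; rewrite -ssNx.
  by rewrite (svalP x); apply: (sspace_eqx _ (imC f)).
have tcc : tfib c.
  apply: (tfib_pullback _ (gQ m k t tI)
    (a := pb2 sspace_pb (incl_map (imb f)) (iproj Q) k ∘ pb1 sset_pb Y.[t] (g m))
    (b := pb_map sset_pb qsq)).
  split=> [l z|l w z e].
    apply: sig_ext; congr pair; first exact (esym (svalP (sval z).1)).
    exact (congr1 (fun y : Y m l => (sval y).2) (svalP z)).
  have e1 : iproj Q k l w = incl_map (imb f) k l (sval z).1.
    exact (congr1 (fun y => (sval y).1) e).
  have e2 : (itot Q).[t] l w = imt f m l (sval z).2 by exact (congr1 (fun y => (sval y).2) e).
  pose y : Y k l := exist _ ((sval z).1, w) (esym e1).
  have yx : Y.[t] l y = g m l (sval z).2.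
    by apply: sig_ext; exact (congr2 pair (svalP z) e2).
  exists (exist _ (y, (sval z).2) yx); split=> //; first by apply: sig_ext; rewrite [RHS]surjective_pairing.
  move=> z' ew ez; apply: sig_ext; rewrite [LHS]surjective_pairing; congr pair.
    apply: sig_ext; rewrite [LHS]surjective_pairing; congr pair; last exact: ew.
    exact (congr1 (fun x => (sval x).1) ez).
  exact (congr1 (fun x => (sval x).2) ez).
apply: (weak_eq_cancel_l (tfib_weak_eq tcc)).
have -> : c ∘ pb_map sset_pb gN = gap P t by apply: sset_ext => l x; apply: sig_ext.
by apply: tfib_weak_eq; apply: gP.
Qed.

Lemma cobar_map_fib (P Q : iobj) (f : imor P Q) : level_kan P -> level_kan Q -> level_kan_fib f ->
  segal_cond (incl (ibase P)) -> segal_cond (incl (ibase Q)) -> action_cond P -> action_cond Q ->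
  fib integral (cobar_map f : @hom integral_cat _ _).
Proof.
move=> kP kQ lf sP sQ aP aQ; split.
  by apply: seg_local_fib; [apply: cobar_seg_local.. | apply: cobar_base_rfib].
have fa := cobar_adjunct_rfib kP kQ lf; split; first exact: rfib_fib_reedy.
apply: adjunct_equifibred => // m k t tI; apply: gap_injective => //;
  by [apply: cobar_proj_rfib | apply: cobar_level_kan | apply: cobar_action_cond].
Qed.

End Gap.

(** * The Postnikov tower *)

Section Assembly.

Lemma paste (C : category) (x1 x y1 y z1 z : C) (t : hom x1 x) (k : hom x y) (k1 : hom x1 y1)
    (m : hom y1 y) (u : hom y z) (u1 : hom y1 z1) (m' : hom z1 z) :
  k ∘ t = m ∘ k1 -> u ∘ m = m' ∘ u1 -> (u ∘ k) ∘ t = m' ∘ (u1 ∘ k1).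
Proof. by move=> e1 e2; rewrite -cmpA e1 !cmpA e2. Qed.

Lemma level_weq_weq (P Q : iobj) (f : imor P Q) : level_weq f ->
  weq integral (f : @hom integral_cat _ _).
Proof.
move=> [wt wb]; split; last exact: diag_weq.
by move=> Z [fZ _]; apply: Map_pre_weq => //; apply: fibrant_reduced_rfib.
Qed.

Lemma cobar_map_cmp (P Q T : integral_cat) (g : hom Q T) (f : hom P Q) :
  (cobar_map g : @hom integral_cat _ _) ∘ cobar_map f = cobar_map (g ∘ f).
Proof.
have e r := @res_map_cmp _ icofree P Q T g f r.
apply: imor_ext; apply: sspace_ext => k l x; apply: sig_ext;
  apply: functional_extensionality_dep => r; apply: functional_extensionality_dep => j;
  apply: functional_extensionality_dep => t; apply: functional_extensionality_dep => u.
- exact (esym (congr1 (fun h : imor _ _ => incl_map (imb h) k j (sval x r j t u)) (e r.+1))).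
- exact (esym (congr1 (fun h : imor _ _ => imt h k j (sval x r j t u)) (e r.+1))).
Qed.

Lemma level_weq_cmp (P Q T : integral_cat) (g : hom Q T) (f : hom P Q) :
  level_weq f -> level_weq g -> level_weq (g ∘ f).
Proof. by move=> [ft fb] [gt gb]; split=> k; apply: weak_eq_cmp. Qed.

Variable R : kan_replacement.

Definition R_red (A : rsspace) : rsspace :=
  exist _ (levelwise R (incl A)) (point_fob pt_point (svalP A) (kr_pt R)).

Definition ikan (P : iobj) : iobj :=
  @IObj (R_red (ibase P)) (levelwise R (itot P)) (fmap (levelwise R) (iproj P)).

Definition ikan_unit (P : iobj) : imor P (ikan P) :=
  @IMor P (ikan P) (levelwise_unit (kr_unit R) (incl (ibase P)))
    (levelwise_unit (kr_unit R) (itot P)) (ntN (levelwise_unit (kr_unit R)) (iproj P)).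

Lemma ikan_level_kan P : level_kan (ikan P).
Proof. by split=> k; apply: kr_kan. Qed.

Lemma ikan_unit_level_weq P : level_weq (ikan_unit P).
Proof. by split=> k; apply: kr_weq. Qed.

Program Definition kappaS n (X : sspace) :
    hom (levelwise (postnikov R n) X) (levelwise (moore n) (levelwise R X)) :=
  @SMor sset (levelwise (postnikov R n) X) (levelwise (moore n) (levelwise R X))
    (fun k => kappa n (@kr_kan R (X k))) _.
Next Obligation.
move=> n X j k t; apply: sset_ext => l u; apply: sig_ext.
by apply: sset_ext.
Qed.

Program Definition kappaI n (P : iobj) : imor (postnikov_obj R P n) (imoore n (ikan P)) :=
  @IMor (postnikov_obj R P n) (imoore n (ikan P)) (kappaS n (incl (ibase P))) (kappaS n (itot P)) _.
Next Obligation.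
move=> n P; apply: sspace_ext => k l u; apply: sig_ext.
by apply: sset_ext.
Qed.

Lemma kappaI_level_weq n P : level_weq (kappaI n P).
Proof. by split=> k; apply: tfib_weak_eq; apply: kappa_tfib. Qed.

Lemma kappaI_tower n (P : iobj) :
  (kappaI n P : @hom integral_cat _ _) ∘ tmap (postnikov_tower R P) n =
  (imoore_tower n (ikan P) : @hom integral_cat _ _) ∘ kappaI n.+1 P.
Proof.
by apply: imor_ext; apply: sspace_ext => k l u; apply: sig_ext; apply: sset_ext.
Qed.

Lemma kappaI_cone n (P : iobj) :
  (kappaI n P : @hom integral_cat _ _) ∘ postnikov_cone R P n =
  (imoore_unit n (ikan P) : @hom integral_cat _ _) ∘ ikan_unit P.
Proof.
by apply: imor_ext; apply: sspace_ext => k l u; apply: sig_ext; apply: sset_ext.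
Qed.

End Assembly.

Theorem theorem5p1p1 (R : kan_replacement) (A : rsspace) (X : sspace)
    (p : hom X (incl A)) (hA : segal_group A) (hp : segal_group_action p) :
  is_holim integral (postnikov_cone R (IObj p)).
Proof.
pose P := IObj p; pose Z := ikan R P.
have kZ : level_kan Z := ikan_level_kan R P.
have sA := segal_group_cond hA; have kA : forall k, kan (incl A k) by case: sA.
have kP : level_kan P.
  split=> // k; apply: (@kan_fib_kan _ _ (p k)) (kA k).
  by apply: rfib_kan_fib; apply: fib_reedy_rfib; apply: (proj1 hp).
have sZ : segal_cond (incl (ibase Z)).
  by apply: (segal_cond_weq (proj2 kZ) (proj2 (ikan_unit_level_weq R P)) sA).
have aZ : action_cond Z.
  apply: (action_cond_weq kP kZ (ikan_unit_level_weq R P)) => k; have [h0 h1] := proj2 hp k.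
  by split; apply: weak_eq_hequiv => //; try apply: kan_prodS => //; apply: (proj1 kP).
have sM n : segal_cond (incl (ibase (imoore n Z))) by apply: segal_cond_moore.
have aM n : action_cond (imoore n Z) by apply: action_cond_imoore.
have kM n : level_kan (imoore n Z) by apply: imoore_level_kan.
pose T' := @Tower integral_cat (fun n => cobar (imoore n Z)) (fun n => cobar_map (imoore_tower n Z)).
pose rf n : @hom integral_cat (postnikov_obj R P n) (cobar (imoore n Z)) :=
  (cobar_unit (imoore n Z) : @hom integral_cat _ _) ∘ kappaI R n P.
have rN n : rf n ∘ tmap (postnikov_tower R P) n = tmap T' n ∘ rf n.+1.
  exact: paste (kappaI_tower R n P) (cobar_unit_nat (imoore_tower n Z)).
pose lf n : @hom integral_cat (cobar Z) (T' n) := cobar_map (imoore_unit n Z).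
have lN n : tmap T' n ∘ lf n.+1 = lf n.
  exact: etrans (cobar_map_cmp (imoore_tower n Z) (imoore_unit n.+1 Z)) (congr1 _ (imoore_unitN n Z)).
exists T', (@TowerMap _ (postnikov_tower R P) T' rf rN), (cobar Z), (Cone lN),
  ((cobar_unit Z : @hom integral_cat _ _) ∘ ikan_unit R P); split.
- move=> n; apply: level_weq_weq; apply: level_weq_cmp; [exact: kappaI_level_weq | exact: cobar_unit_level_weq].
- split=> [|n]; last by apply: cobar_map_fib => //; apply: imoore_level_kan_fib.
  (* Choosing [cobar ipt] as terminal object makes the fibrancy of the bottom stage another instance
     of [cobar_map_fib]. *)
  exists (cobar ipt), (cobar_map (to_ipt (imoore 0 Z))); split; first exact: cobar_ipt_terminal.
  apply: cobar_map_fib => //; [exact: ipt_level_kan | exact: to_ipt_level_kan_fib | |].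
    exact: spoint_segal_cond spt_point.
  by move=> k; split; apply: point_hequiv; try apply: point_prod; apply: pt_point.
- by apply: ilim_limit; apply: ilim_cobar; apply: imoore_ilim.
- move=> n; exact: esym (paste (kappaI_cone R n P) (cobar_unit_nat (imoore_unit n Z))).
- by apply: level_weq_weq; apply: level_weq_cmp; [exact: ikan_unit_level_weq | exact: cobar_unit_level_weq].
Qed.
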